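(* Let $L,\rho_1,\rho_2,k_1,k_2,k_3>0$ and let $g,\xi,p$ satisfy (A1) and (A2) of the context (so $1\le p<\frac32$). Assume that $$\frac{\rho_1}{k_1}\neq\frac{\rho_2}{k_2}\qquad\text{and}\qquad k_1=k_3 .$$ Then there exists $l_0>0$ (depending only on $L$, the coefficients $\rho_1,\rho_2,k_1,k_2,k_3$ and $g$) such that for every $l\in(0,l_0)$, every $t_0>0$, and all data $$(\varphi_0,\varphi_1)\in\big(H^2(0,L)\cap H^1_0(0,L)\big)\times H^1_0(0,L),\qquad (\psi_0,\psi_1),(w_0,w_1)\in\big(H^2_*(0,L)\cap H^1_*(0,L)\big)\times H^1_*(0,L),$$ there exists a constant $C>0$, which may depend on the initial data but is independent of $t$, such that the energy $E$ of the strong solution $(\varphi,\psi,w)$ of $(P)$ satisfies $$E(t)\le C\left(\frac{1}{\int_{t_0}^t\xi^{2p-1}(s)\,ds}\right)^{\frac{1}{2p-1}}\qquad\text{for all } t>t_0 .$$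
   Context: Function spaces: $L^2_*(0,L)=\{v\in L^2(0,L):\int_0^L v\,dx=0\}$, $H^1_*(0,L)=H^1(0,L)\cap L^2_*(0,L)$, $H^2_*(0,L)=\{v\in H^2(0,L):v_x(0)=v_x(L)=0\}$. Problem $(P)$ (finite-memory Bresse system), with positive constants $l,k_1,k_2,k_3,\rho_1,\rho_2$, for $(x,t)\in(0,L)\times(0,\infty)$: $$\rho_1\varphi_{tt}-k_1(\varphi_x+\psi+lw)_x-lk_3(w_x-l\varphi)=0,$$ $$\rho_2\psi_{tt}-k_2\psi_{xx}+k_1(\varphi_x+\psi+lw)+\int_0^t g(t-s)\psi_{xx}(s)\,ds=0,$$ $$\rho_1w_{tt}-k_3(w_x-l\varphi)_x+lk_1(\varphi_x+\psi+lw)=0,$$ with boundary conditions $\varphi(0,t)=\varphi(L,t)=\psi_x(0,t)=\psi_x(L,t)=w_x(0,t)=w_x(L,t)=0$ for $t\ge0$, and initial conditions $\varphi(\cdot,0)=\varphi_0$, $\varphi_t(\cdot,0)=\varphi_1$, $\psi(\cdot,0)=\psi_0$, $\psi_t(\cdot,0)=\psi_1$, $w(\cdot,0)=w_0$, $w_t(\cdot,0)=w_1$. Hypotheses on the relaxation function: (A1) $g:[0,\infty)\to[0,\infty)$ is a non-increasing differentiable function with $g(0)>0$ and $k_2-\int_0^{+\infty}g(s)\,ds>0$. (A2) $\xi:[0,\infty)\to(0,\infty)$ is a non-increasing differentiable function and $p$ is a constant with $1\le p<\frac32$ such that $g'(t)\le-\xi(t)g^p(t)$ for all $t\ge0$.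 Well-posedness (known): under (A1), for data as in the claim, problem $(P)$ has a unique global (strong) solution with $\varphi\in C([0,\infty);H^2\cap H^1_0)\cap C^1([0,\infty);H^1_0)\cap C^2([0,\infty);L^2)$ and $\psi,w\in C([0,\infty);H^2_*\cap H^1_* )\cap C^1([0,\infty);H^1_* )\cap C^2([0,\infty);L^2)$ (all spaces on $(0,L)$). Energy: for $t\ge0$, $$E(t)=\frac12\int_0^L\Big[\rho_1\varphi_t^2+\rho_2\psi_t^2+\rho_1w_t^2+\Big(k_2-\int_0^tg(s)ds\Big)\psi_x^2+k_3(w_x-l\varphi)^2+k_1(\varphi_x+\psi+lw)^2\Big]dx+\frac12(g\circ\psi_x)(t),$$ where $(g\circ v)(t)=\int_0^L\int_0^tg(t-s)\big(v(t)-v(s)\big)^2ds\,dx$. *)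

(* Defs.v *)
From HB Require Import structures.
From mathcomp Require Import all_boot all_order all_algebra.
From mathcomp Require Import all_classical all_reals all_analysis.

Set Implicit Arguments.
Unset Strict Implicit.
Unset Printing Implicit Defensive.

Import Order.TTheory GRing.Theory Num.Theory.
Import numFieldNormedType.Exports.

Local Open Scope classical_set_scope.
Local Open Scope ring_scope.

Section FunctionSpaces.
Variables (R : realType) (L : R).
Implicit Types (v d : R -> R).
Notation mu := (@lebesgue_measure R).

(* A function on (0,L), or a class of such functions modulo equality almost
   everywhere, is represented by a function R -> R whose values outside (0,L),
   resp. on a null set, are irrelevant. *)

Definition eqae v d := {ae mu, forall x, x \in `]0, L[ -> v x = d x}.

Definition L2 : set (R -> R) :=
  [set v | v \_ `]0, L[ \in Lfun mu 2%:E].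

Definition L2norm v : \bar R :=
  Lnorm mu 2%:E (EFin \o (v \_ `]0, L[)).

(* C^oo functions with compact support in (0,L) *)
Definition test_function : set (R -> R) :=
  [set theta | (forall (n : nat) (x : R), derivable (derive1n n theta) x 1) /\
    exists a b : R, [/\ 0 < a, b < L & forall x : R, x \notin `[a, b] -> theta x = 0]].

Definition is_weak_deriv v d := forall theta, test_function theta ->
  \int[mu]_(x in `]0, L[) (v x * derive1 theta x) =
  - \int[mu]_(x in `]0, L[) (d x * theta x).

(* The representative of v that is continuous on [0,L], if v has one (it is
   then unique on [0,L], and v(0), v(L) are understood as its values at the
   endpoints); v itself otherwise. *)
Definition crep v : R -> R :=
  xget v [set u | {within `[0, L], continuous u} /\ eqae u v].

(* The L^2 weak derivative v_x, given by its continuous representative when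
   there is one, i.e. whenever v is in H^2. *)
Definition dx v : R -> R :=
  crep (xget (cst 0) [set d | L2 d /\ is_weak_deriv v d]).

Definition H1 : set (R -> R) :=
  [set v | L2 v /\ exists d, L2 d /\ is_weak_deriv v d].

Definition H2 : set (R -> R) := [set v | H1 v /\ H1 (dx v)].

Definition H1norm v : \bar R := (L2norm v + L2norm (dx v))%E.

Definition H2norm v : \bar R := (H1norm v + L2norm (dx (dx v)))%E.

(* the closure of the test functions in H^1 *)
Definition H10 : set (R -> R) :=
  [set v | H1 v /\ forall e : R, 0 < e ->
    exists2 theta, test_function theta & (H1norm (v \- theta)%R < e%:E)%E].

Definition L2s : set (R -> R) :=
  [set v | L2 v /\ \int[mu]_(x in `]0, L[) v x = 0].

Definition H1s : set (R -> R) := H1 `&` L2s.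

Definition H2s : set (R -> R) :=
  [set v | [/\ H2 v, dx v 0 = 0 & dx v L = 0]].

End FunctionSpaces.

Section Evolution.
Variables (R : realType) (L : R).
Implicit Types (u : R -> R -> R) (X : set (R -> R)) (N : (R -> R) -> \bar R).
Notation mu := (@lebesgue_measure R).

(* A map u from [0,oo) to a function space is written u t x, time first. *)

(* d is the derivative of u at t for the norm N (one-sided at t = 0) *)
Definition is_dt N u t (d : R -> R) :=
  N (fun x => (s - t)^-1 * (u s x - u t x) - d x)
    @[s --> within `[0, +oo[ t^'] --> 0%E.

(* the time derivative u_t, taken in L^2(0,L) *)
Definition dt u : R -> R -> R :=
  fun t => xget (cst 0) [set d | L2 L d /\ is_dt (L2norm L) u t d].

(* u \in C^k([0,oo); X), where X carries the norm N. Since N dominates the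
   L^2 norm, a derivative for N is a derivative in L^2(0,L). *)
Definition C0_in X N u :=
  (forall t : R, 0 <= t -> X (u t)) /\
  (forall t : R, 0 <= t ->
    N (u s \- u t) @[s --> within `[0, +oo[ (nbhs t)] --> 0%E).

Definition C1_in X N u :=
  [/\ C0_in X N u, C0_in X N (dt u) &
      forall t : R, 0 <= t -> is_dt N u t (dt u t)].

Definition C2_in X N u := C1_in X N u /\ C1_in X N (dt u).

(* m is the integral over [0,t] of the L^2(0,L)-valued map F. It is
   characterized by duality, because the elements F s of L^2(0,L) are only
   defined almost everywhere, so that integrating s |-> F s x at a fixed x
   would depend on the representatives. *)
Definition is_L2_integral (t : R) (F : R -> R -> R) (m : R -> R) :=
  L2 L m /\ forall theta, L2 L theta ->
    \int[mu]_(x in `]0, L[) (m x * theta x) =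
    \int[mu]_(s in `[0, t]) \int[mu]_(x in `]0, L[) (F s x * theta x).

End Evolution.

Section RelaxationFunction.
Variable R : realType.
Implicit Types (f g xi : R -> R).
Notation mu := (@lebesgue_measure R).

(* the derivative of f : [0,oo) -> R, one-sided at 0 *)
Definition derivable_half f t :=
  cvg ((s - t)^-1 * (f s - f t) @[s --> within `[0, +oo[ t^']).

Definition deriv_half f t : R :=
  lim ((s - t)^-1 * (f s - f t) @[s --> within `[0, +oo[ t^']).

Definition nonincreasing_half f :=
  forall s t : R, 0 <= s -> s <= t -> f t <= f s.

Definition hypA1 (k2 : R) g :=
  [/\ forall t : R, 0 <= t -> 0 <= g t,
      nonincreasing_half g,
      forall t : R, 0 <= t -> derivable_half g t,
      0 < g 0 &
      (0 < k2%:E - \int[mu]_(s in `[0%R, +oo[) (g s)%:E)%E].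

Definition hypA2 g xi (p : R) :=
  [/\ forall t : R, 0 <= t -> 0 < xi t,
      nonincreasing_half xi,
      forall t : R, 0 <= t -> derivable_half xi t,
      1 <= p < 3 / 2 &
      forall t : R, 0 <= t -> deriv_half g t <= - xi t * (g t `^ p)].

End RelaxationFunction.

Section Bresse.
Variables (R : realType) (L rho1 rho2 k1 k2 k3 l : R) (g : R -> R).
Implicit Types (phi psi w : R -> R -> R).
Notation mu := (@lebesgue_measure R).
Notation dx := (dx L).
Notation dt := (dt L).
Notation crep := (crep L).
Notation "v =ae u" := (eqae L v u) (at level 70).

Definition shear phi psi w (t x : R) : R :=
  dx (phi t) x + psi t x + l * w t x.

Definition axial phi w (t x : R) : R := dx (w t) x - l * phi t x.

Definition Bresse_equations phi psi w (t : R) :=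
  [/\ (fun x => rho1 * dt (dt phi) t x - k1 * dx (shear phi psi w t) x
                - l * k3 * axial phi w t x) =ae cst 0,
      (exists2 m : R -> R,
        is_L2_integral L t (fun s x => g (t - s) * dx (dx (psi s)) x) m &
        (fun x => rho2 * dt (dt psi) t x - k2 * dx (dx (psi t)) x
                  + k1 * shear phi psi w t x + m x) =ae cst 0) &
      (fun x => rho1 * dt (dt w) t x - k3 * dx (axial phi w t) x
                + l * k1 * shear phi psi w t x) =ae cst 0].

Definition Bresse_boundary phi psi w (t : R) :=
  [/\ crep (phi t) 0 = 0 /\ crep (phi t) L = 0,
      dx (psi t) 0 = 0 /\ dx (psi t) L = 0 &
      dx (w t) 0 = 0 /\ dx (w t) L = 0].

Definition Bresse_initial (phi0 phi1 psi0 psi1 w0 w1 : R -> R) phi psi w :=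
  [/\ phi 0 =ae phi0 /\ dt phi 0 =ae phi1,
      psi 0 =ae psi0 /\ dt psi 0 =ae psi1 &
      w 0 =ae w0 /\ dt w 0 =ae w1].

Definition regular_phi phi :=
  [/\ C0_in (H2 L `&` H10 L) (H2norm L) phi,
      C1_in L (H10 L) (H1norm L) phi &
      C2_in L (L2 L) (L2norm L) phi].

Definition regular_psi_w u :=
  [/\ C0_in (H2s L `&` H1s L) (H2norm L) u,
      C1_in L (H1s L) (H1norm L) u &
      C2_in L (L2 L) (L2norm L) u].

Definition strong_solution (phi0 phi1 psi0 psi1 w0 w1 : R -> R) phi psi w :=
  [/\ [/\ regular_phi phi, regular_psi_w psi & regular_psi_w w],
      forall t : R, 0 < t -> Bresse_equations phi psi w t,
      forall t : R, 0 <= t -> Bresse_boundary phi psi w t &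
      Bresse_initial phi0 phi1 psi0 psi1 w0 w1 phi psi w].

(* g o v; applied below to v = psi_x, whose values dx (psi s) x are jointly
   continuous in (s, x) for a strong solution *)
Definition memory (v : R -> R -> R) (t : R) : R :=
  \int[mu]_(x in `]0, L[)
    \int[mu]_(s in `[0, t]) (g (t - s) * (v t x - v s x) ^+ 2).

Definition energy phi psi w (t : R) : R :=
  2^-1 * \int[mu]_(x in `]0, L[)
    (rho1 * dt phi t x ^+ 2 + rho2 * dt psi t x ^+ 2 + rho1 * dt w t x ^+ 2
     + (k2 - \int[mu]_(s in `[0, t]) g s) * dx (psi t) x ^+ 2
     + k3 * axial phi w t x ^+ 2 + k1 * shear phi psi w t x ^+ 2)
  + 2^-1 * memory (fun s => dx (psi s)) t.

End Bresse.

(* Main.v *)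
Require Import Defs.
From HB Require Import structures.
From mathcomp Require Import all_boot all_order all_algebra.
From mathcomp Require Import all_classical all_reals all_analysis.
From mathcomp Require Import measurable_realfun.
From mathcomp Require Import ring lra.

Import Order.TTheory GRing.Theory Num.Theory.
Import numFieldNormedType.Exports.

Local Open Scope classical_set_scope.
Local Open Scope ring_scope.

Set Implicit Arguments.
Unset Strict Implicit.
Unset Printing Implicit Defensive.

(** The proof decomposes the system into Fourier modes. With
    [lam = n * pi / L], the coefficients [a] of phi against [sin (lam x)] and
    [b], [c] of psi and w against [cos (lam x)] solve, thanks to the boundary
    conditions, the ordinary integro-differential system
      [rho1 a'' + k (lam S + l A) = 0],
      [rho2 b'' + k2 lam^2 b + k S - lam^2 (g * b) = 0],
      [rho1 c'' + k (lam A + l S) = 0],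
    where [k = k1 = k3], [S = lam a + b + l c] and [A = lam c + l a]
    ([mode_system]). Everything is proved for one mode, uniformly in
    [lam >= pi / L], and then summed.

    One mode. The energy [E] of a mode only dissipates through the memory of
    [b]. Four multipliers combine into a functional [F], bounded by [E], with
    [F' <= - c E + C (lam^2 b'^2 + P + X)], where [P] is the memory term of the
    energy and [X] its dissipation ([lyap_derive]). Since [k1 = k3], the sums
    [a + c] and [a - c] obey [rho1 (a +- c)'' = - k (lam +- l) (S +- A)]; hence
    [k S] is a second derivative in time and the equation of [b] can be
    multiplied by [b] without losing anything. Dividing by [lam - l] is
    harmless as soon as [l <= pi / (2 L)], which is where [l0] comes from.

    The velocity [b'] is controlled by the memory of [b'] itself, up to
    dissipation ([velocity_bound]). That memory belongs to the energy of the
    system differentiated in time, which is controlled by the data in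
    [H^2 x H^1] ([Zf_derive], [mode_bounds]). So the energy decays relatively to
    this stronger norm [K] of the data.

    The rate. Memory is compared with dissipation through
    [g' <= - xi g^p]: interpolating [g] between [g^p] and [g^(1/2)] gives
    [xi A^(2p-2) P <= C X + small A^(2p-1) K] for every [A >= 0]
    ([mem2_interpolation]); [p < 3/2] makes [xi g^(1/2)] integrable. With
    [A = xi e] and [e] constant, multiplying the inequality for [F'] by
    [xi^(2p-1) e^(2p-2)] and integrating over [[t0, T]] gives
      [e^(2p-2) E(T) I <= C (1 + e^(2p-2)) K + eps e^(2p-1) I K],
    with [I] the integral of [xi^(2p-1)] ([mode_decay]). Here [e] is a free
    parameter common to all modes: summing over the modes and then taking for
    [e] the total energy at time [T], the last term is absorbed by the left-hand
    side and [e^(2p-1) I] is bounded, which is the claim ([absorb_modes],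
    [powR_decay]).

    From the solution to its modes. Weak derivatives are tested against the
    modes by cutting these off near the endpoints; the boundary terms vanish
    because sines do ([weak_ibp_sn]), because the function does ([weak_ibp_cn])
    or by density of test functions ([ip_dx_cn_H10]). Conversely the energy is
    bounded by the sum of the energies of the modes ([energy_le_modes]): the
    coefficients are square summable after multiplication by [lam], so the
    Fourier series converge uniformly, to the function itself by completeness
    ([cosine_complete], [parseval]). *)

(** * Derivatives and integrals on the line *)

Section Calculus.
Variable R : realType.
Implicit Types (f g h : R -> R).

Lemma derD f g (x a b : R) : is_derive x 1 f a -> is_derive x 1 g b ->
  is_derive x 1 (fun t => f t + g t) (a + b).
Proof. by move=> ? ?; exact: is_deriveD. Qed.

Lemma derN f (x a : R) : is_derive x 1 f a ->
  is_derive x 1 (fun t => - f t) (- a).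
Proof. by move=> ?; exact: is_deriveN. Qed.

Lemma derM f g (x a b : R) : is_derive x 1 f a -> is_derive x 1 g b ->
  is_derive x 1 (fun t => f t * g t) (a * g x + f x * b).
Proof.
move=> fa gb; rewrite [X in is_derive _ _ _ X](_ : _ = f x *: b + g x *: a).
  exact: is_deriveM.
by rewrite /GRing.scale /=; ring.
Qed.

Lemma derX f n (x a : R) : is_derive x 1 f a ->
  is_derive x 1 (fun t => f t ^+ n) (n%:R * f x ^+ n.-1 * a).
Proof.
move=> fa; have -> : (fun t => f t ^+ n) = f ^+ n by apply/funext => t; rewrite exprfctE.
exact: is_deriveX.
Qed.

Lemma der_cst (c x : R) : is_derive x 1 (fun=> c) 0.
Proof. exact: is_derive_cst. Qed.

Lemma der_id (x : R) : is_derive x 1 (fun t => t) 1.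
Proof. exact: is_derive_id. Qed.

Lemma der_comp f g (x a b : R) : is_derive (g x) 1 f a -> is_derive x 1 g b ->
  is_derive x 1 (fun t => f (g t)) (a * b).
Proof. by move=> ? ?; exact: is_derive1_comp. Qed.

End Calculus.

(** Differentiates sums, products and powers of functions whose derivatives
    are provided by the context; used on goals whose derivative is an evar. *)
Ltac der := lazymatch goal with
  | |- is_derive _ _ (fun _ => ?c) _ => eapply der_cst
  | |- is_derive _ _ (fun t => t) _ => eapply der_id
  | |- is_derive _ _ (fun t => @?f t + @?g t) _ => eapply (@derD _ f g); [der|der]
  | |- is_derive _ _ (fun t => - @?f t) _ => eapply (@derN _ f); der
  | |- is_derive _ _ (fun t => @?f t * @?g t) _ => eapply (@derM _ f g); [der|der]
  | |- is_derive _ _ (fun t => @?f t ^+ ?n) _ => eapply (@derX _ f n); der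
  | |- is_derive _ _ (fun t => ?f t) _ => change (fun t => f t) with f; der_leaf
  | |- _ => der_leaf
  end
with der_leaf := first
  [ match goal with H : is_derive _ _ ?f _ |- is_derive _ _ ?f _ => exact H end
  | match goal with H : forall _, is_true _ -> is_derive _ _ ?f _ |- is_derive _ _ ?f _ =>
      eapply H; solve [assumption | lra] end
  | match goal with H : forall _, is_derive _ _ ?f _ |- is_derive _ _ ?f _ => eapply H end
  | idtac ].

Section Continuity.
Variable R : realType.
Implicit Types (f g : R -> R).

Lemma contD f g : continuous f -> continuous g -> continuous (fun t => f t + g t).
Proof. by move=> fc gc x; apply: cvgD; [exact: fc|exact: gc]. Qed.

Lemma contN f : continuous f -> continuous (fun t => - f t).
Proof. by move=> fc x; apply: cvgN; exact: fc. Qed.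

Lemma continuousMf f g : continuous f -> continuous g ->
  continuous (fun s => f s * g s).
Proof. by move=> fc gc s; apply: cvgM; [exact: fc|exact: gc]. Qed.

Lemma contX f n : continuous f -> continuous (fun t => f t ^+ n).
Proof.
move=> fc; elim: n => [|n ih]; first by move=> x; exact: cvg_cst.
have -> : (fun t => f t ^+ n.+1) = fun t => f t * f t ^+ n by apply/funext => t; rewrite exprS.
exact: continuousMf.
Qed.

Lemma cont_cst (c : R) : continuous (fun _ : R => c).
Proof. by move=> x; exact: cvg_cst. Qed.

Lemma cont_id : continuous (fun t : R => t).
Proof. by move=> x; exact: cvg_id. Qed.

End Continuity.

(** The analogue of [der] for continuity on the whole line. *)
Ltac ctn := lazymatch goal with
  | |- continuous (fun _ => ?c) => exact (@cont_cst _ c)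
  | |- continuous (fun t => t) => exact (@cont_id _)
  | |- continuous (fun t => @?f t + @?g t) => apply: (@contD _ f g); [ctn|ctn]
  | |- continuous (fun t => - @?f t) => apply: (@contN _ f); ctn
  | |- continuous (fun t => @?f t * @?g t) => apply: (@continuousMf _ f g); [ctn|ctn]
  | |- continuous (fun t => @?f t ^+ ?n) => apply: (@contX _ f n); ctn
  | |- continuous (fun t => ?f t) => change (continuous f); try assumption
  | |- _ => try assumption
  end.

Section Calculus1.
Variable R : realType.
Notation mu := (@lebesgue_measure R).
Implicit Types (f g h : R -> R).

Lemma is_derive_cont f (x a : R) : is_derive x 1 f a -> {for x, continuous f}.
Proof.
by case=> df _; exact/differentiable_continuous/derivable1_diffP.
Qed.

(** Functions of time are only meaningful for [t >= 0]; composing them with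
    [clamp] extends them continuously to the whole line. *)
Definition clamp (t : R) := Num.max 0 t.

Lemma clamp_id (t : R) : 0 <= t -> clamp t = t.
Proof. by move=> t0; apply/max_idPr. Qed.

Lemma clamp0 (t : R) : t <= 0 -> clamp t = 0.
Proof. by move=> t0; apply/max_idPl. Qed.

Lemma clamp_ge0 t : 0 <= clamp t.
Proof. by rewrite /clamp le_max lexx. Qed.

Lemma continuous_clamp : continuous clamp.
Proof.
move=> t.
have E : clamp = fun t => 2^-1 * (t + `|t|).
  apply/funext => u; rewrite /clamp; case: (ltrP 0 u) => u0.
    by rewrite gtr0_norm//; lra.
  by rewrite ler0_norm//; lra.
rewrite E; apply: cvgMr; apply: cvgD; first exact: cvg_id.
exact: norm_continuous.
Qed.

Lemma continuous_clampW f : (forall t : R, 0 <= t -> {for t, continuous f}) ->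
  continuous (fun t => f (clamp t)).
Proof.
move=> fc t; apply: continuous_comp; first exact: continuous_clamp.
exact/fc/clamp_ge0.
Qed.

Lemma continuous_integrable f (a b : R) : continuous f ->
  mu.-integrable `[a, b] (EFin \o f).
Proof.
move=> fc; apply: continuous_compact_integrable; first exact: segment_compact.
exact: continuous_subspaceT.
Qed.

Lemma derive_ge0_le f df (a b : R) : a <= b -> continuous f ->
  (forall x : R, a < x < b -> is_derive x 1 f (df x)) ->
  (forall x : R, a < x < b -> 0 <= df x) -> f a <= f b.
Proof.
move=> ab fc fd d0; apply: (@ger0_derive1_ndecr _ f a b) => //.
- by move=> x; rewrite in_itv/= => /fd[].
- by move=> x; rewrite in_itv/= => xab; rewrite derive1E; have [_ ->] := fd _ xab; exact: d0.
- exact: continuous_subspaceT.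
Qed.

Lemma derive_le0_le f df (a b : R) : a <= b -> continuous f ->
  (forall x : R, a < x < b -> is_derive x 1 f (df x)) ->
  (forall x : R, a < x < b -> df x <= 0) -> f b <= f a.
Proof.
move=> ab fc fd d0; rewrite -lerN2.
apply: (@derive_ge0_le (fun x => - f x) (fun x => - df x)) => //.
- by move=> x; apply: cvgN; exact: fc.
- by move=> x /fd; exact: derN.
- by move=> x /d0; rewrite oppr_ge0.
Qed.

Lemma derive_eq f g df (a b : R) : a <= b -> continuous f -> continuous g ->
  (forall x : R, a < x < b -> is_derive x 1 f (df x)) ->
  (forall x : R, a < x < b -> is_derive x 1 g (df x)) ->
  f b - f a = g b - g a.
Proof.
move=> ab fc gc fd gd.
have c : continuous (fun x => f x - g x) by move=> x; apply: cvgB; [exact: fc|exact: gc].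
have d x : a < x < b -> is_derive x 1 (fun x => f x - g x) 0.
  move=> xab; apply: is_derive_eq; first by apply: derD (fd _ xab) (derN (gd _ xab)).
  by rewrite subrr.
have := @derive_ge0_le _ _ _ _ ab c d (fun _ _ => lexx _).
have := @derive_le0_le _ _ _ _ ab c d (fun _ _ => lexx _).
by move=> *; lra.
Qed.

Definition Iu f t := \int[mu]_(s in `[0, t]) f s.

Lemma Iu0 f (t : R) : t <= 0 -> Iu f t = 0.
Proof.
rewrite /Iu le_eqVlt => /predU1P[->|t0]; first by rewrite set_itv1 Rintegral_set1.
by rewrite set_itv_ge ?Rintegral_set0// bnd_simp -ltNge.
Qed.

Lemma Iu_clamp f t : Iu f (clamp t) = Iu f t.
Proof.
have [t0|/ltW t0] := leP 0 t; first by rewrite clamp_id.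
by rewrite clamp0// !Iu0.
Qed.

Section Iu_continuous.
Variable f : R -> R.
Hypothesis fc : continuous f.

Lemma is_derive_integral (a t : R) : a < t ->
  is_derive t 1 (fun t => \int[mu]_(s in `[a, t]) f s) (f t).
Proof.
move=> at0.
have t1 : t < t + 1 by rewrite ltrDl.
have := @continuous_FTC1_closed R f a t (t + 1) t1 (continuous_integrable a (t + 1) fc) at0 (@fc t).
by move=> [d <-]; rewrite derive1E; exact/derivableP.
Qed.

Lemma is_derive_Iu (t : R) : 0 < t -> is_derive t 1 (Iu f) (f t).
Proof. exact: is_derive_integral. Qed.

Lemma Iu_split (a t : R) : a <= 0 -> 0 <= t ->
  Iu f t = \int[mu]_(s in `[a, t]) f s - \int[mu]_(s in `[a, 0]) f s.
Proof.
move=> a0 t0; rewrite Rintegral_itvB ?bnd_simp//; last exact: continuous_integrable.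
rewrite Rintegral_itv_obnd_cbnd//.
by apply: integrableS (continuous_integrable 0 t fc) => //=; apply: subset_itvr; rewrite bnd_simp.
Qed.

Lemma continuous_Iu : continuous (Iu f).
Proof.
have -> : Iu f = fun t => (fun t : R => \int[mu]_(s in `[-1, t]) f s - \int[mu]_(s in `[-1, 0]) f s) (clamp t).
  by apply/funext => t; rewrite -Iu_clamp; apply: Iu_split; [lra|exact: clamp_ge0].
apply: (@continuous_clampW (fun t : R => \int[mu]_(s in `[-1, t]) f s - \int[mu]_(s in `[-1, 0]) f s)) => t t0.
apply: cvgB; last exact: cvg_cst.
have : -1 < t by lra.
by move/is_derive_integral/is_derive_cont.
Qed.

End Iu_continuous.

Lemma IuD f g t : continuous f -> continuous g ->
  Iu (fun s => f s + g s) t = Iu f t + Iu g t.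
Proof. by move=> fc gc; apply: RintegralD => //; exact: continuous_integrable. Qed.

Lemma IuZ f c t : continuous f -> Iu (fun s => c * f s) t = c * Iu f t.
Proof. by move=> fc; apply: RintegralZl => //; exact: continuous_integrable. Qed.

Lemma Iu_cst c t : 0 <= t -> Iu (fun=> c) t = c * t.
Proof.
move=> t0; rewrite /Iu Rintegral_cst//= lebesgue_measure_itv/= lte_fin.
case: ltP => [t0'|]; first by rewrite oppr0 adde0.
by move=> t0'; have -> : t = 0 by apply/eqP; rewrite eq_le t0 t0'.
Qed.

Lemma Iu_le f g t : continuous f -> continuous g ->
  (forall s : R, 0 <= s <= t -> f s <= g s) -> Iu f t <= Iu g t.
Proof.
move=> fc gc fg; apply: le_Rintegral; [by []|exact: continuous_integrable|exact: continuous_integrable|].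
by move=> s; rewrite /= in_itv/=; exact: fg.
Qed.

Lemma Iu_ge0 f t : (forall s : R, 0 <= s <= t -> 0 <= f s) -> 0 <= Iu f t.
Proof. by move=> f0; apply: Rintegral_ge0 => s; rewrite /= in_itv/=; exact: f0. Qed.

Lemma eq_Iu f g t : (forall s : R, 0 <= s <= t -> f s = g s) -> Iu f t = Iu g t.
Proof. by move=> fg; apply: eq_Rintegral => s; rewrite inE/= in_itv/=; exact: fg. Qed.

Lemma Iu_rev f t : continuous f -> Iu (fun s => f (t - s)) t = Iu f t.
Proof.
move=> fc; have [t0|/ltW t0] := leP 0 t; last by rewrite !Iu0.
have Fd : derive1 (fun s : R => t - s) = cst (-1).
  apply/funext => s; rewrite derive1E.
  by have [_ ->] := derD (der_cst t s) (derN (der_id s)); rewrite add0r.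
have Fc : continuous (fun s : R => t - s).
  by move=> s; apply: cvgB; [exact: cvg_cst|exact: cvg_id].
have := @integration_by_substitution_decreasing R (fun s => t - s) f 0 t t0.
rewrite subrr subr0 Fd => H; congr fine; rewrite H.
- by apply: eq_integral => x _; rewrite !fctE /= opprK mulr1.
- by move=> x y _ _ xy; rewrite ltrD2l ltrN2.
- by move=> x _; exact: cvg_cst.
- exact: is_cvg_cst.
- exact: is_cvg_cst.
- split.
  + by move=> x _; have [] := derD (der_cst t x) (derN (der_id x)).
  + by apply: cvg_at_right_filter; exact: Fc.
  + by apply: cvg_at_left_filter; exact: Fc.
- exact: continuous_subspaceT.
Qed.

(** * Convolutions over bounded intervals *)

Definition conv g f t := Iu (fun s => g s * f (t - s)) t.

Lemma continuous_rev f t : continuous f -> continuous (fun s => f (t - s)).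
Proof.
move=> fc s; apply: (@continuous_comp _ _ _ (fun s => t - s) f); last exact: fc.
by apply: cvgB; [exact: cvg_cst|exact: cvg_id].
Qed.

Lemma convC g f t : continuous g -> continuous f -> conv g f t = conv f g t.
Proof.
move=> gc fc; rewrite /conv -Iu_rev; last first.
  by apply: continuousMf => //; exact: continuous_rev.
by apply: eq_Iu => s _; rewrite mulrC; congr (f _ * _); ring.
Qed.

(* For f of class C^1 on [0, oo) the kernel is split as f 0 + f1 0 * u plus a
   remainder that extends by 0 to a C^1 function on the whole line; for that
   remainder the domain of integration can be taken independent of t. *)
Section conv_C1.
Variables g f f1 : R -> R.
Hypotheses (gc : continuous g) (fc : continuous f) (f1c : continuous f1).
Hypothesis fd : forall u : R, 0 < u -> is_derive u 1 f (f1 u).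

Variable T : R.
Hypothesis T0 : 0 < T.

Let h u := f1 (clamp u) - f1 0.
Let F u := \int[mu]_(s in `[- (2 * T) - 1, u]) h s.

Let hc : continuous h.
Proof.
apply: (@continuous_clampW (fun u => f1 u - f1 0)) => t _.
by apply: cvgB; [exact: f1c|exact: cvg_cst].
Qed.

Let h0 (u : R) : u <= 0 -> h u = 0.
Proof. by move=> u0; rewrite /h clamp0// subrr. Qed.

Let Fd (u : R) : - (2 * T) - 1 < u -> is_derive u 1 F (h u).
Proof. by move=> u0; exact: is_derive_integral. Qed.

Let F0 (u : R) : u <= 0 -> F u = 0.
Proof.
move=> u0; rewrite /F; under eq_Rintegral => s.
  rewrite inE/= in_itv/= => /andP[_ su]; rewrite h0//; last exact: le_trans su u0.
  over.
by rewrite Rintegral_cst// mul0r.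
Qed.

Let Fpos (u : R) : 0 <= u -> F u = f u - f 0 - f1 0 * u.
Proof.
move=> u0.
pose A x := f (clamp x) - f 0 - f1 0 * clamp x.
pose B x := F (clamp x).
have Ac : continuous A.
  apply: (@continuous_clampW (fun x => f x - f 0 - f1 0 * x)) => t _.
  by apply: cvgB; [apply: cvgB; [exact: fc|exact: cvg_cst]|apply: cvgMr; exact: cvg_id].
have Bc : continuous B.
  apply: (@continuous_clampW F) => t t0; have Tt : - (2 * T) - 1 < t by have := T0; lra.
  exact: is_derive_cont (Fd Tt).
have E (x : R) : 0 < x -> \forall y \near x, clamp y = y.
  by move=> x0; near=> y; apply: clamp_id; apply: ltW; near: y; exact: lt_nbhsr.
have := @derive_eq A B h 0 u u0 Ac Bc.
move=> AB; suff : A u - A 0 = B u - B 0.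
  by rewrite /A /B !clamp_id// (F0 (lexx 0)) !subrr mulr0 subr0 !subr0.
apply: AB.
- move=> x /andP[x0 _].
  apply: (@near_eq_is_derive _ _ _ (fun x => f x - f 0 - f1 0 * x)).
    by near=> y; rewrite /A (near (E x x0) y).
  have fx := fd x0.
  by eapply is_derive_eq; [der|rewrite /h clamp_id ?(ltW x0)//; ring].
- move=> x /andP[x0 _].
  apply: (@near_eq_is_derive _ _ _ F).
    by near=> y; rewrite /B (near (E x x0) y).
  by apply: Fd; have := T0; lra.
Unshelve. all: by end_near. Qed.

Let Fc : continuous F.
Proof.
have -> : F = fun u => F (clamp u).
  apply/funext => u; have [u0|/ltW u0] := leP 0 u; first by rewrite clamp_id.
  by rewrite clamp0// !F0.
apply: (@continuous_clampW F) => t t0; have Tt : - (2 * T) - 1 < t by have := T0; lra.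
exact: is_derive_cont (Fd Tt).
Qed.

Let P t := \int[mu]_(s in `[0, T]) (g s * F (t - s)).

Let PE (t : R) : t <= T -> P t = Iu (fun s => g s * F (t - s)) t.
Proof.
move=> tT; have cgF : continuous (fun s => g s * F (t - s)).
  by apply: continuousMf => //; exact: continuous_rev.
have [t0|t0] := leP 0 t; last first.
  rewrite Iu0 ?(ltW t0)// /P; under eq_Rintegral => s.
    rewrite inE/= in_itv/= => /andP[s0 _]; rewrite F0 ?mulr0; last by lra.
    over.
  by rewrite Rintegral_cst// mul0r.
apply/eqP; rewrite -subr_eq0 Rintegral_itvB ?bnd_simp//; last exact: continuous_integrable.
under eq_Rintegral => s.
  rewrite inE/= in_itv/= => /andP[s0 _]; rewrite F0 ?mulr0; last by lra.
  over.
by rewrite Rintegral_cst// mul0r.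
Qed.

Let convE (t : R) : t <= T -> conv g f t =
  f 0 * Iu g t + f1 0 * (t * Iu g t - Iu (fun s => s * g s) t) + P t.
Proof.
move=> tT; rewrite PE//; have [t0|/ltW t0] := leP 0 t; last first.
  by rewrite /conv !Iu0//; ring.
have sgc : continuous (fun s : R => s * g s).
  by apply: continuousMf => //; move=> x; exact: cvg_id.
have cgF : continuous (fun s => g s * F (t - s)).
  by apply: continuousMf => //; exact: continuous_rev.
have -> : conv g f t = Iu (fun s => (f 0 + f1 0 * t) * g s +
    ((- f1 0) * (s * g s) + g s * F (t - s))) t.
  apply: eq_Iu => s /andP[s0 st]; rewrite (Fpos (u := t - s)); first by ring.
  by rewrite subr_ge0.
rewrite IuD; [|by apply: continuousMf => // ?; exact: cvg_cst|]; last first.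
  move=> x; apply: cvgD; last exact: cgF.
  by apply: cvgMr; exact: sgc.
rewrite IuD//; last by apply: continuousMf => // ?; exact: cvg_cst.
by rewrite !IuZ//; ring.
Qed.

Let bounded_on (k : R -> R) (a b : R) : continuous k -> exists2 M : R, 0 <= M &
  forall x : R, a <= x <= b -> `|k x| <= M.
Proof.
move=> kc; have [ab|ba] := leP a b; last first.
  by exists 0 => // x /andP[ax xb]; move: (le_trans ax xb); rewrite leNgt ba.
have nc : {within `[a, b], continuous (fun x => `|k x|)}.
  by apply: continuous_subspaceT => x; apply: cvg_norm; exact: kc.
have [c cab cmax] := EVT_max ab nc.
by exists `|k c| => // x xab; apply: cmax; rewrite in_itv.
Qed.

Let P_derive (t : R) : - T < t < T -> is_derive t 1 P (\int[mu]_(s in `[0, T]) (g s * h (t - s))).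
Proof.
move=> tT; have [M1 M10 gM] := bounded_on 0 T gc.
have [M2 M20 hM] := bounded_on (- (2 * T)) T hc.
pose k (x s : R) := g s * F (x - s).
have kd x s : - T < x < T -> 0 <= s <= T -> is_derive x 1 (k ^~ s) (g s * h (x - s)).
  move=> /andP[x1 x2] /andP[s1 s2]; rewrite /k.
  have Fs : is_derive x 1 (fun x => F (x - s)) (h (x - s) * (1 + 0)).
    have xs : - (2 * T) - 1 < x - s by lra.
    exact: (der_comp (g := fun x => x - s) (Fd xs) (derD (der_id x) (der_cst (- s) x))).
  by eapply is_derive_eq; [der|ring].
have d1E x s : - T < x < T -> 0 <= s <= T -> partial1of2 k x s = g s * h (x - s).
  by move=> xT sT; rewrite partial1of2E; have [_ ->] := kd x s xT sT.
have tin : `](- T), T[%classic t by rewrite /= in_itv.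
have ik x : `](- T), T[%classic x -> mu.-integrable `[0, T] (EFin \o k x).
  move=> _; apply: (@continuous_integrable (k x)).
  by apply: continuousMf => //; exact: continuous_rev.
have kd' x s : `](- T), T[%classic x -> `[0, T]%classic s -> derivable (k ^~ s) x 1.
  by rewrite /= !in_itv/= => xT sT; have [] := kd x s xT sT.
have kb x s : `](- T), T[%classic x -> `[0, T]%classic s -> `|partial1of2 k x s| <= (fun=> M1 * M2) s.
  rewrite /= !in_itv/= => xT sT; rewrite d1E// normrM ler_pM//; first exact: gM.
  by apply: hM; move: xT sT => /andP[? ?] /andP[? ?]; apply/andP; split; lra.
have M0 : forall y : R, 0 <= (fun=> M1 * M2) y by move=> _; exact: mulr_ge0.
have iM : mu.-integrable `[0, T] (EFin \o (fun _ : R => M1 * M2)).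
  by apply: continuous_integrable => x; exact: cvg_cst.
have mT : measurable (`[0, T]%classic : set (measurableTypeR R)) by exact: measurable_itv.
have dP := @derivable_under_integral R _ _ mu k _ mT t (- T) T tin ik kd' _ M0 iM kb.
have eP := @differentiation_under_integral R _ _ mu k _ mT t (- T) T tin ik kd' _ M0 iM kb.
apply: DeriveDef; first exact: dP.
rewrite -derive1E eP; apply: eq_Rintegral => s; rewrite inE/= in_itv/= => sT.
exact: d1E.
Qed.

Let is_derive_conv_lt (t : R) : 0 < t < T -> is_derive t 1 (conv g f) (g t * f 0 + conv g f1 t).
Proof.
move=> /andP[t0 tT].
have sgc : continuous (fun s : R => s * g s).
  by apply: continuousMf => //; move=> x; exact: cvg_id.
apply: (@near_eq_is_derive _ _ _ (fun t => f 0 * Iu g t +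
    f1 0 * (t * Iu g t - Iu (fun s => s * g s) t) + P t)).
  by near=> x; rewrite -convE//; apply: ltW; near: x; exact: lt_nbhsl.
have tT' : - T < t < T by lra.
have Pd := P_derive tT'.
have Gd := is_derive_Iu gc t0; have sGd := is_derive_Iu sgc t0.
eapply is_derive_eq; first by der.
have -> : conv g f1 t = f1 0 * Iu g t + \int[mu]_(s in `[0, T]) (g s * h (t - s)).
  have ch : continuous (fun s => g s * h (t - s)).
    by apply: continuousMf => //; exact: continuous_rev.
  have -> : \int[mu]_(s in `[0, T]) (g s * h (t - s)) = Iu (fun s => g s * h (t - s)) t.
    apply/eqP; rewrite -subr_eq0 Rintegral_itvB ?bnd_simp ?(ltW tT) ?(ltW t0)//; last exact: continuous_integrable.
    under eq_Rintegral => s.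
      rewrite inE/= in_itv/= => /andP[s0 _]; rewrite h0 ?mulr0; last by lra.
      over.
    by rewrite Rintegral_cst// mul0r.
  rewrite -IuZ// -IuD//; last by apply: continuousMf => // ?; exact: cvg_cst.
  apply: eq_Iu => s /andP[s0 st]; rewrite /h clamp_id ?subr_ge0//; ring.
by ring.
Unshelve. all: by end_near. Qed.

Let continuous_conv_lt (t : R) : 0 <= t < T -> {for t, continuous (conv g f)}.
Proof.
move=> /andP[t0 tT].
pose E t := f 0 * Iu g t + f1 0 * (t * Iu g t - Iu (fun s => s * g s) t) + P t.
have En : {near t, E =1 conv g f}.
  by near=> x; rewrite convE//; apply: ltW; near: x; exact: lt_nbhsl.
rewrite /prop_for /continuous_at -(nbhs_singleton En).
apply: (cvg_trans (near_eq_cvg En)).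
have sgc : continuous (fun s : R => s * g s).
  by apply: continuousMf => //; move=> x; exact: cvg_id.
apply: cvgD; last by apply: is_derive_cont (P_derive (t := t) _); lra.
apply: cvgD; first by apply: cvgMr; exact: continuous_Iu.
apply: cvgMr; apply: cvgB; last exact: continuous_Iu.
by apply: cvgM; [exact: cvg_id|exact: continuous_Iu].
Unshelve. all: by end_near. Qed.

Definition conv_C1_local := (is_derive_conv_lt, continuous_conv_lt).

End conv_C1.

Lemma is_derive_conv g f f1 (t : R) : continuous g -> continuous f ->
  continuous f1 -> (forall u : R, 0 < u -> is_derive u 1 f (f1 u)) ->
  0 < t -> is_derive t 1 (conv g f) (g t * f 0 + conv g f1 t).
Proof.
move=> gc fc f1c fd t0; have T0 : 0 < t + 1 by lra.
by apply: (conv_C1_local gc fc f1c fd T0).1; lra.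
Qed.

Lemma continuous_conv g f f1 : continuous g -> continuous f ->
  continuous f1 -> (forall u : R, 0 < u -> is_derive u 1 f (f1 u)) ->
  continuous (conv g f).
Proof.
move=> gc fc f1c fd.
have -> : conv g f = fun t => conv g f (clamp t).
  apply/funext => t; have [t0|/ltW t0] := leP 0 t; first by rewrite clamp_id.
  by rewrite clamp0// /conv !Iu0.
apply: continuous_clampW => t t0; have T0 : 0 < t + 1 by lra.
by apply: (conv_C1_local gc fc f1c fd T0).2; lra.
Qed.

End Calculus1.

(** * Memory and dissipation *)

Section Memory.
Variable R : realType.
Implicit Types (f g : R -> R).

(** Class [C^1] on the half line: the values at negative times are only there
    to make the functions continuous on the whole line. *)
Definition C1half f f1 := [/\ continuous f, continuous f1 &
  forall t : R, 0 < t -> is_derive t 1 f (f1 t)].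

Definition kernel g g1 := [/\ continuous g, forall t : R, 0 <= g t,
  forall t : R, 0 < t -> is_derive t 1 g (g1 t) &
  forall t : R, 0 < t -> g1 t <= 0].

(** [mem1] and [mem2] are the integrals of [g r * (f t - f (t - r))] and of
    [g r * (f t - f (t - r)) ^+ 2] over [[0, t]], expanded so that only
    convolutions have to be differentiated. *)
Definition mem1 g f t := Iu g t * f t - conv g f t.

Definition mem2 g f t :=
  Iu g t * f t ^+ 2 - 2 * f t * conv g f t + conv g (fun s => f s ^+ 2) t.

(** The same integrals with [- g'] in place of [g]. As [g'] may fail to be
    integrable, the integration by parts that removes it is made part of the
    definition; [f1] is the derivative of [f]. *)
Definition dis1 g f f1 t := conv g f1 t - g t * (f t - f 0).

Definition dis2 g f f1 t := 2 * f t * conv g f1 t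
  - 2 * conv g (fun s => f s * f1 s) t - g t * (f t - f 0) ^+ 2.

Lemma C1half_sqr f f1 : C1half f f1 ->
  C1half (fun s => f s ^+ 2) (fun s => 2 * (f s * f1 s)).
Proof.
move=> [fc f1c fd]; split; [by ctn|by ctn|] => t t0; have ft := fd _ t0.
by eapply is_derive_eq; [der|rewrite /=; ring].
Qed.

(** The discriminant of a nonnegative quadratic polynomial. *)
Lemma quad_sqr_le (a b c : R) : 0 <= c ->
  (forall x, 0 <= a - 2 * x * b + x ^+ 2 * c) -> b ^+ 2 <= c * a.
Proof.
move=> c0 H; have [c_eq0|cN0] := eqVneq c 0.
  have [->|bN0] := eqVneq b 0; first by rewrite c_eq0 mul0r expr0n.
  have := H ((a + 1) / (2 * b)); rewrite c_eq0 mulr0 addr0.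
  have -> : 2 * ((a + 1) / (2 * b)) * b = a + 1 by field.
  by move=> ?; exfalso; lra.
have c0' : 0 < c by rewrite lt0r cN0.
have := H (b / c).
have -> : a - 2 * (b / c) * b + (b / c) ^+ 2 * c = (c * a - b ^+ 2) / c by field.
by rewrite pmulr_lge0 ?invr_gt0// subr_ge0.
Qed.

Section kernel_C1.
Variables (g g1 f f1 : R -> R).
Hypotheses (kg : kernel g g1) (Cf : C1half f f1).

Let gc : continuous g. Proof. by case: kg. Qed.
Let fc : continuous f. Proof. by case: Cf. Qed.
Let f1c : continuous f1. Proof. by case: Cf. Qed.
Let fd : forall t : R, 0 < t -> is_derive t 1 f (f1 t). Proof. by case: Cf. Qed.

(** The shift by [a] is what turns the bounds on [mem2] and [dis2] into
    Cauchy-Schwarz inequalities for [mem1] and [dis1]. *)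
Lemma mem_shift (a t : R) :
  mem2 g f t - 2 * a * mem1 g f t + a ^+ 2 * Iu g t =
  Iu (fun r => g r * (f t - f (t - r) - a) ^+ 2) t.
Proof.
have rc : continuous (fun r => f (t - r)) by exact: continuous_rev.
have f2c : continuous (fun s => f s ^+ 2) by ctn.
have r2c : continuous (fun r => f (t - r) ^+ 2) by ctn.
have -> : (fun r => g r * (f t - f (t - r) - a) ^+ 2) = fun r =>
    (f t - a) ^+ 2 * g r + ((- (2 * (f t - a))) * (g r * f (t - r)) + g r * f (t - r) ^+ 2).
  by apply/funext => r; ring.
rewrite IuD; [|by ctn|by ctn]; rewrite IuD; [|by ctn|by ctn].
rewrite IuZ; [|by ctn]; rewrite IuZ; [|by ctn].
by rewrite /mem1 /mem2 /conv; ring.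
Qed.

Lemma mem2E t : mem2 g f t = Iu (fun r => g r * (f t - f (t - r)) ^+ 2) t.
Proof.
have := mem_shift 0 t; rewrite mulr0 mul0r subr0 expr0n mul0r addr0 => ->.
by congr (Iu _ t); apply/funext => r; rewrite subr0.
Qed.

Lemma mem2_ge0 t : 0 <= mem2 g f t.
Proof.
rewrite mem2E; apply: Iu_ge0 => s _; apply: mulr_ge0; last exact: sqr_ge0.
by case: kg.
Qed.

Lemma Iu_kernel_ge0 t : 0 <= Iu g t.
Proof. by apply: Iu_ge0 => s _; case: kg. Qed.

Lemma mem1_sqr t : mem1 g f t ^+ 2 <= Iu g t * mem2 g f t.
Proof.
apply: quad_sqr_le => [|a]; first exact: Iu_kernel_ge0.
rewrite mem_shift; apply: Iu_ge0 => s _; apply: mulr_ge0; last exact: sqr_ge0.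
by case: kg.
Qed.

(** Since [g] is merely differentiable, [- \int g' h] is represented through an
    integration by parts; comparing it with [\int k h] for [k <= - g'] then
    only takes the monotonicity of a function of the upper bound. *)
Lemma dis_shift (k : R -> R) (a t : R) : 0 <= t -> continuous k ->
  (forall s : R, 0 < s -> k s <= - g1 s) ->
  Iu (fun r => k r * (f t - f (t - r) - a) ^+ 2) t <=
  dis2 g f f1 t - 2 * a * dis1 g f f1 t + a ^+ 2 * (g 0 - g t).
Proof.
move=> t0 kc kg1; case: (kg) => _ g0 gd g1le.
have rc : continuous (fun r => f (t - r)) by exact: continuous_rev.
have r1c : continuous (fun r => f1 (t - r)) by exact: continuous_rev.
pose e r := f t - f (t - r).
have ec : continuous e by rewrite /e; ctn.
have ed r : 0 < r < t -> is_derive r 1 e (f1 (t - r)).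
  move=> /andP[r0 rt]; have tr : 0 < t - r by rewrite subr_gt0.
  have H := der_comp (g := fun x => t - x) (fd tr) (derD (der_cst t r) (derN (der_id r))).
  by rewrite /e; eapply is_derive_eq; [der|ring].
have c1 : continuous (fun r => g r * (2 * (e r * f1 (t - r)))) by ctn.
have c2 : continuous (fun r => g r * f1 (t - r)) by ctn.
have c3 : continuous (fun r => k r * (e r - a) ^+ 2) by ctn.
pose W r := Iu (fun r => g r * (2 * (e r * f1 (t - r)))) r - g r * e r ^+ 2
   - 2 * a * (Iu (fun r => g r * f1 (t - r)) r - g r * e r)
   + a ^+ 2 * (g 0 - g r) - Iu (fun r => k r * (e r - a) ^+ 2) r.
have c1' := continuous_Iu c1; have c2' := continuous_Iu c2; have c3' := continuous_Iu c3.
have Wc : continuous W by rewrite /W; ctn.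
have : W 0 <= W t.
  apply: (@derive_ge0_le _ W (fun r => (- g1 r - k r) * (e r - a) ^+ 2)) => //.
    move=> r /andP[r0 rt]; have := ed r; rewrite r0 rt => /(_ isT) er.
    have gr := gd _ r0; have d1 := is_derive_Iu c1 r0; have d2 := is_derive_Iu c2 r0.
    have d3 := is_derive_Iu c3 r0.
    by rewrite /W; eapply is_derive_eq; [der|rewrite /=; ring].
  move=> r /andP[r0 rt]; apply: mulr_ge0; last exact: sqr_ge0.
  by have := kg1 r r0; lra.
have -> : W 0 = 0.
  have e0 : e 0 = 0 by rewrite /e subr0 subrr.
  by rewrite /W !Iu0// e0; ring.
rewrite /W; set I3 := Iu (fun r => k r * _) t.
have -> : Iu (fun r => g r * (2 * (e r * f1 (t - r)))) t =
   2 * f t * conv g f1 t - 2 * conv g (fun s => f s * f1 s) t.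
  have -> : (fun r => g r * (2 * (e r * f1 (t - r)))) = fun r =>
     (2 * f t) * (g r * f1 (t - r)) + (- 2) * (g r * (f (t - r) * f1 (t - r))).
    by apply/funext => r; rewrite /e; ring.
  rewrite IuD; [|by ctn|by ctn]; rewrite IuZ; [|by ctn]; rewrite IuZ; [|by ctn].
  by rewrite /conv; ring.
have -> : e t = f t - f 0 by rewrite /e subrr.
by rewrite /dis1 /dis2 /conv; lra.
Qed.

Lemma dis2_ge0 (t : R) : 0 <= t -> 0 <= dis2 g f f1 t.
Proof.
move=> t0; have := @dis_shift (fun=> 0) 0 t t0.
rewrite mulr0 mul0r subr0 expr0n mul0r addr0 => H.
apply: le_trans (H _ _).
- by apply: Iu_ge0 => s _; rewrite mul0r.
- by ctn.
- by move=> s s0; rewrite oppr_ge0; case: kg => _ _ _; exact.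
Qed.

Lemma dis2_ge (k : R -> R) (t : R) : 0 <= t -> continuous k ->
  (forall s : R, 0 < s -> k s <= - g1 s) ->
  Iu (fun r => k r * (f t - f (t - r)) ^+ 2) t <= dis2 g f f1 t.
Proof.
move=> t0 kc kg1; have := @dis_shift k 0 t t0 kc kg1.
rewrite mulr0 mul0r subr0 expr0n mul0r addr0; apply: le_trans.
by rewrite le_eqVlt; apply/orP; left; apply/eqP; apply: eq_Iu => s _; rewrite subr0.
Qed.

Lemma dis1_sqr (t : R) : 0 <= t -> dis1 g f f1 t ^+ 2 <= g 0 * dis2 g f f1 t.
Proof.
case: (kg) => _ g0 _ g1le.
move=> t0; apply: quad_sqr_le => // a; have := @dis_shift (fun=> 0) a t t0.
have zc : continuous (fun _ : R => 0 : R) by ctn.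
have Hk (s : R) : 0 < s -> 0 <= - g1 s by move=> s0; rewrite oppr_ge0; exact: g1le.
move=> /(_ zc Hk) H.
have I0 : 0 <= Iu (fun r => 0 * (f t - f (t - r) - a) ^+ 2) t.
  by apply: Iu_ge0 => s _; rewrite mul0r.
apply: (le_trans I0); apply: (le_trans H); rewrite lerD2l.
by apply: ler_wpM2l; [exact: sqr_ge0|have := g0 t; lra].
Qed.

Lemma continuous_conv_C1 : continuous (conv g f).
Proof. exact: (continuous_conv gc fc f1c fd). Qed.

Lemma is_derive_conv_C1 (t : R) : 0 < t ->
  is_derive t 1 (conv g f) (g t * f 0 + conv g f1 t).
Proof. exact: is_derive_conv. Qed.

End kernel_C1.

Section kernel_C1_mem2.
Variables (g g1 f f1 : R -> R).
Hypotheses (kg : kernel g g1) (Cf : C1half f f1).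

Let gc : continuous g. Proof. by case: kg. Qed.

Lemma continuous_mem2 : continuous (mem2 g f).
Proof.
case: (Cf) => fc _ _; have Gc := continuous_Iu gc.
have cc := continuous_conv_C1 kg Cf; have c2 := continuous_conv_C1 kg (C1half_sqr Cf).
by rewrite /mem2; ctn.
Qed.

Lemma is_derive_mem2 (t : R) : 0 < t ->
  is_derive t 1 (mem2 g f) (2 * f1 t * mem1 g f t - dis2 g f f1 t).
Proof.
move=> t0; case: (Cf) => fc f1c fd.
have Gd := is_derive_Iu gc t0; have ft := fd _ t0.
have cd := is_derive_conv_C1 kg Cf t0; have cd2 := is_derive_conv_C1 kg (C1half_sqr Cf) t0.
have E : conv g (fun s => 2 * (f s * f1 s)) t = 2 * conv g (fun s => f s * f1 s) t.
  have rc : continuous (fun r => f (t - r)) by exact: continuous_rev.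
  have r1c : continuous (fun r => f1 (t - r)) by exact: continuous_rev.
  rewrite /conv -IuZ; last by ctn.
  by apply: eq_Iu => s _; ring.
by rewrite /mem2; eapply is_derive_eq; [der|rewrite E /dis2 /mem1 /=; ring].
Qed.

End kernel_C1_mem2.

End Memory.

(** * Algebra of the Lyapunov functional *)

(** Sign of expressions built from quantities of known sign. *)
Ltac pos := first [ assumption | apply: ltW; assumption | lazymatch goal with
  | |- is_true (0 <= _ + _) => apply: addr_ge0; pos
  | |- is_true (0 <= _ * _) => apply: mulr_ge0; pos
  | |- is_true (0 <= _ ^+ 2) => exact: sqr_ge0
  | |- is_true (0 <= _ ^+ _) => first [by apply: exprn_even_ge0 | apply: exprn_ge0; pos]
  | |- is_true (0 <= _ ^-1) => rewrite invr_ge0; pos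
  | |- is_true (0 < _ * _) => apply: mulr_gt0; pos
  | |- is_true (0 < _ ^+ _) => apply: exprn_gt0; pos
  | |- is_true (0 < _ ^-1) => rewrite invr_gt0; pos
  | |- is_true (0 < _ + _) => first [apply: ltr_wpDr; solve [pos] | apply: ltr_wpDl; solve [pos] | idtac]
  | |- _ => first [done | by apply: ltW | lra | idtac]
  end ].

Section Algebra.
Variable R : realType.
Implicit Types (x y e i : R).

Lemma young e x y : 0 < e -> x * y <= e * x ^+ 2 + e^-1 * y ^+ 2.
Proof.
move=> e0; have ei : 0 < e^-1 by rewrite invr_gt0.
have H : 0 <= e * (x - e^-1 * y) ^+ 2 by rewrite mulr_ge0 ?sqr_ge0// ltW.
have -> : e * x ^+ 2 + e^-1 * y ^+ 2 = e * (x - e^-1 * y) ^+ 2 + 2 * (x * y) by field; lra.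
have H2 : 0 <= e * x ^+ 2 + e^-1 * y ^+ 2 by rewrite addr_ge0// mulr_ge0 ?sqr_ge0// ltW.
have H3 : 0 <= e * (x + e^-1 * y) ^+ 2 by rewrite mulr_ge0 ?sqr_ge0// ltW.
have H4 : e * (x + e^-1 * y) ^+ 2 = e * (x - e^-1 * y) ^+ 2 + 4 * (x * y) by field; lra.
lra.
Qed.

(** The coefficients met below depend on the frequency, but stay bounded. *)
Lemma youngc e x y c cm : 0 < e -> `|c| <= cm ->
  c * x * y <= e * x ^+ 2 + e^-1 * cm ^+ 2 * y ^+ 2.
Proof.
move=> e0 ccm; have ei : 0 < e^-1 by rewrite invr_gt0.
have := young x (c * y) e0; rewrite exprMn => H.
have -> : c * x * y = x * (c * y) by ring.
apply: (le_trans H); rewrite lerD2l mulrA ler_wpM2r ?sqr_ge0// ler_wpM2l ?(ltW ei)//.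
by rewrite -real_normK ?num_real// ler_pXn2r ?nnegrE ?(le_trans _ ccm).
Qed.

Lemma youngp e x y c cm : 0 < e -> 0 <= c -> c <= cm ->
  c * x * y <= e * x ^+ 2 + e^-1 * cm ^+ 2 * y ^+ 2.
Proof. by move=> e0 c0 ccm; apply: youngc => //; rewrite ger0_norm. Qed.

Lemma youngn e x y c cm : 0 < e -> 0 <= c -> c <= cm ->
  - c * x * y <= e * x ^+ 2 + e^-1 * cm ^+ 2 * y ^+ 2.
Proof. by move=> e0 c0 ccm; apply: youngc => //; rewrite normrN ger0_norm. Qed.

Section Lyapunov_algebra.
Variables (r1 r2 k k2 l kap g0 i0 : R).
Hypotheses (r1p : 0 < r1) (r2p : 0 < r2) (kp : 0 < k) (k2p : 0 < k2) (lp : 0 < l)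
  (kapp : 0 < kap) (g0p : 0 <= g0) (i0p : 0 < i0).

(** In the next lemmas [i], [p], [r] stand for the inverses of [lam], [lam + l]
    and [lam - l], [kk] for [k2] minus the mass of the kernel, [a1] and [c1] for
    velocities, [b] and [d] for [lam] times the memory variable and its
    velocity, [m] and [x] for [lam * mem1] and [lam * dis1], [A] and [S] for the
    strains. Each one isolates the negative square that a multiplier
    provides. *)
Lemma F1_algebra (dl : R) : 0 < dl -> exists2 C, 0 <= C &
  forall i p r kk a1 c1 b d m : R, 0 <= i <= i0 -> 0 <= p <= 2 * i0 -> 0 <= r <= 2 * i0 ->
    kap <= kk <= k2 ->
  r2 * i ^+ 2 * d ^+ 2 - kk * b ^+ 2 - m * b
    - r1 / 2 * ((a1 + c1) * p + (a1 - c1) * r) * i * d <=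
  - (kap / 2) * b ^+ 2 + dl * (a1 ^+ 2 + c1 ^+ 2) + C * (d ^+ 2 + m ^+ 2).
Proof.
have := r1p; have := r2p; have := kapp; have := i0p => i0' kap' r2' r1' dl0.
exists (r2 * i0 ^+ 2 + 2 / kap + 2 * (dl^-1 * (r1 * 2 * i0 ^+ 2) ^+ 2)).
  by pos.
move=> i p r kk a1 c1 b d m /andP[i1 i2] /andP[p1 p2] /andP[s1 s2] /andP[k1' k2'].
have hk : kap * b ^+ 2 <= kk * b ^+ 2 by rewrite ler_wpM2r ?sqr_ge0.
have hm : -1 * b * m <= kap / 2 * b ^+ 2 + (kap / 2)^-1 * 1 ^+ 2 * m ^+ 2.
  by apply: youngc; [lra|rewrite normrN1].
have hi : i ^+ 2 <= i0 ^+ 2 by rewrite ler_pXn2r ?nnegrE// (le_trans i1).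
have hi2 : r2 * i ^+ 2 * d ^+ 2 <= r2 * i0 ^+ 2 * d ^+ 2.
  by rewrite ler_wpM2r ?sqr_ge0// ler_wpM2l// ltW.
have bnd (x : R) : `|x| <= 4 * i0 -> `|- (r1 / 2) * x * i| <= r1 * 2 * i0 ^+ 2.
  move=> xb; rewrite !normrM normrN (ger0_norm i1) (ger0_norm (x := r1 / 2)); last by pos.
  have -> : r1 * 2 * i0 ^+ 2 = r1 / 2 * (4 * i0) * i0 by field.
  by apply: ler_pM => //; [pos|apply: ler_wpM2l => //; pos].
have ha : - (r1 / 2) * (p + r) * i * a1 * d <= dl * a1 ^+ 2 + dl^-1 * (r1 * 2 * i0 ^+ 2) ^+ 2 * d ^+ 2.
  by apply: youngc => //; apply: bnd; rewrite ger0_norm; lra.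
have hc : - (r1 / 2) * (p - r) * i * c1 * d <= dl * c1 ^+ 2 + dl^-1 * (r1 * 2 * i0 ^+ 2) ^+ 2 * d ^+ 2.
  by apply: youngc => //; apply: bnd; rewrite ler_norml; lra.
have E : (kap / 2)^-1 = 2 / kap by field; lra.
rewrite E in hm.
have n1 : 0 <= (r2 * i0 ^+ 2 + 2 * (dl^-1 * (r1 * 2 * i0 ^+ 2) ^+ 2)) * m ^+ 2.
  by pos.
have n2 : 0 <= 2 / kap * d ^+ 2.
  by pos.
set X := dl^-1 * _ in ha hc n1 *.
set Y := 2 / kap in hm n2 *.
lra.
Qed.

Lemma F2_algebra (e : R) : 0 < e -> exists2 C, 0 <= C &
  forall i kk gt a1 c1 A S b d m x : R, 0 <= i <= i0 -> kap <= kk <= k2 -> 0 <= gt <= g0 ->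
  - k * S ^+ 2 + l * (kk * b + m) * A + r2 * d * (a1 + l * i * c1 + i ^+ 2 * d)
    - r1 / k * (k2 * d - gt * b - x) * a1 <=
  - k * S ^+ 2 + e * (A ^+ 2 + a1 ^+ 2 + c1 ^+ 2) +
     C * (b ^+ 2 + d ^+ 2 + m ^+ 2 + x ^+ 2).
Proof.
have := r1p; have := r2p; have := kapp; have := i0p; have := lp; have := kp; have := k2p.
have := g0p => g0' k2' k' l' i0' kap' r2' r1' e0.
pose q := e / 4; have q0 : 0 < q by rewrite /q; lra.
pose c1m := l * k2; pose c2m := l; pose c3m := r2; pose c4m := r2 * l * i0.
pose c5m := r1 / k * k2; pose c6m := r1 / k * g0; pose c7m := r1 / k.
have rk : 0 < r1 / k by rewrite divr_gt0.
exists (q^-1 * (c1m ^+ 2 + c2m ^+ 2 + c3m ^+ 2 + c4m ^+ 2 + c5m ^+ 2 + c6m ^+ 2 + c7m ^+ 2) + r2 * i0 ^+ 2).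
  by pos.
move=> i kk gt a1 c1 A S b d m x /andP[i1 i2] /andP[k1 k22] /andP[gt1 gt2].
have h1 : l * kk * A * b <= q * A ^+ 2 + q^-1 * c1m ^+ 2 * b ^+ 2.
  by apply: youngp => //; [pos|apply: ler_wpM2l => //; pos].
have h2 : l * A * m <= q * A ^+ 2 + q^-1 * c2m ^+ 2 * m ^+ 2.
  by apply: youngp => //; pos.
have h3 : r2 * a1 * d <= q * a1 ^+ 2 + q^-1 * c3m ^+ 2 * d ^+ 2.
  by apply: youngp => //; pos.
have h4 : r2 * l * i * c1 * d <= q * c1 ^+ 2 + q^-1 * c4m ^+ 2 * d ^+ 2.
  by apply: youngp => //; [pos|apply: ler_wpM2l => //; pos].
have h5 : - (r1 / k * k2) * a1 * d <= q * a1 ^+ 2 + q^-1 * c5m ^+ 2 * d ^+ 2.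
  by apply: youngn => //; pos.
have h6 : (r1 / k * gt) * a1 * b <= q * a1 ^+ 2 + q^-1 * c6m ^+ 2 * b ^+ 2.
  by apply: youngp => //; [pos|apply: ler_wpM2l => //; pos].
have h7 : (r1 / k) * a1 * x <= q * a1 ^+ 2 + q^-1 * c7m ^+ 2 * x ^+ 2.
  by apply: youngp => //; pos.
have hi : i ^+ 2 <= i0 ^+ 2 by rewrite ler_pXn2r ?nnegrE// (le_trans i1).
have h8 : r2 * i ^+ 2 * d ^+ 2 <= r2 * i0 ^+ 2 * d ^+ 2.
  by rewrite ler_wpM2r ?sqr_ge0// ler_wpM2l// ltW.
have qi : 0 <= q^-1 by rewrite invr_ge0 ltW.
have sq u : 0 <= q^-1 * u ^+ 2 by rewrite mulr_ge0 ?sqr_ge0.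
have := sq c1m; have := sq c2m; have := sq c3m; have := sq c4m; have := sq c5m.
have := sq c6m; have := sq c7m.
move: h1 h2 h3 h4 h5 h6 h7.
set C1 := q^-1 * c1m ^+ 2; set C2 := q^-1 * c2m ^+ 2; set C3 := q^-1 * c3m ^+ 2.
set C4 := q^-1 * c4m ^+ 2; set C5 := q^-1 * c5m ^+ 2; set C6 := q^-1 * c6m ^+ 2.
set C7 := q^-1 * c7m ^+ 2; set C8 := r2 * i0 ^+ 2.
have -> : q^-1 * (c1m ^+ 2 + c2m ^+ 2 + c3m ^+ 2 + c4m ^+ 2 + c5m ^+ 2 + c6m ^+ 2 + c7m ^+ 2) + C8
  = C1 + C2 + C3 + C4 + C5 + C6 + C7 + C8 by rewrite /C1 /C2 /C3 /C4 /C5 /C6 /C7; ring.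
move=> h1 h2 h3 h4 h5 h6 h7 p7 p6 p5 p4 p3 p2 p1.
have p8 : 0 <= C8 by rewrite mulr_ge0 ?sqr_ge0// ltW.
have prod (u v : R) : 0 <= u -> 0 <= u * v ^+ 2 by move=> u0; rewrite mulr_ge0 ?sqr_ge0.
have pb : 0 <= (C2 + C3 + C4 + C5 + C7 + C8) * b ^+ 2 by apply: prod; lra.
have pd : 0 <= (C1 + C2 + C6 + C7) * d ^+ 2 by apply: prod; lra.
have pm : 0 <= (C1 + C3 + C4 + C5 + C6 + C7 + C8) * m ^+ 2 by apply: prod; lra.
have px : 0 <= (C1 + C2 + C3 + C4 + C5 + C6 + C8) * x ^+ 2 by apply: prod; lra.
have pc : 0 <= q * c1 ^+ 2 by apply: prod; lra.
have pA : 0 <= q * A ^+ 2 by apply: prod; lra.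
have eq4 : e = 4 * q by rewrite /q; lra.
rewrite eq4 /c5m /c7m in h5 h7 *.
set Z := r1 / k in h5 h6 h7 *.
rewrite -/C8 in h8.
lra.
Qed.

Lemma F3_algebra : exists2 C, 0 <= C &
  forall i A S b : R, 0 <= i <= i0 ->
  - (k / r1) * ((1 + (l * i) ^+ 2) * (A * b) - 2 * l * S * (S - i * b) + 2 * l * A ^+ 2) <=
  - (k / r1 * l) * A ^+ 2 + C * (S ^+ 2 + b ^+ 2).
Proof.
have := r1p; have := i0p; have := lp; have := kp => k' l' i0' r1'.
pose c := k / r1; have c0 : 0 < c by rewrite divr_gt0.
pose q := c * l; have q0 : 0 < q by rewrite mulr_gt0.
pose c1m := c * (1 + (l * i0) ^+ 2); pose c2m := 2 * c * l * i0.
exists (q^-1 * c1m ^+ 2 + q^-1 * c2m ^+ 2 + 2 * c * l + q).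
  by pos.
move=> i A S b /andP[i1 i2].
have li : (l * i) ^+ 2 <= (l * i0) ^+ 2.
  by rewrite ler_pXn2r ?nnegrE ?mulr_ge0 ?ler_wpM2l// ltW.
have h1 : - (c * (1 + (l * i) ^+ 2)) * A * b <= q * A ^+ 2 + q^-1 * c1m ^+ 2 * b ^+ 2.
  apply: youngn => //; first by pos.
  by apply: ler_wpM2l; [pos|rewrite lerD2l].
have h2 : - (2 * c * l * i) * S * b <= q * S ^+ 2 + q^-1 * c2m ^+ 2 * b ^+ 2.
  by apply: youngn => //; [pos|apply: ler_wpM2l => //; pos].
have qi : 0 <= q^-1 by rewrite invr_ge0 ltW.
have sq u : 0 <= q^-1 * u ^+ 2 by rewrite mulr_ge0 ?sqr_ge0.
have := sq c1m; have := sq c2m; move: h1 h2.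
set C1 := q^-1 * c1m ^+ 2; set C2 := q^-1 * c2m ^+ 2 => h1 h2 p2 p1.
have cl : 0 < c * l by rewrite mulr_gt0.
have pb : 0 <= (2 * c * l + q) * b ^+ 2 by rewrite mulr_ge0 ?sqr_ge0//; lra.
have pS : 0 <= (C1 + C2) * S ^+ 2 by rewrite mulr_ge0 ?sqr_ge0//; lra.
rewrite -/c; rewrite /q in h1 h2 pb *.
lra.
Qed.

Lemma F4_algebra : exists2 C, 0 <= C &
  forall i a1 c1 A S b : R, 0 <= i <= i0 ->
  - (r1 * (a1 ^+ 2 + c1 ^+ 2)) + k * S * (S - i * b) + k * A ^+ 2 <=
  - (r1 * (a1 ^+ 2 + c1 ^+ 2)) + k * A ^+ 2 + C * (S ^+ 2 + b ^+ 2).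
Proof.
have := i0p; have := kp => k' i0'.
exists (k + 1 + (k * i0) ^+ 2).
  by rewrite !addr_ge0// ?sqr_ge0// ltW.
move=> i a1 c1 A S b /andP[i1 i2].
have h2 : - (k * i) * S * b <= 1 * S ^+ 2 + 1^-1 * (k * i0) ^+ 2 * b ^+ 2.
  by apply: youngn => //; [pos|apply: ler_wpM2l => //; pos].
rewrite invr1 in h2.
have pb : 0 <= (k + 1) * b ^+ 2 by rewrite mulr_ge0 ?sqr_ge0//; lra.
have pS : 0 <= (k * i0) ^+ 2 * S ^+ 2 by rewrite mulr_ge0 ?sqr_ge0.
lra.
Qed.

(** The weights are fixed in the order velocities, axial strain, shear,
    memory variable: each later functional repairs the terms that the earlier
    ones leave with the wrong sign. *)
Lemma lyapunov_algebra : exists al1 al2 al3 C : R,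
  [/\ 0 <= al1, 0 <= al2, 0 <= al3, 0 <= C &
  forall i p r kk gt a1 c1 A S b d m x : R, 0 <= i <= i0 ->
    0 <= p <= 2 * i0 -> 0 <= r <= 2 * i0 -> kap <= kk <= k2 -> 0 <= gt <= g0 ->
  al1 * (r2 * i ^+ 2 * d ^+ 2 - kk * b ^+ 2 - m * b
         - r1 / 2 * ((a1 + c1) * p + (a1 - c1) * r) * i * d)
  + al2 * (- k * S ^+ 2 + l * (kk * b + m) * A + r2 * d * (a1 + l * i * c1 + i ^+ 2 * d)
           - r1 / k * (k2 * d - gt * b - x) * a1)
  + al3 * (- (k / r1) * ((1 + (l * i) ^+ 2) * (A * b) - 2 * l * S * (S - i * b)
           + 2 * l * A ^+ 2))
  + (- (r1 * (a1 ^+ 2 + c1 ^+ 2)) + k * S * (S - i * b) + k * A ^+ 2) <=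
  - (r1 / 4) * (a1 ^+ 2 + c1 ^+ 2 + A ^+ 2 + S ^+ 2 + b ^+ 2) +
     C * (d ^+ 2 + m ^+ 2 + x ^+ 2)].
Proof.
have := r1p; have := r2p; have := kapp; have := i0p; have := lp; have := kp; have := k2p.
have := g0p => g0' k2' k' l' i0' kap' r2' r1'.
have [C3 C30 H3] := F3_algebra; have [C4 C40 H4] := F4_algebra.
pose al3 := (k + r1) / (k / r1 * l).
have al3p : 0 < al3 by rewrite /al3; pos.
pose D1 := al3 * C3 + C4; have D1p : 0 <= D1 by rewrite /D1; pos.
pose al2 := (D1 + r1) / k; have al2p : 0 < al2 by rewrite /al2; apply: divr_gt0 => //; lra.
have e0 : 0 < r1 / (4 * al2) by apply: divr_gt0 => //; lra.
have [C2 C20 H2] := F2_algebra e0.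
pose D2 := D1 + al2 * C2; have D2p : 0 <= D2 by rewrite /D2; pos.
pose al1 := 2 * (D2 + r1) / kap.
have al1p : 0 < al1 by rewrite /al1; apply: divr_gt0 => //; lra.
have dl0 : 0 < r1 / (4 * al1) by apply: divr_gt0 => //; lra.
have [C1 C10 H1] := F1_algebra dl0.
exists al1, al2, al3, (al1 * C1 + al2 * C2); split; try exact: ltW.
  by pos.
move=> i p r kk gt a1 c1 A S b d m x ii pp rr kkk gtt.
have h1 := ler_wpM2l (ltW al1p) (H1 i p r kk a1 c1 b d m ii pp rr kkk).
have h2 := ler_wpM2l (ltW al2p) (H2 i kk gt a1 c1 A S b d m x ii kkk gtt).
have h3 := ler_wpM2l (ltW al3p) (H3 i A S b ii).
have h4 := H4 i a1 c1 A S b ii.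
apply: (le_trans (lerD (lerD (lerD h1 h2) h3) h4)).
have E3 : al3 * (k / r1 * l) = k + r1 by rewrite /al3; field; lra.
have E2 : al2 * k = D1 + r1 by rewrite /al2; field; lra.
have E2' : al2 * (r1 / (4 * al2)) = r1 / 4 by field; lra.
have E1 : al1 * (kap / 2) = D2 + r1 by rewrite /al1; field; lra.
have E1' : al1 * (r1 / (4 * al1)) = r1 / 4 by field; lra.
rewrite [X in X + _ + _ + _ <= _](_ : _ = - (D2 + r1) * b ^+ 2 + r1 / 4 * (a1 ^+ 2 + c1 ^+ 2)
    + al1 * C1 * (d ^+ 2 + m ^+ 2)); last by rewrite -E1 -E1'; ring.
rewrite [X in _ + X + _ + _ <= _](_ : _ = - (D1 + r1) * S ^+ 2 + r1 / 4 * (A ^+ 2 + a1 ^+ 2 + c1 ^+ 2)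
    + al2 * C2 * (b ^+ 2 + d ^+ 2 + m ^+ 2 + x ^+ 2)); last by rewrite -E2 -E2'; ring.
rewrite [X in _ + X + _ <= _](_ : _ = - (k + r1) * A ^+ 2 + al3 * C3 * (S ^+ 2 + b ^+ 2)); last first.
  by rewrite -E3; ring.
rewrite /D2 /D1.
set X1 := al1 * C1; set X2 := al2 * C2; set X3 := al3 * C3.
have P1 : 0 <= X1 * x ^+ 2 by apply: mulr_ge0; [rewrite /X1; pos|exact: sqr_ge0].
have P2 : 0 <= r1 * A ^+ 2 by pos.
have P3 : 0 <= r1 * S ^+ 2 by pos.
have P4 : 0 <= r1 * b ^+ 2 by pos.
have P5 : 0 <= r1 * a1 ^+ 2 by pos.
have P6 : 0 <= r1 * c1 ^+ 2 by pos.
lra.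
Qed.

End Lyapunov_algebra.
End Algebra.

(** * The system of one mode *)

Lemma solve_acceleration (R : realType) (r k X Y : R) : r != 0 -> r * Y + k * X = 0 ->
  Y = - (k / r) * X.
Proof.
by move=> r0 /eqP; rewrite addr_eq0 => /eqP e; apply: (mulfI r0); rewrite e; field.
Qed.

Section Mode.
Variable R : realType.
Variables (r1 r2 k k2 l lam : R) (g : R -> R).

(** Shear and axial strain of a mode. *)
Definition shr (a b c : R) := lam * a + b + l * c.
Definition axl (a c : R) := lam * c + l * a.

Definition En (a0 a1 b0 b1 c0 c1 : R -> R) t := 2^-1 *
  (r1 * a1 t ^+ 2 + r2 * b1 t ^+ 2 + r1 * c1 t ^+ 2
   + (k2 - Iu g t) * (lam * b0 t) ^+ 2 + k * axl (a0 t) (c0 t) ^+ 2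
   + k * shr (a0 t) (b0 t) (c0 t) ^+ 2 + lam ^+ 2 * mem2 g b0 t).

(** The three equations of motion at one time. The term [h] is zero for the
    system itself; it is the forcing that appears after differentiation in
    time. *)
Definition eq_a (a b c a2 : R) := r1 * a2 + k * (lam * shr a b c + l * axl a c) = 0.
Definition eq_c (a b c c2 : R) := r1 * c2 + k * (lam * axl a c + l * shr a b c) = 0.
Definition eq_b (a b c b2 cv h : R) :=
  r2 * b2 + k2 * lam ^+ 2 * b + k * shr a b c - lam ^+ 2 * cv = h.

(** The weights multiply, in order: the multiplier [b] of the second equation,
    corrected by a function whose derivative is [k * S]; a product that
    exchanges shear and memory and yields [- S ^+ 2]; a Wronskian of the
    axial strain and of [S - b] that yields [- A ^+ 2]; and the virial term that yields the squares
    of the velocities. *)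
Definition lyap (al1 al2 al3 : R) (a0 a1 b0 b1 c0 c1 : R -> R) (t : R) :=
  al1 * (r2 * b0 t * b1 t - r1 / 2 * ((a1 t + c1 t) / (lam + l) + (a1 t - c1 t) / (lam - l)) * b0 t)
  + al2 * (r2 * b1 t * shr (a0 t) (b0 t) (c0 t) - r1 / k * lam * (k2 * b0 t - conv g b0 t) * a1 t)
  - al3 * (((lam * a0 t + l * c0 t) * (lam * c1 t + l * a1 t)
            - (lam * a1 t + l * c1 t) * axl (a0 t) (c0 t)) / lam)
  - r1 * (a0 t * a1 t + c0 t * c1 t).

Variable g1 : R -> R.
Hypothesis kg : kernel g g1.

(** The memory term of the energy is dissipated at the rate [dis2], and the
    loss of stiffness in [k2 - Iu g t] contributes with the good sign. *)
Lemma is_derive_En (a0 a1 b0 b1 c0 c1 : R -> R) (t a2 b2 c2 h : R) : 0 < t ->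
  C1half b0 b1 ->
  is_derive t 1 a0 (a1 t) -> is_derive t 1 a1 a2 -> is_derive t 1 b1 b2 ->
  is_derive t 1 c0 (c1 t) -> is_derive t 1 c1 c2 ->
  eq_a (a0 t) (b0 t) (c0 t) a2 -> eq_b (a0 t) (b0 t) (c0 t) b2 (conv g b0 t) h ->
  eq_c (a0 t) (b0 t) (c0 t) c2 ->
  is_derive t 1 (En a0 a1 b0 b1 c0 c1)
    (h * b1 t - 2^-1 * (g t * (lam * b0 t) ^+ 2 + lam ^+ 2 * dis2 g b0 b1 t)).
Proof.
move=> t0 Cb da0 da1 db1 dc0 dc1 ea eb ec.
have gc : continuous g by case: kg.
have db0 : is_derive t 1 b0 (b1 t) by case: Cb => _ _; exact.
have dG := is_derive_Iu gc t0; have dm := is_derive_mem2 kg Cb t0.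
rewrite /En /axl /shr; eapply is_derive_eq; first by der.
rewrite /= !expr1.
rewrite /eq_a /eq_b /eq_c /shr /axl in ea eb ec.
have Ea : r1 * a2 = - (k * (lam * (lam * a0 t + b0 t + l * c0 t) + l * (lam * c0 t + l * a0 t))) by lra.
have Ec : r1 * c2 = - (k * (lam * (lam * c0 t + l * a0 t) + l * (lam * a0 t + b0 t + l * c0 t))) by lra.
have Eb : r2 * b2 = h - k2 * lam ^+ 2 * b0 t - k * (lam * a0 t + b0 t + l * c0 t) + lam ^+ 2 * conv g b0 t by lra.
rewrite (_ : mem1 g b0 t = Iu g t * b0 t - conv g b0 t)//.
transitivity ((r1 * a2) * a1 t + (r2 * b2) * b1 t + (r1 * c2) * c1 t +
 2^-1 * (- g t * (lam * b0 t) ^+ 2 + (k2 - Iu g t) * (2 * (lam * b0 t) * (lam * b1 t))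
  + k * (2 * (lam * c0 t + l * a0 t) * (lam * c1 t + l * a1 t))
  + k * (2 * (lam * a0 t + b0 t + l * c0 t) * (lam * a1 t + b1 t + l * c1 t))
  + lam ^+ 2 * (2 * b1 t * (Iu g t * b0 t - conv g b0 t) - dis2 g b0 b1 t))); first by field.
by rewrite Ea Eb Ec; field.
Qed.

Lemma is_derive_lyap (al1 al2 al3 : R) (a0 a1 b0 b1 c0 c1 : R -> R) (t a2 b2 c2 : R) : 0 < t ->
  r1 != 0 -> k != 0 -> lam != 0 -> lam + l != 0 -> lam - l != 0 ->
  C1half b0 b1 ->
  is_derive t 1 a0 (a1 t) -> is_derive t 1 a1 a2 -> is_derive t 1 b1 b2 ->
  is_derive t 1 c0 (c1 t) -> is_derive t 1 c1 c2 ->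
  eq_a (a0 t) (b0 t) (c0 t) a2 -> eq_b (a0 t) (b0 t) (c0 t) b2 (conv g b0 t) 0 ->
  eq_c (a0 t) (b0 t) (c0 t) c2 ->
  let i := lam^-1 in let p := (lam + l)^-1 in let r := (lam - l)^-1 in
  let kk := k2 - Iu g t in let A := axl (a0 t) (c0 t) in
  let S := shr (a0 t) (b0 t) (c0 t) in let b := lam * b0 t in let d := lam * b1 t in
  let m := lam * mem1 g b0 t in let x := lam * dis1 g b0 b1 t in
  is_derive t 1 (lyap al1 al2 al3 a0 a1 b0 b1 c0 c1)
   (al1 * (r2 * i ^+ 2 * d ^+ 2 - kk * b ^+ 2 - m * b
         - r1 / 2 * ((a1 t + c1 t) * p + (a1 t - c1 t) * r) * i * d)
  + al2 * (- k * S ^+ 2 + l * (kk * b + m) * A + r2 * d * (a1 t + l * i * c1 t + i ^+ 2 * d)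
           - r1 / k * (k2 * d - g t * b - x) * a1 t)
  + al3 * (- (k / r1) * ((1 + (l * i) ^+ 2) * (A * b) - 2 * l * S * (S - i * b)
           + 2 * l * A ^+ 2))
  + (- (r1 * (a1 t ^+ 2 + c1 t ^+ 2)) + k * S * (S - i * b) + k * A ^+ 2)).
Proof.
move=> t0 r1N kN lamN lp lm Cb da0 da1 db1 dc0 dc1 ea eb ec i p r kk A S b d m x.
have db0 : is_derive t 1 b0 (b1 t) by case: Cb => _ _; exact.
have dcv := is_derive_conv_C1 kg Cb t0.
rewrite /lyap /axl /shr; eapply is_derive_eq; first by der.
rewrite /= /i /p /r /kk /A /S /b /d /m /x /mem1 /dis1 /axl /shr.
rewrite /eq_a /eq_b /eq_c /shr /axl in ea eb ec.
have -> : a2 = - (k * (lam * (lam * a0 t + b0 t + l * c0 t) + l * (lam * c0 t + l * a0 t))) / r1.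
  by apply: (mulfI r1N); rewrite mulrCA divff// mulr1; lra.
have -> : c2 = - (k * (lam * (lam * c0 t + l * a0 t) + l * (lam * a0 t + b0 t + l * c0 t))) / r1.
  by apply: (mulfI r1N); rewrite mulrCA divff// mulr1; lra.
have Eb : r2 * b2 = - k2 * lam ^+ 2 * b0 t - k * (lam * a0 t + b0 t + l * c0 t) + lam ^+ 2 * conv g b0 t by lra.
set cv := conv g b0 t in Eb *; set cv1 := conv g b1 t.
rewrite !mul0r !mulr0 !add0r ?addr0 ?subr0.
apply/eqP; rewrite -subr_eq0; apply/eqP.
transitivity ((al1 * b0 t + al2 * (lam * a0 t + b0 t + l * c0 t)) *
  (r2 * b2 - (- k2 * lam ^+ 2 * b0 t - k * (lam * a0 t + b0 t + l * c0 t) + lam ^+ 2 * cv))).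
  by field; rewrite ?r1N ?kN ?lamN ?lp ?lm.
by rewrite Eb subrr mulr0.
Qed.

Definition modesol (a0 a1 a2 b0 b1 b2 c0 c1 c2 : R -> R) :=
  [/\ C1half a0 a1 /\ C1half a1 a2, C1half b0 b1 /\ C1half b1 b2,
     C1half c0 c1 /\ C1half c1 c2 & forall t : R, 0 < t ->
  [/\ eq_a (a0 t) (b0 t) (c0 t) (a2 t),
     eq_b (a0 t) (b0 t) (c0 t) (b2 t) (conv g b0 t) 0 &
     eq_c (a0 t) (b0 t) (c0 t) (c2 t)]].

Lemma continuous_En (a0 a1 b0 b1 c0 c1 : R -> R) : continuous a0 -> continuous a1 ->
  C1half b0 b1 -> continuous c0 -> continuous c1 ->
  continuous (En a0 a1 b0 b1 c0 c1).
Proof.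
move=> a0c a1c Cb c0c c1c; have gc : continuous g by case: kg.
have Gc := continuous_Iu gc; have mc := continuous_mem2 kg Cb.
by case: Cb => b0c b1c _; rewrite /En /axl /shr; ctn.
Qed.

Lemma continuous_lyap (al1 al2 al3 : R) (a0 a1 b0 b1 c0 c1 : R -> R) :
  continuous a0 -> continuous a1 ->
  C1half b0 b1 -> continuous c0 -> continuous c1 ->
  continuous (lyap al1 al2 al3 a0 a1 b0 b1 c0 c1).
Proof.
move=> a0c a1c Cb c0c c1c; have cc := continuous_conv_C1 kg Cb.
by case: Cb => b0c b1c _; rewrite /lyap /axl /shr; ctn.
Qed.

Lemma continuous_eq0 (f : R -> R) : continuous f ->
  (forall t : R, 0 < t -> f t = 0) -> f 0 = 0.
Proof.
move=> fc f0; apply: (@cvg_unique _ (@Rhausdorff R) (f x @[x --> 0^'+])).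
  by apply: cvg_at_right_filter; exact: fc.
apply: (@cvg_trans _ ((fun _ : R => 0 : R) x @[x --> 0^'+])); last exact: cvg_cst.
apply: near_eq_cvg; near=> x; rewrite f0//.
Unshelve. all: by end_near. Qed.

(** The equations hold for positive times; by continuity they also hold at
    time 0, where they express the initial accelerations through the data. *)
Lemma modesol0 a0 a1 a2 b0 b1 b2 c0 c1 c2 : modesol a0 a1 a2 b0 b1 b2 c0 c1 c2 ->
  [/\ eq_a (a0 0) (b0 0) (c0 0) (a2 0), eq_b (a0 0) (b0 0) (c0 0) (b2 0) 0 0 &
     eq_c (a0 0) (b0 0) (c0 0) (c2 0)].
Proof.
move=> [[Ca Ca'] [Cb Cb'] [Cc Cc'] E].
have cvc := continuous_conv_C1 kg Cb; have cv0 : conv g b0 0 = 0 by rewrite /conv Iu0.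
case: Ca Ca' Cb Cb' Cc Cc' => [ac a1c _] [_ a2c _] [bc b1c _] [_ b2c _] [cc c1c _] [_ c2c _].
split.
- pose F t := r1 * a2 t + k * (lam * shr (a0 t) (b0 t) (c0 t) + l * axl (a0 t) (c0 t)).
  apply: (@continuous_eq0 F); first by rewrite /F /shr /axl; ctn.
  by move=> t /E[].
- pose F t := r2 * b2 t + k2 * lam ^+ 2 * b0 t + k * shr (a0 t) (b0 t) (c0 t) - lam ^+ 2 * conv g b0 t.
  have := @continuous_eq0 F; rewrite /F cv0; apply; first by rewrite /shr; ctn.
  by move=> t /E[].
- pose F t := r1 * c2 t + k * (lam * axl (a0 t) (c0 t) + l * shr (a0 t) (b0 t) (c0 t)).
  apply: (@continuous_eq0 F); first by rewrite /F /shr /axl; ctn.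
  by move=> t /E[].
Qed.

Lemma derive_near_pos (f f' : R -> R) (t d : R) : 0 < t ->
  (forall s : R, 0 < s -> f s = f' s) -> is_derive t 1 f d -> is_derive t 1 f' d.
Proof.
move=> t0 ff'; apply: near_eq_is_derive.
by near=> s; apply: ff'; near: s; exact: lt_nbhsr.
Unshelve. all: by end_near. Qed.

(** Differentiating the system in time: the memory leaves the forcing term
    [lam ^+ 2 * g t * b0 0]. *)
Lemma is_derive_En1 a0 a1 a2 b0 b1 b2 c0 c1 c2 (t : R) : r1 != 0 -> r2 != 0 ->
  modesol a0 a1 a2 b0 b1 b2 c0 c1 c2 -> 0 < t ->
  is_derive t 1 (En a1 a2 b1 b2 c1 c2)
   (lam ^+ 2 * g t * b0 0 * b2 t -
    2^-1 * (g t * (lam * b1 t) ^+ 2 + lam ^+ 2 * dis2 g b1 b2 t)).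
Proof.
move=> r1N r2N [[Ca Ca'] [Cb Cb'] [Cc Cc'] E] t0.
have dcv := is_derive_conv_C1 kg Cb t0.
case: (Ca) (Ca') (Cb) (Cb') (Cc) (Cc') => [_ _ da] [_ _ da'] [_ _ db] [_ _ db'] [_ _ dc] [_ _ dc'].
have dat := da _ t0; have dbt := db _ t0; have dct := dc _ t0.
have dat' := da' _ t0; have dbt' := db' _ t0; have dct' := dc' _ t0.
pose fa s := - (k / r1) * (lam * shr (a0 s) (b0 s) (c0 s) + l * axl (a0 s) (c0 s)).
pose fc s := - (k / r1) * (lam * axl (a0 s) (c0 s) + l * shr (a0 s) (b0 s) (c0 s)).
pose fb s := r2^-1 * (lam ^+ 2 * conv g b0 s - k2 * lam ^+ 2 * b0 s - k * shr (a0 s) (b0 s) (c0 s)).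
have ea (s : R) : 0 < s -> fa s = a2 s.
  by move=> /E[e _ _]; rewrite (solve_acceleration r1N e).
have ec (s : R) : 0 < s -> fc s = c2 s.
  by move=> /E[_ _ e]; rewrite (solve_acceleration r1N e).
have eb (s : R) : 0 < s -> fb s = b2 s.
  move=> /E[]; rewrite /eq_b /fb => _ e _.
  by apply: (mulfI r2N); rewrite mulrA divff// mul1r; lra.
have dfa : is_derive t 1 a2 (- (k / r1) * (lam * shr (a1 t) (b1 t) (c1 t) + l * axl (a1 t) (c1 t))).
  apply: (derive_near_pos t0 ea); try (rewrite /fa /shr /axl; eapply is_derive_eq; [der|rewrite /=; ring]).
have dfc : is_derive t 1 c2 (- (k / r1) * (lam * axl (a1 t) (c1 t) + l * shr (a1 t) (b1 t) (c1 t))).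
  apply: (derive_near_pos t0 ec); try (rewrite /fc /shr /axl; eapply is_derive_eq; [der|rewrite /=; ring]).
have dfb : is_derive t 1 b2 (r2^-1 * (lam ^+ 2 * (g t * b0 0 + conv g b1 t)
    - k2 * lam ^+ 2 * b1 t - k * shr (a1 t) (b1 t) (c1 t))).
  apply: (derive_near_pos t0 eb); try (rewrite /fb /shr; eapply is_derive_eq; [der|rewrite /=; ring]).
apply: (is_derive_En t0 Cb' dat' dfa dfb dct' dfc).
- by rewrite /eq_a; field.
- by rewrite /eq_b; field.
- by rewrite /eq_c; field.
Qed.

End Mode.

(** * Bounds uniform in the frequency *)

Section UniformBounds.
Variable R : realType.
Implicit Types x y z c B N : R.

Lemma normM_le x y X Y : `|x| <= X -> `|y| <= Y -> `|x * y| <= X * Y.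
Proof. by move=> hx hy; rewrite normrM ler_pM. Qed.

Lemma normD_le x y X Y : `|x| <= X -> `|y| <= Y -> `|x + y| <= X + Y.
Proof. by move=> hx hy; apply: (le_trans (ler_normD _ _)); rewrite lerD. Qed.

Lemma normN_le x X : `|x| <= X -> `|- x| <= X.
Proof. by rewrite normrN. Qed.

Lemma normX2_le x X : `|x| <= X -> `|x ^+ 2| <= X ^+ 2.
Proof. by move=> hx; rewrite normrX !expr2 ler_pM. Qed.

Lemma prod_le_sqr c B x y N : `|c| <= B -> x ^+ 2 <= N -> y ^+ 2 <= N ->
  `|c * x * y| <= B * N.
Proof.
move=> cB xN yN; rewrite -mulrA normrM; apply: ler_pM => //.
rewrite normrM; have H : 0 <= (`|x| - `|y|) ^+ 2 by exact: sqr_ge0.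
have Hx : `|x| ^+ 2 = x ^+ 2 by rewrite real_normK// num_real.
have Hy : `|y| ^+ 2 = y ^+ 2 by rewrite real_normK// num_real.
have : (`|x| - `|y|) ^+ 2 = x ^+ 2 + y ^+ 2 - 2 * (`|x| * `|y|) by rewrite -Hx -Hy; ring.
lra.
Qed.

Lemma sum3_sqr_le c1 c2 c3 B x y z : `|c1| <= B -> `|c2| <= B -> `|c3| <= B ->
  (c1 * x + c2 * y + c3 * z) ^+ 2 <= 3 * B ^+ 2 * (x ^+ 2 + y ^+ 2 + z ^+ 2).
Proof.
move=> h1 h2 h3.
have s c u : `|c| <= B -> (c * u) ^+ 2 <= B ^+ 2 * u ^+ 2.
  move=> h; rewrite exprMn ler_wpM2r ?sqr_ge0//.
  by have := normX2_le h; rewrite ger0_norm ?sqr_ge0.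
have := s _ x h1; have := s _ y h2; have := s _ z h3.
set X := c1 * x; set Y := c2 * y; set Z := c3 * z => hz hy hx.
have H1 : 0 <= (X - Y) ^+ 2 by exact: sqr_ge0.
have H2 : 0 <= (Y - Z) ^+ 2 by exact: sqr_ge0.
have H3 : 0 <= (X - Z) ^+ 2 by exact: sqr_ge0.
have E : (X + Y + Z) ^+ 2 = 3 * (X ^+ 2 + Y ^+ 2 + Z ^+ 2) - (X - Y) ^+ 2 - (Y - Z) ^+ 2 - (X - Z) ^+ 2 by ring.
rewrite E; lra.
Qed.

Lemma sum6_ge x y z u v w q : 0 <= q ->
  let N := x^+2+y^+2+z^+2+u^+2+v^+2+w^+2+q in
  [/\ x^+2 <= N, y^+2 <= N, z^+2 <= N & [/\ u^+2 <= N, v^+2 <= N & w^+2 <= N]].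
Proof.
move=> q0 N; have := sqr_ge0 x; have := sqr_ge0 y; have := sqr_ge0 z; have := sqr_ge0 u.
have := sqr_ge0 v; have := sqr_ge0 w; rewrite /N => *.
by split; [lra|lra|lra|split; lra].
Qed.

End UniformBounds.

(** Bounds the absolute value of a polynomial expression from bounds on its
    variables found in the context. *)
Ltac nbd := lazymatch goal with
  | |- is_true (`| _ + _ | <= _) => eapply normD_le; nbd
  | |- is_true (`| _ * _ | <= _) => eapply normM_le; nbd
  | |- is_true (`| - _ | <= _) => eapply normN_le; nbd
  | |- is_true (`| _ ^+ 2 | <= _) => eapply normX2_le; nbd
  | |- _ => first [eassumption | exact: lexx]
  end.

Section Constants.
Variable R : realType.
Variables (r1 r2 k k2 l mu kap : R) (g g1 : R -> R).
Hypotheses (r1p : 0 < r1) (r2p : 0 < r2) (kp : 0 < k) (k2p : 0 < k2) (lp : 0 < l)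
  (mup : 0 < mu) (kapp : 0 < kap) (lmu : l <= mu / 2) (kg : kernel g g1)
  (gkap : forall t : R, 0 <= t -> kap <= k2 - Iu g t).

Notation En := (En r1 r2 k k2 l).
Notation lyap := (lyap r1 r2 k k2 l).
Notation shr := (shr l).
Notation axl := (axl l).

(** The quantities of the energy with all their weights set to 1. *)
Definition full lam (a0 a1 b0 b1 c0 c1 : R -> R) t :=
  a1 t ^+ 2 + b1 t ^+ 2 + c1 t ^+ 2 + (lam * b0 t) ^+ 2 + axl lam (a0 t) (c0 t) ^+ 2
  + shr lam (a0 t) (b0 t) (c0 t) ^+ 2 + lam ^+ 2 * mem2 g b0 t.

Let G_bound (t : R) : 0 <= t -> 0 <= Iu g t <= k2.
Proof.
move=> t0; have := gkap t0; have := Iu_kernel_ge0 kg t; have := kapp => *.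
by apply/andP; split; lra.
Qed.

Lemma full_le_En : exists2 C, 0 <= C & forall lam a0 a1 b0 b1 c0 c1 (t : R),
  C1half b0 b1 -> 0 <= t -> full lam a0 a1 b0 b1 c0 c1 t <= C * En lam g a0 a1 b0 b1 c0 c1 t.
Proof.
have := r1p; have := r2p; have := kp; have := kapp => kap' k' r2' r1'.
exists (2 * (r1^-1 + r2^-1 + k^-1 + kap^-1 + 1)); first by pos.
move=> lam a0 a1 b0 b1 c0 c1 t Cb t0; rewrite /full /En.
set C := r1^-1 + _ + _ + _ + _.
have := gkap t0; set kk := k2 - Iu g t => kkap.
have q0 := mem2_ge0 kg Cb t.
have [i1 i2 i3 i4] : [/\ 0 < r1^-1, 0 < r2^-1, 0 < k^-1 & 0 < kap^-1] by split; pos.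
have w (c x : R) : 0 < c -> c^-1 <= C -> x ^+ 2 <= C * (c * x ^+ 2).
  move=> cp cC; rewrite mulrA ler_peMl ?sqr_ge0//.
  by rewrite -[leLHS](mulVf (lt0r_neq0 cp)) ler_wpM2r// ltW.
have h1 := @w r1 (a1 t) r1p; have h2 := @w r2 (b1 t) r2p; have h3 := @w r1 (c1 t) r1p.
have h4 := @w kap (lam * b0 t) kapp; have h5 := @w k (axl lam (a0 t) (c0 t)) kp.
have h6 := @w k (shr lam (a0 t) (b0 t) (c0 t)) kp.
have C1 : 1 <= C by rewrite /C; lra.
have h7 : lam ^+ 2 * mem2 g b0 t <= C * (lam ^+ 2 * mem2 g b0 t).
  by rewrite ler_peMl// mulr_ge0 ?sqr_ge0.
have h8 : C * (kap * (lam * b0 t) ^+ 2) <= C * (kk * (lam * b0 t) ^+ 2).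
  by apply: ler_wpM2l; [lra|rewrite ler_wpM2r ?sqr_ge0].
have {}h1 := h1 ltac:(rewrite /C; lra).
have {}h2 := h2 ltac:(rewrite /C; lra).
have {}h3 := h3 ltac:(rewrite /C; lra).
have {}h4 := h4 ltac:(rewrite /C; lra).
have {}h5 := h5 ltac:(rewrite /C; lra).
have {}h6 := h6 ltac:(rewrite /C; lra).
move: h1 h2 h3 h4 h5 h6 h7 h8; clearbody C kk; move=> *; lra.
Qed.

Lemma En_le_full : exists2 C, 0 <= C & forall lam a0 a1 b0 b1 c0 c1 (t : R),
  C1half b0 b1 -> 0 <= t -> En lam g a0 a1 b0 b1 c0 c1 t <= C * full lam a0 a1 b0 b1 c0 c1 t.
Proof.
have := r1p; have := r2p; have := kp; have := k2p => k2' k' r2' r1'.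
exists (r1 + r2 + k + k2 + 1); first by pos.
move=> lam a0 a1 b0 b1 c0 c1 t Cb t0; rewrite /full /En.
set C := r1 + _ + _ + _ + _.
have := gkap t0; have := G_bound t0; set kk := k2 - Iu g t => /andP[gb1 gb2] kkap.
have kkk2 : kk <= k2 by rewrite /kk; lra.
have q0 : 0 <= lam ^+ 2 * mem2 g b0 t by rewrite mulr_ge0 ?sqr_ge0// (mem2_ge0 kg Cb).
have w (c x : R) : c <= C -> c * x ^+ 2 <= C * x ^+ 2 by move=> cC; rewrite ler_wpM2r ?sqr_ge0.
have h1 := @w r1 (a1 t) ltac:(rewrite /C; lra).
have h2 := @w r2 (b1 t) ltac:(rewrite /C; lra).
have h3 := @w r1 (c1 t) ltac:(rewrite /C; lra).
have h4 := @w kk (lam * b0 t) ltac:(rewrite /C; lra).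
have h5 := @w k (axl lam (a0 t) (c0 t)) ltac:(rewrite /C; lra).
have h6 := @w k (shr lam (a0 t) (b0 t) (c0 t)) ltac:(rewrite /C; lra).
have C1 : 1 <= C by rewrite /C; lra.
have h7 : lam ^+ 2 * mem2 g b0 t <= C * (lam ^+ 2 * mem2 g b0 t) by rewrite ler_peMl.
have f0 : 0 <= C * (a1 t ^+ 2 + b1 t ^+ 2 + c1 t ^+ 2 + (lam * b0 t) ^+ 2 + axl lam (a0 t) (c0 t) ^+ 2
  + shr lam (a0 t) (b0 t) (c0 t) ^+ 2 + lam ^+ 2 * mem2 g b0 t).
  apply: mulr_ge0; first by lra.
  by do 6 (apply: addr_ge0; last by [exact: sqr_ge0|exact: q0]); exact: sqr_ge0.
move: h1 h2 h3 h4 h5 h6 h7 f0; clearbody C kk; move=> *; lra.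
Qed.

Lemma full_ge0 lam a0 a1 b0 b1 c0 c1 (t : R) : C1half b0 b1 -> 0 <= full lam a0 a1 b0 b1 c0 c1 t.
Proof.
move=> Cb; have q0 : 0 <= lam ^+ 2 * mem2 g b0 t by rewrite mulr_ge0 ?sqr_ge0// (mem2_ge0 kg Cb).
by rewrite /full; do 6 (apply: addr_ge0; last by [exact: sqr_ge0|exact: q0]); exact: sqr_ge0.
Qed.

Lemma En_ge0 lam a0 a1 b0 b1 c0 c1 (t : R) : C1half b0 b1 -> 0 <= t -> 0 <= En lam g a0 a1 b0 b1 c0 c1 t.
Proof.
move=> Cb t0; rewrite /En; have := gkap t0; have := mem2_ge0 kg Cb t; have := kapp.
have := r1p; have := r2p; have := kp => *.
apply: mulr_ge0; first by pos.
do 6 (apply: addr_ge0; last by apply: mulr_ge0; [first [exact: sqr_ge0|lra]|first [exact: sqr_ge0|lra]]).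
by apply: mulr_ge0; [lra|exact: sqr_ge0].
Qed.

Definition i0 := mu^-1.

Lemma freq_bounds lam : mu <= lam ->
  [/\ 0 < lam, 0 <= lam^-1 <= i0, 0 <= (lam + l)^-1 <= 2 * i0,
      0 <= (lam - l)^-1 <= 2 * i0 & 0 < lam - l].
Proof.
move=> ml; have := mup; have := lmu; have := lp => lp' lm mup'.
have lam0 : 0 < lam by lra.
have m0 : 0 < lam - l by lra.
have i00 : 0 < i0 by rewrite /i0; pos.
have E : 2 * i0 = (mu / 2)^-1 by rewrite /i0; field; lra.
split=> //.
- by rewrite invr_ge0 ltW//= lef_pV2// posrE.
- by rewrite E invr_ge0 lef_pV2 ?posrE//; [lra|lra|lra].
- by rewrite E invr_ge0 ltW//= lef_pV2 ?posrE//; lra.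
Qed.

(** Divided by the right powers of the frequency, every term of the functional
    is a bounded coefficient times the product of two quantities that the energy
    controls. *)
Lemma lyap_le_En (al1 al2 al3 : R) : exists2 C, 0 <= C &
  forall lam a0 a1 b0 b1 c0 c1 (t : R), mu <= lam -> C1half b0 b1 -> 0 <= t ->
  `|lyap lam g al1 al2 al3 a0 a1 b0 b1 c0 c1 t| <= C * En lam g a0 a1 b0 b1 c0 c1 t.
Proof.
have [C0 C00 HC0] := full_le_En.
pose I := `|i0|; pose K2 := `|k2|.
suff [C1 HC1] : exists C1, forall i p r kk b S A a1 b1 c1 m N : R,
  `|i| <= i0 -> `|p| <= 2 * i0 -> `|r| <= 2 * i0 -> `|kk| <= k2 ->
  b ^+ 2 <= N -> S ^+ 2 <= N -> A ^+ 2 <= N -> a1 ^+ 2 <= N -> b1 ^+ 2 <= N -> c1 ^+ 2 <= N ->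
  m ^+ 2 <= N ->
  `| al1 * (r2 * i * b * b1 - r1 / 2 * ((a1 + c1) * p + (a1 - c1) * r) * (i * b))
  + al2 * (r2 * b1 * S - r1 / k * (kk * b + m) * a1)
  - al3 * ((S - i * b) * (c1 + l * i * a1) - (a1 + l * i * c1) * A)
  - r1 * (((p + r) / 2 * (S - i * b) + (p - r) / 2 * A) * a1
        + ((p - r) / 2 * (S - i * b) + (p + r) / 2 * A) * c1)| <= C1 * N.
  exists (`|C1| * ((1 + k2) * C0)).
    by have := k2p => *; pos.
  move=> lam a0 a1 b0 b1 c0 c1 t ml Cb t0.
  have [lam0 /andP[ii0 ii1] /andP[pp0 pp1] /andP[rr0 rr1] lm0] := freq_bounds ml.
  have lp' : 0 < lam + l by have := lp => ?; lra.
  have fE := HC0 lam a0 a1 b0 b1 c0 c1 t Cb t0.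
  have /andP[G0 G1] := G_bound t0.
  set F := full lam a0 a1 b0 b1 c0 c1 t in fE.
  have F0 : 0 <= F by exact: full_ge0.
  have FN : F <= (1 + k2) * F by have := k2p; nra.
  have q0 : 0 <= lam ^+ 2 * mem2 g b0 t by rewrite mulr_ge0 ?sqr_ge0// (mem2_ge0 kg Cb).
  have qF : lam ^+ 2 * mem2 g b0 t <= F.
    by rewrite /F /full lerDr; do 5 (apply: addr_ge0; last by exact: sqr_ge0); exact: sqr_ge0.
  have [s1 s2 s3 [s4 s5 s6]] := @sum6_ge _ (a1 t) (b1 t) (c1 t) (lam * b0 t) (axl lam (a0 t) (c0 t)) (shr lam (a0 t) (b0 t) (c0 t)) _ q0.
  rewrite -/(full lam a0 a1 b0 b1 c0 c1 t) -/F in s1 s2 s3 s4 s5 s6.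
  have mF : (lam * mem1 g b0 t) ^+ 2 <= (1 + k2) * F.
    rewrite exprMn; apply: (@le_trans _ _ (lam ^+ 2 * (k2 * mem2 g b0 t))).
      apply: ler_wpM2l; first exact: sqr_ge0.
      by apply: (le_trans (mem1_sqr kg Cb t)); rewrite ler_wpM2r// (mem2_ge0 kg Cb).
    rewrite mulrCA mulrDl mul1r; apply: (@le_trans _ _ (k2 * F)); last by lra.
    by rewrite ler_wpM2l// ltW.
  have := HC1 lam^-1 (lam + l)^-1 (lam - l)^-1 (k2 - Iu g t) (lam * b0 t)
    (shr lam (a0 t) (b0 t) (c0 t)) (axl lam (a0 t) (c0 t)) (a1 t) (b1 t) (c1 t)
    (lam * mem1 g b0 t) ((1 + k2) * F).
  have kk0 : 0 <= k2 - Iu g t by rewrite subr_ge0.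
  have kk1 : k2 - Iu g t <= k2 by rewrite lerBlDr lerDl.
  rewrite (ger0_norm ii0) (ger0_norm pp0) (ger0_norm rr0) (ger0_norm kk0).
  move=> /(_ ii1 pp1 rr1 kk1 (le_trans s4 FN) (le_trans s6 FN) (le_trans s5 FN)
    (le_trans s1 FN) (le_trans s2 FN) (le_trans s3 FN) mF) H.
  have := kp; have := r1p => r1' k'.
  rewrite (_ : lyap lam g al1 al2 al3 a0 a1 b0 b1 c0 c1 t =
    al1 * (r2 * lam^-1 * (lam * b0 t) * b1 t - r1 / 2 * ((a1 t + c1 t) * (lam + l)^-1 + (a1 t - c1 t) * (lam - l)^-1) * (lam^-1 * (lam * b0 t)))
  + al2 * (r2 * b1 t * shr lam (a0 t) (b0 t) (c0 t) - r1 / k * ((k2 - Iu g t) * (lam * b0 t) + lam * mem1 g b0 t) * a1 t)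
  - al3 * ((shr lam (a0 t) (b0 t) (c0 t) - lam^-1 * (lam * b0 t)) * (c1 t + l * lam^-1 * a1 t) - (a1 t + l * lam^-1 * c1 t) * axl lam (a0 t) (c0 t))
  - r1 * ((((lam + l)^-1 + (lam - l)^-1) / 2 * (shr lam (a0 t) (b0 t) (c0 t) - lam^-1 * (lam * b0 t)) + ((lam + l)^-1 - (lam - l)^-1) / 2 * axl lam (a0 t) (c0 t)) * a1 t
        + (((lam + l)^-1 - (lam - l)^-1) / 2 * (shr lam (a0 t) (b0 t) (c0 t) - lam^-1 * (lam * b0 t)) + ((lam + l)^-1 + (lam - l)^-1) / 2 * axl lam (a0 t) (c0 t)) * c1 t)).
    apply: (le_trans H); apply: (@le_trans _ _ (`|C1| * ((1 + k2) * F))).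
      apply: ler_wpM2r; last exact: ler_norm.
      by apply: mulr_ge0 => //; have := k2p; lra.
    rewrite -[leRHS]mulrA; apply: ler_wpM2l => //; rewrite -mulrA ler_wpM2l//.
    by have := k2p; lra.
  rewrite /lyap /shr /axl /mem1; field.
  by rewrite !lt0r_neq0.
eexists => i p r kk b S A a1 b1 c1 m N hi hp hr hk hb hS hA ha1 hb1 hc1 hm.
have T (c x y : R) B : `|c| <= B -> x ^+ 2 <= N -> y ^+ 2 <= N -> `|c * x * y| <= B * N.
  exact: prod_le_sqr.
rewrite [X in `|X|](_ : _ =
   (al1 * r2 * i) * b * b1 + (- (al1 * (r1 / 2) * (p + r) * i)) * a1 * b
   + (- (al1 * (r1 / 2) * (p - r) * i)) * c1 * b
   + (al2 * r2) * b1 * S + (- (al2 * (r1 / k) * kk)) * b * a1 + (- (al2 * (r1 / k))) * m * a1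
   + (- al3) * S * c1 + (- (al3 * l * i)) * S * a1 + (al3 * i) * b * c1
   + (al3 * l * i ^+ 2) * b * a1 + al3 * a1 * A + (al3 * l * i) * c1 * A
   + (- (r1 * ((p + r) / 2))) * S * a1 + (r1 * ((p + r) / 2) * i) * b * a1
   + (- (r1 * ((p - r) / 2))) * A * a1 + (- (r1 * ((p - r) / 2))) * S * c1
   + (r1 * ((p - r) / 2) * i) * b * c1 + (- (r1 * ((p + r) / 2))) * A * c1); last by ring.
eapply le_trans.
  do 17 (eapply normD_le; [|by eapply T; [nbd|assumption|assumption]]).
  by eapply T; [nbd|assumption|assumption].
rewrite -!mulrDl; exact: lexx.
Qed.

End Constants.

(** * Energies of first and second order *)

Section ModeEstimates.
Variable R : realType.
Variables (r1 r2 k k2 l mu kap : R) (g g1 : R -> R).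
Hypotheses (r1p : 0 < r1) (r2p : 0 < r2) (kp : 0 < k) (k2p : 0 < k2) (lp : 0 < l)
  (mup : 0 < mu) (kapp : 0 < kap) (lmu : l <= mu / 2) (kg : kernel g g1)
  (gkap : forall t : R, 0 <= t -> kap <= k2 - Iu g t).

Notation En := (En r1 r2 k k2 l).
Notation shr := (shr l).
Notation axl := (axl l).
Notation modesol := (modesol r1 r2 k k2 l).
Notation i0 := (i0 mu).

Let gc : continuous g. Proof. by case: kg. Qed.
Let gpos (t : R) : 0 <= g t. Proof. by case: kg. Qed.

Lemma derive_le0_le_ex (f : R -> R) (a b : R) : a <= b -> continuous f ->
  (forall x : R, a < x < b -> exists2 d : R, is_derive x 1 f d & d <= 0) -> f b <= f a.
Proof.
move=> ab fc fd; apply: (@derive_le0_le _ f (fun x => 'D_1 f x)) => // x /fd[d [fx <-]] //.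
Qed.

Lemma kernel_mono (s t : R) : 0 <= s -> s <= t -> g t <= g s.
Proof.
move=> s0 st; case: kg => _ _ gd gle; apply: (@derive_le0_le _ g g1 _ _ st gc).
  by move=> x /andP[sx _]; apply: gd; exact: le_lt_trans sx.
by move=> x /andP[sx _]; apply: gle; exact: le_lt_trans sx.
Qed.

Lemma Iu_kernel_mono (s t : R) : 0 <= s -> s <= t -> Iu g s <= Iu g t.
Proof.
move=> s0 st; apply: (@derive_ge0_le _ (Iu g) g) => //.
  exact: continuous_Iu.
by move=> x /andP[sx _]; apply: is_derive_Iu => //; exact: le_lt_trans sx.
Qed.

(** The share of the mode in the squared [H^2 x H^1] norm of the data. *)
Definition data (lam : R) (a0 a1 b0 b1 c0 c1 : R -> R) :=
  lam ^+ 4 * (a0 0 ^+ 2 + b0 0 ^+ 2 + c0 0 ^+ 2) + lam ^+ 2 * (a1 0 ^+ 2 + b1 0 ^+ 2 + c1 0 ^+ 2).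

Lemma data_ge0 lam a0 a1 b0 b1 c0 c1 : 0 <= data lam a0 a1 b0 b1 c0 c1.
Proof. by rewrite /data addr_ge0// mulr_ge0 ?exprn_even_ge0// !addr_ge0// sqr_ge0. Qed.

Section fixed_mode.
Variables (lam : R) (a0 a1 a2 b0 b1 b2 c0 c1 c2 : R -> R).
Hypothesis sol : modesol lam g a0 a1 a2 b0 b1 b2 c0 c1 c2.

Notation E0 := (En lam g a0 a1 b0 b1 c0 c1).
Notation E1 := (En lam g a1 a2 b1 b2 c1 c2).

Lemma sol_C1 : [/\ C1half a0 a1 /\ C1half a1 a2, C1half b0 b1 /\ C1half b1 b2 &
  C1half c0 c1 /\ C1half c1 c2].
Proof. by case: sol. Qed.

Lemma continuous_E0 : continuous E0.
Proof.
have [[[? ? _] _] [Cb _] [[? ? _] _]] := sol_C1.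
by apply: continuous_En => //; exact: kg.
Qed.

Lemma continuous_E1 : continuous E1.
Proof.
have [[_ [? ? _]] [_ Cb] [_ [? ? _]]] := sol_C1.
by apply: continuous_En => //; exact: kg.
Qed.

Lemma is_derive_E0 (t : R) : 0 < t -> is_derive t 1 E0
  (- 2^-1 * (g t * (lam * b0 t) ^+ 2 + lam ^+ 2 * dis2 g b0 b1 t)).
Proof.
move=> t0; case: (sol) => [[Ca Ca'] [Cb Cb'] [Cc Cc'] eqs].
have [ea eb ec] := eqs t t0.
case: (Ca) (Ca') (Cb) (Cb') (Cc) (Cc') => [_ _ da] [_ _ da'] [_ _ db] [_ _ db'] [_ _ dc] [_ _ dc'].
have H := is_derive_En kg t0 Cb (da t t0) (da' t t0) (db' t t0) (dc t t0) (dc' t t0) ea eb ec.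
by rewrite mul0r sub0r -mulNr in H.
Qed.

Lemma dE0_le0 (t : R) : 0 <= t ->
  - 2^-1 * (g t * (lam * b0 t) ^+ 2 + lam ^+ 2 * dis2 g b0 b1 t) <=
  - 2^-1 * (lam ^+ 2 * dis2 g b0 b1 t) <= 0.
Proof.
move=> t0; have [_ [Cb _] _] := sol_C1.
have d0 : 0 <= lam ^+ 2 * dis2 g b0 b1 t by apply: mulr_ge0; [exact: sqr_ge0|exact: dis2_ge0 kg Cb t t0].
have h0 : 0 <= g t * (lam * b0 t) ^+ 2 by rewrite mulr_ge0 ?sqr_ge0.
by apply/andP; split; lra.
Qed.

Lemma E0_mono (s t : R) : 0 <= s -> s <= t -> E0 t <= E0 s.
Proof.
move=> s0 st; apply: (@derive_le0_le _ E0 (fun x => - 2^-1 * (g x * (lam * b0 x) ^+ 2 + lam ^+ 2 * dis2 g b0 b1 x)) _ _ st continuous_E0).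
  by move=> x /andP[sx _]; apply: is_derive_E0; exact: le_lt_trans sx.
move=> x /andP[sx _]; have x0 : 0 <= x by apply: ltW; exact: le_lt_trans sx.
by have /andP[H1 H2] := dE0_le0 x0; exact: le_trans H2.
Qed.

End fixed_mode.

(** The accelerations at time 0 are given by the equations, hence bounded by
    the data. *)
Lemma E0_init : exists2 C, 0 <= C & forall lam a0 a1 a2 b0 b1 b2 c0 c1 c2,
  mu <= lam -> modesol lam g a0 a1 a2 b0 b1 b2 c0 c1 c2 ->
  En lam g a0 a1 b0 b1 c0 c1 0 + En lam g a1 a2 b1 b2 c1 c2 0 <=
  C * data lam a0 a1 b0 b1 c0 c1.
Proof.
have := r1p; have := r2p; have := kp; have := k2p; have := lp; have := mup.
move=> mup' lp' k2p' kp' r2p' r1p'.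
have i0p : 0 < i0 by rewrite /i0; pos.
(* every term of the energy is a bounded combination of the six normalised data *)
suff [B [B0 HB]] : exists B : R, 0 <= B /\ forall i : R, 0 <= i <= i0 ->
   [/\ `|i| <= B, `|i ^+ 2| <= B, `|l * i ^+ 2| <= B, `|l * i| <= B & `|1 : R| <= B] /\
   [/\ `|k / r1 * (1 + l ^+ 2 * i ^+ 2)| <= B, `|k / r1 * i| <= B, `|k / r1 * (2 * l * i)| <= B &
     `|k / r1 * (l * i ^+ 2)| <= B] /\
   [/\ `|k / r2 * i| <= B, `|(k2 + k * i ^+ 2) / r2| <= B & `|k / r2 * (l * i ^+ 2)| <= B] /\ `|0 : R| <= B.
  pose W := 3 * B ^+ 2.
  exists ((r1 + r2 + k + k2 + 1) * 10 * W); first by rewrite /W; pos.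
  move=> lam a0 a1 a2 b0 b1 b2 c0 c1 c2 ml sol.
  have [lam0 ii _ _ _] := freq_bounds lp mup lmu ml.
  have := HB _ ii; set i := lam^-1 => -[[B1 B2 B3 B4 B5] [[B6 B7 B8 B9] [[B10 B11 B12] Bz]]].
  have li : lam * i = 1 by rewrite /i mulfV// lt0r_neq0.
  have [ea eb ec] := modesol0 kg sol.
  rewrite /En /data !Iu0//.
  have m0 f : mem2 g f 0 = 0 by rewrite /mem2 /conv !Iu0//; ring.
  rewrite !m0 !mulr0 !addr0 !subr0.
  set x := lam ^+ 2 * a0 0; set y := lam ^+ 2 * b0 0; set z := lam ^+ 2 * c0 0.
  set x' := lam * a1 0; set y' := lam * b1 0; set z' := lam * c1 0.
  pose N := x ^+ 2 + y ^+ 2 + z ^+ 2; pose N' := x' ^+ 2 + y' ^+ 2 + z' ^+ 2.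
  have -> : lam ^+ 4 * (a0 0 ^+ 2 + b0 0 ^+ 2 + c0 0 ^+ 2) + lam ^+ 2 * (a1 0 ^+ 2 + b1 0 ^+ 2 + c1 0 ^+ 2) = N + N'.
    by rewrite /N /N' /x /y /z /x' /y' /z'; ring.
  have N0 : 0 <= N by rewrite /N; pos.
  have N'0 : 0 <= N' by rewrite /N'; pos.
  have Wp : 0 <= W by rewrite /W; pos.
  have T1 c c' c'' : `|c| <= B -> `|c'| <= B -> `|c''| <= B -> (c * x + c' * y + c'' * z) ^+ 2 <= W * (N + N').
    move=> h1 h2 h3; apply: (le_trans (sum3_sqr_le x y z h1 h2 h3)).
    by rewrite -/W -/N ler_wpM2l// lerDl.
  have T2 c c' c'' : `|c| <= B -> `|c'| <= B -> `|c''| <= B -> (c * x' + c' * y' + c'' * z') ^+ 2 <= W * (N + N').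
    move=> h1 h2 h3; apply: (le_trans (sum3_sqr_le x' y' z' h1 h2 h3)).
    by rewrite -/W -/N' ler_wpM2l// lerDr.
  have Ea0 : a0 0 = i ^+ 2 * x by rewrite /x mulrA -exprMn [i * _]mulrC li expr1n mul1r.
  have Eb0 : b0 0 = i ^+ 2 * y by rewrite /y mulrA -exprMn [i * _]mulrC li expr1n mul1r.
  have Ec0 : c0 0 = i ^+ 2 * z by rewrite /z mulrA -exprMn [i * _]mulrC li expr1n mul1r.
  have Ea1 : a1 0 = i * x' by rewrite /x' mulrA [i * _]mulrC li mul1r.
  have Eb1 : b1 0 = i * y' by rewrite /y' mulrA [i * _]mulrC li mul1r.
  have Ec1 : c1 0 = i * z' by rewrite /z' mulrA [i * _]mulrC li mul1r.
  have ES0 : shr lam (a0 0) (b0 0) (c0 0) = i * x + i ^+ 2 * y + (l * i ^+ 2) * z.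
    rewrite /shr Ea0 Eb0 Ec0 (_ : lam * (i ^+ 2 * x) = (lam * i) * i * x); last by ring.
    by rewrite li; ring.
  have EA0 : axl lam (a0 0) (c0 0) = (l * i ^+ 2) * x + 0 * y + i * z.
    rewrite /axl Ea0 Ec0 (_ : lam * (i ^+ 2 * z) = (lam * i) * i * z); last by ring.
    by rewrite li; ring.
  have ES1 : shr lam (a1 0) (b1 0) (c1 0) = 1 * x' + i * y' + (l * i) * z'.
    rewrite /shr Ea1 Eb1 Ec1 (_ : lam * (i * x') = (lam * i) * x'); last by ring.
    by rewrite li; ring.
  have EA1 : axl lam (a1 0) (c1 0) = (l * i) * x' + 0 * y' + 1 * z'.
    rewrite /axl Ea1 Ec1 (_ : lam * (i * z') = (lam * i) * z'); last by ring.
    by rewrite li; ring.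
  have Ea2 : - a2 0 = k / r1 * (1 + l ^+ 2 * i ^+ 2) * x + k / r1 * i * y + k / r1 * (2 * l * i) * z.
    have -> : - a2 0 = k / r1 * (lam * shr lam (a0 0) (b0 0) (c0 0) + l * axl lam (a0 0) (c0 0)).
      by rewrite (solve_acceleration (lt0r_neq0 r1p) ea) mulNr opprK.
    rewrite ES0 EA0 (_ : lam * (i * x + i ^+ 2 * y + l * i ^+ 2 * z) = (lam * i) * (x + i * y + l * i * z)); last by ring.
    by rewrite li; ring.
  have Ec2 : - c2 0 = k / r1 * (2 * l * i) * x + k / r1 * (l * i ^+ 2) * y + k / r1 * (1 + l ^+ 2 * i ^+ 2) * z.
    have -> : - c2 0 = k / r1 * (lam * axl lam (a0 0) (c0 0) + l * shr lam (a0 0) (b0 0) (c0 0)).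
      by rewrite (solve_acceleration (lt0r_neq0 r1p) ec) mulNr opprK.
    rewrite ES0 EA0 (_ : lam * (l * i ^+ 2 * x + 0 * y + i * z) = (lam * i) * (l * i * x + z)); last by ring.
    by rewrite li; ring.
  have Eb2 : - b2 0 = k / r2 * i * x + (k2 + k * i ^+ 2) / r2 * y + k / r2 * (l * i ^+ 2) * z.
    have -> : - b2 0 = (k2 * y + k * shr lam (a0 0) (b0 0) (c0 0)) / r2.
      have e : r2 * b2 0 + 1 * (k2 * y + k * shr lam (a0 0) (b0 0) (c0 0)) = 0.
        by rewrite -[RHS]eb /eq_b /y; ring.
      by rewrite (solve_acceleration (lt0r_neq0 r2p) e) mulNr opprK mul1r mulrC.
    by rewrite ES0; ring.
  have Sa1 : a1 0 ^+ 2 <= W * (N + N').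
    by have := T2 i 0 0 B1 Bz Bz; rewrite !mul0r !addr0 -Ea1.
  have Sb1 : b1 0 ^+ 2 <= W * (N + N').
    by have := T2 0 i 0 Bz B1 Bz; rewrite !mul0r addr0 add0r -Eb1.
  have Sc1 : c1 0 ^+ 2 <= W * (N + N').
    by have := T2 0 0 i Bz Bz B1; rewrite !mul0r !add0r -Ec1.
  have Sb0 : (lam * b0 0) ^+ 2 <= W * (N + N').
    have := T1 0 i 0 Bz B1 Bz; rewrite !mul0r addr0 add0r.
    rewrite (_ : i * y = (lam * i) * (lam * b0 0)); last by rewrite /y; ring.
    by rewrite li mul1r.
  have Slb1 : y' ^+ 2 <= W * (N + N').
    by have := T2 0 1 0 Bz B5 Bz; rewrite !mul0r addr0 add0r mul1r.
  have SS0 := T1 _ _ _ B1 B2 B3; rewrite -ES0 in SS0.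
  have SA0 := T1 _ _ _ B3 Bz B1; rewrite -EA0 in SA0.
  have SS1 := T2 _ _ _ B5 B1 B4; rewrite -ES1 in SS1.
  have SA1 := T2 _ _ _ B4 Bz B5; rewrite -EA1 in SA1.
  have Sa2 := T1 _ _ _ B6 B7 B8; rewrite -Ea2 sqrrN in Sa2.
  have Sc2 := T1 _ _ _ B8 B9 B6; rewrite -Ec2 sqrrN in Sc2.
  have Sb2 := T1 _ _ _ B10 B11 B12; rewrite -Eb2 sqrrN in Sb2.
  have WN : 0 <= W * (N + N') by rewrite mulr_ge0// addr_ge0.
  have wl (c u : R) : 0 <= c -> u ^+ 2 <= W * (N + N') -> c * u ^+ 2 <= c * (W * (N + N')).
    by move=> ? ?; rewrite ler_wpM2l.
  have := wl r1 _ (ltW r1p') Sa1; have := wl r2 _ (ltW r2p') Sb1; have := wl r1 _ (ltW r1p') Sc1.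
  have := wl k2 _ (ltW k2p') Sb0; have := wl k _ (ltW kp') SA0; have := wl k _ (ltW kp') SS0.
  have := wl r1 _ (ltW r1p') Sa2; have := wl r2 _ (ltW r2p') Sb2; have := wl r1 _ (ltW r1p') Sc2.
  have := wl k2 _ (ltW k2p') Slb1; have := wl k _ (ltW kp') SA1; have := wl k _ (ltW kp') SS1.
  have -> : (r1 + r2 + k + k2 + 1) * 10 * W * (N + N') =
    r1 * (W * (N + N')) * 10 + r2 * (W * (N + N')) * 10 + k * (W * (N + N')) * 10
    + k2 * (W * (N + N')) * 10 + (W * (N + N')) * 10 by ring.
  have p1 : 0 <= r1 * (W * (N + N')) by rewrite mulr_ge0// ltW.
  have p2 : 0 <= r2 * (W * (N + N')) by rewrite mulr_ge0// ltW.
  have p3 : 0 <= k * (W * (N + N')) by rewrite mulr_ge0// ltW.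
  have p4 : 0 <= k2 * (W * (N + N')) by rewrite mulr_ge0// ltW.
  move: p1 p2 p3 p4 WN.
  set q1 := r1 * (W * _); set q2 := r2 * (W * _); set q3 := k * (W * _); set q4 := k2 * (W * _).
  set q5 := W * _.
  clear; move=> *; lra.
have [Bi HBi] : exists B : R, forall i : R, `|i| <= i0 ->
   [/\ `|i| <= B, `|i ^+ 2| <= B, `|l * i ^+ 2| <= B, `|l * i| <= B & `|1 : R| <= B] /\
   [/\ `|k / r1 * (1 + l ^+ 2 * i ^+ 2)| <= B, `|k / r1 * i| <= B, `|k / r1 * (2 * l * i)| <= B &
     `|k / r1 * (l * i ^+ 2)| <= B] /\
   [/\ `|k / r2 * i| <= B, `|(k2 + k * i ^+ 2) / r2| <= B & `|k / r2 * (l * i ^+ 2)| <= B].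
  have nb (f : R -> R) : (exists B : R, forall i : R, `|i| <= i0 -> `|f i| <= B) ->
    exists2 B : R, 0 <= B & forall i : R, `|i| <= i0 -> `|f i| <= B.
    move=> [B HB]; exists `|B| => // i /HB /le_trans; apply; exact: ler_norm.
  have [x1 ? h1] : exists2 B : R, 0 <= B & forall i : R, `|i| <= i0 -> `|i| <= B by apply: (@nb id); eexists=> i hi; exact: hi.
  have [x2 ? h2] := @nb (fun i => i ^+ 2) ltac:(eexists=> i hi; nbd).
  have [x3 ? h3] := @nb (fun i => l * i ^+ 2) ltac:(eexists=> i hi; nbd).
  have [x4 ? h4] := @nb (fun i => l * i) ltac:(eexists=> i hi; nbd).
  have [x5 ? h5] := @nb (fun i => 1) ltac:(eexists=> i hi; nbd).
  have [x6 ? h6] := @nb (fun i => k / r1 * (1 + l ^+ 2 * i ^+ 2)) ltac:(eexists=> i hi; nbd).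
  have [x7 ? h7] := @nb (fun i => k / r1 * i) ltac:(eexists=> i hi; nbd).
  have [x8 ? h8] := @nb (fun i => k / r1 * (2 * l * i)) ltac:(eexists=> i hi; nbd).
  have [x9 ? h9] := @nb (fun i => k / r1 * (l * i ^+ 2)) ltac:(eexists=> i hi; nbd).
  have [x10 ? h10] := @nb (fun i => k / r2 * i) ltac:(eexists=> i hi; nbd).
  have [x11 ? h11] := @nb (fun i => (k2 + k * i ^+ 2) / r2) ltac:(eexists=> i hi; nbd).
  have [x12 ? h12] := @nb (fun i => k / r2 * (l * i ^+ 2)) ltac:(eexists=> i hi; nbd).
  exists (x1 + x2 + x3 + x4 + x5 + x6 + x7 + x8 + x9 + x10 + x11 + x12) => i hi.
  move: {h1 h2 h3 h4 h5 h6 h7 h8 h9 h10 h11 h12} (h1 i hi) (h2 i hi) (h3 i hi) (h4 i hi) (h5 i hi) (h6 i hi)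
    (h7 i hi) (h8 i hi) (h9 i hi) (h10 i hi) (h11 i hi) (h12 i hi) => h1 h2 h3 h4 h5 h6 h7 h8 h9 h10 h11 h12.
  have tr (u v w : R) : u <= v -> v <= w -> u <= w by exact: le_trans.
  by split; [split|split; [split|split]];
    (eapply tr; [eassumption|clear h1 h2 h3 h4 h5 h6 h7 h8 h9 h10 h11 h12; lra]).
have [_ [_ _ _ _ B1]] : True /\ [/\ True, True, True, True & `|1 : R| <= Bi].
  by split=> //; split=> //; have [|[]] := HBi 0; [rewrite normr0 ltW|].
exists Bi; split; first by rewrite normr1 in B1; lra.
move=> i /andP[i1 i2]; have [] := HBi i; first by rewrite ger0_norm.
by move=> ? [? ?]; split=> //; split=> //; split=> //; rewrite normr0; rewrite normr1 in B1; lra.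
Qed.

(** The rate at which the forcing can feed the second-order energy, per unit
    of mass of the kernel. *)
Definition gam : R := 2^-1 + r2^-1.

Let gam0 : 0 <= gam. Proof. by rewrite /gam; have := r2p => ?; pos. Qed.

Section second_order.
Variables (lam : R) (a0 a1 a2 b0 b1 b2 c0 c1 c2 : R -> R).
Hypothesis sol : modesol lam g a0 a1 a2 b0 b1 b2 c0 c1 c2.

Notation E1 := (En lam g a1 a2 b1 b2 c1 c2).
Notation K := (data lam a0 a1 b0 b1 c0 c1).

(** The integrating factor absorbs the forcing that the initial value of the
    memory variable exerts on the differentiated system. *)
Definition Zf t := (E1 t + K) * expR (- (gam * Iu g t)).

Lemma continuous_Zf : continuous Zf.
Proof.
have E1c := continuous_E1 sol; have Gc := continuous_Iu gc.
have ec : continuous (fun t => expR (- (gam * Iu g t))).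
  by move=> t; apply: continuous_comp; [apply: contN; apply: continuousMf => //; exact: cont_cst|exact: continuous_expR].
by rewrite /Zf; ctn.
Qed.

(** The integrating factor stays bounded below since [g] has finite mass, so
    that the total dissipation of second order is bounded by the data. *)
Lemma Zf_derive (t : R) : 0 < t -> exists2 dZ, is_derive t 1 Zf dZ &
  dZ <= - (2^-1 * expR (- (gam * k2))) * (lam ^+ 2 * dis2 g b1 b2 t).
Proof.
move=> t0; have [_ [Cb Cb'] _] := sol_C1 sol.
have dE := is_derive_En1 kg (lt0r_neq0 r1p) (lt0r_neq0 r2p) sol t0.
have dG := is_derive_Iu gc t0.
have dg : is_derive t 1 (fun t => - (gam * Iu g t)) (- (gam * g t)).
  by eapply is_derive_eq; [der|ring].
have de := der_comp (g := fun t => - (gam * Iu g t)) (is_derive_expR (- (gam * Iu g t))) dg.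
have dZ : is_derive t 1 Zf _ := derM (derD dE (der_cst K t)) de.
eexists; first exact: dZ.
set D := lam ^+ 2 * dis2 g b1 b2 t.
have D0 : 0 <= D by apply: mulr_ge0; [exact: sqr_ge0|exact: dis2_ge0 kg Cb' t (ltW t0)].
set e := expR (- (gam * Iu g t)).
have e0 : 0 < e by exact: expR_gt0.
have G2 : Iu g t <= k2 by have := gkap (ltW t0); have := kapp; lra.
have ee : expR (- (gam * k2)) <= e by rewrite ler_expR lerN2 ler_wpM2l.
rewrite addr0 (_ : _ + _ = e * (lam ^+ 2 * g t * b0 0 * b2 t - 2^-1 * (g t * (lam * b1 t) ^+ 2 + D) - gam * g t * (E1 t + K))); last by ring.
have gt0 := gpos t.
have b2E : b2 t ^+ 2 <= 2 / r2 * E1 t.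
  rewrite /En; have q0 := mem2_ge0 kg Cb' t; have kk := gkap (ltW t0).
  have r2' := r2p; have r1' := r1p; have k' := kp; have kap' := kapp.
  have kk0 : 0 <= k2 - Iu g t by apply: le_trans kk; exact: ltW.
  have s0 : 0 <= r1 * a2 t ^+ 2 + r1 * c2 t ^+ 2 + (k2 - Iu g t) * (lam * b1 t) ^+ 2
     + k * axl lam (a1 t) (c1 t) ^+ 2 + k * shr lam (a1 t) (b1 t) (c1 t) ^+ 2 + lam ^+ 2 * mem2 g b1 t.
    by pos.
  have i2 : 0 <= r2^-1 by rewrite invr_ge0 ltW.
  have := mulr_ge0 i2 s0; set s := (X in r2^-1 * X) => ss.
  rewrite [leRHS](_ : _ = b2 t ^+ 2 + r2^-1 * s); first by lra.
  by rewrite /s; field; lra.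
have E10 : 0 <= E1 t by exact: (En_ge0 l r1p r2p kp kapp kg gkap _ _ _ _ _ Cb' (ltW t0)).
have forcing : lam ^+ 2 * b0 0 * b2 t <= gam * (E1 t + K).
  have Kb : (lam ^+ 2 * b0 0) ^+ 2 <= K.
    rewrite /data (_ : (lam ^+ 2 * b0 0) ^+ 2 = lam ^+ 4 * b0 0 ^+ 2); last by ring.
    have l4 : 0 <= lam ^+ 4 by rewrite exprn_even_ge0.
    have : 0 <= lam ^+ 4 * (a0 0 ^+ 2 + c0 0 ^+ 2) by pos.
    have : 0 <= lam ^+ 2 * (a1 0 ^+ 2 + b1 0 ^+ 2 + c1 0 ^+ 2) by pos.
    by lra.
  have := sqr_ge0 (lam ^+ 2 * b0 0 - b2 t); rewrite sqrrB => H.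
  rewrite /gam mulrDl.
  have i2 : 0 < r2^-1 by rewrite invr_gt0.
  have P1 : 0 <= r2^-1 * K by apply: mulr_ge0; [exact: ltW|exact: data_ge0].
  rewrite -mulr_natr in H; rewrite (mulrDr 2^-1 (E1 t)) (mulrDr r2^-1 (E1 t)); set w := lam ^+ 2 * b0 0 in H Kb *.
  move: b2E P1 E10 H Kb; rewrite -[2 / r2 * _]mulrA; set q := r2^-1 * E1 t; set q' := r2^-1 * K.
  by move=> *; lra.
have : lam ^+ 2 * g t * b0 0 * b2 t - 2^-1 * (g t * (lam * b1 t) ^+ 2 + D) - gam * g t * (E1 t + K) <= - (2^-1 * D).
  have := ler_wpM2l gt0 forcing.
  have : 0 <= g t * (lam * b1 t) ^+ 2 by rewrite mulr_ge0 ?sqr_ge0.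
  set q := g t * (gam * _); rewrite (_ : gam * g t * (E1 t + K) = q); last by rewrite /q; ring.
  by rewrite (_ : lam ^+ 2 * g t * b0 0 * b2 t = g t * (lam ^+ 2 * b0 0 * b2 t)); [lra|ring].
move=> /(ler_wpM2l (ltW e0)) /le_trans; apply.
rewrite [leRHS](_ : _ = expR (- (gam * k2)) * (- (2^-1 * D))); last by ring.
by rewrite !mulrN lerN2 ler_wpM2r// mulr_ge0.
Qed.

Lemma Zf_ge0 (t : R) : 0 <= t -> 0 <= Zf t.
Proof.
move=> t0; have [_ [Cb Cb'] _] := sol_C1 sol.
apply: mulr_ge0; last exact: expR_ge0.
by rewrite addr_ge0 ?data_ge0// (En_ge0 l r1p r2p kp kapp kg gkap _ _ _ _ _ Cb' t0).
Qed.

Lemma Zf_mono (t : R) : 0 <= t -> Zf t <= Zf 0.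
Proof.
move=> t0; have [_ [Cb Cb'] _] := sol_C1 sol.
apply: (@derive_le0_le_ex Zf 0 t t0 continuous_Zf) => x /andP[x0 _].
have [d d1 d2] := Zf_derive x0; exists d => //; apply: (le_trans d2).
rewrite mulNr oppr_le0; apply: mulr_ge0.
  by apply: mulr_ge0; [rewrite invr_ge0|exact: expR_ge0].
by apply: mulr_ge0; [exact: sqr_ge0|exact: dis2_ge0 kg Cb' x (ltW x0)].
Qed.

Lemma E1_le_Zf (t : R) : 0 <= t -> E1 t + K <= expR (gam * k2) * Zf 0.
Proof.
move=> t0; have := Zf_mono t0; rewrite {1}/Zf => H.
have G2 : Iu g t <= k2 by have := gkap t0; have := kapp; lra.
have -> : E1 t + K = expR (gam * Iu g t) * ((E1 t + K) * expR (- (gam * Iu g t))).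
  by rewrite mulrCA -expRD subrr expR0 mulr1.
apply: (@le_trans _ _ (expR (gam * Iu g t) * Zf 0)).
  by apply: ler_wpM2l; [exact: expR_ge0|exact: H].
apply: ler_wpM2r; first exact: Zf_ge0.
by rewrite ler_expR; apply: ler_wpM2l.
Qed.

End second_order.

Lemma conv_norm_le (f : R -> R) (M t : R) : continuous f -> 0 <= t -> 0 <= M ->
  (forall s : R, 0 <= s <= t -> `|f s| <= M) -> `|conv g f t| <= Iu g t * M.
Proof.
move=> fc t0 M0 fM.
have rc : continuous (fun s => f (t - s)) by exact: continuous_rev.
have cgf : continuous (fun s => g s * f (t - s)) by ctn.
have b (s : R) : 0 <= s <= t -> `|f (t - s)| <= M.
  by move=> /andP[s0 st]; apply: fM; rewrite subr_ge0 st lerBlDr lerDl.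
rewrite ler_norml; apply/andP; split.
  rewrite -mulrN mulrC -IuZ//; apply: Iu_le => //; first by ctn.
  move=> s /b; rewrite ler_norml => /andP[h _].
  by rewrite mulrC ler_wpM2l.
rewrite mulrC -IuZ//; apply: Iu_le => //; first by ctn.
by move=> s /b; rewrite ler_norml => /andP[_ h]; rewrite [leRHS]mulrC ler_wpM2l.
Qed.

(** The last bound has one power of the frequency more than the energy gives.
    It comes from the equation of [b0], read as a Volterra equation at the time
    where [b0] is largest. *)
Lemma mode_bounds : exists2 C, 0 <= C & forall lam a0 a1 a2 b0 b1 b2 c0 c1 c2,
  mu <= lam -> modesol lam g a0 a1 a2 b0 b1 b2 c0 c1 c2 -> forall t : R, 0 <= t ->
  let K := data lam a0 a1 b0 b1 c0 c1 in
  [/\ En lam g a0 a1 b0 b1 c0 c1 t <= C * K, Zf lam a0 a1 a2 b0 b1 b2 c0 c1 c2 t <= C * K,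
     (lam * b0 t) ^+ 2 <= C * K, (lam * b1 t) ^+ 2 <= C * K &
     (lam ^+ 2 * b0 t) ^+ 2 <= C * K].
Proof.
have [C0 C00 H0] := E0_init.
have [C1 C10 H1] := full_le_En l r1p r2p kp kapp kg gkap.
have kap' := kapp; have r2' := r2p; have k' := kp; have gam' := gam0.
pose Q := expR (gam * k2).
have Q1 : 1 <= Q by rewrite -expR0 ler_expR mulr_ge0// ltW.
pose C2 := C1 * (Q * (C0 + 1)).
have C20 : 0 <= C2 by rewrite /C2; pos; rewrite /Q expR_ge0.
pose C3 := 2 * (r2 ^+ 2 + k ^+ 2) * C2 / kap ^+ 2.
have C30 : 0 <= C3 by rewrite /C3; pos.
exists (C0 + 1 + C2 + C3); first by pos.
move=> lam a0 a1 a2 b0 b1 b2 c0 c1 c2 ml sol t t0 K.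
have [_ [Cb Cb'] _] := sol_C1 sol.
have K0 : 0 <= K by exact: data_ge0.
have init := H0 _ _ _ _ _ _ _ _ _ _ ml sol; rewrite -/K in init.
set E0 := En lam g a0 a1 b0 b1 c0 c1 in init *.
set E1 := En lam g a1 a2 b1 b2 c1 c2 in init *.
have E0p (s : R) : 0 <= s -> 0 <= E0 s by move=> s0; exact: (En_ge0 l r1p r2p kp kapp kg gkap _ _ _ _ _ Cb s0).
have E1p (s : R) : 0 <= s -> 0 <= E1 s by move=> s0; exact: (En_ge0 l r1p r2p kp kapp kg gkap _ _ _ _ _ Cb' s0).
have e0 := E0p 0 (lexx _); have e1 := E1p 0 (lexx _).
have E0b (s : R) : 0 <= s -> E0 s <= C0 * K.
  by move=> s0; apply: (le_trans (E0_mono sol (lexx 0) s0)); rewrite -/E0; lra.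
have Z0 : Zf lam a0 a1 a2 b0 b1 b2 c0 c1 c2 0 <= (C0 + 1) * K.
  by rewrite /Zf Iu0// mulr0 oppr0 expR0 mulr1 -/E1 -/K; lra.
have E1b (s : R) : 0 <= s -> E1 s <= Q * (C0 + 1) * K.
  move=> s0; have := E1_le_Zf sol s0; rewrite -/E1 -/K -/Q => H.
  have : Q * Zf lam a0 a1 a2 b0 b1 b2 c0 c1 c2 0 <= Q * ((C0 + 1) * K).
    by rewrite ler_wpM2l// expR_ge0.
  by rewrite [Q * ((C0 + 1) * K)]mulrA => H2; lra.
have E0b' (s : R) : 0 <= s -> E0 s <= Q * (C0 + 1) * K.
  move=> s0; apply: (le_trans (E0b s s0)); rewrite ler_wpM2r//.
  by rewrite (@le_trans _ _ (1 * (C0 + 1)))//; [lra|rewrite ler_wpM2r//; lra].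
have q0 (f f1 : R -> R) : C1half f f1 -> forall s : R, 0 <= lam ^+ 2 * mem2 g f s.
  by move=> Cf s; rewrite mulr_ge0 ?sqr_ge0// (mem2_ge0 kg Cf).
have fb (s : R) : 0 <= s -> [/\ (lam * b0 s) ^+ 2 <= C2 * K, (lam * b1 s) ^+ 2 <= C2 * K,
    b2 s ^+ 2 <= C2 * K & shr lam (a0 s) (b0 s) (c0 s) ^+ 2 <= C2 * K].
  move=> s0.
  have h0 : full l g lam a0 a1 b0 b1 c0 c1 s <= C2 * K.
    apply: (le_trans (H1 lam a0 a1 b0 b1 c0 c1 s Cb s0)); rewrite /C2 -[C1 * _ * K]mulrA ler_wpM2l//.
    exact: E0b'.
  have h1 : full l g lam a1 a2 b1 b2 c1 c2 s <= C2 * K.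
    apply: (le_trans (H1 lam a1 a2 b1 b2 c1 c2 s Cb' s0)); rewrite /C2 -[C1 * _ * K]mulrA ler_wpM2l//.
    exact: E1b.
  have [_ _ _ [s1 _ s2]] := sum6_ge (a1 s) (b1 s) (c1 s) (lam * b0 s) (axl lam (a0 s) (c0 s)) (shr lam (a0 s) (b0 s) (c0 s)) (q0 _ _ Cb s).
  have [_ s3 _ [s4 _ _]] := sum6_ge (a2 s) (b2 s) (c2 s) (lam * b1 s) (axl lam (a1 s) (c1 s)) (shr lam (a1 s) (b1 s) (c1 s)) (q0 _ _ Cb' s).
  by split; [exact: le_trans h0|exact: le_trans h1|exact: le_trans h1|exact: le_trans h0].
have [f1 f2 _ _] := fb t t0.
have C3K : 0 <= C3 * K by rewrite mulr_ge0.
have C0K : 0 <= (C0 + 1) * K by rewrite mulr_ge0// addr_ge0.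
have C0K' : 0 <= C0 * K by rewrite mulr_ge0.
have C2K : 0 <= C2 * K by rewrite mulr_ge0.
have split3 : (C0 + 1 + C2 + C3) * K = (C0 + 1) * K + C2 * K + C3 * K by ring.
split.
- by rewrite split3; have := E0b t t0; lra.
- apply: (le_trans (le_trans (Zf_mono sol t0) Z0)).
  by rewrite split3 -addrA lerDl addr_ge0.
- by rewrite split3; lra.
- by rewrite split3; lra.
suff : (lam ^+ 2 * b0 t) ^+ 2 <= C3 * K by rewrite split3; lra.
(* the kernel of the Volterra equation has mass at most [k2 - kap] *)
have [b0c b1c db] := Cb.
pose y s := `|lam ^+ 2 * b0 s|.
have yc : {within `[0, t], continuous y}.
  have c : continuous (fun s => lam ^+ 2 * b0 s) by ctn.
  by apply: continuous_subspaceT => x; apply: cvg_norm; exact: c.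
have [s sin smax] := EVT_max t0 yc.
move: sin; rewrite in_itv/= => /andP[s0 st].
have [_ _ fb2 fS] := fb s s0.
have eqb : lam ^+ 2 * (k2 * b0 s - conv g b0 s) = - (r2 * b2 s + k * shr lam (a0 s) (b0 s) (c0 s)).
  have : eq_b r2 k k2 l lam (a0 s) (b0 s) (c0 s) (b2 s) (conv g b0 s) 0.
    move: s0; rewrite le_eqVlt => /predU1P[<-|s0].
      by have [_ + _] := modesol0 kg sol; rewrite /conv Iu0.
    by case: sol => _ _ _ /(_ s s0)[].
  by rewrite /eq_b => e; lra.
have cvb : `|conv g (fun s => lam ^+ 2 * b0 s) s| <= Iu g s * y s.
  apply: conv_norm_le => //; [by ctn|exact: normr_ge0|].
  by move=> u /andP[u0 us]; apply: smax; rewrite in_itv/= u0 (le_trans us).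
have cvE : conv g (fun s => lam ^+ 2 * b0 s) s = lam ^+ 2 * conv g b0 s.
  rewrite /conv -IuZ; last by apply: continuousMf => //; exact: continuous_rev.
  by apply: eq_Iu => u _; ring.
have key : kap * y s <= `|r2 * b2 s + k * shr lam (a0 s) (b0 s) (c0 s)|.
  have -> : r2 * b2 s + k * shr lam (a0 s) (b0 s) (c0 s) = - (lam ^+ 2 * (k2 * b0 s) - lam ^+ 2 * conv g b0 s).
    by rewrite -[LHS]opprK -eqb; ring.
  rewrite normrN; apply: le_trans (lerB_dist _ _); rewrite -cvE.
  rewrite mulrCA normrM (ger0_norm (ltW k2p)) -/(y s).
  have := gkap s0; have yp : 0 <= y s by exact: normr_ge0.
  by move=> /(ler_wpM2r yp); rewrite mulrBl; lra.
have key2 : (kap * y s) ^+ 2 <= 2 * (r2 ^+ 2 + k ^+ 2) * (C2 * K).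
  apply: (@le_trans _ _ (`|r2 * b2 s + k * shr lam (a0 s) (b0 s) (c0 s)| ^+ 2)).
    have yp : 0 <= y s by exact: normr_ge0.
    by rewrite ler_pXn2r ?nnegrE// mulr_ge0// ltW.
  rewrite real_normK ?num_real//.
  set u := r2 * b2 s; set v := k * _.
  have hu : u ^+ 2 <= r2 ^+ 2 * (C2 * K) by rewrite exprMn ler_wpM2l ?sqr_ge0.
  have hv : v ^+ 2 <= k ^+ 2 * (C2 * K) by rewrite exprMn ler_wpM2l ?sqr_ge0.
  have huv := sqr_ge0 (u - v).
  rewrite [leRHS](_ : _ = 2 * (r2 ^+ 2 * (C2 * K)) + 2 * (k ^+ 2 * (C2 * K))); last by ring.
  rewrite (_ : (u + v) ^+ 2 = 2 * u ^+ 2 + 2 * v ^+ 2 - (u - v) ^+ 2); last by ring.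
  move: hu hv huv; set U := u ^+ 2; set V := v ^+ 2; set X := r2 ^+ 2 * _; set Y := k ^+ 2 * _.
  set D := (u - v) ^+ 2; move=> *; lra.
have key3 : y s ^+ 2 <= C3 * K.
  rewrite exprMn in key2; rewrite /C3 [leRHS](_ : _ = (2 * (r2 ^+ 2 + k ^+ 2) * (C2 * K)) / kap ^+ 2); last by ring.
  by rewrite ler_pdivlMr ?exprn_gt0// mulrC.
have yp : 0 <= y s by exact: normr_ge0.
apply: le_trans key3; rewrite -[leLHS]real_normK ?num_real// ler_pXn2r ?nnegrE//.
by apply: smax; rewrite in_itv/= t0 lexx.
Qed.

End ModeEstimates.

(** * Interpolation between memory and dissipation *)

Section Powers.
Variable R : realType.

Lemma continuous_powR_nneg (f : R -> R) (p : R) : 0 < p -> continuous f ->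
  (forall t, 0 <= f t) -> continuous (fun t => f t `^ p).
Proof.
move=> p0 fc f0 t; have := f0 t; rewrite le_eqVlt => /predU1P[ft0|ft0]; last first.
  apply: (@continuous_comp _ _ _ f (fun x => x `^ p)); first exact: fc.
  exact: is_derive_cont (is_derive1_powR p ft0).
rewrite /continuous_at -ft0 powR0 ?gt_eqF//; apply/cvgrPdist_lt => e e0.
have /cvgrPdist_lt/(_ e e0) := powR_cvg0 p0.
move=> [d /= d0 H]; have := fc t; rewrite /continuous_at -ft0 => /cvgrPdist_lt/(_ d d0) Hf.
near=> s; have fs : `|0 - f s| < d by near: s.
have := f0 s; rewrite le_eqVlt => /predU1P[<-|fs0].
  by rewrite powR0 ?gt_eqF// subrr normr0.
exact: H.
Unshelve. all: by end_near. Qed.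

(** The exponents are such that the left-hand side is below the first term
    when [e * A] is at most the square root of [x], and below the second term
    otherwise. *)
Lemma powR_interpolation (p e A x : R) : 1 <= p -> 0 < e -> 0 <= A -> 0 <= x ->
  A `^ (2 * p - 2) * x <=
  e `^ (2 - 2 * p) * x `^ p + e * A `^ (2 * p - 1) * x `^ 2^-1.
Proof.
move=> p1 e0 A0; rewrite le_eqVlt => /predU1P[<-|x0].
  by rewrite mulr0 addr_ge0// mulr_ge0 ?powR_ge0// mulr_ge0 ?powR_ge0// ltW.
have T1 : 0 <= e `^ (2 - 2 * p) * x `^ p by rewrite mulr_ge0 ?powR_ge0.
have T2 : 0 <= e * A `^ (2 * p - 1) * x `^ 2^-1.
  by rewrite mulr_ge0 ?powR_ge0// mulr_ge0 ?powR_ge0// ltW.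
move: A0; rewrite le_eqVlt => /predU1P[A0|A0].
  have [p1'|pN1] := eqVneq p 1; last first.
    have z : A `^ (2 * p - 2) = 0.
      by rewrite -A0 powR0//; apply: contra pN1 => /eqP h; apply/eqP; lra.
    by rewrite z mul0r addr_ge0.
  rewrite -A0 p1' (_ : 2 * 1 - 2 = 0); last by ring.
  rewrite (_ : 2 - 2 * 1 = 0); last by ring.
  rewrite !powRr0 !mul1r (powRr1 (ltW x0)) lerDl.
  by apply: mulr_ge0; [apply: mulr_ge0; [exact: ltW|exact: powR_ge0]|exact: powR_ge0].
have [h|h] := leP (e * A) (x `^ 2^-1).
  apply: (@le_trans _ _ (e `^ (2 - 2 * p) * x `^ p)); last by rewrite lerDl.
  have eA : 0 <= e * A by rewrite mulr_ge0// ltW.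
  have h2 : (e * A) `^ (2 * p - 2) <= (x `^ 2^-1) `^ (2 * p - 2).
    by apply: ge0_ler_powR => //; [lra|rewrite nnegrE powR_ge0].
  rewrite powRM ?(ltW e0) ?(ltW A0)// -powRrM in h2.
  have ei : 0 <= e `^ (2 - 2 * p) by exact: powR_ge0.
  have := ler_wpM2l ei h2; rewrite mulrA -powRD; last by rewrite (gt_eqF e0) implybT.
  rewrite (_ : 2 - 2 * p + (2 * p - 2) = 0); last by ring.
  rewrite powRr0 mul1r => /(ler_wpM2r (ltW x0)) /le_trans; apply.
  rewrite -mulrA ler_wpM2l// -[X in _ * X]powRr1 ?(ltW x0)// -powRD; last by rewrite (gt_eqF x0) implybT.
  by rewrite (_ : 2^-1 * (2 * p - 2) + 1 = p)//; field.
apply: (@le_trans _ _ (e * A `^ (2 * p - 1) * x `^ 2^-1)); last by rewrite lerDr.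
have -> : A `^ (2 * p - 1) = A `^ (2 * p - 2) * A.
  rewrite -[X in _ = _ * X](powRr1 (ltW A0)) -powRD; last by rewrite (gt_eqF A0) implybT.
  by congr (_ `^ _); ring.
have -> : e * (A `^ (2 * p - 2) * A) * x `^ 2^-1 = A `^ (2 * p - 2) * (e * A * x `^ 2^-1) by ring.
rewrite ler_wpM2l ?powR_ge0//; apply: (@le_trans _ _ (x `^ 2^-1 * x `^ 2^-1)).
  rewrite -powRD; last by rewrite (gt_eqF x0) implybT.
  by rewrite (_ : 2^-1 + 2^-1 = 1) ?powRr1 ?(ltW x0)//; field.
by rewrite ler_wpM2r ?powR_ge0// ltW.
Qed.

End Powers.

Section Weight.
Variable R : realType.
Variables (g g1 xi xi1 : R -> R) (p : R).
Hypotheses (kg : kernel g g1) (xic : continuous xi) (xi0 : forall t, 0 < xi t)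
  (xid : forall t : R, 0 < t -> is_derive t 1 xi (xi1 t))
  (xi1le : forall t : R, 0 < t -> xi1 t <= 0)
  (p1 : 1 <= p) (p2 : p < 3 / 2)
  (gxi : forall t : R, 0 < t -> xi t * g t `^ p <= - g1 t).

Let gc : continuous g. Proof. by case: kg. Qed.
Let gpos (t : R) : 0 <= g t. Proof. by case: kg. Qed.

Lemma xi_mono (s t : R) : 0 <= s -> s <= t -> xi t <= xi s.
Proof.
move=> s0 st; apply: (@derive_le0_le _ xi xi1 _ _ st xic).
  by move=> x /andP[sx _]; apply: xid; exact: le_lt_trans sx.
by move=> x /andP[sx _]; apply: xi1le; exact: le_lt_trans sx.
Qed.

Let wc : continuous (fun s => xi s * g s `^ 2^-1).
Proof. by apply: continuousMf => //; apply: continuous_powR_nneg. Qed.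

Let kc : continuous (fun s => xi s * g s `^ p).
Proof. by apply: continuousMf => //; apply: continuous_powR_nneg => //; have := p1; lra. Qed.

(** With [r = 3 / 2 - p > 0], the inequality [g' <= - xi g^p] says that
    [xi * g^(1/2)] is at most minus the derivative of [g^r / r]. Powers of [g] are
    not differentiable where [g] vanishes, but from there on the integral stays
    constant. *)
Lemma root_kernel_integrable : exists2 J : R, 0 <= J & forall t : R, 0 <= t ->
  Iu (fun s => xi s * g s `^ 2^-1) t <= J.
Proof.
have p1' := p1; have p2' := p2.
pose r := 3 / 2 - p; have r0 : 0 < r by rewrite /r; lra.
exists (r^-1 * g 0 `^ r); first by rewrite mulr_ge0 ?invr_ge0 ?powR_ge0 ?ltW.
move=> t t0.
set I := Iu (fun s => xi s * g s `^ 2^-1); have Ic : continuous I := continuous_Iu wc.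
have pos_case (s : R) : 0 <= s -> 0 < g s -> I s <= r^-1 * g 0 `^ r.
  move=> s0 gs0; pose V x := I x + r^-1 * g x `^ r.
  have Vc : continuous V.
    by rewrite /V; apply: contD => //; apply: continuousMf; [exact: cont_cst|exact: continuous_powR_nneg].
  have : V s <= V 0.
    apply: (@derive_le0_le_ex _ V 0 s s0 Vc) => x /andP[x0 xs].
    have gx0 : 0 < g x by apply: lt_le_trans gs0 _; apply: (kernel_mono kg) => //; exact: ltW.
    have dg : is_derive x 1 g (g1 x) by case: kg => _ _ + _; exact.
    have dI := is_derive_Iu wc x0.
    have dp := der_comp (f := fun y => y `^ r) (is_derive1_powR r gx0) dg.
    exists (xi x * g x `^ 2^-1 + (0 * g x `^ r + r^-1 * (r * g x `^ (r - 1) * g1 x))).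
      exact: derD dI (derM (der_cst _ _) dp).
    rewrite mul0r add0r mulrA mulrA mulVf ?gt_eqF// mul1r.
    have := ler_wpM2l (powR_ge0 (g x) (r - 1)) (gxi x0).
    rewrite mulrN mulrCA -powRD; last by rewrite (gt_eqF gx0) implybT.
    rewrite (_ : r - 1 + p = 2^-1); last by rewrite /r; field.
    by move=> *; lra.
  have I00 : I 0 = 0 by rewrite /I Iu0.
  rewrite /V I00 add0r => h; apply: le_trans h.
  by rewrite lerDl mulr_ge0 ?powR_ge0// invr_ge0 ltW.
have [gt0|] := ltP 0 (g t); first exact: pos_case.
move=> gt0; rewrite leNgt; apply/negP => It.
have I0 : I 0 = 0 by rewrite /I Iu0.
have J0 : 0 <= r^-1 * g 0 `^ r by rewrite mulr_ge0 ?invr_ge0 ?powR_ge0 ?ltW.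
pose v := (r^-1 * g 0 `^ r + I t) / 2.
have [] := @IVT R I 0 t v t0.
- exact: continuous_subspaceT.
- by rewrite I0 minEle maxEle; case: ifPn => [_|/negP]; rewrite /v; [apply/andP; split; lra|move=> []; lra].
move=> s; rewrite in_itv/= => /andP[s0 st] Is.
have [gs0|gs0] := ltP 0 (g s); first by have := pos_case s s0 gs0; rewrite Is /v; lra.
suff : I s = I t by rewrite Is /v; lra.
have z (x : R) : s < x < t -> is_derive x 1 I 0.
  move=> /andP[sx xt]; have x0 := le_lt_trans s0 sx.
  have gx : g x = 0.
    by apply/eqP; rewrite eq_le gpos andbT; apply: le_trans gs0; apply: (kernel_mono kg) => //; exact: ltW.
  by have := is_derive_Iu wc x0; rewrite gx powR0 ?mulr0.
have cst0 : continuous (fun _ : R => 0 : R) by exact: cont_cst.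
have := @derive_eq _ I (fun=> 0) (fun=> 0) s t st Ic cst0 z.
by move=> /(_ (fun x _ => der_cst 0 x)); lra.
Qed.

(** The pointwise interpolation of [g], integrated against the squared
    increments: the part with [g^p] is below the dissipation, the part with
    [g^(1/2)] is integrable. The weight [xi t] moves inside because [xi] is
    nonincreasing. *)
Lemma mem2_interpolation : exists2 C : R, 0 <= C &
  forall (e A H t : R) (f f1 : R -> R), 0 < e -> 0 <= A -> C1half f f1 -> 0 <= t ->
  (forall s : R, 0 <= s <= t -> f s ^+ 2 <= H) ->
  xi t * A `^ (2 * p - 2) * mem2 g f t <=
  e `^ (2 - 2 * p) * dis2 g f f1 t + e * A `^ (2 * p - 1) * (C * H).
Proof.
have [J J0 HJ] := root_kernel_integrable.
exists (4 * J); first by rewrite mulr_ge0.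
move=> e A H t f f1 e0 A0 Cf t0 fH.
have [fc f1c _] := Cf.
have H0 : 0 <= H by apply: le_trans (fH t _); [exact: sqr_ge0|rewrite t0 lexx].
have rc : continuous (fun r => f (t - r)) by exact: continuous_rev.
have hc : continuous (fun r => (f t - f (t - r)) ^+ 2) by ctn.
have hH (r : R) : 0 <= r <= t -> (f t - f (t - r)) ^+ 2 <= 4 * H.
  move=> /andP[r0 rt]; have := fH t; rewrite t0 lexx => /(_ isT) h1.
  have h2 : f (t - r) ^+ 2 <= H by apply: fH; rewrite subr_ge0 rt lerBlDr lerDl.
  have := sqr_ge0 (f t + f (t - r)).
  have -> : (f t - f (t - r)) ^+ 2 = 2 * f t ^+ 2 + 2 * f (t - r) ^+ 2 - (f t + f (t - r)) ^+ 2 by ring.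
  by move=> *; lra.
rewrite (mem2E kg Cf) -IuZ; last by ctn.
have kdis := dis2_ge kg Cf t0 kc gxi.
have e1 : 0 <= e `^ (2 - 2 * p) by exact: powR_ge0.
have eA : 0 <= e * A `^ (2 * p - 1) by rewrite mulr_ge0 ?powR_ge0// ltW.
apply: (@le_trans _ _ (Iu (fun r => e `^ (2 - 2 * p) * (xi r * g r `^ p * (f t - f (t - r)) ^+ 2)
    + (e * A `^ (2 * p - 1) * (4 * H)) * (xi r * g r `^ 2^-1)) t)).
  apply: Iu_le; [by ctn| |].
    apply: contD; apply: continuousMf => //; try exact: cont_cst.
    by apply: continuousMf; [exact: kc|exact: hc].
  move=> r /andP[r0 rt].
  have h0 : 0 <= (f t - f (t - r)) ^+ 2 by exact: sqr_ge0.
  have hh := hH r; rewrite r0 rt in hh; have {}hh := hh isT.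
  have xr := xi_mono r0 rt; have xr0 := ltW (xi0 r).
  have I := powR_interpolation p1 e0 A0 (gpos r).
  set h := (f t - f (t - r)) ^+ 2 in h0 hh *.
  apply: (@le_trans _ _ (xi r * (A `^ (2 * p - 2) * g r * h))).
    rewrite [leLHS](_ : _ = xi t * (A `^ (2 * p - 2) * g r * h)); last by ring.
    apply: ler_wpM2r => //; apply: mulr_ge0 => //; apply: mulr_ge0 => //; exact: powR_ge0.
  have := ler_wpM2l xr0 (ler_wpM2r h0 I).
  move=> /le_trans; apply; rewrite mulrDl mulrDr; apply: lerD.
    by rewrite le_eqVlt; apply/orP; left; apply/eqP; ring.
  rewrite [leRHS](_ : _ = xi r * (e * A `^ (2 * p - 1) * g r `^ 2^-1 * (4 * H))); last by ring.
  rewrite ler_wpM2l// ler_wpM2l// mulr_ge0 ?powR_ge0//.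
rewrite IuD; last 2 first.
- by apply: continuousMf; [exact: cont_cst|apply: continuousMf; [exact: kc|exact: hc]].
- by apply: continuousMf; [exact: cont_cst|exact: wc].
rewrite IuZ; last by apply: continuousMf; [exact: kc|exact: hc].
rewrite IuZ; last exact: wc.
apply: lerD; first exact: ler_wpM2l.
rewrite [leRHS](_ : _ = e * A `^ (2 * p - 1) * (4 * H) * J); last by ring.
by apply: ler_wpM2l; [apply: mulr_ge0 => //; exact: mulr_ge0|exact: HJ].
Qed.

End Weight.

(** * Decay of one mode *)

Lemma sqrB_le4 (R : realType) (x y B : R) :
  x ^+ 2 <= B -> y ^+ 2 <= B -> (x - y) ^+ 2 <= 4 * B.
Proof. by have := sqr_ge0 (x + y); lra. Qed.

Lemma absorb_velocity (R : realType) (Cl Cv B P1 P2 X G dF c E : R) :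
  0 <= Cl -> 0 <= Cv -> 0 <= P1 -> 0 <= P2 -> 0 <= X -> 0 <= G ->
  dF <= - c * E + Cl * (B + P1 + X) -> B <= Cv * (P2 + X + G) ->
  dF <= - c * E + Cl * (1 + Cv) * (P1 + P2 + X + G).
Proof.
move=> Cl0 Cv0 P10 P20 X0 G0 h hB; apply: (le_trans h).
have n0 : Cl * B <= Cl * (Cv * (P2 + X + G)) by exact: ler_wpM2l.
have n2 : 0 <= Cl * (P2 + G) by apply: mulr_ge0 => //; exact: addr_ge0.
have n3 : 0 <= Cl * (Cv * P1) by apply: mulr_ge0 => //; exact: mulr_ge0.
lra.
Qed.

Lemma absorb_dissipation (R : realType) (w b Cm Ce d X Y G : R) :
  0 <= w -> 0 <= b -> 0 <= Cm -> 0 <= Ce -> 0 <= d -> 0 <= X -> 0 <= Y -> 0 <= G ->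
  w * b * Cm * (X + d * G) + Cm * (Ce * (X + Y)) <=
  (Cm * Ce + w * Cm * (1 + d)) * (1 + b) * (X + Y + G).
Proof.
move=> *; rewrite -subr_ge0 [leRHS](_ : _ = Cm * Ce * G + Cm * Ce * b * (X + Y + G)
  + w * Cm * (1 + d) * (X + Y + G) + w * Cm * b * (Y + G + d * (X + Y))); last by ring.
by pos.
Qed.

Lemma absorb_memory (R : realType) (w w0 c E E' dF Cm Ce P1 P2 X Y G m : R) :
  0 <= w -> w <= w0 -> 0 <= c -> E' <= E -> 0 <= Cm -> 0 <= X -> 0 <= G ->
  dF <= - c * E + Cm * (P1 + P2 + X + G) ->
  w * P1 <= Ce * X + m -> w * P2 <= Ce * Y + m ->
  w * dF <= - c * w * E' + Cm * (Ce * (X + Y) + 2 * m) + w0 * Cm * (X + G).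
Proof.
move=> w0p ww c0 EE Cm0 X0 G0 h i1 i2; apply: (le_trans (ler_wpM2l w0p h)).
have h2 : c * w * E' <= c * w * E by apply: ler_wpM2l => //; exact: mulr_ge0.
have h3 := ler_wpM2l Cm0 (lerD i1 i2).
have h4 : w * (Cm * (X + G)) <= w0 * (Cm * (X + G)).
  by apply: ler_wpM2r => //; apply: mulr_ge0 => //; exact: addr_ge0.
lra.
Qed.

Lemma shift_norm_bound (R : realType) (x y c : R) :
  `|x| <= c * y -> 0 <= x + c * y <= 2 * c * y.
Proof. by rewrite ler_norml => /andP[? ?]; apply/andP; split; lra. Qed.

Lemma telescope_bound (R : realType) (a a' b b' z z' d d' y i i' x1 x2 x3 x4 N M : R) :
  a' + b' + z' - d' + y * i' <= a + b + z - d + y * i ->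
  a <= x1 * N * M -> b <= x2 * N * M -> z <= x3 * N * M -> d' <= x4 * N * M ->
  0 <= a' -> 0 <= b' -> 0 <= z' -> 0 <= d ->
  y * (i' - i) <= (x1 + x2 + x3 + x4) * N * M.
Proof. move=> *; lra. Qed.

Lemma double_le_of_half (R : realType) (d X : R) : d <= - 2^-1 * X -> 2 * d <= - X.
Proof. lra. Qed.

Section ModeDecay.
Variable R : realType.
Variables (r1 r2 k k2 l mu kap : R) (g g1 : R -> R).
Hypotheses (r1p : 0 < r1) (r2p : 0 < r2) (kp : 0 < k) (k2p : 0 < k2) (lp : 0 < l)
  (mup : 0 < mu) (kapp : 0 < kap) (lmu : l <= mu / 2) (kg : kernel g g1)
  (gkap : forall t : R, 0 <= t -> kap <= k2 - Iu g t).

Notation En := (En r1 r2 k k2 l).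
Notation lyap := (lyap r1 r2 k k2 l).
Notation modesol := (modesol r1 r2 k k2 l).

Let gc : continuous g. Proof. by case: kg. Qed.
Let gpos (t : R) : 0 <= g t. Proof. by case: kg. Qed.

(** Of the terms that remain on the right, the last one is dissipation; the
    velocity and the memory are dealt with by [velocity_bound] and
    [mem2_interpolation]. *)
Lemma lyap_derive : exists al1 al2 al3 c C : R, [/\ 0 < c, 0 <= C &
  forall lam a0 a1 a2 b0 b1 b2 c0 c1 c2,
  mu <= lam -> modesol lam g a0 a1 a2 b0 b1 b2 c0 c1 c2 -> forall t : R, 0 < t ->
  exists2 dF, is_derive t 1 (lyap lam g al1 al2 al3 a0 a1 b0 b1 c0 c1) dF &
  dF <= - c * En lam g a0 a1 b0 b1 c0 c1 t +
    C * ((lam * b1 t) ^+ 2 + lam ^+ 2 * mem2 g b0 t + lam ^+ 2 * dis2 g b0 b1 t)].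
Proof.
have r1' := r1p; have k2' := k2p; have mu' := mup.
have i0p : 0 < i0 mu by rewrite /i0 invr_gt0.
have [al1 [al2 [al3 [C [_ _ _ C0 H]]]]] := lyapunov_algebra r1p r2p kp k2p lp kapp (gpos 0) i0p.
have [C2 C20 H2] := En_le_full l r1p r2p kp k2p kapp kg gkap.
pose C2' := C2 + 1; have C2'p : 0 < C2' by rewrite /C2'; lra.
have g0p := gpos 0.
exists al1, al2, al3, (r1 / 4 / C2'), (r1 / 4 * (i0 mu ^+ 2 + 1) + C * (1 + k2 + g 0)).
split.
- by rewrite !divr_gt0.
- by apply: addr_ge0; apply: mulr_ge0 => //; [lra|rewrite addr_ge0 ?sqr_ge0|rewrite !addr_ge0// ltW].
move=> lam a0 a1 a2 b0 b1 b2 c0 c1 c2 ml sol t t0.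
have [lam0 ii pp rr lm0] := freq_bounds lp mup lmu ml.
have lp0 : 0 < lam + l by rewrite addr_gt0.
case: (sol) => [[Ca Ca'] [Cb Cb'] [Cc Cc'] eqs].
have [ea eb ec] := eqs t t0.
case: (Ca) (Ca') (Cb) (Cb') (Cc) (Cc') => [_ _ da] [_ _ da'] [_ _ db] [_ _ db'] [_ _ dc] [_ _ dc'].
have dd := is_derive_lyap kg al1 al2 al3 t0 (lt0r_neq0 r1p) (lt0r_neq0 kp) (lt0r_neq0 lam0)
  (lt0r_neq0 lp0) (lt0r_neq0 lm0) Cb (da t t0) (da' t t0) (db' t t0) (dc t t0) (dc' t t0) ea eb ec.
eexists; first exact: dd.
have kk1 := gkap (ltW t0); have G0 := Iu_kernel_ge0 kg t.
have kkb : kap <= k2 - Iu g t <= k2 by rewrite kk1 lerBlDr lerDl.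
have gb : 0 <= g t <= g 0 by rewrite gpos (kernel_mono kg (lexx 0) (ltW t0)).
apply: (le_trans (H _ _ _ _ _ _ _ _ _ _ _ _ _ ii pp rr kkb gb)).
have F := H2 lam a0 a1 b0 b1 c0 c1 t Cb (ltW t0).
have q0 := mem2_ge0 kg Cb t.
have d0 := dis2_ge0 kg Cb (ltW t0).
have m1 := mem1_sqr kg Cb t; have x1 := dis1_sqr kg Cb (ltW t0).
have l2 : 0 <= lam ^+ 2 by exact: sqr_ge0.
have Q0 : 0 <= lam ^+ 2 * mem2 g b0 t by rewrite mulr_ge0.
have D0 : 0 <= lam ^+ 2 * dis2 g b0 b1 t by rewrite mulr_ge0.
have mm : (lam * mem1 g b0 t) ^+ 2 <= k2 * (lam ^+ 2 * mem2 g b0 t).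
  rewrite exprMn [leRHS]mulrCA ler_wpM2l// (le_trans m1)// ler_wpM2r//.
  by have := kapp; lra.
have xx : (lam * dis1 g b0 b1 t) ^+ 2 <= g 0 * (lam ^+ 2 * dis2 g b0 b1 t).
  by rewrite exprMn [leRHS]mulrCA ler_wpM2l.
have b1b : b1 t ^+ 2 <= i0 mu ^+ 2 * (lam * b1 t) ^+ 2.
  have /andP[i1 i2] := ii.
  have -> : b1 t ^+ 2 = lam^-1 ^+ 2 * (lam * b1 t) ^+ 2.
    by rewrite -exprMn mulrA mulVf ?mul1r// lt0r_neq0.
  by rewrite ler_wpM2r ?sqr_ge0// ler_pXn2r ?nnegrE// (le_trans i1).
set X := a1 t ^+ 2 + _ + _ + _ + _.
have FX : full l g lam a0 a1 b0 b1 c0 c1 t = X + b1 t ^+ 2 + lam ^+ 2 * mem2 g b0 t.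
  by rewrite /full /X; ring.
have f0 := full_ge0 l kg lam a0 a1 c0 c1 t Cb.
have hE : En lam g a0 a1 b0 b1 c0 c1 t / C2' <= full l g lam a0 a1 b0 b1 c0 c1 t.
  rewrite ler_pdivrMr// mulrC; apply: (le_trans F); rewrite ler_wpM2r// /C2'; lra.
move: hE; rewrite FX => hE.
set E := En lam g a0 a1 b0 b1 c0 c1 t in hE *.
rewrite [leRHS](_ : _ = - (r1 / 4) * (E / C2') +
  (r1 / 4 * (i0 mu ^+ 2 + 1) + C * (1 + k2 + g 0)) *
  ((lam * b1 t) ^+ 2 + lam ^+ 2 * mem2 g b0 t + lam ^+ 2 * dis2 g b0 b1 t)); last by ring.
set Y := E / C2' in hE *.
set Q := lam ^+ 2 * mem2 g b0 t in Q0 mm hE *; set D := lam ^+ 2 * dis2 g b0 b1 t in D0 xx *.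
set B := (lam * b1 t) ^+ 2 in b1b *.
have B0 : 0 <= B by exact: sqr_ge0.
set M := (lam * mem1 g b0 t) ^+ 2 in mm *; set N := (lam * dis1 g b0 b1 t) ^+ 2 in xx *.
set I := i0 mu ^+ 2 in b1b *.
have I0 : 0 <= I by exact: sqr_ge0.
have r4 : 0 <= r1 / 4 by lra.
have h1 : r1 / 4 * Y <= r1 / 4 * (X + I * B + Q) by rewrite ler_wpM2l//; lra.
have h2 : C * (B + M + N) <= C * (B + k2 * Q + g 0 * D) by rewrite ler_wpM2l//; lra.
have P1 : 0 <= (r1 / 4 * I) * (Q + D) by apply: mulr_ge0; [exact: mulr_ge0|exact: addr_ge0].
have P2 : 0 <= r1 / 4 * (B + D) by apply: mulr_ge0 => //; exact: addr_ge0.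
have P3 : 0 <= C * (k2 * (B + D) + g 0 * (B + Q) + Q + D).
  have k20 := ltW k2'.
  apply: mulr_ge0 => //; apply: addr_ge0 => //; apply: addr_ge0 => //.
  by apply: addr_ge0; apply: mulr_ge0 => //; exact: addr_ge0.
move: h1 h2 P1 P2 P3; clearbody X Y Q D B M N I E; move=> *; lra.
Qed.

(** The velocity of the memory variable is recovered from the memory of the
    differentiated variable: averaging [b1 t - b1 (t - s)] against [g] leaves a
    convolution in which the time derivative can be moved onto the kernel. *)
Lemma velocity_bound (t0 : R) : 0 < Iu g t0 -> 0 <= t0 -> exists2 C, 0 <= C &
  forall b0 b1 b2 : R -> R, C1half b0 b1 -> C1half b1 b2 -> forall t : R, t0 <= t ->
  b1 t ^+ 2 <= C * (mem2 g b1 t + dis2 g b0 b1 t + g t * (b0 t - b0 0) ^+ 2).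
Proof.
move=> G0 t00; have k2' := k2p; have g0p := gpos 0.
pose C := 3 * (k2 + g 0) / Iu g t0 ^+ 2.
exists C.
  rewrite /C; apply: mulr_ge0; first by apply: mulr_ge0 => //; lra.
  by rewrite invr_ge0 sqr_ge0.
move=> b0 b1 b2 Cb Cb' t t0t.
have tpos : 0 <= t by exact: le_trans t0t.
have E : Iu g t * b1 t = mem1 g b1 t + dis1 g b0 b1 t + g t * (b0 t - b0 0).
  by rewrite /mem1 /dis1; ring.
have GG : Iu g t0 <= Iu g t by exact: (Iu_kernel_mono kg t00 t0t).
have Gk : Iu g t <= k2 by have := gkap tpos; have := kapp; lra.
have m1 := mem1_sqr kg Cb' t; have x1 := dis1_sqr kg Cb tpos.
have gb : g t <= g 0 := kernel_mono kg (lexx 0) tpos.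
have gt0 := gpos t.
have Q0 := mem2_ge0 kg Cb' t; have D0 := dis2_ge0 kg Cb tpos.
rewrite /C [leRHS](_ : _ = (3 * (k2 + g 0) * (mem2 g b1 t + dis2 g b0 b1 t + g t * (b0 t - b0 0) ^+ 2)) / Iu g t0 ^+ 2); last by ring.
rewrite ler_pdivlMr ?exprn_gt0//.
apply: (@le_trans _ _ ((Iu g t * b1 t) ^+ 2)).
  rewrite exprMn mulrC ler_wpM2r ?sqr_ge0// ler_pXn2r ?nnegrE ?(ltW G0)//.
  exact: le_trans (ltW G0) GG.
rewrite E.
have b0t : 0 <= (b0 t - b0 0) ^+ 2 by exact: sqr_ge0.
have w1 : (g t * (b0 t - b0 0)) ^+ 2 <= g 0 * (g t * (b0 t - b0 0) ^+ 2).
  by rewrite exprMn expr2 -mulrA ler_wpM2r// mulr_ge0.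
have w0 : 0 <= g t * (b0 t - b0 0) ^+ 2 by rewrite mulr_ge0.
have m1' : mem1 g b1 t ^+ 2 <= k2 * mem2 g b1 t by apply: (le_trans m1); rewrite ler_wpM2r.
have S := @sum3_sqr_le _ 1 1 1 1 (mem1 g b1 t) (dis1 g b0 b1 t) (g t * (b0 t - b0 0)).
have n1 : `|1 : R| <= 1 by rewrite normr1.
have {}S := S n1 n1 n1; rewrite !mul1r expr1n mulr1 in S.
apply: (le_trans S).
set q := mem2 g b1 t in Q0 m1' *; set d := dis2 g b0 b1 t in D0 x1 *; set w := g t * _ ^+ 2 in w0 w1 *.
have P1 : 0 <= k2 * d by rewrite mulr_ge0// ltW.
have P2 : 0 <= k2 * w by rewrite mulr_ge0// ltW.
have P3 : 0 <= g 0 * q by rewrite mulr_ge0.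
set u := mem1 g b1 t ^+ 2 in m1' *; set v := dis1 g b0 b1 t ^+ 2 in x1 *; set z := (g t * _) ^+ 2 in w1 *.
move: m1' x1 w1 P1 P2 P3; clearbody q d w u v z; move=> *; lra.
Qed.

Variables (xi xi1 : R -> R) (p : R).
Hypotheses (xic : continuous xi) (xi0 : forall t, 0 < xi t)
  (xid : forall t : R, 0 < t -> is_derive t 1 xi (xi1 t))
  (xi1le : forall t : R, 0 < t -> xi1 t <= 0)
  (p1 : 1 <= p) (p2 : p < 3 / 2)
  (gxi : forall t : R, 0 < t -> xi t * g t `^ p <= - g1 t).

Definition wgt (t : R) := xi t `^ (2 * p - 1).

Lemma wgt_derive (t : R) : 0 < t -> exists2 d, is_derive t 1 wgt d & d <= 0.
Proof.
move=> t0; have p1' := p1.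
have d := der_comp (f := fun x => x `^ (2 * p - 1)) (is_derive1_powR (2 * p - 1) (xi0 t)) (xid t0).
eexists; first exact: d.
apply: mulr_ge0_le0; last exact: xi1le.
by rewrite mulr_ge0 ?powR_ge0//; lra.
Qed.

Lemma continuous_wgt : continuous wgt.
Proof.
have p1' := p1; apply: continuous_powR_nneg => //; first by lra.
by move=> t; exact: ltW.
Qed.

(** The functional [V] below decreases: its derivative collects the inequality
    for [lyap], weighted by [xi^(2p-1) e^(2p-2)], and pays for the two memory
    terms with the dissipation of first and second order. The final energy
    [E T] enters through the monotonicity of [E], so that the integral of the
    weight appears without integrating [E]. The number [e] is a parameter,
    because it has to be the same for all modes. *)
Theorem mode_decay (t0 : R) : 0 < t0 -> 0 < Iu g t0 -> forall eps : R, 0 < eps ->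
  exists2 C : R, 0 <= C & forall lam a0 a1 a2 b0 b1 b2 c0 c1 c2,
  mu <= lam -> modesol lam g a0 a1 a2 b0 b1 b2 c0 c1 c2 -> forall e T : R, 0 < e -> t0 <= T ->
  e `^ (2 * p - 2) * En lam g a0 a1 b0 b1 c0 c1 T * (Iu wgt T - Iu wgt t0) <=
  C * (1 + e `^ (2 * p - 2)) * data lam a0 a1 b0 b1 c0 c1 +
  eps * e `^ (2 * p - 1) * (Iu wgt T - Iu wgt t0) * data lam a0 a1 b0 b1 c0 c1.
Proof.
move=> t00 G0 eps eps0.
have p1' := p1; have q1p : 0 < 2 * p - 1 by lra.
have r2' := r2p; have k2' := k2p.
have [al1 [al2 [al3 [c [Cl [c0' Cl0 Hl]]]]]] := lyap_derive.
have [CF CF0 HF] := lyap_le_En r1p r2p kp k2p lp mup kapp lmu kg gkap al1 al2 al3.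
have [Cb Cb0 HB] := mode_bounds r1p r2p kp k2p lp mup kapp lmu kg gkap.
have [Cv Cv0 HV] := velocity_bound G0 (ltW t00).
have [Ci Ci0 HI] := mem2_interpolation kg xic xi0 xid xi1le p1 p2 gxi.
pose c7 := 2^-1 * expR (- (gam r2 * k2)); have c7p : 0 < c7 by rewrite mulr_gt0 ?expR_gt0.
(* Cm bounds the weight of both memory terms once the velocity is eliminated *)
pose Cm := Cl * (1 + Cv).
have Cm0 : 0 <= Cm by rewrite mulr_ge0// addr_ge0.
pose D := Cm * (Ci * Cb) * 2 + 1.
have D0 : 0 < D by rewrite /D ltr_wpDl//; pos.
pose e' := c * eps / D; have e'p : 0 < e' by rewrite divr_gt0 ?mulr_gt0.
pose Ce := e' `^ (2 - 2 * p); have Ce0 : 0 <= Ce by exact: powR_ge0.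
pose w0 := wgt 0; have w00 : 0 <= w0 by exact: powR_ge0.
(* the total weights of the two dissipation terms and of g *)
pose C6 := Cm * Ce + w0 * Cm * (1 + 4 * Cb).
have C60 : 0 <= C6 by rewrite addr_ge0 ?mulr_ge0// addr_ge0 ?mulr_ge0.
pose C8 := w0 * (2 * CF * Cb) + 2 * C6 * Cb + C6 / c7 * Cb + C6 * k2.
have C80 : 0 <= C8 by rewrite /C8 !addr_ge0 ?mulr_ge0 ?invr_ge0 ?(ltW c7p) ?(ltW k2p).
exists (C8 / c); first by rewrite mulr_ge0// invr_ge0 ltW.
move=> lam a0 a1 a2 b0 b1 b2 c0 c1 c2 ml sol e T e0 t0T.
set K := data lam a0 a1 b0 b1 c0 c1; set I := Iu wgt T - Iu wgt t0.
have [[Ca Ca'] [CbC CbC'] [Cc Cc']] := sol_C1 sol.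
pose b := e `^ (2 * p - 2); have b_ge0 : 0 <= b by exact: powR_ge0.
pose E := En lam g a0 a1 b0 b1 c0 c1.
pose F := lyap lam g al1 al2 al3 a0 a1 b0 b1 c0 c1.
pose Z := Zf r1 r2 k k2 l g lam a0 a1 a2 b0 b1 b2 c0 c1 c2.
pose V t := wgt t * b * (F t + CF * E t) + 2 * (C6 * (1 + b)) * E t
  + C6 * (1 + b) / c7 * Z t - C6 * (1 + b) * K * Iu g t
  + (c * b * E T - c * eps * e `^ (2 * p - 1) * K) * Iu wgt t.
have K0 : 0 <= K by exact: data_ge0.
have Ec : continuous E := continuous_E0 kg sol.
have Fc : continuous F.
  by case: Ca Ca' Cc Cc' => [? ? _] [_ ? _] [? ? _] [_ ? _]; apply: (continuous_lyap kg).
have Zc : continuous Z := continuous_Zf kg sol.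
have wc := continuous_wgt; have Gc := continuous_Iu gc; have Wc := continuous_Iu wc.
have Vc : continuous V by rewrite /V; ctn.
have EpN (s : R) : 0 <= s -> 0 <= E s := En_ge0 l r1p r2p kp kapp kg gkap lam a0 a1 c0 c1 CbC.
have bnd (s : R) : 0 <= s -> _ := fun s0 => HB _ _ _ _ _ _ _ _ _ _ ml sol s s0.
have FE (s : R) : 0 <= s -> 0 <= F s + CF * E s <= 2 * CF * E s.
  move=> s0; have := HF lam a0 a1 b0 b1 c0 c1 s ml CbC s0.
  exact: shift_norm_bound.
have C6b : 0 <= C6 * (1 + b) by rewrite mulr_ge0// addr_ge0.
have TP : 0 <= T by apply: le_trans t0T; exact: ltW.
have VT : V T <= V t0.
  apply: (@derive_le0_le_ex _ V t0 T t0T Vc) => t /andP[t0t tT].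
  have tp : 0 < t by exact: lt_trans t0t.
  have tp' := ltW tp.
  have [dF dFd dFle] := Hl _ _ _ _ _ _ _ _ _ _ ml sol t tp.
  have [dw dwd dwle] := wgt_derive tp.
  have dE := is_derive_E0 kg sol tp.
  have [dZ dZd dZle] := Zf_derive r1p r2p kp kapp kg gkap sol tp.
  have dG := is_derive_Iu gc tp; have dW := is_derive_Iu wc tp.
  eexists.
    by rewrite /V; eapply derD; [eapply derD; [eapply derD; [eapply derD; [
      eapply derM; [eapply derM; [exact: dwd|exact: der_cst]|
        eapply derD; [exact: dFd|eapply derM; [exact: der_cst|exact: dE]]]
     |eapply derM; [exact: der_cst|exact: dE]]
     |eapply derM; [exact: der_cst|exact: dZd]]
     |eapply derN; eapply derM; [exact: der_cst|exact: dG]]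
     |eapply derM; [exact: der_cst|exact: dW]].
  rewrite -/E -/F -/Z in dFle dZle *.
  set dEt := - 2^-1 * _.
  have /andP[dE1 dE2] := dE0_le0 kg sol tp'.
  rewrite -/dEt in dE1.
  have [_ _ Bb0 Bb1 _] := bnd t tp'; rewrite -/K in Bb0 Bb1.
  set X := lam ^+ 2 * dis2 g b0 b1 t in dFle dE1 dE2 *.
  pose Y := lam ^+ 2 * dis2 g b1 b2 t; rewrite -/Y in dZle.
  have l2 : 0 <= lam ^+ 2 by exact: sqr_ge0.
  have X0 : 0 <= X by apply: mulr_ge0 => //; exact: (dis2_ge0 kg CbC tp').
  have Y0 : 0 <= Y by apply: mulr_ge0 => //; exact: (dis2_ge0 kg CbC' tp').
  pose P1 := lam ^+ 2 * mem2 g b0 t; pose P2 := lam ^+ 2 * mem2 g b1 t.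
  have P10 : 0 <= P1 by apply: mulr_ge0 => //; exact: (mem2_ge0 kg CbC).
  have P20 : 0 <= P2 by apply: mulr_ge0 => //; exact: (mem2_ge0 kg CbC').
  have A0 : 0 <= xi t * e by rewrite mulr_ge0// ltW.
  have wb : xi t * (xi t * e) `^ (2 * p - 2) = wgt t * b.
    rewrite powRM ?(ltW e0) ?(ltW (xi0 t))// /b mulrA; congr (_ * _).
    rewrite (_ : 2 * p - 2 = 2 * p - 1 - 1); last by ring.
    by apply: mulr_powRB1 => //; exact: ltW.
  have wq : (xi t * e) `^ (2 * p - 1) = wgt t * e `^ (2 * p - 1).
    by rewrite powRM ?(ltW e0) ?(ltW (xi0 t)).
  have scale (f f1 : R -> R) : C1half f f1 -> (forall s : R, 0 <= s -> (lam * f s) ^+ 2 <= Cb * K) ->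
     wgt t * b * (lam ^+ 2 * mem2 g f t) <= Ce * (lam ^+ 2 * dis2 g f f1 t) + e' * (wgt t * e `^ (2 * p - 1)) * (Ci * (Cb * K)).
    move=> Cf fb; have lam0 : 0 < lam by exact: lt_le_trans ml.
    have l20 : 0 < lam ^+ 2 by rewrite exprn_gt0.
    have := HI e' (xi t * e) (Cb * K / lam ^+ 2) t f f1 e'p A0 Cf tp'.
    rewrite wb wq -/Ce => H.
    have sb (s : R) : 0 <= s <= t -> f s ^+ 2 <= Cb * K / lam ^+ 2.
      by move=> /andP[s0 _]; rewrite ler_pdivlMr// mulrC -exprMn; exact: fb.
    have {}H := ler_wpM2l l2 (H sb).
    rewrite [leLHS](_ : _ = lam ^+ 2 * (wgt t * b * mem2 g f t)); last by ring.
    apply: (le_trans H); rewrite le_eqVlt; apply/orP; left; apply/eqP.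
    by field; rewrite lt0r_neq0.
  have I1 := scale b0 b1 CbC (fun s s0 => let: And5 _ _ h _ _ := bnd s s0 in h).
  have I2 := scale b1 b2 CbC' (fun s s0 => let: And5 _ _ _ h _ := bnd s s0 in h).
  rewrite -/P1 -/X in I1; rewrite -/P2 -/Y in I2.
  have vel : (lam * b1 t) ^+ 2 <= Cv * (P2 + X + g t * (4 * Cb * K)).
    rewrite exprMn; have h := ler_wpM2l l2 (HV b0 b1 b2 CbC CbC' t (ltW t0t)).
    apply: (le_trans h); rewrite [leLHS](_ : _ = Cv * (P2 + X + g t * (lam ^+ 2 * (b0 t - b0 0) ^+ 2))); last first.
      by rewrite /P2 /X; ring.
    apply: ler_wpM2l => //; rewrite lerD2l; apply: ler_wpM2l => //.
    have [_ _ h0 _ _] := bnd 0 (lexx 0); rewrite -/K in h0.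
    rewrite (_ : lam ^+ 2 * (b0 t - b0 0) ^+ 2 = (lam * b0 t - lam * b0 0) ^+ 2); last by ring.
    by rewrite -mulrA; exact: sqrB_le4.
  rewrite -/P1 in dFle.
  clearbody X P1 P2 Y dEt.
  have wt0 : 0 <= wgt t by exact: powR_ge0.
  have wtw0 : wgt t <= w0.
    apply: (@derive_le0_le_ex _ wgt 0 t tp' wc) => x /andP[x0 _]; exact: wgt_derive.
  have wbp : 0 <= wgt t * b by rewrite mulr_ge0.
  have Etp := EpN t tp'.
  have ETt : E T <= E t by apply: (E0_mono kg sol tp'); exact: ltW.
  have /andP[FE1 FE2] := FE t tp'.
  have gt0 := gpos t.
  (* derivative of the Lyapunov functional, velocity eliminated *)
  have S1 : dF <= - c * E t + Cm * (P1 + P2 + X + g t * (4 * Cb * K)).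
    by apply: absorb_velocity dFle vel => //; rewrite !mulr_ge0.
  have S2 : wgt t * b * dF <= - c * (wgt t * b) * E T
     + Cm * (Ce * (X + Y) + (2 * (Ci * Cb)) * e' * (wgt t * e `^ (2 * p - 1)) * K)
     + w0 * b * Cm * (X + g t * (4 * Cb * K)).
    rewrite [leRHS](_ : _ = - c * (wgt t * b) * E T
      + Cm * (Ce * (X + Y) + 2 * (e' * (wgt t * e `^ (2 * p - 1)) * (Ci * (Cb * K))))
      + w0 * b * Cm * (X + g t * (4 * Cb * K))); last by ring.
    apply: absorb_memory S1 I1 I2 => //; [exact: ler_wpM2r|exact: ltW|pos].
  have S3 : w0 * b * Cm * (X + g t * (4 * Cb * K)) + Cm * (Ce * (X + Y)) <=
     C6 * (1 + b) * (X + Y + g t * K).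
    rewrite (_ : g t * (4 * Cb * K) = 4 * Cb * (g t * K)); last by ring.
    by apply: absorb_dissipation => //; pos.
  have S4 : Cm * ((2 * (Ci * Cb)) * e' * (wgt t * e `^ (2 * p - 1)) * K) <= c * eps * e `^ (2 * p - 1) * K * wgt t.
    rewrite [leLHS](_ : _ = (Cm * (Ci * Cb) * 2) * e' * (e `^ (2 * p - 1) * K * wgt t)); last by ring.
    rewrite [leRHS](_ : _ = c * eps * (e `^ (2 * p - 1) * K * wgt t)); last by ring.
    apply: ler_wpM2r; first by rewrite !mulr_ge0// powR_ge0.
    have -> : c * eps = D * e' by rewrite /e' [RHS]mulrC divfK// lt0r_neq0.
    by rewrite ler_wpM2r ?(ltW e'p)// /D lerDl.
  have S5 : dw * b * (F t + CF * E t) <= 0 by rewrite mulr_le0_ge0// mulr_le0_ge0.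
  have S6 : wgt t * b * (CF * dEt) <= 0.
    by rewrite mulr_ge0_le0// mulr_ge0_le0//; exact: le_trans dE1 dE2.
  have S7 : C6 * (1 + b) * (2 * dEt) <= - (C6 * (1 + b) * X).
    by rewrite -mulrN; apply: ler_wpM2l; [pos|exact: double_le_of_half].
  have S8 : C6 * (1 + b) / c7 * dZ <= - (C6 * (1 + b) * Y).
    rewrite [leRHS](_ : _ = C6 * (1 + b) / c7 * (- c7 * Y)); last by field; rewrite lt0r_neq0.
    by apply: ler_wpM2l => //; apply: mulr_ge0 => //; rewrite invr_ge0 ltW.
  move: S2 S3 S4 S5 S6 S7 S8; set B := C6 * (1 + b) => S2 S3 S4 S5 S6 S7 S8.
  rewrite ?(mul0r, add0r, mulr0, addr0).
  set q := e `^ (2 * p - 1) in S2 S4 *.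
  lra.
have [V1 V2 _ _ _] := bnd t0 (ltW t00); rewrite -/E -/Z -/K in V1 V2.
have [W1 W2 _ _ _] := bnd T TP.
have ZT : 0 <= Z T := Zf_ge0 r1p r2p kp kapp kg gkap sol TP.
have GT2 : Iu g T <= k2.
  by rewrite -subr_ge0; apply: le_trans (gkap TP); exact: ltW.
have Gt0 := Iu_kernel_ge0 kg t0.
have /andP[FE1 FE2] := FE t0 (ltW t00); have /andP[FT1 FT2] := FE T TP.
have wtw0 : wgt t0 <= w0.
  by apply: (@derive_le0_le_ex _ wgt 0 t0 (ltW t00) wc) => x /andP[x0 _]; exact: wgt_derive.
have ET := EpN T TP.
have u1 : wgt t0 * b * (F t0 + CF * E t0) <= w0 * (2 * CF * Cb) * (1 + b) * K.
  apply: (@le_trans _ _ (w0 * b * (2 * CF * (Cb * K)))).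
    apply: ler_pM => //; first by rewrite mulr_ge0// powR_ge0.
      by rewrite ler_wpM2r.
    by apply: (le_trans FE2); rewrite ler_wpM2l// mulr_ge0.
  rewrite [leRHS](_ : _ = w0 * (2 * CF * Cb) * K + w0 * b * (2 * CF * (Cb * K))); last by ring.
  by rewrite lerDr; apply: mulr_ge0 => //; pos.
have u2 : 0 <= wgt T * b * (F T + CF * E T).
  by apply: mulr_ge0 => //; apply: mulr_ge0 => //; exact: powR_ge0.
have u3 : 2 * (C6 * (1 + b)) * E t0 <= 2 * C6 * Cb * (1 + b) * K.
  rewrite [leRHS](_ : _ = 2 * (C6 * (1 + b)) * (Cb * K)); last by ring.
  exact: (ler_wpM2l (mulr_ge0 (ler0n _ 2) C6b) V1).
have u4 : 0 <= 2 * (C6 * (1 + b)) * E T := mulr_ge0 (mulr_ge0 (ler0n _ 2) C6b) ET.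
have c7i : 0 <= c7^-1 by rewrite invr_ge0 ltW.
have u5 : C6 * (1 + b) / c7 * Z t0 <= C6 / c7 * Cb * (1 + b) * K.
  rewrite [leRHS](_ : _ = C6 * (1 + b) / c7 * (Cb * K)); last by ring.
  exact: (ler_wpM2l (mulr_ge0 C6b c7i) V2).
have u6 : 0 <= C6 * (1 + b) / c7 * Z T := mulr_ge0 (mulr_ge0 C6b c7i) ZT.
have u7 : C6 * (1 + b) * K * Iu g T <= C6 * k2 * (1 + b) * K.
  rewrite [leRHS](_ : _ = C6 * (1 + b) * K * k2); last by ring.
  exact: (ler_wpM2l (mulr_ge0 C6b K0) GT2).
have u8 : 0 <= C6 * (1 + b) * K * Iu g t0 := mulr_ge0 (mulr_ge0 C6b K0) Gt0.
have main : (c * b * E T - c * eps * e `^ (2 * p - 1) * K) * I <= C8 * (1 + b) * K.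
  exact: (telescope_bound VT u1 u3 u5 u7 u2 u4 u6 u8).
rewrite -/E -/b [leRHS](_ : _ = (C8 * (1 + b) * K + c * eps * e `^ (2 * p - 1) * K * I) / c); last first.
  by field; rewrite lt0r_neq0.
rewrite ler_pdivlMr; last exact: c0'.
rewrite -lerBlDr; apply: le_trans main; rewrite le_eqVlt; apply/orP; left; apply/eqP.
by rewrite /E; ring.
Qed.

End ModeDecay.

(** * Square integrable functions on an interval *)

Section SquareIntegrable.
Variables (R : realType) (L : R).
Implicit Types (u v w f : R -> R) (c : R).
Notation mu := (@lebesgue_measure R).
Notation D := (`]0, L[%classic : set (measurableTypeR R)).
Notation L2 := (L2 L).

Let mD : measurable D. Proof. exact: measurable_itv. Qed.

Lemma ae_imp (P Q : R -> Prop) : (forall x, P x -> Q x) ->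
  {ae mu, forall x, P x} -> {ae mu, forall x, Q x}.
Proof. by move=> h; apply: filterS => //; exact: (ae_filter_ringOfSetsType mu). Qed.

Lemma ae_imp2 (P P' Q : R -> Prop) : (forall x, P x -> P' x -> Q x) ->
  {ae mu, forall x, P x} -> {ae mu, forall x, P' x} -> {ae mu, forall x, Q x}.
Proof. by move=> h; apply: filterS2 => //; exact: (ae_filter_ringOfSetsType mu). Qed.

Lemma L2P v : L2 v <-> measurable_fun D v /\ mu.-integrable D (EFin \o (fun x => v x ^+ 2)).
Proof.
have E : (fun x => (v \_ D) x ^+ 2) = (fun x => v x ^+ 2) \_ D.
  by apply/funext => x; rewrite !patchE; case: ifP => // _; rewrite expr0n.
split => [|[mv iv]].
- rewrite /L2 /= => h; move: (h) => /[!inE] /andP[/[!inE]/= mv _]; split.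
    by apply/(measurable_restrictT _ mD).
  have := Lfun2_integrable_sqr h; rewrite E => i.
  by rewrite -restrict_EFin in i; apply/(integrable_mkcond _ mD).
- rewrite /L2 /= inE; apply/andP; rewrite !inE /=; split.
    by apply/(measurable_restrictT _ mD).
  rewrite /finite_norm unlock /= poweR_lty//.
  move/(integrable_mkcond _ mD)/integrableP : iv => [_]; apply: le_lt_trans.
  rewrite le_eqVlt; apply/orP; left; apply/eqP; apply: eq_integral => x _ /=.
  rewrite !patchE; case: ifP => _ /=; rewrite ?normr0 ?powR0//.
  by rewrite powR_mulrn// normrX.
Qed.

Definition ip u v := \int[mu]_(x in D) (u x * v x).

Lemma L2_measurable v : L2 v -> measurable_fun D v. Proof. by move/L2P => []. Qed.

Lemma L2_mul_integrable u v : L2 u -> L2 v -> mu.-integrable D (EFin \o (fun x => u x * v x)).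
Proof.
move=> /L2P[mu2 iu] /L2P[mv iv].
apply: (@le_integrable _ _ _ mu _ mD _ _ _ _ (integrableD mD iu iv)).
  by apply/measurable_EFinP; exact: measurable_funM.
move=> x _ /=; rewrite lee_fin [leRHS]ger0_norm ?addr_ge0 ?sqr_ge0//.
have [a b] := (sqr_ge0 (u x + v x), sqr_ge0 (u x - v x)).
by rewrite ler_norml; apply/andP; split; have := (sqr_ge0 (u x), sqr_ge0 (v x)) => -[]; lra.
Qed.

Lemma L2D u v : L2 u -> L2 v -> L2 (fun x => u x + v x).
Proof.
move=> hu hv; have [mu2 iu] := (L2P u).1 hu; have [mv iv] := (L2P v).1 hv.
apply/L2P; split; first exact: measurable_funD.
have i := integrableD mD (integrableD mD iu iv)
  (integrableZl mD 2 (L2_mul_integrable hu hv)).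
by move: i; congr (_.-integrable _ _); apply/funext => x /=; congr EFin; ring.
Qed.

Lemma L2Z c u : L2 u -> L2 (fun x => c * u x).
Proof.
move=> /L2P[mu2 iu]; apply/L2P; split; first exact: measurable_funM.
have i := integrableZl mD (c ^+ 2) iu.
by move: i; congr (_.-integrable _ _); apply/funext => x /=; congr EFin; ring.
Qed.

Lemma L2N u : L2 u -> L2 (fun x => - u x).
Proof. by move=> /(L2Z (-1)); congr L2; apply/funext => x; ring. Qed.

Lemma L2B u v : L2 u -> L2 v -> L2 (fun x => u x - v x).
Proof. by move=> hu hv; apply: L2D => //; exact: L2N. Qed.

Lemma within_continuous_L2 u : {within `[0, L], continuous u} -> L2 u.
Proof.
move=> cu; apply/L2P; split.
  apply: (measurable_funS (E := `[0, L]%classic)) => //; first exact: subset_itv_oo_cc.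
  exact: subspace_continuous_measurable_fun.
apply: (@integrableS _ _ _ mu `[0, L]%classic) => //; first exact: subset_itv_oo_cc.
apply: continuous_compact_integrable; first exact: segment_compact.
by move=> x; exact: cvgM (cu x) (cu x).
Qed.

Lemma continuous_L2 u : continuous u -> L2 u.
Proof. by move=> cu; apply: within_continuous_L2; exact: continuous_subspaceT. Qed.

Lemma ipC u v : ip u v = ip v u.
Proof. by apply: eq_Rintegral => x _; rewrite mulrC. Qed.

Lemma ipDl u v w : L2 u -> L2 v -> L2 w -> ip (fun x => u x + v x) w = ip u w + ip v w.
Proof.
move=> hu hv hw; rewrite /ip -RintegralD//; do ?exact: L2_mul_integrable.
by apply: eq_Rintegral => x _; rewrite mulrDl.
Qed.

Lemma ipZl c u w : L2 u -> L2 w -> ip (fun x => c * u x) w = c * ip u w.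
Proof.
move=> hu hw; rewrite /ip -RintegralZl//; last exact: L2_mul_integrable.
by apply: eq_Rintegral => x _; rewrite mulrA.
Qed.

Lemma ipNl u w : L2 u -> L2 w -> ip (fun x => - u x) w = - ip u w.
Proof.
move=> hu hw; rewrite -mulN1r -ipZl//; congr ip; apply/funext => x; ring.
Qed.

Lemma ipBl u v w : L2 u -> L2 v -> L2 w -> ip (fun x => u x - v x) w = ip u w - ip v w.
Proof. by move=> hu hv hw; rewrite ipDl ?ipNl//; exact: L2N. Qed.

Lemma ipDr u v w : L2 u -> L2 v -> L2 w -> ip w (fun x => u x + v x) = ip w u + ip w v.
Proof. by move=> *; rewrite ipC ipDl// ![ip _ w]ipC. Qed.

Lemma ipZr c u w : L2 u -> L2 w -> ip w (fun x => c * u x) = c * ip w u.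
Proof. by move=> *; rewrite ipC ipZl// ipC. Qed.

Lemma ip_ge0 u : 0 <= ip u u.
Proof. by apply: Rintegral_ge0 => x _; rewrite -expr2 sqr_ge0. Qed.

Lemma eq_ip u v u' v' : (forall x : R, 0 < x < L -> u x = u' x) ->
  (forall x : R, 0 < x < L -> v x = v' x) -> ip u v = ip u' v'.
Proof.
move=> h h'; apply: eq_Rintegral => x; rewrite inE /= in_itv /= => xD.
by rewrite h// h'.
Qed.

Lemma cauchy_schwarz u v : L2 u -> L2 v -> ip u v ^+ 2 <= ip u u * ip v v.
Proof.
move=> hu hv; apply: quad_sqr_le => [|s]; first exact: ip_ge0.
have hs : L2 (fun x => - s * u x) by exact: L2Z.
have := ip_ge0 (fun x => v x + - s * u x).
have h : L2 (fun x => v x + - s * u x) by exact: L2D.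
rewrite ipDl// !ipDr// !ipZl// !ipZr// [ip v u]ipC.
by move=> ?; rewrite [leRHS](_ : _ = ip v v + - s * ip u v + (- s * ip u v + - s * (- s * ip u u)))//; ring.
Qed.

Lemma L2normE u : L2 u -> L2norm L u = (Num.sqrt (ip u u))%:E.
Proof.
move=> hu; rewrite /L2norm unlock /=.
have -> : (\int[mu]_x (`|(u \_ D) x| `^ 2)%:E = (ip u u)%:E)%E.
  rewrite /ip /Rintegral fineK; last exact/integrable_fin_num/L2_mul_integrable.
  rewrite [RHS]integral_mkcond; apply: eq_integral => x _ /=.
  rewrite !patchE; case: ifP => _; last by rewrite normr0 powR0.
  by rewrite powR_mulrn// -normrX ger0_norm ?sqr_ge0// expr2.
by rewrite poweR_EFin powR12_sqrt// ip_ge0.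
Qed.

Lemma ip_le_norm u v (e : R) : L2 u -> L2 v -> 0 <= e -> (L2norm L u <= e%:E)%E ->
  `|ip u v| <= e * Num.sqrt (ip v v).
Proof.
move=> hu hv e0; rewrite L2normE// lee_fin => h.
have := cauchy_schwarz hu hv; rewrite -ler_sqrt; last by rewrite mulr_ge0 ?ip_ge0.
rewrite sqrtr_sqr sqrtrM ?ip_ge0// => /le_trans; apply.
by rewrite ler_wpM2r// sqrtr_ge0.
Qed.

Lemma eqae_ip u v w : L2 u -> L2 v -> L2 w -> eqae L u v -> ip u w = ip v w.
Proof.
move=> hu hv hw h; congr fine; apply: ae_eq_integral => //.
- by apply/measurable_EFinP; apply: measurable_funM; exact: L2_measurable.
- by apply/measurable_EFinP; apply: measurable_funM; exact: L2_measurable.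
- by move: h; apply: ae_imp => x h Dx /=; rewrite h// inE.
Qed.

Lemma L2_sum (n : nat) (F : nat -> R -> R) : (forall i, L2 (F i)) ->
  L2 (fun x => \sum_(i < n) F i x).
Proof.
move=> h; elim: n => [|n ih].
  have -> : (fun x => \sum_(i < 0) F i x) = (fun=> 0) by apply/funext => x; rewrite big_ord0.
  by apply: continuous_L2; exact: cont_cst.
have -> : (fun x => \sum_(i < n.+1) F i x) = fun x => \sum_(i < n) F i x + F n x.
  by apply/funext => x; rewrite big_ord_recr.
exact: L2D.
Qed.

Lemma ip_suml (n : nat) (F : nat -> R -> R) w : (forall i, L2 (F i)) -> L2 w ->
  ip (fun x => \sum_(i < n) F i x) w = \sum_(i < n) ip (F i) w.
Proof.
move=> h hw; elim: n => [|n ih].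
  rewrite big_ord0 -[RHS](mul0r (ip w w)) -ipZl//; apply: eq_ip => // x _.
  by rewrite big_ord0 mul0r.
rewrite big_ord_recr /= -ih -ipDl//; last exact: L2_sum.
by apply: eq_ip => // x _; rewrite big_ord_recr.
Qed.

End SquareIntegrable.

(** * A smooth cutoff *)

Section Smooth.
Variable R : realType.
Implicit Types (f g : R -> R) (a b c x : R) (n : nat).

(** Differentiability of order [n] with the derivatives as witnesses; it is
    stable under the operations by plain induction. *)
Fixpoint Ck n f : Prop := if n is m.+1 then
  exists2 f' : R -> R, (forall x : R, is_derive x 1 f (f' x)) & Ck m f' else True.

Lemma CkW n f : Ck n.+1 f -> Ck n f.
Proof.
elim: n f => [//|n ih] f [f' d h]; exists f' => //; exact: ih.
Qed.

Lemma CkD n f g : Ck n f -> Ck n g -> Ck n (fun x => f x + g x).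
Proof.
elim: n f g => [//|n ih] f g [f' df hf] [g' dg hg].
by exists (fun x => f' x + g' x); [move=> x; exact: derD|exact: ih].
Qed.

Lemma CkM n f g : Ck n f -> Ck n g -> Ck n (fun x => f x * g x).
Proof.
elim: n f g => [//|n ih] f g hf hg; have [f0 g0] := (CkW hf, CkW hg).
case: hf hg => [f' df hf] [g' dg hg].
exists (fun x => f' x * g x + f x * g' x); first by move=> x; exact: derM.
by apply: CkD; exact: ih.
Qed.

Lemma Ck_cst n c : Ck n (fun=> c).
Proof. by elim: n c => [//|n ih] c; exists (fun=> 0) => [x|]; [exact: der_cst|exact: ih]. Qed.

Lemma Ck_affine n f a b : Ck n f -> Ck n (fun x => f (a * x + b)).
Proof.
elim: n f => [//|n ih] f [f' df hf].
exists (fun x => f' (a * x + b) * a); last by apply: CkM; [exact: ih|exact: Ck_cst].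
move=> x; apply: (der_comp (f := f) (g := fun x => a * x + b)) => //.
by eapply is_derive_eq; [der|ring].
Qed.

Lemma Ck_trig n a : Ck n (fun x => sin (a * x)) /\ Ck n (fun x => cos (a * x)).
Proof.
have d x : is_derive x 1 (fun x => a * x) a by eapply is_derive_eq; [der|ring].
elim: n => [//|n [ihs ihc]]; split.
- exists (fun x => cos (a * x) * a); last by apply: CkM => //; exact: Ck_cst.
  by move=> x; apply: (der_comp (f := sin) (g := fun x => a * x)).
- exists (fun x => - sin (a * x) * a).
    by move=> x; apply: (der_comp (f := cos) (g := fun x => a * x)).
  apply: CkM; last exact: Ck_cst.
  have -> : (fun x => - sin (a * x)) = fun x => (-1) * sin (a * x) by apply/funext => x; ring.
  by apply: CkM => //; exact: Ck_cst.
Qed.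

Lemma Ck_derivable n f x : Ck n.+1 f -> derivable (derive1n n f) x 1.
Proof.
elim: n f => [|n ih] f [f' df hf].
  by have [] := df x.
have E : f' = derive1 f.
  by apply/funext => y; rewrite derive1E; have [_ <-] := df y.
by rewrite derive1Sn -E; exact: ih.
Qed.

Lemma poly_expR_bounded (p : {poly R}) a : 0 < a ->
  exists2 C, 0 <= C & forall z : R, 0 <= z -> `|p.[z]| * expR (- (a * z)) <= C.
Proof.
elim/poly_ind: p a => [|p c ih] a a0.
  by exists 0 => // z _; rewrite horner0 normr0 mul0r.
have a20 : 0 < a / 2 by rewrite divr_gt0.
have [C C0 HC] := ih (a / 2) a20.
exists (C * (2 / a) + `|c|); first by rewrite addr_ge0// mulr_ge0// divr_ge0// ltW.
move=> z z0; rewrite hornerMXaddC.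
have e1 : z * expR (- (a / 2 * z)) <= 2 / a.
  rewrite expRN ler_pdivrMr ?expR_gt0//.
  have := expR_ge1Dx (a / 2 * z) => h.
  apply: (@le_trans _ _ (2 / a * (1 + a / 2 * z))); last by rewrite ler_wpM2l// divr_ge0// ltW.
  rewrite mulrDr mulr1 mulrA (_ : 2 / a * (a / 2) = 1) ?mul1r ?lerDr ?divr_ge0 ?(ltW a0)//.
  by field; rewrite lt0r_neq0.
have e2 : expR (- (a * z)) = expR (- (a / 2 * z)) * expR (- (a / 2 * z)).
  by rewrite -expRD; congr expR; field.
have e3 : expR (- (a * z)) <= 1 by rewrite expR_le1 oppr_le0 mulr_ge0// ltW.
apply: (@le_trans _ _ (`|p.[z] * z| * expR (- (a * z)) + `|c| * expR (- (a * z)))).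
  by rewrite -mulrDl ler_wpM2r ?expR_ge0// ler_normD.
apply: lerD; last by rewrite ler_piMr.
rewrite e2 normrM (ger0_norm z0).
rewrite [leLHS](_ : _ = (`|p.[z]| * expR (- (a / 2 * z))) * (z * expR (- (a / 2 * z)))); last by ring.
apply: ler_pM e1; [| |exact: HC].
- by rewrite mulr_ge0// expR_ge0.
- by rewrite mulr_ge0// expR_ge0.
Qed.

(** The family is closed under differentiation, whence smoothness in one
    induction. *)
Definition bump (p : {poly R}) (x : R) : R :=
  if 1 < x then p.[(x - 1)^-1] * expR (- (x - 1)^-1) else 0.

(** Vanishing of second order at 1 gives the derivative there. *)
Lemma bump_le p : exists2 C, 0 <= C & forall x : R, `|bump p x| <= C * (x - 1) ^+ 2.
Proof.
have [C C0 HC] := poly_expR_bounded ('X^2 * p) (@ltr01 R).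
exists C => // x; rewrite /bump; case: ifPn => x1; last by rewrite normr0 mulr_ge0// sqr_ge0.
have x10 : 0 < x - 1 by rewrite subr_gt0.
have z0 : 0 <= (x - 1)^-1 by rewrite invr_ge0 ltW.
have := HC _ z0; rewrite hornerM hornerXn mul1r !normrM [`|expR _|]ger0_norm ?expR_ge0//.
rewrite (ger0_norm z0) => h; rewrite -ler_pdivrMr ?exprn_gt0//.
by apply: le_trans h; rewrite le_eqVlt; apply/orP; left; apply/eqP; field; rewrite gt_eqF.
Qed.

Lemma is_derive_quadratic f x a (C : R) : 0 <= C ->
  (forall y : R, `|f y - f x - a * (y - x)| <= C * (y - x) ^+ 2) -> is_derive x 1 f a.
Proof.
move=> C0 H.
have c : h^-1 *: (f (h *: 1 + x) - f x) @[h --> 0^'] --> a.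
  apply/cvgrPdist_le => e e0; near=> h.
  have h0 : h != 0 by near: h; exact: nbhs_dnbhs_neq.
  have he : `|h| <= e / (C + 1).
    near: h; apply: dnbhs0_le.
    by rewrite divr_gt0// ltr_wpDl.
  have := H (h *: 1 + x); rewrite scaler1 addrK => {}H.
  have -> : a - h^-1 *: (f (h + x) - f x) = - (h^-1 * (f (h + x) - f x - a * h)).
    by rewrite /GRing.scale /=; field.
  rewrite normrN normrM normfV ler_pdivrMl ?normr_gt0//; apply: (le_trans H).
  rewrite -(ger0_norm (sqr_ge0 h)) normrX [leLHS](_ : _ = `|h| * (C * `|h|)); last by ring.
  apply: ler_wpM2l => //; apply: (@le_trans _ _ ((C + 1) * `|h|)).
    by apply: ler_wpM2r => //; rewrite lerDl.
  by rewrite mulrC -ler_pdivlMr// ltr_wpDl.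
apply: DeriveDef; first by apply/cvg_ex; exists a.
exact/cvg_lim.
Unshelve. all: by end_near. Qed.

Lemma is_derive_bump p x : is_derive x 1 (bump p) (bump ('X^2 * (p - deriv p)) x).
Proof.
have [x1|x1|->] := ltgtP x 1.
- rewrite [bump ('X^2 * _) x]/bump ltNge (ltW x1) /=.
  have dc := @der_cst R 0 x; apply: (near_eq_is_derive _ dc).
  near=> y; rewrite /bump ltNge (_ : y <= 1)//; apply: ltW; near: y; exact: lt_nbhsl.
- rewrite [bump ('X^2 * _) x]/bump x1.
  have n : x - 1 != 0 by rewrite subr_eq0 gt_eqF.
  have dz : is_derive x 1 (fun y : R => (y - 1)^-1) (- ((x - 1)^-1) ^+ 2).
    have d1 : is_derive x 1 (fun y : R => y - 1) 1 by eapply is_derive_eq; [der|ring].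
    have [dv ev] := d1.
    apply: DeriveDef; first exact: derivableV.
    by rewrite deriveV// ev /GRing.scale /=; field.
  have dp := der_comp (f := fun z => p.[z]) (g := fun y : R => (y - 1)^-1) (is_derive_poly p (x - 1)^-1) dz.
  have de := der_comp (g := fun y : R => - (y - 1)^-1) (is_derive_expR (- (x - 1)^-1)) (derN dz).
  have dF := derM dp de.
  eapply is_derive_eq.
    eapply near_eq_is_derive; [|exact: dF].
    near=> y; rewrite /bump (_ : 1 < y)//; near: y; exact: lt_nbhsr.
  by rewrite hornerM hornerXn hornerD hornerN; ring.
- rewrite [bump ('X^2 * _) 1]/bump ltxx; have [C C0 HC] := bump_le p.
  apply: (is_derive_quadratic C0) => y; rewrite [bump p 1]/bump ltxx subr0 mul0r subr0.
  exact: HC.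
Unshelve. all: by end_near. Qed.

Lemma Ck_bump n p : Ck n (bump p).
Proof.
elim: n p => [//|n ih] p; exists (bump ('X^2 * (p - deriv p))) => //.
by move=> x; exact: is_derive_bump.
Qed.

(** The cutoff: 0 below 1, increasing to 1 at infinity. *)
Definition cut : R -> R := bump 1.
Definition cut' : R -> R := bump 'X^2.

Lemma is_derive_cut x : is_derive x 1 cut (cut' x).
Proof. by have := is_derive_bump 1 x; rewrite derivC subr0 mulr1. Qed.

Lemma cut_eq0 x : x <= 1 -> cut x = 0 /\ cut' x = 0.
Proof. by rewrite /cut /cut' /bump ltNge => ->. Qed.

Lemma cut_bounds x : 0 <= cut x <= 1.
Proof.
rewrite /cut /bump; case: ifPn => [x1|_]; last by rewrite lexx ler01.
by rewrite hornerC mul1r expR_ge0 expR_le1 oppr_le0 invr_ge0 subr_ge0 ltW.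
Qed.

Lemma cut'_ge0 x : 0 <= cut' x.
Proof.
rewrite /cut' /bump; case: ifPn => // x1.
by rewrite hornerXn mulr_ge0 ?expR_ge0 ?sqr_ge0.
Qed.

Lemma expR_ge_quad (z : R) : 0 <= z -> (1 + z / 2) ^+ 2 <= expR z.
Proof.
move=> z0; have -> : expR z = expR (z / 2) ^+ 2 by rewrite expr2 -expRD; congr expR; field.
rewrite ler_pXn2r ?nnegrE ?expR_ge0//; first exact: expR_ge1Dx.
by rewrite addr_ge0// divr_ge0.
Qed.

Lemma cut'_bound x : 0 <= x -> x * cut' x <= 4.
Proof.
move=> x0; rewrite /cut' /bump; case: ifPn => [x1|_]; last by rewrite mulr0.
rewrite hornerXn; set z := (x - 1)^-1.
have z0 : 0 < z by rewrite invr_gt0 subr_gt0.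
have -> : x * (z ^+ 2 * expR (- z)) = (z ^+ 2 + z) * expR (- z).
  by rewrite /z; field; rewrite subr_eq0 gt_eqF.
rewrite expRN ler_pdivrMr ?expR_gt0//.
by have := expR_ge_quad (ltW z0); have := sqr_ge0 z; lra.
Qed.

Lemma cvg_dilation f x (C : R) : 0 <= C -> 0 < x ->
  (forall y : R, 1 < y -> `|f y| <= C / (y - 1)) ->
  (fun n : nat => f (n%:R * x)) @ \oo --> (0 : R).
Proof.
move=> C0 x0 H; apply/cvgrPdist_le => e e0; near=> n.
rewrite sub0r normrN.
have hn : (C / e + 2) / x <= n%:R by near: n; exact: nbhs_infty_ger.
have {}hn : C / e + 2 <= n%:R * x by rewrite -ler_pdivrMr.
have Ce : 0 <= C / e by rewrite divr_ge0// ltW.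
have n1 : 1 < n%:R * x by lra.
apply: (le_trans (H _ n1)); rewrite ler_pdivrMr; last by lra.
by rewrite mulrC -ler_pdivrMr//; lra.
Unshelve. all: by end_near. Qed.

Lemma cut_cvg x : 0 < x -> (fun n : nat => cut (n%:R * x)) @ \oo --> (1 : R).
Proof.
move=> x0; have -> : (fun n : nat => cut (n%:R * x)) = fun n : nat => (cut (n%:R * x) - 1) + 1.
  by apply/funext => n; rewrite subrK.
rewrite -[X in _ --> X]add0r; apply: cvgD; last exact: cvg_cst.
apply: (@cvg_dilation (fun y => cut y - 1) x 1) => // y y1.
have z0 : 0 < y - 1 by rewrite subr_gt0.
rewrite /cut /bump y1 hornerC mul1r distrC ger0_norm; last first.
  by rewrite subr_ge0 expR_le1 oppr_le0 invr_ge0 ltW.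
by have := expR_ge1Dx (- (y - 1)^-1); rewrite mul1r; lra.
Qed.

Lemma cut'_cvg x : 0 < x -> (fun n : nat => n%:R * x * cut' (n%:R * x)) @ \oo --> (0 : R).
Proof.
move=> x0; apply: (@cvg_dilation (fun y => y * cut' y) x 4) => // y y1.
have y0 : 0 <= y by apply: ltW; exact: lt_trans y1.
have z0 : 0 < y - 1 by rewrite subr_gt0.
rewrite ger0_norm ?mulr_ge0 ?cut'_ge0//.
have [y2|y2] := leP y 2.
  by apply: (le_trans (cut'_bound y0)); rewrite ler_pdivlMr//; lra.
rewrite /cut' /bump y1 hornerXn; set z := (y - 1)^-1.
have zp : 0 < z by rewrite invr_gt0.
have z1 : z <= 1 by rewrite invf_le1//; lra.
have -> : y * (z ^+ 2 * expR (- z)) = (z ^+ 2 + z) * expR (- z).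
  by rewrite /z; field; rewrite subr_eq0 gt_eqF.
have e1 : expR (- z) <= 1 by rewrite expR_le1 oppr_le0 ltW.
apply: (@le_trans _ _ (z ^+ 2 + z)); first by rewrite ler_piMr// addr_ge0 ?sqr_ge0// ltW.
have z2 : z ^+ 2 <= z by rewrite expr2 ler_piMr// ltW.
lra.
Qed.

End Smooth.

(** * Weak derivatives tested against smooth functions *)

Section WeakDerivatives.
Variables (R : realType) (L : R).
Hypothesis L0 : 0 < L.
Implicit Types (f d th z : R -> R) (n : nat).
Notation mu := (@lebesgue_measure R).
Notation D := (`]0, L[%classic : set (measurableTypeR R)).
Notation L2 := (L2 L).
Notation ip := (ip L).
Notation is_weak_deriv := (is_weak_deriv L).

Let mD : measurable D. Proof. exact: measurable_itv. Qed.

Lemma int_D_Iu f : continuous f -> \int[mu]_(x in D) f x = Iu f L.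
Proof.
move=> fc; rewrite /Iu; have i := continuous_integrable 0 L fc.
have mf : measurable_fun `]0, L[ f.
  by apply: (measurable_funS (E := setT)) => //; exact: continuous_measurable_fun.
by rewrite Rintegral_itv_bndo_bndc ?Rintegral_itv_obnd_cbnd//;
  apply: integrableS i => //; apply: subset_itv; rewrite ?bnd_simp.
Qed.

Lemma int_derive f f1 : (forall x : R, is_derive x 1 f (f1 x)) -> continuous f1 ->
  \int[mu]_(x in D) f1 x = f L - f 0.
Proof.
move=> fd fc; rewrite int_D_Iu//.
have := @derive_eq R (Iu f1) f f1 0 L (ltW L0) (continuous_Iu fc)
  (fun x => is_derive_cont (fd x)).
rewrite (Iu0 _ (lexx 0)) subr0; apply => //.
by move=> x /andP[x0 _]; exact: is_derive_Iu.
Qed.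

Lemma dominated_ip f (h : nat -> R -> R) (h0 : R -> R) (M : R) : L2 f ->
  (forall n, measurable_fun D (h n)) -> measurable_fun D h0 ->
  (forall n (x : R), 0 < x < L -> `|h n x| <= M) ->
  (forall x : R, 0 < x < L -> h n x @[n --> \oo] --> h0 x) ->
  ip f (h n) @[n --> \oo] --> ip f h0.
Proof.
move=> hf mh mh0 hM hc.
have mf := L2_measurable hf.
have l1 : L2 (fun=> 1) := continuous_L2 L (@cont_cst R 1).
have i1 := L2_mul_integrable hf l1.
have ig : mu.-integrable D (EFin \o (fun x => M * `|f x * 1|)).
  have := integrableZl mD M (integrable_abse i1).
  by congr (_.-integrable _ _); apply/funext => x.
have [||||i _ c] := @dominated_convergence _ _ R mu D mD
  (fun n => EFin \o (fun x => f x * h n x)) (EFin \o (fun x => f x * h0 x))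
  (EFin \o (fun x => M * `|f x * 1|)) _ _ _ ig.
- by move=> n; apply/measurable_EFinP; exact: measurable_funM.
- by apply/measurable_EFinP; exact: measurable_funM.
- apply: aeW => x; rewrite /= in_itv /= => xD; apply: cvg_EFin; first exact: nearW.
  by apply: cvgM; [exact: cvg_cst|exact: hc].
- apply: aeW => x n; rewrite /= in_itv /= => xD.
  by rewrite lee_fin normrM mulr1 mulrC ler_wpM2r// hM.
apply: fine_cvg; rewrite /ip /Rintegral fineK//; exact: integrable_fin_num.
Qed.

Lemma cont_comp (f g : R -> R) : continuous f -> continuous g -> continuous (fun x : R => f (g x)).
Proof. by move=> fc gc x; apply: continuous_comp; [exact: gc|exact: fc]. Qed.

Lemma continuous_measurable_D f : continuous f -> measurable_fun D f.
Proof.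
by move=> fc; apply: (measurable_funS (E := setT)) => //; exact: continuous_measurable_fun.
Qed.

Definition smooth th := forall n, Ck n th.

Lemma smooth_continuous th : smooth th -> continuous th.
Proof. by move=> /(_ 1%N)[th' dth _] x; exact: is_derive_cont (dth x). Qed.

Let cutc : continuous (@cut R). Proof. by move=> x; exact: is_derive_cont (is_derive_cut x). Qed.
Let cut'c : continuous (@cut' R).
Proof. by have [th' dth _] := @Ck_bump R 1 'X^2 => x; exact: is_derive_cont (dth x). Qed.

(** A cutoff that is 0 within [1 / n] of the endpoints; it is close to 1 only
    far from them on that scale, and converges to 1 inside the interval. *)
Definition chi n (x : R) : R := cut (n%:R * x) * cut (n%:R * (L - x)).
Definition dchi n (x : R) : R := n%:R * cut' (n%:R * x) * cut (n%:R * (L - x))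
  - cut (n%:R * x) * (n%:R * cut' (n%:R * (L - x))).

Lemma chi_bounds n (x : R) : 0 <= chi n x <= 1.
Proof.
have /andP[a0 a1] := cut_bounds (n%:R * x); have /andP[b0 b1] := cut_bounds (n%:R * (L - x)).
by rewrite /chi mulr_ge0//= -[leRHS]mulr1 ler_pM.
Qed.

Lemma chi_eq0 n (x : R) : x \notin `[n.+1%:R^-1, L - n.+1%:R^-1] -> chi n x = 0.
Proof.
have small (y : R) : y < n.+1%:R^-1 -> cut (n%:R * y) = 0.
  move=> yn; apply: (cut_eq0 _).1; have [y0|y0] := leP y 0.
    by apply: (@le_trans _ _ 0) => //; rewrite mulr_ge0_le0.
  have : n%:R * y <= n.+1%:R * n.+1%:R^-1.
    by apply: ler_pM; rewrite ?ler_nat// ltW.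
  by rewrite mulfV// pnatr_eq0.
rewrite in_itv /= negb_and -!ltNge /chi => /orP[xl|xr]; first by rewrite small// mul0r.
by rewrite [cut (_ * (L - x))]small ?mulr0//; move: (n.+1%:R^-1) xr => e; lra.
Qed.

Lemma smooth_chi n : smooth (chi n).
Proof.
move=> m; rewrite /chi; apply: CkM.
  have -> : (fun x => cut (n%:R * x)) = (fun x => @cut R (n%:R * x + 0)).
    by apply/funext => x; rewrite addr0.
  by apply: Ck_affine; exact: Ck_bump.
have -> : (fun x => cut (n%:R * (L - x))) = (fun x => @cut R (- n%:R * x + n%:R * L)).
  by apply/funext => x; congr cut; ring.
by apply: Ck_affine; exact: Ck_bump.
Qed.

Lemma chi_test th n : smooth th -> test_function L (fun x => chi n x * th x).
Proof.
move=> sth; split; first by move=> m x; apply: Ck_derivable; apply: CkM => //; exact: smooth_chi.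
have i : 0 < n.+1%:R^-1 :> R by rewrite invr_gt0 ltr0n.
exists n.+1%:R^-1, (L - n.+1%:R^-1); split => //; first by rewrite ltrBlDr ltrDl.
by move=> x /chi_eq0 ->; rewrite mul0r.
Qed.

Lemma is_derive_chi n (x : R) : is_derive x 1 (chi n) (dchi n x).
Proof.
rewrite /chi /dchi; move: (n%:R : R) => m.
have d1 : is_derive x 1 (fun x : R => m * x) m by eapply is_derive_eq; [der|ring].
have d2 : is_derive x 1 (fun x : R => m * (L - x)) (- m) by eapply is_derive_eq; [der|ring].
have e1 := der_comp (f := @cut R) (g := fun x : R => m * x) (is_derive_cut _) d1.
have e2 := der_comp (f := @cut R) (g := fun x : R => m * (L - x)) (is_derive_cut _) d2.
by eapply is_derive_eq; [exact: (derM e1 e2)|rewrite /=; ring].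
Qed.

Lemma derive_chi_mul th th' n : (forall x : R, is_derive x 1 th (th' x)) ->
  derive1 (fun x => chi n x * th x) = (fun x => chi n x * th' x + dchi n x * th x).
Proof.
move=> dth; apply/funext => x; rewrite derive1E.
have [_ ->] := derM (is_derive_chi n x) (dth x); ring.
Qed.

Lemma continuous_chi n : continuous (chi n).
Proof. exact/smooth_continuous/smooth_chi. Qed.

Lemma continuous_dchi n : continuous (dchi n).
Proof.
have c1 : continuous (fun x : R => n%:R * x : R) by ctn.
have c2 : continuous (fun x : R => n%:R * (L - x) : R) by ctn.
have k1 : continuous (fun x : R => @cut R (n%:R * x)) by exact: (cont_comp cutc c1).
have k2 : continuous (fun x : R => @cut R (n%:R * (L - x))) by exact: (cont_comp cutc c2).
have k3 : continuous (fun x : R => @cut' R (n%:R * x)) by exact: (cont_comp cut'c c1).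
have k4 : continuous (fun x : R => @cut' R (n%:R * (L - x))) by exact: (cont_comp cut'c c2).
rewrite /dchi; ctn.
Qed.

Lemma chi_cvg (x : R) : 0 < x < L -> chi n x @[n --> \oo] --> (1 : R).
Proof.
move=> /andP[x0 xL]; rewrite -[X in _ --> X]mulr1; apply: cvgM; apply: cut_cvg => //.
by rewrite subr_gt0.
Qed.

Lemma ip_chi_cvg f th : L2 f -> continuous th ->
  ip f (fun x => chi n x * th x) @[n --> \oo] --> ip f th.
Proof.
move=> hf cth.
have /continuous_compact/(_ (@segment_compact _ 0 L)) /compact_bounded[M [_ HM]] :
  {within `[0, L], continuous th} by exact: continuous_subspaceT.
have mth : measurable_fun D th.
  exact: continuous_measurable_D.
apply: (@dominated_ip _ _ _ (M + 1)) => //.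
- move=> n; apply: measurable_funM => //; apply: continuous_measurable_D.
  exact: continuous_chi.
- move=> n x /andP[x0 xL]; have /andP[c0 c1] := chi_bounds n x.
  rewrite normrM (ger0_norm c0) (@le_trans _ _ `|th x|) ?ler_piMl//.
  apply: HM; first by rewrite ltrDl.
  by exists x => //; rewrite /= in_itv /= !ltW.
- move=> x xD; rewrite -[X in _ --> X]mul1r; apply: cvgM; last exact: cvg_cst.
  exact: chi_cvg.
Qed.

(** A smooth function becomes a test function after the cutoff; what remains
    in the limit is the contribution of the derivative of the cutoff. *)
Lemma weak_ibp f d th th' : L2 f -> L2 d -> is_weak_deriv f d -> smooth th ->
  (forall x : R, is_derive x 1 th (th' x)) -> continuous th' ->
  ip f (fun x => dchi n x * th x) @[n --> \oo] --> (0 : R) ->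
  ip d th = - ip f th'.
Proof.
move=> hf hd w sth dth cth' c0; have cth := smooth_continuous sth.
have c1 := ip_chi_cvg hd cth; have c2 := ip_chi_cvg hf cth'.
have E n : ip d (fun x => chi n x * th x) =
    - (ip f (fun x => chi n x * th' x) + ip f (fun x => dchi n x * th x)).
  rewrite -ipDr//; first last.
  - by apply: continuous_L2; apply: continuousMf => //; exact: continuous_dchi.
  - by apply: continuous_L2; apply: continuousMf => //; exact: continuous_chi.
  rewrite -[LHS]opprK -(w _ (chi_test n sth)); congr (- _).
  by rewrite (derive_chi_mul _ dth).
have c3 : ip d (fun x => chi n x * th x) @[n --> \oo] --> - (ip f th' + 0).
  by under eq_cvg do rewrite E; apply: cvgN; exact: cvgD.
rewrite addr0 in c3; exact: (cvg_unique _ c1 c3).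
Qed.

Lemma weak_zero z th : L2 z -> smooth th ->
  (forall eta, test_function L eta -> ip z eta = 0) -> ip z th = 0.
Proof.
move=> hz sth H; have c := ip_chi_cvg hz (smooth_continuous sth).
have E : (fun n => ip z (fun x => chi n x * th x)) = fun=> 0.
  by apply/funext => n; exact: (H _ (chi_test n sth)).
have c0 : (fun _ : nat => 0 : R) @ \oo --> (0 : R) by exact: cvg_cst.
by rewrite E in c; exact: (cvg_unique _ c c0).
Qed.

End WeakDerivatives.

(** * Fourier coefficients of weak derivatives *)

Section TrigIBP.
Variables (R : realType) (L : R).
Hypothesis L0 : 0 < L.
Implicit Types (f d th z : R -> R) (n : nat).
Notation mu := (@lebesgue_measure R).
Notation D := (`]0, L[%classic : set (measurableTypeR R)).
Notation L2 := (L2 L).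
Notation ip := (ip L).
Notation is_weak_deriv := (is_weak_deriv L).
Notation dchi := (dchi L).

Let mD : measurable D. Proof. exact: measurable_itv. Qed.

Lemma sin_le (x : R) : 0 <= x -> sin x <= x /\ - x <= sin x.
Proof.
move=> x0.
have d1 (y : R) : is_derive y 1 (fun y : R => y - sin y) (1 - cos y).
  exact: (derD (der_id y) (derN (is_derive_sin y))).
have d2 (y : R) : is_derive y 1 (fun y : R => y + sin y) (1 + cos y).
  exact: (derD (der_id y) (is_derive_sin y)).
have h1 := @derive_ge0_le _ _ _ 0 x x0 (fun y => is_derive_cont (d1 y)) (fun y _ => d1 y).
have h2 := @derive_ge0_le _ _ _ 0 x x0 (fun y => is_derive_cont (d2 y)) (fun y _ => d2 y).
rewrite !sin0 in h1 h2.
have c1 (y : R) : 0 <= 1 - cos y by rewrite subr_ge0 cos_le1.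
have c2 (y : R) : 0 <= 1 + cos y by have := cos_geN1 y; lra.
by have := h1 (fun y _ => c1 y); have := h2 (fun y _ => c2 y); split; lra.
Qed.

Definition lam n : R := n%:R * pi / L.
Definition sn n (x : R) : R := sin (lam n * x).
Definition cn n (x : R) : R := cos (lam n * x).

Lemma lam_ge0 n : 0 <= lam n.
Proof. by rewrite /lam divr_ge0 ?mulr_ge0 ?pi_ge0// ltW. Qed.

Lemma lam_gt0 n : (0 < n)%N -> 0 < lam n.
Proof. by move=> n0; rewrite /lam divr_gt0 ?mulr_gt0 ?pi_gt0// ltr0n. Qed.

Lemma smooth_sn n : smooth (sn n). Proof. by move=> m; have [] := Ck_trig m (lam n). Qed.
Lemma smooth_cn n : smooth (cn n). Proof. by move=> m; have [] := Ck_trig m (lam n). Qed.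

Let dlam n (x : R) : is_derive x 1 (fun x : R => lam n * x) (lam n).
Proof. by eapply is_derive_eq; [der|ring]. Qed.

Lemma is_derive_sn n (x : R) : is_derive x 1 (sn n) (lam n * cn n x).
Proof.
have := der_comp (f := sin) (g := fun x : R => lam n * x) (is_derive_sin _) (dlam n x).
by move=> h; eapply is_derive_eq; [exact: h|rewrite mulrC].
Qed.

Lemma is_derive_cn n (x : R) : is_derive x 1 (cn n) (- (lam n * sn n x)).
Proof.
have := der_comp (f := cos) (g := fun x : R => lam n * x) (is_derive_cos _) (dlam n x).
by move=> h; eapply is_derive_eq; [exact: h|rewrite /sn; ring].
Qed.

Lemma continuous_sn n : continuous (sn n). Proof. exact/smooth_continuous/smooth_sn. Qed.
Lemma continuous_cn n : continuous (cn n). Proof. exact/smooth_continuous/smooth_cn. Qed.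
Lemma L2_sn n : L2 (sn n). Proof. exact/continuous_L2/continuous_sn. Qed.
Lemma L2_cn n : L2 (cn n). Proof. exact/continuous_L2/continuous_cn. Qed.

Lemma lamL n : lam n * L = n%:R * pi.
Proof. by rewrite /lam divfK// lt0r_neq0. Qed.

Lemma sin_natpi n : sin (n%:R * pi) = 0 :> R.
Proof.
elim: n => [|n ih]; first by rewrite mul0r sin0.
by rewrite -natr1 mulrDl mul1r sinDpi ih oppr0.
Qed.

Lemma cos_natpi n : cos (n%:R * pi) = (-1) ^+ n :> R.
Proof.
elim: n => [|n ih]; first by rewrite mul0r cos0.
by rewrite -natr1 mulrDl mul1r cosDpi ih exprS mulN1r.
Qed.

Lemma sn0 n : sn n 0 = 0. Proof. by rewrite /sn mulr0 sin0. Qed.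
Lemma snL n : sn n L = 0. Proof. by rewrite /sn lamL sin_natpi. Qed.

Lemma sn_le n (x : R) : 0 <= x -> `|sn n x| <= lam n * x.
Proof.
move=> x0; have [a b] := sin_le (mulr_ge0 (lam_ge0 n) x0).
by rewrite /sn ler_norml a b.
Qed.

Lemma sn_leL n (x : R) : x <= L -> `|sn n x| <= lam n * (L - x).
Proof.
move=> xL; have -> : sn n x = - (-1) ^+ n * sn n (L - x).
  rewrite /sn mulrBr lamL sinB sin_natpi cos_natpi mul0r sub0r mulrNN mulrA.
  by rewrite -exprD addnn -mul2n exprM sqrrN expr1n expr1n mul1r.
rewrite normrM normrN normrX normrN1 expr1n mul1r; apply: sn_le.
by rewrite subr_ge0.
Qed.

Lemma cn_le1 n (x : R) : `|cn n x| <= 1. Proof. exact: cos_max. Qed.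
Lemma sn_le1 n (x : R) : `|sn n x| <= 1. Proof. exact: sin_max. Qed.

(** [A] is the size of the derivative of the cutoff near 0: it has mass at most
    1, and [x * A k x] is bounded and tends to 0. *)
Let A k (x : R) : R := k%:R * cut' (k%:R * x).
Let G k (x : R) : R := x * A k x + (L - x) * A k (L - x).

Let A0 k (x : R) : 0 <= A k x. Proof. by rewrite mulr_ge0// cut'_ge0. Qed.

Let Ac k : continuous (A k).
Proof.
have [th' dth _] := @Ck_bump R 1 'X^2.
have c1 : continuous (fun x : R => k%:R * x : R) by ctn.
have k1 : continuous (fun x : R => @cut' R (k%:R * x)).
  by apply: (cont_comp _ c1) => x; exact: is_derive_cont (dth x).
by rewrite /A; ctn.
Qed.

Let Arc k : continuous (fun x : R => A k (L - x)).
Proof. by apply: (cont_comp (Ac (k := k))); ctn. Qed.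

Let Gc k : continuous (G k).
Proof. by have ac := @Ac k; have arc := @Arc k; rewrite /G; ctn. Qed.

Let dchi_le k (x : R) : `|dchi k x| <= A k x + A k (L - x).
Proof.
have /andP[a0 a1] := cut_bounds (k%:R * x); have /andP[b0 b1] := cut_bounds (k%:R * (L - x)).
rewrite /dchi; apply: (le_trans (ler_normB _ _)); apply: lerD.
  by rewrite -/(A k x) normrM (ger0_norm b0) ger0_norm ?A0// ler_piMr.
by rewrite -/(A k (L - x)) normrM (ger0_norm a0) (ger0_norm (A0 _ _)) ler_piMl.
Qed.

Let xA k (x : R) : x * A k x = k%:R * x * cut' (k%:R * x).
Proof. by rewrite /A; ring. Qed.

Let G_bounds k (x : R) : 0 < x < L -> 0 <= G k x <= 8.
Proof.
move=> /andP[x0 xL]; have x1 : 0 <= L - x by rewrite subr_ge0 ltW.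
have h1 : x * A k x <= 4 by rewrite xA; apply: cut'_bound; rewrite mulr_ge0// ltW.
have h2 : (L - x) * A k (L - x) <= 4 by rewrite xA; apply: cut'_bound; rewrite mulr_ge0.
have g1 : 0 <= x * A k x by rewrite mulr_ge0 ?A0// ltW.
have g2 : 0 <= (L - x) * A k (L - x) by rewrite mulr_ge0 ?A0.
by rewrite /G; apply/andP; split; lra.
Qed.

Let G_cvg (x : R) : 0 < x < L -> G k x @[k --> \oo] --> (0 : R).
Proof.
move=> /andP[x0 xL]; rewrite -[X in _ --> X]addr0.
have -> : (fun k => G k x) = fun k => k%:R * x * cut' (k%:R * x) + k%:R * (L - x) * cut' (k%:R * (L - x)).
  by apply/funext => k; rewrite /G !xA.
by apply: cvgD; apply: cut'_cvg => //; rewrite subr_gt0.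
Qed.

Let ip0 f : ip f (fun=> 0) = 0.
Proof.
transitivity (\int[mu]_(_ in D) (0 : R)); last by rewrite Rintegral_cst// mul0r.
by apply: eq_Rintegral => x _; rewrite mulr0.
Qed.

(** Sines vanish linearly at the endpoints, which compensates the size of the
    derivative of the cutoff. *)
Lemma dchi_sn_cvg f n : L2 f -> ip f (fun x => dchi k x * sn n x) @[k --> \oo] --> (0 : R).
Proof.
move=> hf; rewrite -(ip0 f).
have le k (x : R) : 0 < x < L -> `|dchi k x * sn n x| <= lam n * G k x.
  move=> /andP[x0 xL]; rewrite normrM.
  apply: (le_trans (ler_wpM2r (normr_ge0 _) (dchi_le k x))); rewrite mulrDl /G mulrDr.
  apply: lerD.
    rewrite [leRHS](_ : _ = A k x * (lam n * x)); last by ring.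
    by rewrite ler_wpM2l ?A0//; apply: sn_le; exact: ltW.
  rewrite [leRHS](_ : _ = A k (L - x) * (lam n * (L - x))); last by ring.
  by rewrite ler_wpM2l ?A0//; apply: sn_leL; exact: ltW.
apply: (@dominated_ip _ _ _ _ _ (lam n * 8)) => //.
- move=> k; apply: continuous_measurable_D; apply: continuousMf; last exact: continuous_sn.
  exact: continuous_dchi.
- move=> k x xD; apply: (le_trans (le k x xD)); apply: ler_wpM2l; first exact: lam_ge0.
  by have /andP[] := G_bounds k xD.
- move=> x xD; apply: norm_cvg0.
  apply: (@squeeze_cvgr _ _ _ _ (fun=> 0) (fun k => lam n * G k x)).
  + by apply: nearW => k; rewrite normr_ge0 le.
  + exact: cvg_cst.
  + by rewrite -(mulr0 (lam n)); apply: cvgM; [exact: cvg_cst|exact: G_cvg].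
Qed.

Lemma weak_ibp_sn f d n : L2 f -> L2 d -> is_weak_deriv f d ->
  ip d (sn n) = - (lam n * ip f (cn n)).
Proof.
move=> hf hd w; have h := weak_ibp hf hd w (smooth_sn n) (is_derive_sn n).
rewrite h ?ipZr//; [exact: L2_cn| |exact: dchi_sn_cvg].
by apply: continuousMf; [exact: cont_cst|exact: continuous_cn].
Qed.

Lemma ip_norm_le u v h : L2 u -> L2 v -> continuous h ->
  (forall x : R, 0 < x < L -> `|u x * v x| <= h x) -> `|ip u v| <= \int[mu]_(x in D) h x.
Proof.
move=> hu hv hc H; have i := L2_mul_integrable hu hv.
apply: (le_trans (le_normr_Rintegral mD i)); apply: le_Rintegral => //.
- exact: integrable_abse i.
- apply: (@integrableS _ _ _ mu `[0, L]%classic) => //; first exact: subset_itv_oo_cc.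
  exact: continuous_integrable.
Qed.

Let int_A k : \int[mu]_(x in D) A k x <= 1.
Proof.
have d (x : R) : is_derive x 1 (fun x : R => @cut R (k%:R * x)) (A k x).
  have d1 : is_derive x 1 (fun x : R => k%:R * x) (k%:R : R) by eapply is_derive_eq; [der|ring].
  have := der_comp (f := @cut R) (g := fun x : R => k%:R * x) (is_derive_cut _) d1.
  by rewrite mulrC.
rewrite (int_derive L0 d (Ac (k := k))) mulr0 (cut_eq0 (ltW (@ltr01 R))).1 subr0.
by have /andP[] := cut_bounds (k%:R * L).
Qed.

Let int_Ar k : \int[mu]_(x in D) A k (L - x) <= 1.
Proof.
have d (x : R) : is_derive x 1 (fun x : R => - @cut R (k%:R * (L - x))) (A k (L - x)).
  have d1 : is_derive x 1 (fun x : R => k%:R * (L - x)) (- (k%:R : R)) by eapply is_derive_eq; [der|ring].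
  have := derN (der_comp (f := @cut R) (g := fun x : R => k%:R * (L - x)) (is_derive_cut _) d1).
  by move=> h; eapply is_derive_eq; [exact: h|rewrite /A /=; ring].
rewrite (int_derive L0 d (Arc (k := k))) subrr mulr0 (cut_eq0 (ltW (@ltr01 R))).1 oppr0 add0r opprK addr0.
by have /andP[] := cut_bounds (k%:R * L).
Qed.

Lemma continuous_integrable_D h : continuous h -> mu.-integrable D (EFin \o h).
Proof.
move=> hc; apply: (@integrableS _ _ _ mu `[0, L]%classic) => //; first exact: subset_itv_oo_cc.
exact: continuous_integrable.
Qed.

Lemma int_comb3 (x y z : R) (a b c : R -> R) : continuous a -> continuous b -> continuous c ->
  \int[mu]_(t in D) (x * a t + y * b t + z * c t) = x * \int[mu]_(t in D) a t
    + y * \int[mu]_(t in D) b t + z * \int[mu]_(t in D) c t.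
Proof.
move=> ac bc cc.
by rewrite !RintegralD// ?RintegralZl//; apply: continuous_integrable_D; ctn.
Qed.

(** Near an endpoint continuity makes [f] small, away from it the linear term
    dominates. *)
Lemma vanishing_bound f : {within `[0, L], continuous f} -> f 0 = 0 -> f L = 0 ->
  forall e : R, 0 < e -> exists2 C, 0 <= C & forall x : R, 0 < x < L ->
  `|f x| <= e + C * x /\ `|f x| <= e + C * (L - x).
Proof.
move=> fc f0 fL e e0.
have /compact_bounded[M [_ HM]] := continuous_compact fc (@segment_compact _ 0 L).
have [_ c0 cL] := (continuous_within_itvP f L0).1 fc.
rewrite f0 in c0; rewrite fL in cL.
have [d1 /= d10 H1] : \forall x \near 0^'+, `|f x| <= e.
  by move/cvgrPdist_le : c0 => /(_ _ e0); apply: filterS => x; rewrite sub0r normrN.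
have [d2 /= d20 H2] : \forall x \near L^'-, `|f x| <= e.
  by move/cvgrPdist_le : cL => /(_ _ e0); apply: filterS => x; rewrite sub0r normrN.
have fM (x : R) : 0 < x < L -> `|f x| <= `|M| + 1.
  move=> /andP[x0 xL]; apply: (HM (`|M| + 1)); first by rewrite ltr_pwDr// ler_norm.
  by exists x => //; rewrite /= in_itv /= !ltW.
pose m := Num.min d1 d2; have m0 : 0 < m by rewrite lt_min d10 d20.
exists ((`|M| + 1) / m) => [|x /andP[x0 xL]]; first by rewrite divr_ge0 ?addr_ge0// ltW.
have MM : 0 <= `|M| + 1 by rewrite addr_ge0.
have gen (y : R) : 0 < y -> (y < m -> `|f x| <= e) -> `|f x| <= e + (`|M| + 1) / m * y.
  move=> y0 h; have [ym|ym] := ltP y m.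
    by apply: (le_trans (h ym)); rewrite lerDl mulr_ge0// ?divr_ge0// ltW.
  apply: (le_trans (fM x _)); first by rewrite x0.
  apply: (@le_trans _ _ ((`|M| + 1) / m * y)); last by rewrite lerDr ltW.
  by rewrite -mulrA ler_peMr// mulrC ler_pdivlMr// mul1r.
split; apply: gen => //; rewrite ?subr_gt0//.
  move=> xm; apply: H1 => //=; rewrite sub0r normrN gtr0_norm//.
  by apply: (lt_le_trans xm); rewrite ge_min lexx.
move=> xm; apply: H2 => //=; rewrite gtr0_norm ?subr_gt0//.
by apply: (lt_le_trans xm); rewrite ge_min lexx orbT.
Qed.

(** Cosines do not vanish at the endpoints, but [f] does: the small constant
    is paired with the bounded mass of [A], the linear term with [x * A k x]. *)
Lemma weak_ibp_cn f d n : {within `[0, L], continuous f} -> f 0 = 0 -> f L = 0 ->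
  L2 d -> is_weak_deriv f d -> ip d (cn n) = lam n * ip f (sn n).
Proof.
move=> fc f0 fL hd w; have hf := within_continuous_L2 fc.
rewrite (weak_ibp hf hd w (smooth_cn n) (is_derive_cn n)).
- rewrite -[RHS]opprK; congr (- _); rewrite -mulNr -ipZr//; last exact: L2_sn.
  by apply: eq_ip => // x _; rewrite mulNr.
- by apply: contN; apply: continuousMf; [exact: cont_cst|exact: continuous_sn].
have Gcv : \int[mu]_(x in D) G k x @[k --> \oo] --> (0 : R).
  rewrite -[X in _ --> X](ip0 (fun=> 1)).
  have -> : (fun k => \int[mu]_(x in D) G k x) = fun k => ip (fun=> 1) (G k).
    by apply/funext => k; apply: eq_Rintegral => x _; rewrite mul1r.
  apply: (@dominated_ip _ _ _ _ _ 8) => //.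
  + by apply: continuous_L2; exact: cont_cst.
  + by move=> k; exact: continuous_measurable_D.
  + by move=> k x xD; have /andP[g0 g8] := G_bounds k xD; rewrite ger0_norm.
apply/cvgrPdist_le => e e0.
have e3 : 0 < e / 3 by rewrite divr_gt0.
have [C C0 HC] := vanishing_bound fc f0 fL e3.
have C1 : 0 < C + 1 by rewrite ltr_wpDl.
have e4 : 0 < e / 3 / (C + 1) by rewrite divr_gt0.
move/cvgrPdist_le : Gcv => /(_ _ e4); apply: filterS => k; rewrite !sub0r !normrN => Gk.
apply: (@le_trans _ _ (\int[mu]_(x in D) (e / 3 * A k x + e / 3 * A k (L - x) + C * G k x))).
  apply: ip_norm_le => //.
  - by apply: continuous_L2; apply: continuousMf; [exact: continuous_dchi|exact: continuous_cn].
  - by have ac := @Ac k; have arc := @Arc k; have gc := @Gc k; ctn.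
  move=> x xD; have [h1 h2] := HC x xD; have c1 := cn_le1 n x.
  rewrite !normrM mulrA; apply: (@le_trans _ _ (`|f x| * `|dchi k x|)).
    by rewrite ler_piMr// mulr_ge0.
  apply: (le_trans (ler_wpM2l (normr_ge0 _) (dchi_le k x))); rewrite mulrDr.
  apply: (le_trans (lerD (ler_wpM2r (A0 k x) h1) (ler_wpM2r (A0 k (L - x)) h2))).
  by rewrite /G le_eqVlt; apply/orP; left; apply/eqP; ring.
rewrite (int_comb3 (e / 3) (e / 3) C (Ac (k := k)) (Arc (k := k)) (Gc (k := k))).
have a1 := int_A k; have a2 := int_Ar k.
have g1 : C * \int[mu]_(x in D) G k x <= e / 3.
  apply: (@le_trans _ _ ((C + 1) * `|\int[mu]_(x in D) G k x|)).
    apply: (@le_trans _ _ (C * `|\int[mu]_(x in D) G k x|)); first by rewrite ler_wpM2l// ler_norm.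
    by rewrite ler_wpM2r// lerDl.
  by rewrite mulrC -ler_pdivlMr.
have b1 : e / 3 * \int[mu]_(x in D) A k x <= e / 3 by apply: ler_piMr; [exact: ltW|exact: a1].
have b2 : e / 3 * \int[mu]_(x in D) A k (L - x) <= e / 3 by rewrite ler_piMr// ltW.
apply: (le_trans (lerD (lerD b1 b2) g1)).
by rewrite le_eqVlt; apply/orP; left; apply/eqP; field.
Qed.

End TrigIBP.

(** * Weak derivatives and their representatives *)

Section SobolevFunctions.
Variables (R : realType) (L : R).
Hypothesis L0 : 0 < L.
Implicit Types (f d th z v : R -> R) (n : nat).
Notation mu := (@lebesgue_measure R).
Notation D := (`]0, L[%classic : set (measurableTypeR R)).
Notation L2 := (L2 L).
Notation ip := (ip L).
Notation is_weak_deriv := (is_weak_deriv L).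
Notation crep := (crep L).
Notation dx := (dx L).
Notation H1 := (H1 L).
Notation H10 := (H10 L).
Notation lam := (lam L).
Notation sn := (sn L).
Notation cn := (cn L).

Let mD : measurable D. Proof. exact: measurable_itv. Qed.

Lemma eqae_sym u v : eqae L u v -> eqae L v u.
Proof. by apply: ae_imp => x h /h. Qed.

Lemma eqae_refl u : eqae L u u. Proof. exact: aeW. Qed.

Lemma test_derive th : test_function L th ->
  [/\ forall x : R, is_derive x 1 th (derive1 th x), continuous (derive1 th) & th 0 = 0 /\ th L = 0].
Proof.
move=> [der_th [a [b [a0 bL thE]]]]; split.
- by move=> x; rewrite derive1E; apply/derivableP; exact: (der_th 0%N).
- by move=> x; apply/differentiable_continuous/derivable1_diffP; exact: (der_th 1%N).
- by split; apply: thE; rewrite in_itv /= negb_and -!ltNge ?a0 ?bL ?orbT.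
Qed.

Lemma test_L2 th : test_function L th -> L2 th /\ L2 (derive1 th).
Proof.
move=> /test_derive[d c _]; split; apply: continuous_L2 => //.
by move=> x; exact: is_derive_cont (d x).
Qed.

Lemma test_ibp th u u' : test_function L th -> (forall x : R, is_derive x 1 u (u' x)) ->
  continuous u' -> ip (derive1 th) u = - ip th u'.
Proof.
move=> tth du cu'; have [d c [t0 tL]] := test_derive tth.
have cth : continuous th by move=> x; exact: is_derive_cont (d x).
have cu : continuous u by move=> x; exact: is_derive_cont (du x).
have h := int_derive L0 (fun x => derM (d x) (du x)).
have {}h : \int[mu]_(x in D) (derive1 th x * u x + th x * u' x) = 0.
  by rewrite h ?t0 ?tL ?mul0r ?subr0//; ctn.
rewrite RintegralD// in h; try by apply: continuous_integrable_D; ctn.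
by apply/eqP; rewrite -addr_eq0; apply/eqP.
Qed.

Lemma crepP d : L2 d -> L2 (crep d) /\ eqae L (crep d) d.
Proof.
move=> hd; rewrite /crep; case: xgetP => [u _ [uc ud]|_].
  by split => //; exact: within_continuous_L2.
by split => //; exact: eqae_refl.
Qed.

Lemma crep_continuous d u : {within `[0, L], continuous u} -> eqae L u d ->
  {within `[0, L], continuous (crep d)}.
Proof.
move=> uc ud; rewrite /crep; case: xgetP => [u' _ [] //|h].
by case: (h u).
Qed.

Lemma weak_eqae v d d' : L2 d -> L2 d' -> eqae L d d' -> is_weak_deriv v d -> is_weak_deriv v d'.
Proof.
move=> hd hd' e w th tth; rewrite (w th tth); congr (- _).
by apply: eqae_ip => //; have [] := test_L2 tth.
Qed.

Lemma raw_derivative v : H1 v ->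
  let d := xget (cst 0) [set d | L2 d /\ is_weak_deriv v d] in L2 d /\ is_weak_deriv v d.
Proof.
by move=> [_ h]; have := @xgetPex _ (cst 0 : R -> R) [set d | L2 d /\ is_weak_deriv v d] h.
Qed.

Lemma dxP v : H1 v -> L2 (dx v) /\ is_weak_deriv v (dx v).
Proof.
move=> /raw_derivative /= [hd w]; have [hc e] := crepP hd; split => //.
exact: weak_eqae (eqae_sym e) w.
Qed.

Lemma dx_continuous v u : H1 v -> {within `[0, L], continuous u} -> eqae L u (dx v) ->
  {within `[0, L], continuous (dx v)}.
Proof.
move=> hv uc ud; have [hd _] := raw_derivative hv; have [_ e] := crepP hd.
apply: (crep_continuous uc); apply: (ae_imp2 (P := fun x => x \in `]0, L[ -> u x = dx v x)
  (P' := fun x => x \in `]0, L[ -> dx v x = _)) ud e => x h1 h2 xD.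
by rewrite h1// h2.
Qed.

Lemma weak_derivD u v d d' : L2 u -> L2 v -> L2 d -> L2 d' -> is_weak_deriv u d ->
  is_weak_deriv v d' -> is_weak_deriv (fun x => u x + v x) (fun x => d x + d' x).
Proof.
move=> hu hv hd hd' w w' th tth; have [l l'] := test_L2 tth.
have := ipDl hu hv l'; have := ipDl hd hd' l; rewrite /ip => -> ->.
by rewrite (w th tth) (w' th tth) opprD.
Qed.

Lemma weak_derivZ u d (c : R) : L2 u -> L2 d -> is_weak_deriv u d ->
  is_weak_deriv (fun x => c * u x) (fun x => c * d x).
Proof.
move=> hu hd w th tth; have [l l'] := test_L2 tth.
have := ipZl c hu l'; have := ipZl c hd l; rewrite /ip => -> ->.
by rewrite (w th tth) mulrN.
Qed.

Lemma H1D u v : H1 u -> H1 v -> H1 (fun x => u x + v x).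
Proof.
move=> hu hv; have [[lu _] [lv _]] := (hu, hv); have [du wu] := dxP hu; have [dv wv] := dxP hv.
split; first exact: L2D.
by exists (fun x => dx u x + dx v x); split; [exact: L2D|exact: weak_derivD].
Qed.

Lemma H1Z c u : H1 u -> H1 (fun x => c * u x).
Proof.
move=> hu; have [lu _] := hu; have [du wu] := dxP hu; split; first exact: L2Z.
by exists (fun x => c * dx u x); split; [exact: L2Z|exact: weak_derivZ].
Qed.

Lemma H1B u v : H1 u -> H1 v -> H1 (fun x => u x - v x).
Proof.
move=> hu hv; have := H1D hu (H1Z (-1) hv); congr H1.
by apply/funext => x; rewrite mulN1r.
Qed.

Lemma test_H1 th : test_function L th -> H1 th /\ is_weak_deriv th (derive1 th).
Proof.
move=> tth; have [l l'] := test_L2 tth.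
have w : is_weak_deriv th (derive1 th).
  move=> eta teta; have [d c _] := test_derive teta.
  have := test_ibp tth d c; rewrite /ip => ->; by rewrite opprK.
by split => //; split => //; exists (derive1 th).
Qed.

(** To be applied to [dx v] and to a derivative obtained by linearity, which
    need not be the same representative. *)
Lemma weak_unique v d d' th : L2 d -> L2 d' -> is_weak_deriv v d -> is_weak_deriv v d' ->
  smooth th -> ip d th = ip d' th.
Proof.
move=> hd hd' w w' sth.
have lth : L2 th by apply: continuous_L2; exact: smooth_continuous.
apply/eqP; rewrite -subr_eq0 -ipBl//; apply/eqP; apply: weak_zero => //; first exact: L2B.
move=> eta teta; have [l _] := test_L2 teta; rewrite ipBl//.
have := w eta teta; have := w' eta teta; rewrite /ip => -> /oppr_inj ->; exact: subrr.
Qed.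

Lemma ip_dx_sn f n : H1 f -> ip (dx f) (sn n) = - (lam n * ip f (cn n)).
Proof. by move=> hf; have [hd w] := dxP hf; have [lf _] := hf; exact: weak_ibp_sn. Qed.

(** For test functions the integration by parts is exact, and both sides are
    continuous in the [H^1] norm. *)
Lemma ip_dx_cn_H10 f n : H10 f -> ip (dx f) (cn n) = lam n * ip f (sn n).
Proof.
move=> [hf dense]; have [lf _] := hf; have [ld wd] := dxP hf.
have [ls lc] := (L2_sn L n, L2_cn L n).
pose S := Num.sqrt (ip (cn n) (cn n)) + lam n * Num.sqrt (ip (sn n) (sn n)).
have S0 : 0 <= S by rewrite addr_ge0 ?sqrtr_ge0// mulr_ge0 ?sqrtr_ge0// lam_ge0.
have bound (e : R) : 0 < e -> `|ip (dx f) (cn n) - lam n * ip f (sn n)| <= e * S.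
  move=> e0; have [th tth] := dense _ e0; set v := _ \- _ => hv.
  have [hth wth] := test_H1 tth; have [lth lth'] := test_L2 tth.
  have hv1 : H1 v := H1B hf hth; have [lv _] := hv1; have [ldv wdv] := dxP hv1.
  have w2 : is_weak_deriv v (fun x => dx f x - derive1 th x).
    have := weak_derivD lf (L2Z (-1) lth) ld (L2Z (-1) lth') wd (weak_derivZ (-1) lth lth' wth).
    by congr is_weak_deriv; apply/funext => x; rewrite /v /= mulN1r.
  have E1 := weak_unique ldv (L2B ld lth') wdv w2 (smooth_cn L n).
  rewrite ipBl// in E1.
  have E2 : ip (derive1 th) (cn n) = lam n * ip th (sn n).
    rewrite (test_ibp tth (is_derive_cn L n)); last first.
      by apply: contN; apply: continuousMf; [exact: cont_cst|exact: continuous_sn].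
    have -> : (fun x => - (lam n * sn n x)) = fun x => - lam n * sn n x.
      by apply/funext => x; rewrite mulNr.
    by rewrite ipZr// mulNr opprK.
  have E3 : ip v (sn n) = ip f (sn n) - ip th (sn n) by exact: ipBl.
  have -> : ip (dx f) (cn n) - lam n * ip f (sn n) = ip (dx v) (cn n) - lam n * ip v (sn n).
    by rewrite E1 E2 E3; ring.
  have n1 : (L2norm L v <= e%:E)%E.
    by apply: le_trans (ltW hv); rewrite /H1norm leeDl// Lnorm_ge0.
  have n2 : (L2norm L (dx v) <= e%:E)%E.
    by apply: le_trans (ltW hv); rewrite /H1norm leeDr// Lnorm_ge0.
  apply: (le_trans (ler_normB _ _)); rewrite /S mulrDr; apply: lerD.
    by apply: ip_le_norm => //; exact: ltW.
  rewrite normrM (ger0_norm (lam_ge0 L0 n)) mulrCA; apply: ler_wpM2l; first exact: lam_ge0.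
  by apply: ip_le_norm => //; exact: ltW.
apply/eqP; rewrite -subr_eq0 -normr_le0; apply/ler_addgt0Pl => e e0; rewrite addr0.
have S1 : 0 < S + 1 by rewrite ltr_wpDl.
apply: (le_trans (bound (e / (S + 1)) _)); first by rewrite divr_gt0.
by rewrite mulrAC ler_pdivrMr// ler_wpM2l ?(ltW e0)// lerDl.
Qed.

End SobolevFunctions.

(** * Completeness of cosines and sines *)

Section Completeness.
Variables (R : realType) (L : R).
Hypothesis L0 : 0 < L.
Implicit Types (f d th z v : R -> R) (n k : nat).
Notation mu := (@lebesgue_measure R).
Notation D := (`]0, L[%classic : set (measurableTypeR R)).
Notation L2 := (L2 L).
Notation ip := (ip L).
Notation lam := (lam L).
Notation sn := (sn L).
Notation cn := (cn L).

Let mD : measurable D. Proof. exact: measurable_itv. Qed.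

Lemma bernoulli_ge (x : R) n : -1 <= x -> 1 + n%:R * x <= (1 + x) ^+ n.
Proof.
move=> x1; elim: n => [|n ih]; first by rewrite mul0r addr0 expr0.
rewrite exprS; apply: (@le_trans _ _ ((1 + x) * (1 + n%:R * x))).
  by have := mulr_ge0 (ler0n R n) (sqr_ge0 x); rewrite -natr1; lra.
by rewrite ler_wpM2l//; lra.
Qed.

Lemma pow_le_expR (t : R) n : t <= 1 -> (1 - t) ^+ n <= expR (- (n%:R * t)).
Proof.
move=> t1; rewrite -mulrN expRM_natl.
rewrite lerXn2r ?nnegrE ?expR_ge0 ?subr_ge0//; exact: expR_ge1Dx.
Qed.

Lemma cvg_natM_expr (z : R) : 0 <= z < 1 -> (fun n => n%:R * z ^+ n) @ \oo --> (0 : R).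
Proof.
move=> /andP[z0 z1]; have [->|zn] := eqVneq z 0.
  have E : (fun n => n%:R * 0 ^+ n : R) = fun=> 0.
    by apply/funext => -[|n]; rewrite ?mul0r// expr0n mulr0.
  by rewrite E; exact: cvg_cst.
have zp : 0 < z by rewrite lt_neqAle eq_sym zn.
pose s := (1 + z) / 2; have sz : z < s by rewrite /s; lra.
have s1 : s < 1 by rewrite /s; lra.
have s0 : 0 < s := lt_trans zp sz.
pose C := (s / z - 1)^-1.
have q0 : 0 < s / z - 1 by rewrite subr_gt0 ltr_pdivlMr// mul1r.
have H n : n%:R * z ^+ n <= C * s ^+ n.
  have b : 1 + n%:R * (s / z - 1) <= (s / z) ^+ n.
    by rewrite -[X in X ^+ n](subrKC 1); apply: bernoulli_ge; lra.
  have b' : n%:R * (s / z - 1) <= (s / z) ^+ n by apply: le_trans b; rewrite lerDr.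
  rewrite /C mulrC [leRHS]mulrC ler_pdivlMr// mulrAC.
  have -> : s ^+ n = (s / z) ^+ n * z ^+ n by rewrite -exprMn divfK// lt0r_neq0.
  rewrite [leLHS](_ : _ = n%:R * (s / z - 1) * z ^+ n); last by ring.
  by apply: ler_wpM2r => //; exact: exprn_ge0.
apply: (@squeeze_cvgr _ _ _ _ (fun=> 0) (fun n => C * s ^+ n)).
- by apply: nearW => n; rewrite H mulr_ge0// exprn_ge0.
- exact: cvg_cst.
- rewrite -(mulr0 C); apply: cvgM; first exact: cvg_cst.
  by apply: cvg_expr; rewrite gtr0_norm.
Qed.

(** Polynomials in [y] that converge to the indicator of [y < a] on [[0, 1]]:
    since [(1 - y ^+ n) ^+ m] is about [exp (- m * y ^+ n)], taking [m] about
    [n / a ^+ n] makes the exponent [- n * (y / a) ^+ n]. *)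
Definition steep (a y : R) n : R := (1 - y ^+ n) ^+ (Num.truncn (n%:R / a ^+ n)).+1.

Lemma steep_bounds (a y : R) n : 0 <= y <= 1 -> 0 <= steep a y n <= 1.
Proof.
move=> /andP[y0 y1]; have h0 : 0 <= y ^+ n by exact: exprn_ge0.
have h1 : y ^+ n <= 1 by exact: exprn_ile1.
by rewrite /steep exprn_ge0 ?exprn_ile1//; lra.
Qed.

Let truncn_bounds (q : R) : 0 <= q -> q <= (Num.truncn q).+1%:R <= q + 1.
Proof.
by move=> /truncn_itv /andP[h1 h2]; rewrite (ltW h2) -natr1 lerD2r.
Qed.

Lemma steep_cvg1 (a y : R) : 0 < a -> a <= 1 -> 0 <= y -> y < a -> steep a y n @[n --> \oo] --> (1 : R).
Proof.
move=> a0 a1 y0 ya; have y1 : y < 1 := lt_le_trans ya a1.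
apply: (@squeeze_cvgr _ _ _ _ (fun n => 1 - (n%:R * (y / a) ^+ n + y ^+ n)) (fun=> 1)).
- apply: nearW => n; have h0 : 0 <= y ^+ n by exact: exprn_ge0.
  have h1 : y ^+ n <= 1 by apply: exprn_ile1 => //; exact: ltW.
  have yb : 0 <= y <= 1 by rewrite y0 ltW.
  have /andP[_ ->] := steep_bounds a n yb.
  rewrite andbT; apply: le_trans (bernoulli_ge _ _); last by lra.
  rewrite lerD2l mulrN lerN2.
  have q0 : 0 <= n%:R / a ^+ n by rewrite divr_ge0// exprn_ge0// ltW.
  have /andP[_ q1] := truncn_bounds q0.
  apply: (le_trans (ler_wpM2r h0 q1)); rewrite le_eqVlt; apply/orP; left; apply/eqP.
  by rewrite exprMn exprVn; ring.
- rewrite -[X in _ --> X]subr0 -[in X in _ --> X](addr0 0).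
  apply: cvgB; first exact: cvg_cst.
  apply: cvgD; last by apply: cvg_expr; rewrite ger0_norm.
  by apply: cvg_natM_expr; rewrite divr_ge0 ?ltr_pdivrMr ?mul1r// ltW.
- exact: cvg_cst.
Qed.

Lemma steep_cvg0 (a y : R) : 0 < a -> a <= y -> y <= 1 -> steep a y n @[n --> \oo] --> (0 : R).
Proof.
move=> a0 ay y1; have y0 : 0 < y := lt_le_trans a0 ay.
apply: (@squeeze_cvgr _ _ _ _ (fun=> 0) (fun n => n.+1%:R^-1)).
- apply: nearW => n; have yb : 0 <= y <= 1 by rewrite y1 ltW.
  have /andP[-> _] := steep_bounds a n yb.
  have h1 : y ^+ n <= 1 by apply: exprn_ile1 => //; exact: ltW.
  rewrite /=; apply: (le_trans (pow_le_expR _ h1)).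
  rewrite expRN lef_pV2 ?posrE ?expR_gt0//.
  apply: le_trans (expR_ge1Dx _); rewrite -natr1 addrC lerD2l.
  have q0 : 0 <= n%:R / a ^+ n by rewrite divr_ge0// exprn_ge0// ltW.
  have /andP[q1 _] := truncn_bounds q0.
  apply: le_trans (ler_wpM2r (exprn_ge0 n (ltW y0)) q1).
  rewrite mulrAC ler_pdivlMr ?exprn_gt0// ler_wpM2l//.
  by rewrite lerXn2r ?nnegrE// ltW.
- exact: cvg_cst.
- exact: cvg_harmonic.
Qed.

Lemma lamD n m : lam (n + m) = lam n + lam m.
Proof. by rewrite /lam natrD !mulrDl. Qed.

Let cos_cos (a b : R) : cos a * cos (a + b) = 2^-1 * cos (a + a + b) + 2^-1 * cos b.
Proof.
rewrite -addrA (cosD a (a + b)) (_ : cos b = cos (a + b - a)); last by congr cos; ring.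
by rewrite cosB; field.
Qed.

Let sin_sin (a b : R) : sin a * sin (a + b) = 2^-1 * cos b - 2^-1 * cos (a + a + b).
Proof.
rewrite -addrA (cosD a (a + b)) (_ : cos b = cos (a + b - a)); last by congr cos; ring.
by rewrite cosB; field.
Qed.

Let sin_cos (a b : R) : sin a * cos (a + b) = 2^-1 * sin (a + a + b) - 2^-1 * sin b.
Proof.
rewrite -addrA (sinD a (a + b)) (_ : sin b = sin (a + b - a)); last by congr sin; ring.
by rewrite sinB; field.
Qed.

Lemma cn_cn n k x : cn n x * cn (n + k) x = 2^-1 * cn (n + n + k) x + 2^-1 * cn k x.
Proof. by rewrite /cn !lamD !mulrDl cos_cos. Qed.

Lemma sn_sn n k x : sn n x * sn (n + k) x = 2^-1 * cn k x - 2^-1 * cn (n + n + k) x.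
Proof. by rewrite /cn /sn !lamD !mulrDl sin_sin. Qed.

Lemma sn_cn n k x : sn n x * cn (n + k) x = 2^-1 * sn (n + n + k) x - 2^-1 * sn k x.
Proof. by rewrite /cn /sn !lamD !mulrDl sin_cos. Qed.

Lemma cn_0 x : cn 0 x = 1. Proof. by rewrite /cn /lam !mul0r cos0. Qed.
Lemma sn_0 x : sn 0 x = 0. Proof. by rewrite /sn /lam !mul0r sin0. Qed.

(** The primitive of [f] vanishes identically, so [f] does almost everywhere by
    Lebesgue's differentiation theorem. *)
Lemma eqae0_of_primitive f : L2 f -> (forall y : R, 0 < y < L -> ip f (fun x => (y < x)%R%:R) = 0) ->
  ip f (fun=> 1) = 0 -> eqae L f (cst 0).
Proof.
move=> hf H H0.
have l1 : L2 (fun=> 1) by apply: continuous_L2; exact: cont_cst.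
have i : mu.-integrable D (EFin \o f).
  by have := L2_mul_integrable hf l1; congr (_.-integrable _ _); apply/funext => x /=; rewrite mulr1.
have i0 : mu.-integrable setT (EFin \o (f \_ D)).
  by rewrite -restrict_EFin; apply/(integrable_mkcond _ mD).
have iy (y : R) : mu.-integrable `]-oo, y]%classic (EFin \o (f \_ D)) by apply: integrableS i0.
have loc : locally_integrable setT (f \_ D) by exact: integrable_locally.
have := FTC1Ny iy loc.
have F0 (y : R) : \int[mu]_(t in `]-oo, y]) (f \_ D) t = 0.
  have mstep (c : R) : measurable_fun D (fun x : R => (c < x)%R%:R : R).
    have -> : (fun x : R => (c < x)%R%:R : R) = \1_(`]c, +oo[%classic).
      by apply/funext => x; rewrite indicE mem_setE in_itv /= andbT.
    exact: measurable_indic.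
  have bstep (c : R) : L2 (fun x : R => (c < x)%R%:R : R).
    apply/L2P; split; first exact: mstep.
    apply: (@le_integrable _ _ _ mu _ mD _ _ _ _ (L2_mul_integrable l1 l1)).
      by apply/measurable_EFinP; exact: measurable_funX.
    by move=> x _ /=; rewrite lee_fin mulr1 normr1; case: ltP => _ /=; rewrite ?expr1n ?expr0n /= ?normr1 ?normr0.
  have -> : \int[mu]_(t in `]-oo, y]) (f \_ D) t = ip f (fun x => 1 - (y < x)%R%:R).
    rewrite Rintegral_mkcond /ip [RHS]Rintegral_mkcond; apply: eq_Rintegral => x _.
    rewrite !patchE !mem_setE !in_itv /= leNgt.
    by case: ltP => _ /=; case: ifP => // _; rewrite ?subrr ?mulr0 ?subr0 ?mulr1.
  rewrite ipC ipBl// ipC H0 sub0r ipC; apply/eqP; rewrite oppr_eq0; apply/eqP.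
  have [y0|y0] := leP y 0.
    by rewrite -[RHS]H0; apply: eq_ip => // x /andP[x0 _]; rewrite (le_lt_trans y0 x0).
  have [yL|yL] := ltP y L; first by apply: H; rewrite y0.
  rewrite -[RHS](mul0r (ip (fun=> 1) f)) -[in RHS]ipC -ipZr//.
  by apply: eq_ip => // x /andP[_ xL]; rewrite ltNge (ltW (lt_le_trans xL yL)) mul0r.
apply: ae_imp => x /= [_ h] xD.
have E : (fun y : R => \int[mu]_(t in `]-oo, y]) (f \_ D) t) = cst 0 by apply/funext => y; exact: F0.
by move: h; rewrite E derive1_cst patchE mem_set.
Qed.

Section cosine.
Variable f : R -> R.
Hypotheses (hf : L2 f) (orth : forall n, ip f (cn n) = 0).

Let cpc k n : continuous (fun x => cn 1 x ^+ k * cn n x).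
Proof. by apply: continuousMf; [apply: contX; exact: continuous_cn|exact: continuous_cn]. Qed.

(** Products of cosines are combinations of cosines. *)
Lemma ip_cos_pow k n : ip f (fun x => cn 1 x ^+ k * cn n x) = 0.
Proof.
elim: k n => [|k ih] [|n].
- by rewrite -[RHS](orth 0); apply: eq_ip => // x _; rewrite expr0 mul1r.
- by rewrite -[RHS](orth n.+1); apply: eq_ip => // x _; rewrite expr0 mul1r.
- by rewrite -[RHS](ih 1%N); apply: eq_ip => // x _; rewrite cn_0 mulr1 exprSr.
- have -> : (fun x => cn 1 x ^+ k.+1 * cn n.+1 x) =
     fun x => 2^-1 * (cn 1 x ^+ k * cn n.+2 x) + 2^-1 * (cn 1 x ^+ k * cn n x).
    apply/funext => x; rewrite exprSr -mulrA -(add1n n) cn_cn; ring.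
  rewrite ipDr//; [|by apply: L2Z; exact/continuous_L2/cpc|by apply: L2Z; exact/continuous_L2/cpc].
  by rewrite !ipZr//; [rewrite !ih !mulr0 addr0|exact/continuous_L2/cpc|exact/continuous_L2/cpc].
Qed.

Let cpoly (q : {poly R}) k : continuous (fun x => q.[cn 1 x] * cn 1 x ^+ k).
Proof.
apply: continuousMf; last by apply: contX; exact: continuous_cn.
by apply: (cont_comp _ (@continuous_cn R L 1)) => x; exact: continuous_horner.
Qed.

Lemma ip_poly (q : {poly R}) k : ip f (fun x => q.[cn 1 x] * cn 1 x ^+ k) = 0.
Proof.
elim/poly_ind: q k => [|q c ih] k.
  rewrite -[RHS](mul0r (ip f f)) -ipZr//; apply: eq_ip => // x _.
  by rewrite horner0 !mul0r.
have -> : (fun x => (q * 'X + c%:P).[cn 1 x] * cn 1 x ^+ k) =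
    fun x => q.[cn 1 x] * cn 1 x ^+ k.+1 + c * (cn 1 x ^+ k * cn 0 x).
  by apply/funext => x; rewrite hornerMXaddC cn_0 exprS; ring.
rewrite ipDr//; [|exact/continuous_L2/cpoly|by apply: L2Z; exact/continuous_L2/cpc].
by rewrite ipZr ?ih ?ip_cos_pow ?mulr0 ?addr0//; exact/continuous_L2/cpc.
Qed.

Let half (x : R) : R := 2^-1 * (1 + cn 1 x).

Let half01 x : 0 <= half x <= 1.
Proof. by have := cos_geN1 (lam 1 * x); have := cos_le1 (lam 1 * x); rewrite /half /cn => ? ?; lra. Qed.

Let half_lt (x y : R) : 0 <= x <= L -> 0 <= y <= L -> (half x < half y) = (y < x).
Proof.
have lp : 0 < lam 1 by exact: lam_gt0.
move=> /andP[x0 xL] /andP[y0 yL]; rewrite /half ltr_pM2l ?invr_gt0// ltrD2l ltr_cos ?ltr_pM2l// in_itv /=.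
  by rewrite mulr_ge0 ?(ltW lp)//= -[leRHS]mul1r -(lamL L0 1) ler_wpM2l// ltW.
by rewrite mulr_ge0 ?(ltW lp)//= -[leRHS]mul1r -(lamL L0 1) ler_wpM2l// ltW.
Qed.

(** Polynomials in [cos (pi x / L)] are combinations of cosines, and this
    function decreases strictly from 1 to -1; composing it with [steep]
    approximates the indicator of each interval [(c, L)], without any density
    theorem. *)
Lemma cosine_complete : eqae L f (cst 0).
Proof.
apply: eqae0_of_primitive => //; last first.
  by rewrite -[RHS](orth 0); apply: eq_ip => // x _; rewrite cn_0.
move=> c /andP[c0 cL].
have lp : 0 < lam 1 by exact: lam_gt0.
have cb : 0 <= c <= L by rewrite !ltW.
pose a := half c; have a0 : 0 < a.
  apply: le_lt_trans (_ : half L < a); first by have /andP[] := half01 L.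
  by rewrite half_lt ?lexx ?(ltW L0).
have a1 : a <= 1 by have /andP[] := half01 c.
have cv : ip f (fun x => steep a (half x) n) @[n --> \oo] --> ip f (fun x => (c < x)%R%:R).
  apply: (@dominated_ip _ _ _ _ _ 1) => //.
  - move=> n; apply: continuous_measurable_D; rewrite /steep /half.
    by have cc := @continuous_cn R L 1; ctn.
  - have -> : (fun x : R => (c < x)%R%:R : R) = \1_(`]c, +oo[%classic).
      by apply/funext => x; rewrite indicE mem_setE in_itv /= andbT.
    exact: measurable_indic.
  - by move=> n x _; have /andP[s0 s1] := steep_bounds a n (half01 x); rewrite ger0_norm.
  - move=> x /andP[x0 xL]; have xb : 0 <= x <= L by rewrite !ltW.
    have /andP[h0 h1] := half01 x; have [cx|cx] := ltP c x.
      by apply: steep_cvg1 => //; rewrite half_lt.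
    by apply: steep_cvg0 => //; rewrite leNgt half_lt// -leNgt.
have z n : ip f (fun x => steep a (half x) n) = 0.
  pose q : {poly R} := (1 - (2^-1 *: (1 + 'X)) ^+ n) ^+ (Num.truncn (n%:R / a ^+ n)).+1.
  rewrite -[RHS](ip_poly q 0); apply: eq_ip => // x _.
  by rewrite expr0 mulr1 /q /steep /half !(hornerE, horner_exp).
have c0' : (fun _ : nat => 0 : R) @ \oo --> (0 : R) by exact: cvg_cst.
have E : (fun n => ip f (fun x => steep a (half x) n)) = fun=> 0 by apply/funext.
by rewrite E in cv; exact: (cvg_unique _ cv c0').
Qed.

End cosine.

(** Multiplying by [sin (pi x / L)], which is positive inside the interval,
    turns orthogonality to sines into orthogonality to cosines. *)
Lemma sine_complete f : L2 f -> (forall n, ip f (sn n) = 0) -> eqae L f (cst 0).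
Proof.
move=> hf orth; have s1c := @continuous_sn R L 1.
have hg : L2 (fun x => f x * sn 1 x).
  apply/L2P; split.
    by apply: measurable_funM; [exact: L2_measurable|exact: continuous_measurable_D].
  have [_ i] := (L2P _ _).1 hf; apply: (@le_integrable _ _ _ mu _ mD _ _ _ _ i).
    apply/measurable_EFinP; apply: measurable_funX; apply: measurable_funM.
      exact: L2_measurable.
    exact: continuous_measurable_D.
  move=> x _ /=; rewrite lee_fin exprMn normrM ler_piMr// normrX.
  by rewrite exprn_ile1// sn_le1.
have E n k : ip (fun x => f x * sn 1 x) (cn n) = ip f (fun x => sn 1 x * cn n x).
  by apply: eq_Rintegral => x _; rewrite mulrA.
have {}E n : ip (fun x => f x * sn 1 x) (cn n) = 0.
  rewrite (E n 0%N); case: n => [|n].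
    by rewrite -[RHS](orth 1%N); apply: eq_ip => // x _; rewrite cn_0 mulr1.
  have -> : (fun x => sn 1 x * cn n.+1 x) = fun x => 2^-1 * sn n.+2 x + - 2^-1 * sn n x.
    by apply/funext => x; rewrite -(add1n n) sn_cn; ring.
  have l m := L2_sn L m.
  rewrite ipDr//; [|exact: L2Z|exact: L2Z].
  by rewrite !ipZr// !orth !mulr0 addr0.
have := cosine_complete hg E; apply: ae_imp => x h xD.
have /eqP := h xD; rewrite mulf_eq0 => /orP[/eqP //|].
have lp : 0 < lam 1 by exact: lam_gt0.
move: xD; rewrite in_itv /= => /andP[x0 xL].
rewrite gt_eqF// /sn sin_gt0_pi// mulr_gt0//=.
by rewrite -[ltRHS]mul1r -(lamL L0 1) ltr_pM2l.
Qed.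

End Completeness.

(** * Uniformly convergent Fourier series *)

Section UniformSeries.
Variable R : realType.
Implicit Types (a : nat -> R) (f : nat -> R -> R) (n N : nat).

Lemma cont_sum f N : (forall n, continuous (f n)) -> continuous (fun x => \sum_(i < N) f i x).
Proof.
move=> fc; elim: N => [|N ih].
  have -> : (fun x => \sum_(i < 0) f i x) = fun=> 0 by apply/funext => x; rewrite big_ord0.
  exact: cont_cst.
have -> : (fun x => \sum_(i < N.+1) f i x) = fun x => \sum_(i < N) f i x + f N x.
  by apply/funext => x; rewrite big_ord_recr.
by apply: contD.
Qed.

Lemma uniform_limit_continuous (h : R -> R) (hN : nat -> R -> R) (p : nat -> R) :
  (forall N, continuous (hN N)) -> (forall N x, `|h x - hN N x| <= p N) ->
  p N @[N --> \oo] --> (0 : R) -> continuous h.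
Proof.
move=> hc hp pc x; apply/cvgrPdist_le => e e0.
have e3 : 0 < e / 3 by rewrite divr_gt0.
have [N _ hN3] := (cvgrPdist_le _ _).1 pc _ e3.
have {}hN3 : p N <= e / 3.
  by have := hN3 N (leqnn N); rewrite sub0r normrN; apply: le_trans; exact: ler_norm.
near=> y.
have hy : `|hN N x - hN N y| <= e / 3.
  by near: y; exact: ((cvgrPdist_le _ _).1 (hc N x) _ e3).
have h1 := le_trans (hp N x) hN3; have h2 := le_trans (hp N y) hN3.
rewrite (_ : h x - h y = (h x - hN N x) + (hN N x - hN N y) - (h y - hN N y)); last by ring.
apply: (le_trans (ler_normB _ _)); apply: le_trans (_ : e / 3 + e / 3 + e / 3 <= _); last first.
  by rewrite le_eqVlt; apply/orP; left; apply/eqP; field.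
by apply: lerD => //; apply: (le_trans (ler_normD _ _)); exact: lerD.
Unshelve. all: by end_near. Qed.

(** The remainders of a convergent series of nonnegative terms, used as explicit
    rates of uniform convergence. *)
Definition tail a N : R := limn (fun N => \sum_(i < N) a i) - \sum_(i < N) a i.

Variables (a : nat -> R) (M : R).
Hypotheses (a0 : forall n, 0 <= a n) (aM : forall N, \sum_(i < N) a i <= M).

Let nd : nondecreasing_seq (fun N => \sum_(i < N) a i).
Proof. by apply/nondecreasing_seqP => n; rewrite big_ord_recr /= lerDl. Qed.

Let cv : cvgn (fun N => \sum_(i < N) a i).
Proof.
apply: nondecreasing_is_cvgn => //; exists M => _ [n _ <-]; exact: aM.
Qed.

Lemma tail_ge0 N : 0 <= tail a N.
Proof. by rewrite subr_ge0; exact: nondecreasing_cvgn_le. Qed.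

Lemma tail_cvg : tail a N @[N --> \oo] --> (0 : R).
Proof. by rewrite -(subrr (limn (fun N => \sum_(i < N) a i))); apply: cvgB => //; exact: cvg_cst. Qed.

Lemma sum_sub_le (u : nat -> R) n k : (forall i, `|u i| <= a i) ->
  `|\sum_(i < n + k) u i - \sum_(i < n) u i| <= \sum_(i < n + k) a i - \sum_(i < n) a i.
Proof.
move=> ua; elim: k => [|k ih]; first by rewrite addn0 !subrr normr0.
rewrite addnS !big_ord_recr /= -!addrA [u _ + _]addrC [a _ + _]addrC !addrA.
by apply: (le_trans (ler_normD _ _)); rewrite lerD.
Qed.

Lemma uniform_series f : (forall n, continuous (f n)) -> (forall n x, `|f n x| <= a n) ->
  exists2 u : R -> R, continuous u &
    forall N x, `|u x - \sum_(i < N) f i x| <= tail a N.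
Proof.
move=> fc fa.
have cvx x : cvgn (fun N => \sum_(i < N) f i x).
  have E (v : nat -> R) : (fun N => \sum_(i < N) v i) = series v.
    by apply/funext => N; rewrite /series /= big_mkord.
  have ca : cvgn (series a) by rewrite -E.
  suff : cvgn (series (f^~ x)) by rewrite -E.
  apply: normed_cvg; apply: (@series_le_cvg _ _ a) => //; move=> n /=.
    exact: normr_ge0.
  exact: fa.
pose u x := limn (fun N => \sum_(i < N) f i x).
have H N x : `|u x - \sum_(i < N) f i x| <= tail a N.
  apply/ler_addgt0Pr => e e0.
  have := cvx x; rewrite -/(u x) => /cvgrPdist_le /(_ _ e0) [m _ hm].
  have h1 := hm (maxn m N) (leq_maxl _ _).
  have E : maxn m N = (N + (maxn m N - N))%N by rewrite subnKC// leq_maxr.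
  have h2 := sum_sub_le N (maxn m N - N) (fun i => fa i x).
  rewrite -E in h2.
  have h3 : \sum_(i < maxn m N) a i - \sum_(i < N) a i <= tail a N.
    by rewrite lerD2r; exact: nondecreasing_cvgn_le.
  rewrite -(subrKA (\sum_(i < maxn m N) f i x)); apply: (le_trans (ler_normD _ _)).
  by rewrite addrC; apply: lerD => //; exact: le_trans h3.
exists u => //; apply: (uniform_limit_continuous _ H tail_cvg) => N.
exact: cont_sum.
Qed.

End UniformSeries.

Section Parseval.
Variables (R : realType) (L : R).
Hypothesis L0 : 0 < L.
Implicit Types (f d z v : R -> R) (n N : nat).
Notation D := (`]0, L[%classic : set (measurableTypeR R)).
Notation L2 := (L2 L).
Notation ip := (ip L).
Notation lam := (lam L).

Let mD : measurable D. Proof. exact: measurable_itv. Qed.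

Variable e : nat -> R -> R.
Hypotheses (ec : forall n, continuous (e n)) (e1 : forall n x, `|e n x| <= 1)
  (eo : forall n m, ip (e n) (e m) = if n == m then L / 2 else 0).

Let L2e n : L2 (e n). Proof. exact: continuous_L2. Qed.

Definition psum f N (x : R) : R := \sum_(i < N) 2 / L * ip f (e i) * e i x.

Lemma continuous_psum f N : continuous (psum f N).
Proof.
apply: (@cont_sum _ (fun i x => 2 / L * ip f (e i) * e i x)) => n.
by apply: continuousMf => //; exact: cont_cst.
Qed.

Let L2psum f N : L2 (psum f N). Proof. exact/continuous_L2/continuous_psum. Qed.

Lemma ip_psum f v N : L2 v -> ip (psum f N) v = \sum_(i < N) 2 / L * ip f (e i) * ip (e i) v.
Proof.
move=> hv; rewrite (@ip_suml _ _ N (fun i x => 2 / L * ip f (e i) * e i x)) //.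
  by apply: eq_bigr => i _; rewrite ipZl.
by move=> i; apply: L2Z.
Qed.

Lemma ip_psum_e f N n : ip (psum f N) (e n) = if (n < N)%N then ip f (e n) else 0.
Proof.
rewrite ip_psum//; case: ltnP => nN.
  rewrite (bigD1 (Ordinal nN)) //= eo eqxx big1 ?addr0; first by field; rewrite lt0r_neq0.
  by move=> i; rewrite eo -val_eqE /= => /negbTE ->; rewrite mulr0.
rewrite big1// => i _; rewrite eo (_ : (val i == n) = false) ?mulr0//.
by apply/negbTE; rewrite neq_ltn (leq_trans (ltn_ord i) nN).
Qed.

Lemma psum_bessel_id f N : L2 f ->
  ip (fun x => f x - psum f N x) (fun x => f x - psum f N x) =
  ip f f - 2 / L * \sum_(i < N) ip f (e i) ^+ 2.
Proof.
move=> hf; have hs := L2psum f N; have hr := L2B hf hs.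
have E1 : ip (psum f N) f = 2 / L * \sum_(i < N) ip f (e i) ^+ 2.
  rewrite ip_psum// mulr_sumr; apply: eq_bigr => i _; rewrite (ipC _ (e i)); ring.
have E2 : ip (psum f N) (psum f N) = 2 / L * \sum_(i < N) ip f (e i) ^+ 2.
  rewrite ip_psum// mulr_sumr; apply: eq_bigr => i _.
  by rewrite (ipC _ (e i)) ip_psum_e ltn_ord; ring.
rewrite ipBl// (ipC _ f) (ipC _ (psum f N)) !ipBl// E2 (ipC _ f) E1; ring.
Qed.

Lemma bessel f N : L2 f -> \sum_(i < N) ip f (e i) ^+ 2 <= L / 2 * ip f f.
Proof.
move=> hf; have := ip_ge0 L (fun x => f x - psum f N x).
rewrite psum_bessel_id// subr_ge0 => h.
rewrite [leLHS](_ : _ = L / 2 * (2 / L * \sum_(i < N) ip f (e i) ^+ 2)); last by field; rewrite lt0r_neq0.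
by rewrite ler_wpM2l// divr_ge0// ltW.
Qed.

(** A bound [b n] on the square of [lam * c] bounds [c] by the mean of [b n] and
    of [1 / lam ^ 2], both summable. *)
Definition majorant (b : nat -> R) n : R := 2 / L * (2^-1 * (b n + (lam n.+1)^-1 ^+ 2)).

Definition prem (b : nat -> R) : nat -> R := tail (majorant b).

Section majorant.
Variables (b : nat -> R) (B : R).
Hypotheses (b0 : forall n, 0 <= b n) (bB : forall N, \sum_(i < N) b i <= B).

Lemma majorant_ge0 n : 0 <= majorant b n.
Proof.
by rewrite /majorant mulr_ge0 ?divr_ge0 ?(ltW L0)// mulr_ge0 ?addr_ge0 ?sqr_ge0.
Qed.

Let sum_inv_sqr N : \sum_(i < N) (i.+1%:R^-1 ^+ 2 : R) <= 2.
Proof.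
case: N => [|N]; first by rewrite big_ord0.
apply: (@le_trans _ _ (2 - N.+1%:R^-1)); last by rewrite lerBlDr lerDl invr_ge0.
elim: N => [|N ih]; first by rewrite big_ord_recr big_ord0 /= invr1 expr1n add0r; lra.
rewrite big_ord_recr /=; apply: (le_trans (lerD ih (lexx _))).
have h1 : N.+2%:R^-1 ^+ 2 <= N.+1%:R^-1 * N.+2%:R^-1 :> R.
  by rewrite expr2 ler_wpM2r ?invr_ge0// lef_pV2 ?posrE ?ltr0n// ler_nat.
have h2 : N.+1%:R^-1 * N.+2%:R^-1 = N.+1%:R^-1 - N.+2%:R^-1 :> R.
  have x0 : N.+1%:R != 0 :> R by rewrite pnatr_eq0.
  have x1 : N.+1%:R + 1 != 0 :> R by rewrite natr1 pnatr_eq0.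
  by rewrite -(natr1 N.+1); move: (N.+1%:R) x0 x1 => x x0 x1; field; rewrite ?x0 ?x1.
by move: h1; rewrite h2; move: (N.+1%:R^-1) (N.+2%:R^-1) => x y; lra.
Qed.

Lemma majorant_sum N : \sum_(i < N) majorant b i <= 2 / L * (2^-1 * (B + (L / pi) ^+ 2 * 2)).
Proof.
rewrite /majorant -mulr_sumr -mulr_sumr.
do 2 (apply: ler_wpM2l; first by rewrite ?divr_ge0 ?invr_ge0 ?(ltW L0)).
have E i : (lam i.+1)^-1 ^+ 2 = (L / pi) ^+ 2 * (i.+1%:R^-1 ^+ 2).
  by rewrite /lam -exprMn; congr (_ ^+ 2); rewrite !invfM invrK; ring.
rewrite (eq_bigr (fun i : 'I_N => b i + (L / pi) ^+ 2 * (i.+1%:R^-1 ^+ 2))); last by move=> i _; rewrite E.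
rewrite big_split /= -mulr_sumr; apply: lerD; first exact: bB.
by apply: ler_wpM2l; [exact: sqr_ge0|exact: sum_inv_sqr].
Qed.

Lemma prem_cvg : prem b N @[N --> \oo] --> (0 : R).
Proof. exact: (tail_cvg majorant_ge0 majorant_sum). Qed.

Lemma prem_ge0 N : 0 <= prem b N.
Proof. exact: (tail_ge0 majorant_ge0 majorant_sum). Qed.

Lemma coef_le_majorant (c : R) n : (lam n.+1 * c) ^+ 2 <= b n -> `|2 / L * c| <= majorant b n.
Proof.
move=> h; have lp : 0 < lam n.+1 by exact: lam_gt0.
rewrite normrM ger0_norm ?divr_ge0 ?(ltW L0)//; apply: ler_wpM2l; first by rewrite divr_ge0// ltW.
have E : `|c| = `|lam n.+1 * c| * (lam n.+1)^-1.
  by rewrite normrM (gtr0_norm lp) mulrAC mulfV ?mul1r// gt_eqF.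
rewrite E; have := sqr_ge0 (`|lam n.+1 * c| - (lam n.+1)^-1).
have : `|lam n.+1 * c| ^+ 2 <= b n by rewrite -normrX ger0_norm ?sqr_ge0.
by move: `|_| (lam n.+1)^-1 => x y; lra.
Qed.

(** [z] is the direction that the system [e] leaves out: constants for the
    cosines, nothing for the sines. *)
Variable z : R -> R.
Hypotheses (zc : continuous z) (z1 : forall x, `|z x| <= 1) (ze : forall n, ip (e n) z = 0).
Hypothesis complete : forall f, L2 f -> (forall n, ip f (e n) = 0) -> ip f z = 0 ->
  eqae L f (cst 0).

(** The sum of the series is continuous and has the coefficients of [f], so it is
    [f]. The remainder in the last inequality depends on [f] only through the
    majorant, which will be the same at all times. *)
Theorem parseval f : L2 f -> ip f z = 0 ->
  (forall n, (lam n.+1 * ip f (e n)) ^+ 2 <= b n) ->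
  exists u, [/\ continuous u, eqae L u f,
    forall N x, `|u x - psum f N x| <= prem b N &
    forall N, ip f f <= 2 / L * \sum_(i < N) ip f (e i) ^+ 2 + L * prem b N ^+ 2].
Proof.
move=> hf fz fb.
have mb n x : `|2 / L * ip f (e n) * e n x| <= majorant b n.
  rewrite normrM; apply: le_trans (coef_le_majorant (fb n)).
  by rewrite ler_piMr.
have [u uc uS] := uniform_series majorant_ge0 majorant_sum
  (fun n y => cvgM (cvg_cst _) (@ec n y)) mb.
have hu : L2 u := continuous_L2 L uc.
have ipu v : continuous v -> (forall x, `|v x| <= 1) ->
    ip (psum f N) v @[N --> \oo] --> ip u v.
  move=> vc v1; apply/cvgrPdist_le => eps eps0.
  have epsL : 0 < eps / L by rewrite divr_gt0.
  move/cvgrPdist_le : prem_cvg => /(_ _ epsL); apply: filterS => N.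
  rewrite sub0r normrN ger0_norm ?prem_ge0// => hN.
  have hv : L2 v := continuous_L2 L vc.
  rewrite -ipBl//; apply: (le_trans (@ip_norm_le _ _ _ _ (fun=> prem b N) _ hv _ _)).
  - exact: L2B.
  - exact: cont_cst.
  - move=> x _; rewrite normrM; apply: le_trans (uS N x).
    by rewrite ler_piMr.
  - by rewrite int_D_Iu ?Iu_cst ?(ltW L0)// -?ler_pdivlMr//; exact: cont_cst.
have ue n : ip u (e n) = ip f (e n).
  have c2 : ip (psum f N) (e n) @[N --> \oo] --> ip f (e n).
    apply: cvg_near_cst; near=> N; rewrite ip_psum_e (_ : (n < N)%N)//.
    by near: N; exact: nbhs_infty_ge.
  exact: (cvg_unique _ (ipu _ (ec (n := n)) (e1 n)) c2).
have uz : ip u z = 0.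
  have E : (fun N => ip (psum f N) z) = fun=> 0.
    apply/funext => N; rewrite ip_psum ?big1//; last exact: continuous_L2.
    by move=> i _; rewrite ze mulr0.
  have c := ipu _ zc z1; rewrite E in c.
  have c0' : (fun _ : nat => 0 : R) @ \oo --> (0 : R) by exact: cvg_cst.
  exact: (cvg_unique _ c c0').
have uf : eqae L u f.
  have := complete (L2B hu hf) (fun n => _) _.
  move=> h; apply: ae_imp (h _ _) => [x hx xD||].
  - by apply/eqP; rewrite -subr_eq0; apply/eqP; exact: hx.
  - by move=> n; rewrite ipBl// ue subrr.
  - by rewrite ipBl ?uz ?fz ?subrr//; exact: continuous_L2.
exists u; split => // N.
rewrite -lerBlDl -psum_bessel_id//.
have hr : L2 (fun x => f x - psum f N x) by exact: L2B.
have hr' : L2 (fun x => u x - psum f N x) by exact: L2B.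
have er : eqae L (fun x => u x - psum f N x) (fun x => f x - psum f N x).
  by move: uf; apply: ae_imp => x h xD; rewrite h.
rewrite -(eqae_ip hr' hr hr er) ipC -(eqae_ip hr' hr hr' er).
apply: (le_trans (ler_norm _)).
apply: (le_trans (@ip_norm_le _ _ _ _ (fun=> prem b N ^+ 2) hr' hr' _ _)).
- exact: cont_cst.
- by move=> x _; rewrite normrM -expr2 lerXn2r ?nnegrE ?prem_ge0//; exact: uS.
- by rewrite int_D_Iu ?Iu_cst ?(ltW L0) 1?mulrC//; exact: cont_cst.
Unshelve. all: by end_near. Qed.

End majorant.
End Parseval.

Section TrigSystems.
Variables (R : realType) (L : R).
Hypothesis L0 : 0 < L.
Implicit Types (f d v : R -> R) (n m k N : nat).
Notation mu := (@lebesgue_measure R).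
Notation D := (`]0, L[%classic : set (measurableTypeR R)).
Notation L2 := (L2 L).
Notation ip := (ip L).
Notation lam := (lam L).
Notation sn := (sn L).
Notation cn := (cn L).

Let mD : measurable D. Proof. exact: measurable_itv. Qed.

Lemma int_cn k : \int[mu]_(x in D) cn k x = if k == 0%N then L else 0.
Proof.
case: k => [|k] /=.
  rewrite int_D_Iu//; last exact: continuous_cn.
  rewrite -[RHS]mul1r -(Iu_cst 1 (ltW L0)); apply: eq_Iu => x _; exact: cn_0.
have lp : lam k.+1 != 0 by rewrite gt_eqF// lam_gt0.
have d (x : R) : is_derive x 1 (fun x => (lam k.+1)^-1 * sn k.+1 x) (cn k.+1 x).
  have h := derM (der_cst (lam k.+1)^-1 x) (is_derive_sn L k.+1 x).
  by eapply is_derive_eq; [exact: h|rewrite /=; field].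
by rewrite (int_derive L0 d (@continuous_cn _ _ _)) snL// sn0 mulr0 subrr.
Qed.

Let int_comb k m (a b : R) : \int[mu]_(x in D) (a * cn k x + b * cn m x) =
  a * (if k == 0%N then L else 0) + b * (if m == 0%N then L else 0).
Proof.
have c j : continuous (cn j) := @continuous_cn R L j.
have := int_comb3 L a b 0 (c k) (c m) (c 0%N); rewrite !int_cn mul0r addr0 => <-.
by apply: eq_Rintegral => x _; rewrite mul0r addr0.
Qed.

Lemma ip_cn n m : ip (cn n.+1) (cn m.+1) = if n == m then L / 2 else 0.
Proof.
have H k j : ip (cn j.+1) (cn (j.+1 + k)) = if k == 0%N then L / 2 else 0.
  transitivity (\int[mu]_(x in D) (2^-1 * cn (j.+1 + j.+1 + k) x + 2^-1 * cn k x)).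
    by apply: eq_Rintegral => x _; rewrite cn_cn.
  by rewrite int_comb addSn /=; case: eqP => _; ring.
have [nm|mn|->] := ltngtP n m.
- by rewrite -(subnKC (ltnW nm)) -addSn H subn_eq0 leqNgt nm.
- by rewrite ipC -(subnKC (ltnW mn)) -addSn H subn_eq0 leqNgt mn.
- by rewrite -[in X in ip _ X](addn0 m.+1) H.
Qed.

Lemma ip_sn n m : ip (sn n.+1) (sn m.+1) = if n == m then L / 2 else 0.
Proof.
have H k j : ip (sn j.+1) (sn (j.+1 + k)) = if k == 0%N then L / 2 else 0.
  transitivity (\int[mu]_(x in D) (- 2^-1 * cn (j.+1 + j.+1 + k) x + 2^-1 * cn k x)).
    by apply: eq_Rintegral => x _; rewrite sn_sn; ring.
  by rewrite int_comb addSn /=; case: eqP => _; ring.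
have [nm|mn|->] := ltngtP n m.
- by rewrite -(subnKC (ltnW nm)) -addSn H subn_eq0 leqNgt nm.
- by rewrite ipC -(subnKC (ltnW mn)) -addSn H subn_eq0 leqNgt mn.
- by rewrite -[in X in ip _ X](addn0 m.+1) H.
Qed.

Let c1 : continuous (fun _ : R => 1 : R). Proof. exact: cont_cst. Qed.
Let c0 : continuous (fun _ : R => 0 : R). Proof. exact: cont_cst. Qed.

Lemma ip_cn_1 n : ip (cn n.+1) (fun=> 1) = 0.
Proof. by rewrite /ip -[RHS](int_cn n.+1); apply: eq_Rintegral => x _; rewrite mulr1. Qed.

Section bounded_data.
Variables (b : nat -> R) (B : R).
Hypotheses (b0 : forall n, 0 <= b n) (bB : forall N, \sum_(i < N) b i <= B).

Lemma parseval_cn f : L2 f -> ip f (fun=> 1) = 0 ->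
  (forall n, (lam n.+1 * ip f (cn n.+1)) ^+ 2 <= b n) ->
  exists u, [/\ continuous u, eqae L u f,
    forall N x, `|u x - psum L (fun n => cn n.+1) f N x| <= prem L b N &
    forall N, ip f f <= 2 / L * \sum_(i < N) ip f (cn i.+1) ^+ 2 + L * prem L b N ^+ 2].
Proof.
apply: (parseval L0 (e := fun n => cn n.+1) _ _ ip_cn b0 bB c1) => //.
- by move=> n; exact: continuous_cn.
- by move=> n x; exact: cn_le1.
- by move=> x; rewrite normr1.
- exact: ip_cn_1.
move=> h hh orth h1; apply: cosine_complete => // -[|n] //.
by rewrite -[RHS]h1; apply: eq_ip => // x _; rewrite cn_0.
Qed.

Lemma parseval_sn f : L2 f ->
  (forall n, (lam n.+1 * ip f (sn n.+1)) ^+ 2 <= b n) ->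
  exists u, [/\ continuous u, eqae L u f,
    forall N x, `|u x - psum L (fun n => sn n.+1) f N x| <= prem L b N &
    forall N, ip f f <= 2 / L * \sum_(i < N) ip f (sn i.+1) ^+ 2 + L * prem L b N ^+ 2].
Proof.
have z v : L2 v -> ip v (fun=> 0) = 0.
  by move=> hv; rewrite -[RHS](mul0r (ip v v)) -ipZr//; apply: eq_ip => // x _; rewrite mul0r.
move=> hf; apply: (parseval L0 (e := fun n => sn n.+1) _ _ ip_sn b0 bB c0) => //.
- by move=> n; exact: continuous_sn.
- by move=> n x; exact: sn_le1.
- by move=> x; rewrite normr0.
- by move=> n; apply: z; exact: L2_sn.
- move=> h hh orth _; apply: sine_complete => // -[|n] //.
  by rewrite -[RHS](z _ hh); apply: eq_ip => // x _; rewrite sn_0.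
- exact: z.
Qed.

End bounded_data.

Lemma bessel_cn f N : L2 f -> \sum_(i < N) ip f (cn i.+1) ^+ 2 <= L / 2 * ip f f.
Proof.
apply: (bessel L0 (e := fun n => cn n.+1) _ ip_cn).
by move=> n; exact: continuous_cn.
Qed.

Lemma bessel_sn f N : L2 f -> \sum_(i < N) ip f (sn i.+1) ^+ 2 <= L / 2 * ip f f.
Proof.
apply: (bessel L0 (e := fun n => sn n.+1) _ ip_sn).
by move=> n; exact: continuous_sn.
Qed.

End TrigSystems.

(** * Time regularity on the half line *)

Section HalfLine.
Variable R : realType.
Implicit Types (f : R -> R) (F : set_system R).

(** Limits relative to the half line with explicit neighbourhoods; at time 0
    they are one-sided. *)
Definition half_limit (P : R -> R -> Prop) (t : R) := forall e : R, 0 < e ->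
  exists2 d : R, 0 < d & forall s : R, 0 <= s -> `|s - t| < d -> P e s.

Definition half_cont f t := half_limit (fun e s => `|f s - f t| <= e) t.

Definition half_diff f t (q : R) :=
  half_limit (fun e s => s != t -> `|(s - t)^-1 * (f s - f t) - q| <= e) t.

Lemma half_continuous f : (forall t : R, 0 <= t -> half_cont f t) ->
  continuous (fun t => f (clamp t)).
Proof.
move=> H t; apply/cvgrPdist_le => e e0.
have [d d0 Hd] := H (clamp t) (clamp_ge0 t) e e0.
have c := @continuous_clamp R t; move/cvgrPdist_lt : c => /(_ _ d0); apply: filterS => s hs.
by rewrite distrC; apply: Hd; rewrite ?clamp_ge0// distrC.
Qed.

Lemma half_is_derive f (t q : R) : 0 < t -> half_diff f t q ->
  is_derive t 1 (fun t => f (clamp t)) q.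
Proof.
move=> t0 H.
have c : h^-1 *: (f (clamp (h *: 1 + t)) - f (clamp t)) @[h --> 0^'] --> q.
  apply/cvgrPdist_le => e e0; have [d d0 Hd] := H e e0.
  near=> h.
  have h0 : h != 0 by near: h; exact: nbhs_dnbhs_neq.
  have hd : `|h| < d by near: h; exact: dnbhs0_lt.
  have ht : `|h| < t by near: h; exact: dnbhs0_lt.
  have p : 0 <= h + t by have := ler_norm (- h); rewrite normrN => ?; lra.
  rewrite scaler1 (clamp_id (ltW t0)) (clamp_id p) distrC.
  have := Hd (h + t) p; rewrite addrK => /(_ hd); apply.
  by rewrite -subr_eq0 addrK.
apply: DeriveDef; first by apply/cvg_ex; exists q.
exact/cvg_lim.
Unshelve. all: by end_near. Qed.

Lemma half_diff_cont f (t q : R) : half_diff f t q -> half_cont f t.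
Proof.
move=> H e e0; have [d d0 Hd] := H 1 ltr01.
have m0 : 0 < e / (`|q| + 1) by rewrite divr_gt0// ltr_wpDl.
exists (Num.min d (e / (`|q| + 1))); first by rewrite lt_min d0.
move=> s s0; rewrite lt_min => /andP[h1 h2]; have [->|st] := eqVneq s t.
  by rewrite subrr normr0 ltW.
have b := Hd s s0 h1 st.
have st0 : s - t != 0 by rewrite subr_eq0.
rewrite (_ : f s - f t = (s - t) * ((s - t)^-1 * (f s - f t))); last by rewrite mulVKf.
rewrite normrM.
have b' : `|(s - t)^-1 * (f s - f t)| <= `|q| + 1.
  rewrite -[X in `|X|](subrK q); apply: (le_trans (ler_normD _ _)).
  by rewrite addrC lerD2l.
apply: (le_trans (ler_wpM2l (normr_ge0 _) b')).
by rewrite -ler_pdivlMr ?ltr_wpDl//; exact: ltW.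
Qed.

Lemma derivable_half_diff f (t : R) : derivable_half f t -> half_diff f t (deriv_half f t).
Proof.
move=> c e e0; move: c => /cvgrPdist_le /(_ _ e0).
move=> [d /= d0 H]; exists d => // s s0 sd st; rewrite distrC; apply: H => //=.
- by rewrite distrC.
- by rewrite in_itv /= andbT.
Qed.

Lemma half_diff_le0 f (t q : R) : 0 <= t -> nonincreasing_half f -> half_diff f t q -> q <= 0.
Proof.
move=> t0 H D; rewrite leNgt; apply/negP => q0.
have [d d0 Hd] := D (q / 2) (divr_gt0 q0 (ltr0n _ 2)).
have d2 : 0 < d / 2 by rewrite divr_gt0.
have := Hd (t + d / 2) (addr_ge0 t0 (ltW d2)).
rewrite addrAC subrr add0r gtr0_norm// => /(_ _ _) => h.
have {}h : `|(d / 2)^-1 * (f (t + d / 2) - f t) - q| <= q / 2.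
  apply: h; last by rewrite -subr_eq0 addrAC subrr add0r gt_eqF.
  by rewrite ltr_pdivrMr// ltr_pMr// ltr1n.
have n : (d / 2)^-1 * (f (t + d / 2) - f t) <= 0.
  rewrite pmulr_rle0 ?invr_gt0// subr_le0; apply: H => //.
  by rewrite lerDl ltW.
by move: h; rewrite ler_norml => /andP[h _]; lra.
Qed.

Lemma cvge0_lt (T : Type) (F : set_system T) {FF : Filter F} (f : T -> \bar R) (e : R) :
  f x @[x --> F] --> 0%E -> 0 < e -> \forall x \near F, (f x < e%:E)%E.
Proof.
move=> c e0; apply: (c [set y | (y < e%:E)%E]).
by apply: open_nbhs_nbhs; split; [exact: open_ereal_lt_ereal|rewrite /= lte_fin].
Qed.

End HalfLine.

Section Coefficients.
Variables (R : realType) (L : R).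
Hypothesis L0 : 0 < L.
Implicit Types (u : R -> R -> R) (th : R -> R).
Notation L2 := (L2 L).
Notation ip := (ip L).
Notation dt := (dt L).

(** The extension by constants to negative times makes the coefficients of a
    continuous map continuous on the whole line. *)
Definition coef u th (t : R) : R := ip (u (clamp t)) th.

Lemma coef_nonneg u th (t : R) : 0 <= t -> coef u th t = ip (u t) th.
Proof. by move=> t0; rewrite /coef clamp_id. Qed.

Lemma coef_continuous u th : C0_in L2 (L2norm L) u -> L2 th -> continuous (coef u th).
Proof.
move=> [Xu cu] hth; apply: (half_continuous (f := fun t => ip (u t) th)) => t t0 e e0.
pose K := Num.sqrt (ip th th); have K0 : 0 <= K by exact: sqrtr_ge0.
have K1 : 0 < K + 1 by rewrite ltr_wpDl.
have e1 : 0 < e / (K + 1) by rewrite divr_gt0.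
have := cvge0_lt (cu t t0) e1 => -[d /= d0 H]; exists d => // s s0 sd.
rewrite -ipBl; [|exact: Xu|exact: Xu|by []].
have := H s; rewrite /= distrC => /(_ sd); rewrite in_itv /= andbT => /(_ s0) h.
have := ip_le_norm (L2B (Xu s s0) (Xu t t0)) hth (ltW e1) (ltW h).
move=> /le_trans; apply; rewrite -/K mulrAC ler_pdivrMr//.
by apply: ler_wpM2l; [exact: ltW|rewrite lerDl].
Qed.

Lemma coef_C1half u th : C1_in L L2 (L2norm L) u -> L2 th ->
  C1half (coef u th) (coef (dt u) th).
Proof.
move=> [cu cdu du] hth; split; [exact: coef_continuous|exact: coef_continuous|].
move=> t t0; rewrite [coef (dt u) th t]coef_nonneg ?(ltW t0)//.
apply: (half_is_derive (f := fun t => ip (u t) th)) => // e e0.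
pose K := Num.sqrt (ip th th); have K0 : 0 <= K by exact: sqrtr_ge0.
have K1 : 0 < K + 1 by rewrite ltr_wpDl.
have e1 : 0 < e / (K + 1) by rewrite divr_gt0.
have t0' := ltW t0; have [Xu _] := cu; have [Xdu _] := cdu.
have := cvge0_lt (du t t0') e1 => -[d /= d0 H]; exists d => // s s0 sd st.
have := H s; rewrite /= distrC => /(_ sd); rewrite in_itv /= andbT => /(_ st s0) h.
have hB : L2 (fun x => u s x - u t x) by apply: L2B; exact: Xu.
have hd := Xdu t t0'.
have := ip_le_norm (L2B (L2Z (s - t)^-1 hB) hd) hth (ltW e1) (ltW h).
rewrite ipBl//; last exact: L2Z.
rewrite ipZl// ipBl//; [|exact: Xu|exact: Xu].
move=> /le_trans; apply; rewrite -/K mulrAC ler_pdivrMr//.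
by apply: ler_wpM2l; [exact: ltW|rewrite lerDl].
Qed.

End Coefficients.

(** * The modes of a strong solution *)

Section SecondOrder.
Variables (R : realType) (L : R).
Hypothesis L0 : 0 < L.
Implicit Types (v d : R -> R).
Notation L2 := (L2 L).
Notation H1 := (H1 L).
Notation H2 := (H2 L).
Notation H2s := (H2s L).
Notation ip := (ip L).
Notation dx := (dx L).
Notation lam := (lam L).
Notation sn := (sn L).
Notation cn := (cn L).

Let l1 : L2 (fun=> 1). Proof. by apply: continuous_L2; exact: cont_cst. Qed.

Let lcst (c : R) : L2 (fun=> c). Proof. by apply: continuous_L2; exact: cont_cst. Qed.

Lemma ip_1_1 : ip (fun=> 1) (fun=> 1) = L.
Proof.
rewrite /ip int_D_Iu//; last by ctn.
by rewrite -[RHS]mul1r -(Iu_cst 1 (ltW L0)); apply: eq_Iu => x _; rewrite mulr1.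
Qed.

Lemma lam_ip_cn_sqr d d' n : L2 d -> L2 d' -> is_weak_deriv L d d' ->
  (lam n * ip d (cn n)) ^+ 2 = ip d' (sn n) ^+ 2.
Proof. by move=> hd hd' w; rewrite (weak_ibp_sn L0 _ hd hd' w) sqrrN. Qed.

(** The Fourier series of an [H1] function converges uniformly, because its
    coefficients are those of the derivative divided by the frequency. *)
Lemma H1_continuous_rep d : H1 d -> exists2 u : R -> R, continuous u & eqae L u d.
Proof.
move=> hd; have [ld _] := hd; have [ld' w] := dxP hd.
pose m := ip d (fun=> 1) / L; pose d0 x := d x - m.
have ld0 : L2 d0 by exact: L2B.
have d01 : ip d0 (fun=> 1) = 0.
  rewrite ipBl// (_ : (fun=> m) = fun x => m * (fun=> 1) x); last by apply/funext => x; rewrite mulr1.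
  by rewrite ipZl// ip_1_1 /m divfK ?subrr// gt_eqF.
have d0c n : ip d0 (cn n.+1) = ip d (cn n.+1).
  have lc := L2_cn L n.+1.
  rewrite ipBl// (_ : (fun=> m) = fun x => m * (fun=> 1) x); last by apply/funext => x; rewrite mulr1.
  by rewrite ipZl// (ipC _ (fun=> 1)) ip_cn_1// mulr0 subr0.
have b n : (lam n.+1 * ip d0 (cn n.+1)) ^+ 2 <= ip (dx d) (sn n.+1) ^+ 2.
  by rewrite d0c (lam_ip_cn_sqr _ ld ld' w).
have [u [uc ud _ _]] := parseval_cn L0 (fun n => sqr_ge0 (ip (dx d) (sn n.+1)))
  (fun N => bessel_sn L0 N ld') ld0 d01 b.
exists (fun x => u x + m); first by apply: contD => //; exact: cont_cst.
by move: ud; apply: ae_imp => x h xD; rewrite h// /d0 subrK.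
Qed.

(** For this representative the boundary values that define [H2s] are limits at
    the endpoints, and the integration by parts against cosines applies. *)
Lemma H2_dx_continuous v : H2 v -> {within `[0, L], continuous (dx v)}.
Proof.
move=> [hv hdv]; have [u uc ud] := H1_continuous_rep hdv.
have uc' : {within `[0, L], continuous u} by exact: continuous_subspaceT.
exact: (dx_continuous hv uc' ud).
Qed.

Lemma ip_dxdx_cn v n : H2s v -> ip (dx (dx v)) (cn n) = lam n * ip (dx v) (sn n).
Proof.
move=> [hv v0 vL]; have [ld w] := dxP hv.2.
by apply: (weak_ibp_cn L0) => //; exact: H2_dx_continuous.
Qed.

Lemma eqae0_ip f th : L2 f -> L2 th -> eqae L f (cst 0) -> ip f th = 0.
Proof.
move=> hf hth h; have l0 : L2 (cst 0) := lcst 0.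
rewrite (eqae_ip hf l0 hth h) -[RHS](mul0r (ip th th)) -ipZl//.
by apply: eq_ip => // x _; rewrite mul0r.
Qed.

Lemma eqae_comb4 (a b c : R) u v z m th : L2 u -> L2 v -> L2 z -> L2 m -> L2 th ->
  eqae L (fun x => a * u x + b * v x + c * z x + m x) (cst 0) ->
  a * ip u th + b * ip v th + c * ip z th + ip m th = 0.
Proof.
move=> hu hv hz hm hth h.
have au := L2Z a hu; have bv := L2Z b hv; have cz := L2Z c hz.
have l2 := L2D au bv; have l3 := L2D l2 cz.
rewrite -(ipZl a hu hth) -(ipZl b hv hth) -(ipZl c hz hth) -(ipDl au bv hth).
rewrite -(ipDl l2 cz hth) -(ipDl l3 hm hth); apply: eqae0_ip h => //.
exact: L2D.
Qed.

End SecondOrder.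

Section ModeSystem.
Variables (R : realType) (L rho1 rho2 k1 k2 l : R) (g : R -> R) (phi psi w : R -> R -> R).
Hypothesis L0 : 0 < L.
Hypotheses (rphi : regular_phi L phi) (rpsi : regular_psi_w L psi) (rw : regular_psi_w L w)
  (eqs : forall t : R, 0 < t -> Bresse_equations L rho1 rho2 k1 k2 k1 l g phi psi w t).
Notation L2 := (L2 L).
Notation H1 := (H1 L).
Notation H2s := (H2s L).
Notation H1s := (H1s L).
Notation H10 := (H10 L).
Notation ip := (ip L).
Notation dx := (dx L).
Notation dt := (dt L).
Notation lam := (lam L).
Notation sn := (sn L).
Notation cn := (cn L).
Notation coef := (coef L).
Notation shear := (shear L l).
Notation axial := (axial L l).

Lemma phi_spaces (t : R) : 0 <= t ->
  [/\ H1 (phi t), H1 (dx (phi t)), H10 (phi t), H10 (dt phi t) & L2 (dt (dt phi) t)].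
Proof.
move=> t0; case: rphi => [[h _] [_ [h1 _] _] [_ [_ [h2 _] _]]].
have [[a b] c] := h t t0; split; [exact: a|exact: b|exact: c|exact: (h1 t t0)|exact: (h2 t t0)].
Qed.

Lemma psi_w_spaces u : regular_psi_w L u -> forall t : R, 0 <= t ->
  [/\ H2s (u t), H1s (u t), H1s (dt u t) & L2 (dt (dt u) t)].
Proof.
move=> [[h _] [_ [h1 _] _] [_ [_ [h2 _] _]]] t t0.
have [a b] := h t t0; split; [exact: a|exact: b|exact: (h1 t t0)|exact: (h2 t t0)].
Qed.

Lemma shear_H1 (t : R) : 0 <= t -> H1 (shear phi psi w t).
Proof.
move=> t0; have [_ h1 _ _ _] := phi_spaces t0.
have [_ [h2 _] _ _] := psi_w_spaces rpsi t0; have [_ [h3 _] _ _] := psi_w_spaces rw t0.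
by apply: H1D; [exact: H1D|exact: H1Z].
Qed.

Lemma axial_H1 (t : R) : 0 <= t -> H1 (axial phi w t).
Proof.
move=> t0; have [h1 _ _ _ _] := phi_spaces t0.
have [[[_ h3] _ _] _ _ _] := psi_w_spaces rw t0.
by apply: H1B => //; exact: H1Z.
Qed.

Lemma ip_shear_cn (t : R) n : 0 <= t ->
  ip (shear phi psi w t) (cn n) = shr l (lam n) (coef phi (sn n) t) (coef psi (cn n) t) (coef w (cn n) t).
Proof.
move=> t0; have [h0 h1 h2 _ _] := phi_spaces t0.
have [_ [[h3 _] _] _ _] := psi_w_spaces rpsi t0; have [_ [[h4 _] _] _ _] := psi_w_spaces rw t0.
have [h1' _] := h1; have lc := L2_cn L n.
rewrite /shear ipDl//; [|exact: L2D|exact: L2Z].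
by rewrite ipDl// ipZl// ip_dx_cn_H10// !coef_nonneg.
Qed.

Lemma ip_axial_sn (t : R) n : 0 <= t ->
  ip (axial phi w t) (sn n) = - axl l (lam n) (coef phi (sn n) t) (coef w (cn n) t).
Proof.
move=> t0; have [[h0 _] _ _ _ _] := phi_spaces t0.
have [[[h3 [h3' _]] _ _] _ _ _] := psi_w_spaces rw t0; have ls := L2_sn L n.
rewrite /axial ipBl//; last exact: L2Z.
by rewrite ipZl// ip_dx_sn// !coef_nonneg// /axl; ring.
Qed.

(** The boundary terms vanish for two different reasons, [w_x] being continuous
    and zero at the endpoints and phi being in [H10]. *)
Lemma ip_dx_axial_cn (t : R) n : 0 <= t -> ip (dx (axial phi w t)) (cn n) = lam n * ip (axial phi w t) (sn n).
Proof.
move=> t0; have [h0 _ h2 _ _] := phi_spaces t0; have [l0 _] := h0.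
have [hw2 _ _ _] := psi_w_spaces rw t0; have [[h3 h3'] _ _] := hw2.
have [d1 w1] := dxP (axial_H1 t0); have [d2 w2] := dxP h3'; have [d3 w3] := dxP h0.
have [l3 _] := h3'; have ls := L2_sn L n; have lc := L2_cn L n.
have w4 : is_weak_deriv L (axial phi w t) (fun x => dx (dx (w t)) x + - l * dx (phi t) x).
  have := weak_derivD l3 (L2Z (- l) l0) d2 (L2Z (- l) d3) w2 (weak_derivZ (- l) l0 d3 w3).
  by congr is_weak_deriv; apply/funext => x; rewrite /axial mulNr.
rewrite (weak_unique d1 (L2D d2 (L2Z (- l) d3)) w1 w4 (smooth_cn L n)).
have e1 := ip_dxdx_cn L0 n hw2; have e2 := ip_dx_cn_H10 L0 n h2.
have e3 := etrans (ipZl (- l) d3 lc) (congr1 ( *%R (- l)) e2).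
apply: (etrans (etrans (ipDl d2 (L2Z (- l) d3) lc) (congr2 +%R e1 e3))).
by rewrite /axial (ipBl l3 (L2Z l l0) ls) (ipZl l l0 ls); ring.
Qed.

Lemma ip_psi_xx_cn (t : R) n : 0 <= t ->
  ip (dx (dx (psi t))) (cn n) = - (lam n ^+ 2 * coef psi (cn n) t).
Proof.
move=> t0; have [h2 _ _ _] := psi_w_spaces rpsi t0.
have [[h1 _] _ _] := h2; rewrite ip_dxdx_cn// ip_dx_sn// coef_nonneg//; ring.
Qed.

Hypothesis gc : continuous (fun t => g (clamp t)).

(** The equations are tested against the mode; the characterization of the
    memory integral by duality gives directly the convolution of the
    coefficient. *)
Theorem mode_system n : modesol rho1 rho2 k1 k2 l (lam n) (fun t => g (clamp t))
  (coef phi (sn n)) (coef (dt phi) (sn n)) (coef (dt (dt phi)) (sn n))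
  (coef psi (cn n)) (coef (dt psi) (cn n)) (coef (dt (dt psi)) (cn n))
  (coef w (cn n)) (coef (dt w) (cn n)) (coef (dt (dt w)) (cn n)).
Proof.
have ls := L2_sn L n; have lc := L2_cn L n.
have C2 u th : C2_in L L2 (L2norm L) u -> L2 th ->
    C1half (coef u th) (coef (dt u) th) /\ C1half (coef (dt u) th) (coef (dt (dt u)) th).
  by move=> [h1 h2] hth; split; exact: coef_C1half.
have [_ _ cphi] := rphi; have [_ _ cpsi] := rpsi; have [_ _ cw] := rw.
split; [exact: C2|exact: C2|exact: C2|move=> t t0].
have t0' := ltW t0; have [_ h1 _ _ att] := phi_spaces t0'.
have [hpsi _ _ btt] := psi_w_spaces rpsi t0'; have [_ _ _ ctt] := psi_w_spaces rw t0'.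
have hs := shear_H1 t0'; have ha := axial_H1 t0'.
have [lsh _] := hs; have [lax _] := ha; have [dsh _] := dxP hs; have [dax _] := dxP ha.
have [[_ hpsi1] _ _] := hpsi; have [dpsi _] := dxP hpsi1.
have [e1 [m [lm hm] e2] e3] := eqs t0.
have S := ip_shear_cn n t0'; have A := ip_axial_sn n t0'.
have l0 : L2 (fun=> 0) by apply: continuous_L2; exact: cont_cst.
have z0 : ip (fun=> 0) (sn n) = 0 /\ ip (fun=> 0) (cn n) = 0.
  by split; apply: eqae0_ip => //; exact: aeW.
split.
- have := @eqae_comb4 _ _ rho1 (- k1) (- (l * k1)) _ _ _ _ _ att dsh lax l0 ls.
  rewrite z0.1 (ip_dx_sn L0 n hs) S A -(coef_nonneg L _ _ t0') => h.
  rewrite /eq_a -[RHS]h; first by ring.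
  by apply: ae_imp e1 => x h' xD; rewrite -[RHS](h' xD); ring.
- have := @eqae_comb4 _ _ rho2 (- k2) k1 _ _ _ _ _ btt dpsi lsh lm lc.
  rewrite ip_psi_xx_cn// S -(coef_nonneg L _ _ t0') => h.
  have hmE : ip m (cn n) = - (lam n ^+ 2 * conv (fun t => g (clamp t)) (coef psi (cn n)) t).
    have [[cc _ _] _] := C2 _ _ cpsi lc; have gr := @continuous_rev R _ t gc.
    rewrite /ip (hm _ lc) convC// /conv -mulNr -IuZ; last exact: continuousMf.
    apply: eq_Rintegral => s; rewrite inE /= in_itv /= => /andP[s0 st].
    have [[[_ hs21] _ _] _ _ _] := psi_w_spaces rpsi s0; have [ds _] := dxP hs21.
    have st0 : 0 <= t - s by rewrite subr_ge0.
    rewrite (clamp_id st0); transitivity (g (t - s) * ip (dx (dx (psi s))) (cn n)).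
      exact: (ipZl (g (t - s)) ds lc).
    by rewrite ip_psi_xx_cn//; ring.
  rewrite /eq_b -[RHS]h ?hmE; first by ring.
  by apply: ae_imp e2 => x h' xD; rewrite -[RHS](h' xD); ring.
- have := @eqae_comb4 _ _ rho1 (- k1) (l * k1) _ _ _ _ _ ctt dax lsh l0 lc.
  rewrite z0.2 ip_dx_axial_cn// S A -(coef_nonneg L _ _ t0') => h.
  rewrite /eq_c -[RHS]h; first by ring.
  by apply: ae_imp e3 => x h' xD; rewrite -[RHS](h' xD); ring.
Qed.

End ModeSystem.

Section UniformLimits.
Variable R : realType.
Implicit Types (f : R -> R) (n N : nat).

Lemma Iu_sum (F : nat -> R -> R) N (t : R) : (forall n, continuous (F n)) ->
  Iu (fun s => \sum_(i < N) F i s) t = \sum_(i < N) Iu (F i) t.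
Proof.
move=> Fc; elim: N => [|N ih].
  rewrite big_ord0; transitivity (Iu (fun=> 0 * (0 : R)) t).
    by apply: eq_Iu => s _; rewrite big_ord0 mulr0.
  by rewrite IuZ ?mul0r//; exact: cont_cst.
rewrite big_ord_recr /= -ih -IuD //; last exact: cont_sum.
by apply: eq_Iu => s _; rewrite big_ord_recr.
Qed.

Lemma cvg_comb (a1 a2 a3 a4 a5 a6 : R) (u1 u2 u3 u4 u5 u6 u7 : nat -> R) :
  u1 N @[N --> \oo] --> (0 : R) -> u2 N @[N --> \oo] --> (0 : R) ->
  u3 N @[N --> \oo] --> (0 : R) -> u4 N @[N --> \oo] --> (0 : R) ->
  u5 N @[N --> \oo] --> (0 : R) -> u6 N @[N --> \oo] --> (0 : R) ->
  u7 N @[N --> \oo] --> (0 : R) ->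
  2^-1 * (a1 * u1 N + a2 * u2 N + a3 * u3 N + a4 * u4 N + a5 * u5 N + a6 * u6 N)
    + 2^-1 * u7 N @[N --> \oo] --> (0 : R).
Proof.
move=> h1 h2 h3 h4 h5 h6 h7.
have z (a : R) (u : nat -> R) : u N @[N --> \oo] --> (0 : R) -> a * u N @[N --> \oo] --> (0 : R).
  by move=> hu; rewrite -(mulr0 a); apply: cvgM => //; exact: cvg_cst.
have s (u v : nat -> R) : u N @[N --> \oo] --> (0 : R) -> v N @[N --> \oo] --> (0 : R) ->
    u N + v N @[N --> \oo] --> (0 : R).
  by move=> hu hv; rewrite -(addr0 0); exact: cvgD.
apply: (s); last exact: z.
by apply: (z); do 5!(apply: (s); last exact: (z)); exact: (z).
Qed.

Lemma le_comb (q a1 a2 a3 a4 a5 a6 v1 v2 v3 v4 v5 v6 v7 s1 s2 s3 s4 s5 s6 s7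
    e1 e2 e3 e4 e5 e6 e7 : R) :
  0 <= a1 -> 0 <= a2 -> 0 <= a3 -> 0 <= a4 -> 0 <= a5 -> 0 <= a6 ->
  v1 <= q * s1 + e1 -> v2 <= q * s2 + e2 -> v3 <= q * s3 + e3 -> v4 <= q * s4 + e4 ->
  v5 <= q * s5 + e5 -> v6 <= q * s6 + e6 -> v7 <= q * s7 + e7 ->
  2^-1 * (a1 * v1 + a2 * v2 + a3 * v3 + a4 * v4 + a5 * v5 + a6 * v6) + 2^-1 * v7 <=
  q * (2^-1 * (a1 * s1 + a2 * s2 + a3 * s3 + a4 * s4 + a5 * s5 + a6 * s6 + s7))
  + (2^-1 * (a1 * e1 + a2 * e2 + a3 * e3 + a4 * e4 + a5 * e5 + a6 * e6) + 2^-1 * e7).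
Proof.
move=> p1 p2 p3 p4 p5 p6 /(ler_wpM2l p1) h1 /(ler_wpM2l p2) h2 /(ler_wpM2l p3) h3.
move=> /(ler_wpM2l p4) h4 /(ler_wpM2l p5) h5 /(ler_wpM2l p6) h6 h7.
have half0 : 0 <= 2^-1 :> R by [].
have hh := lerD (ler_wpM2l half0 (lerD (lerD (lerD (lerD (lerD h1 h2) h3) h4) h5) h6))
  (ler_wpM2l half0 h7).
by apply: (le_trans hh); rewrite le_eqVlt; apply/orP; left; apply/eqP; ring.
Qed.

Variable L : R.
Hypothesis L0 : 0 < L.

(** Two continuous functions that differ at a point differ on an interval. *)
Lemma eqae_continuous f u : {within `[0, L], continuous f} -> {within `[0, L], continuous u} ->
  eqae L u f -> forall x : R, 0 < x < L -> u x = f x.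
Proof.
move=> fc uc h x xD; apply/eqP; apply: contrapT => /negP ux.
have [fi _ _] := (continuous_within_itvP f L0).1 fc.
have [ui _ _] := (continuous_within_itvP u L0).1 uc.
have xi : x \in `]0, L[ by rewrite in_itv /=.
pose e := `|u x - f x| / 3; have e0 : 0 < e by rewrite divr_gt0// normr_gt0 subr_eq0.
have nD : \forall y \near x, y \in `]0, L[ by exact: near_in_itvoo.
have := filterI (filterI ((cvgrPdist_le _ _).1 (fi x xi) _ e0) ((cvgrPdist_le _ _).1 (ui x xi) _ e0)) nD.
move=> [d /= d0 H].
have ne (y : R) : x <= y -> y < x + d -> (y \in `]0, L[) /\ (u y != f y).
  move=> y1 y2; have [|[h1 h2] h3] := H y.
    by rewrite /= distrC ger0_norm ?subr_ge0//; lra.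
  split => //; apply/eqP => uf; rewrite uf in h2.
  have : `|u x - f x| <= e + e.
    rewrite (_ : u x - f x = (u x - f y) - (f x - f y)); last by ring.
    by apply: (le_trans (ler_normB _ _)); exact: lerD.
  have : `|u x - f x| = e + e + e by rewrite /e; field.
  by lra.
have [A [mA A0 hA]] := h.
have sub : `[x, x + d[%classic `<=` A.
  move=> y; rewrite /= in_itv /= => /andP[y1 y2]; apply: hA => /= hy.
  by have [yD /eqP] := ne y y1 y2; apply; exact: hy.
have : (lebesgue_measure (`[x, (x + d)%R[%classic : set R) <= lebesgue_measure A)%E.
  by apply: le_measure => //; rewrite inE.
rewrite A0 lebesgue_measure_itv /= lte_fin ltrDl d0 -EFinB lee_fin addrAC subrr add0r.
by rewrite leNgt d0.
Qed.

End UniformLimits.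

(** * The energy is bounded by the energies of the modes *)

Section MemoryEnergy.
Variables (R : realType) (L : R).
Hypothesis L0 : 0 < L.
Notation mu := (@lebesgue_measure R).
Notation D := (`]0, L[%classic : set (measurableTypeR R)).
Notation L2 := (L2 L).
Notation ip := (ip L).
Notation lam := (lam L).
Notation sn := (sn L).
Notation coef := (coef L).
Implicit Types (n N i j : nat).

Variables (f : R -> R -> R) (b : nat -> R) (B : R).
Hypotheses (f2 : forall s : R, 0 <= s -> L2 (f s))
  (fc : forall s : R, 0 <= s -> {within `[0, L], continuous (f s)})
  (coefc : forall n, continuous (coef f (sn n)))
  (b0 : forall n, 0 <= b n) (bB : forall N, \sum_(i < N) b i <= B)
  (fb : forall (s : R) n, 0 <= s -> (lam n.+1 * ip (f s) (sn n.+1)) ^+ 2 <= b n).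

Variables (g : R -> R) (K T : R).
Hypotheses (gc : continuous g) (g0 : forall t, 0 <= g t) (T0 : 0 <= T) (gK : Iu g T <= K).

Let p := prem L b.
Let p0 N : 0 <= p N. Proof. exact: (prem_ge0 L0 b0 bB). Qed.
Let pc : p N @[N --> \oo] --> (0 : R). Proof. exact: (prem_cvg L0 b0 bB). Qed.

Let P N (s x : R) : R := \sum_(i < N) 2 / L * coef f (sn i.+1) s * sn i.+1 x.

Let U_ex : exists U : R -> R -> R, forall s : R, [/\ continuous (U s),
   forall x : R, 0 < x < L -> U s x = f (clamp s) x & forall N x, `|U s x - P N s x| <= p N].
Proof.
have /choice[U HU] : forall s : R, exists u : R -> R, [/\ continuous u,
   forall x : R, 0 < x < L -> u x = f (clamp s) x & forall N x, `|u x - P N s x| <= p N].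
  move=> s; have s0 := clamp_ge0 s.
  have [u [uc uf uP _]] := parseval_sn L0 b0 bB (f2 s0) (fun n => fb n s0).
  exists u; split => //; apply: (eqae_continuous L0 (fc s0) _ uf).
  exact: continuous_subspaceT.
by exists U.
Qed.

Let q N := 2 * p N * (4 * p 0 + 2 * p N).

Let q_cvg : q N @[N --> \oo] --> (0 : R).
Proof.
have -> : 0 = 2 * 0 * (4 * p 0 + 2 * 0) :> R by rewrite mulr0 mul0r.
apply: cvgM; first by apply: cvgM => //; exact: cvg_cst.
by apply: cvgD; [exact: cvg_cst|apply: cvgM => //; exact: cvg_cst].
Qed.

Let WN N (s x : R) := P N T x - P N s x.

Let JN N x := Iu (fun s => g (T - s) * WN N s x ^+ 2) T.

Let al i (s : R) : R := 2 / L * (coef f (sn i.+1) T - coef f (sn i.+1) s).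

Let alc i : continuous (al i).
Proof. by have := @coefc i.+1 => c; rewrite /al; ctn. Qed.

Let gr : continuous (fun s : R => g (T - s)). Proof. exact: continuous_rev. Qed.

Let m i j := Iu (fun s => g (T - s) * (al i s * al j s)) T.

Let JN_E N x : JN N x = \sum_(i < N) (\sum_(j < N) m i j * sn j.+1 x) * sn i.+1 x.
Proof.
rewrite /JN (@eq_Iu _ _ (fun s => \sum_(i < N) \sum_(j < N)
   (sn j.+1 x * sn i.+1 x) * (g (T - s) * (al i s * al j s)))); last first.
  move=> s _; have -> : WN N s x = \sum_(i < N) al i s * sn i.+1 x.
    by rewrite /WN /P -sumrB; apply: eq_bigr => i _; rewrite /al; ring.
  rewrite expr2 big_distrlr /= mulr_sumr; apply: eq_bigr => i _.
  by rewrite mulr_sumr; apply: eq_bigr => j _; ring.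
have c i j : continuous (fun s => g (T - s) * (al i s * al j s)).
  by have := @alc i; have := @alc j; have := gr => ? ? ?; ctn.
have c' i j : continuous (fun s => (sn j.+1 x * sn i.+1 x) * (g (T - s) * (al i s * al j s))).
  by apply: continuousMf; [exact: cont_cst|exact: c].
rewrite (Iu_sum _ _ (F := fun i s => \sum_(j < N) (sn j.+1 x * sn i.+1 x) * (g (T - s) * (al i s * al j s)))); last first.
  by move=> i; apply: (@cont_sum _ (fun j s => (sn j.+1 x * sn i.+1 x) * (g (T - s) * (al i s * al j s)))) => j; exact: c'.
apply: eq_bigr => i _.
rewrite (Iu_sum _ _ (F := fun j s => (sn j.+1 x * sn i.+1 x) * (g (T - s) * (al i s * al j s)))); last by move=> j; exact: c'.
by rewrite mulr_suml; apply: eq_bigr => j _; rewrite IuZ// /m; ring.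
Qed.

Let mc i N : continuous (fun x => \sum_(j < N) m i j * sn j.+1 x).
Proof.
apply: (@cont_sum _ (fun j x => m i j * sn j.+1 x)) => j.
by apply: continuousMf; [exact: cont_cst|exact: continuous_sn].
Qed.

Let JNc N : continuous (JN N).
Proof.
have -> : JN N = fun x => \sum_(i < N) (\sum_(j < N) m i j * sn j.+1 x) * sn i.+1 x.
  by apply/funext => x; exact: JN_E.
apply: (@cont_sum _ (fun i x => (\sum_(j < N) m i j * sn j.+1 x) * sn i.+1 x)) => i.
by apply: continuousMf; [exact: mc|exact: continuous_sn].
Qed.

Let int_JN N : \int[mu]_(x in D) JN N x =
  2 / L * \sum_(i < N) Iu (fun s => g (T - s) * (coef f (sn i.+1) T - coef f (sn i.+1) s) ^+ 2) T.
Proof.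
have l1 : L2 (fun=> 1) by apply: continuous_L2; exact: cont_cst.
transitivity (ip (fun x => \sum_(i < N) (\sum_(j < N) m i j * sn j.+1 x) * sn i.+1 x) (fun=> 1)).
  by apply: eq_Rintegral => x _; rewrite JN_E mulr1.
rewrite (@ip_suml _ _ N (fun i x => (\sum_(j < N) m i j * sn j.+1 x) * sn i.+1 x))//; last first.
  by move=> i; apply: continuous_L2; apply: continuousMf; [exact: mc|exact: continuous_sn].
rewrite mulr_sumr; apply: eq_bigr => i _.
transitivity (ip (fun x => \sum_(j < N) m i j * sn j.+1 x) (sn i.+1)).
  by apply: eq_Rintegral => x _; rewrite mulr1.
rewrite (@ip_suml _ _ N (fun j x => m i j * sn j.+1 x)); [|by move=> j; apply: L2Z; exact: L2_sn|exact: L2_sn].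
rewrite (bigD1 i)//= big1 ?addr0; last first.
  move=> j ji; rewrite ipZl; [|exact: L2_sn|exact: L2_sn].
  by rewrite ip_sn// (_ : (val j == val i) = false) ?mulr0//; exact/negbTE.
rewrite ipZl; [|exact: L2_sn|exact: L2_sn].
rewrite ip_sn// eqxx /m.
rewrite (@eq_Iu _ _ (fun s => (2 / L) ^+ 2 * (g (T - s) * (coef f (sn i.+1) T - coef f (sn i.+1) s) ^+ 2))).
  rewrite IuZ; first by field; rewrite gt_eqF.
  by have := @coefc i.+1; have := gr => ? ?; ctn.
by move=> s _; rewrite /al; ring.
Qed.

(** The integrand is approximated by trigonometric sums [P N], uniformly in space
    and time, for which the double integral is a finite sum that orthogonality
    computes. In this way the two integrals are never exchanged. *)
Lemma memory_le_modes : exists2 r : nat -> R, r N @[N --> \oo] --> (0 : R) & forall N,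
  \int[mu]_(x in D) \int[mu]_(s in `[0, T]) (g (T - s) * (f T x - f s x) ^+ 2) <=
  2 / L * \sum_(i < N) Iu (fun s => g (T - s) * (coef f (sn i.+1) T - coef f (sn i.+1) s) ^+ 2) T
  + r N.
Proof.
have [U HU] := U_ex.
have UP N s x : `|U s x - P N s x| <= p N by have [_ _ ->] := HU s.
have PC N x : continuous (fun s => P N s x).
  apply: (@cont_sum _ (fun i s => 2 / L * coef f (sn i.+1) s * sn i.+1 x)) => i.
  by have := @coefc i.+1 => c; ctn.
have Us x : continuous (fun s => U s x).
  exact: (uniform_limit_continuous (fun N => PC N x) (fun N s => UP N s x)).
have Ub s x : `|U s x| <= p 0 by have := UP 0%N s x; rewrite /P big_ord0 subr0.
pose W s x := U T x - U s x.
have WW N s x : `|W s x ^+ 2 - WN N s x ^+ 2| <= q N.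
  have h1 : `|W s x - WN N s x| <= 2 * p N.
    rewrite (_ : _ - _ = (U T x - P N T x) - (U s x - P N s x)); last by rewrite /W /WN; ring.
    by apply: (le_trans (ler_normB _ _)); rewrite mulr_natl mulr2n lerD.
  have h2 : `|W s x| <= 2 * p 0.
    by apply: (le_trans (ler_normB _ _)); rewrite mulr_natl mulr2n lerD.
  rewrite (_ : _ - _ = (W s x - WN N s x) * (2 * W s x - (W s x - WN N s x))); last by ring.
  rewrite normrM /q; apply: ler_pM => //; apply: (le_trans (ler_normB _ _)); apply: lerD => //.
  by rewrite normrM ger0_norm// (_ : 4 * p 0 = 2 * (2 * p 0)) ?ler_wpM2l//; ring.
have Wc x : continuous (W^~ x).
  by apply: contD; [exact: cont_cst|apply: contN; exact: Us].
have WNc N x : continuous (WN N^~ x).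
  by apply: contD; [exact: cont_cst|apply: contN; exact: PC].
pose J x := Iu (fun s => g (T - s) * W s x ^+ 2) T.
have q0 N : 0 <= q N by apply: le_trans (WW N 0 0); exact: normr_ge0.
have Kq N : Iu (fun s => q N * g (T - s)) T <= K * q N.
  by rewrite IuZ// Iu_rev// mulrC ler_wpM2r.
have step N (h h' : R -> R) : continuous h -> continuous h' ->
    (forall s, `|h s ^+ 2 - h' s ^+ 2| <= q N) ->
    Iu (fun s => g (T - s) * h s ^+ 2) T <= Iu (fun s => g (T - s) * h' s ^+ 2) T + K * q N.
  move=> hc h'c hh; apply: le_trans (lerD (lexx _) (Kq N)); rewrite -IuD; [|by ctn|by ctn].
  apply: Iu_le; [by ctn|by ctn|move=> s _].
  rewrite [q N * _]mulrC -mulrDr; apply: ler_wpM2l => //.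
  by have := hh s; rewrite ler_norml => /andP[_ ?]; rewrite -lerBlDl.
have JJ N x : `|J x - JN N x| <= K * q N.
  rewrite ler_norml; apply/andP; split; last first.
    by rewrite lerBlDl; apply: step => // s; exact: WW.
  rewrite lerBrDl lerBlDr; apply: step => // s.
  by rewrite distrC; exact: WW.
have Jc : continuous J.
  apply: (uniform_limit_continuous JNc JJ); rewrite -(mulr0 K).
  by apply: cvgM; [exact: cvg_cst|exact: q_cvg].
exists (fun N => L * (K * q N)).
  rewrite -(mulr0 L) -(mulr0 K); apply: cvgM; first exact: cvg_cst.
  by apply: cvgM; [exact: cvg_cst|exact: q_cvg].
move=> N; rewrite -int_JN.
have -> : \int[mu]_(x in D) \int[mu]_(s in `[0, T]) (g (T - s) * (f T x - f s x) ^+ 2) =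
    \int[mu]_(x in D) J x.
  apply: eq_Rintegral => x; rewrite inE /= in_itv /= => xD.
  apply: eq_Rintegral => s; rewrite inE /= in_itv /= => /andP[s0 sT].
  have [_ e1 _] := HU T; have [_ e2 _] := HU s.
  by rewrite /W e1// e2// !clamp_id.
have -> : L * (K * q N) = \int[mu]_(_ in D) (K * q N).
  by rewrite int_D_Iu ?Iu_cst ?(ltW L0) 1?mulrC//; exact: cont_cst.
have i h : continuous h -> mu.-integrable D (EFin \o h) by exact: continuous_integrable_D.
rewrite -RintegralD//; [|exact/i/JNc|by apply: i; exact: cont_cst].
apply: le_Rintegral => //; [exact: i|by apply: i; apply: contD; [exact: JNc|exact: cont_cst]|].
move=> x _; have := JJ N x; rewrite ler_norml => /andP[_ ?]; by rewrite -lerBlDl.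
Qed.

End MemoryEnergy.

Section EnergyModes.
Variables (R : realType) (L rho1 rho2 k1 k2 l : R) (g g1 : R -> R) (phi psi w : R -> R -> R).
Hypotheses (L0 : 0 < L) (r1p : 0 < rho1) (r2p : 0 < rho2) (k1p : 0 < k1) (k2p : 0 < k2)
  (lp : 0 < l) (lmu : l <= pi / L / 2).
Hypotheses (rphi : regular_phi L phi) (rpsi : regular_psi_w L psi) (rw : regular_psi_w L w)
  (eqs : forall t : R, 0 < t -> Bresse_equations L rho1 rho2 k1 k2 k1 l g phi psi w t).
Variable kap : R.
Notation gh := (fun t => g (clamp t)).
Hypotheses (kapp : 0 < kap) (kg : kernel gh g1)
  (gkap : forall t : R, 0 <= t -> kap <= k2 - Iu gh t).
Notation mu := (@lebesgue_measure R).
Notation D := (`]0, L[%classic : set (measurableTypeR R)).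
Notation L2 := (L2 L).
Notation H1 := (H1 L).
Notation H2 := (H2 L).
Notation H2s := (H2s L).
Notation H1s := (H1s L).
Notation H10 := (H10 L).
Notation ip := (ip L).
Notation dx := (dx L).
Notation dt := (dt L).
Notation lam := (lam L).
Notation sn := (sn L).
Notation cn := (cn L).
Notation coef := (coef L).
Implicit Types (n N i : nat).

Let mD : measurable D. Proof. exact: measurable_itv. Qed.

Let ghc : continuous gh. Proof. by case: kg. Qed.
Let gh0 (t : R) : 0 <= gh t. Proof. by case: kg. Qed.

Definition mode_En n (t : R) : R := En rho1 rho2 k1 k2 l (lam n) gh
  (coef phi (sn n)) (coef (dt phi) (sn n)) (coef psi (cn n)) (coef (dt psi) (cn n))
  (coef w (cn n)) (coef (dt w) (cn n)) t.

Definition mode_data n : R := data (lam n)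
  (coef phi (sn n)) (coef (dt phi) (sn n)) (coef psi (cn n)) (coef (dt psi) (cn n))
  (coef w (cn n)) (coef (dt w) (cn n)).

Let sol n := mode_system L0 rphi rpsi rw eqs ghc n.

Lemma mode_data_sum phi0 phi1 psi0 psi1 w0 w1 N :
  Bresse_initial L phi0 phi1 psi0 psi1 w0 w1 phi psi w ->
  (H2 `&` H10) phi0 -> H10 phi1 -> (H2s `&` H1s) psi0 -> H1s psi1 -> (H2s `&` H1s) w0 -> H1s w1 ->
  \sum_(i < N) mode_data i.+1 <= L / 2 *
    (ip (dx (dx phi0)) (dx (dx phi0)) + ip (dx (dx psi0)) (dx (dx psi0)) + ip (dx (dx w0)) (dx (dx w0))
     + ip (dx phi1) (dx phi1) + ip (dx psi1) (dx psi1) + ip (dx w1) (dx w1)).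
Proof.
move=> [[p0 p1] [s0 s1] [v0 v1]] [[hp0 hp0'] hp0z] hp1 [hs0 hs0'] hs1 [hw0 hw0'] hw1.
have lex0 : 0 <= (0 : R) by [].
have [[lphi _] _ _ [[ldphi _] _] _] := phi_spaces rphi lex0.
have [_ [[lpsi _] _] [[ldpsi _] _] _] := psi_w_spaces rpsi lex0.
have [_ [[lw _] _] [[ldw _] _] _] := psi_w_spaces rw lex0.
have [lphi0 _] := hp0; have [[lphi1 _] _] := hp1.
have [[[lpsi0 _] _] [[lpsi1 _] _]] := (hs0', hs1).
have [[[lw0 _] _] [[lw1 _] _]] := (hw0', hw1).
have [dp0 _] := dxP hp0'; have [hp1' _] := hp1; have [dp1 _] := dxP hp1'.
have [[_ hs0x] _ _] := hs0; have [ds0 _] := dxP hs0x; have [hs1' _] := hs1; have [ds1 _] := dxP hs1'.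
have [[_ hw0x] _ _] := hw0; have [dw0 _] := dxP hw0x; have [hw1' _] := hw1; have [dw1 _] := dxP hw1'.
have E i : mode_data i.+1 = ip (dx (dx phi0)) (sn i.+1) ^+ 2 + ip (dx (dx psi0)) (cn i.+1) ^+ 2
   + ip (dx (dx w0)) (cn i.+1) ^+ 2 + ip (dx phi1) (cn i.+1) ^+ 2
   + ip (dx psi1) (sn i.+1) ^+ 2 + ip (dx w1) (sn i.+1) ^+ 2.
  have ls := L2_sn L i.+1; have lc := L2_cn L i.+1.
  rewrite /mode_data /data !(coef_nonneg L _ _ lex0).
  rewrite (eqae_ip lphi lphi0 ls p0) (eqae_ip ldphi lphi1 ls p1).
  rewrite (eqae_ip lpsi lpsi0 lc s0) (eqae_ip ldpsi lpsi1 lc s1).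
  rewrite (eqae_ip lw lw0 lc v0) (eqae_ip ldw lw1 lc v1).
  have [[hs0H _] _ _] := hs0; have [[hw0H _] _ _] := hw0.
  have e1 := ip_dx_sn L0 i.+1 hp0'; have e2 := ip_dx_cn_H10 L0 i.+1 hp0z.
  have e3 := ip_dx_cn_H10 L0 i.+1 hp1; have e4 := ip_dxdx_cn L0 i.+1 hs0.
  have e5 := ip_dxdx_cn L0 i.+1 hw0; have e6 := ip_dx_sn L0 i.+1 hs0H.
  have e7 := ip_dx_sn L0 i.+1 hw0H; have e8 := ip_dx_sn L0 i.+1 hs1'.
  have e9 := ip_dx_sn L0 i.+1 hw1'.
  have alg (la a0 a1 b c0 c1 y0 y1 z0 z1 x1 x2 x3 x4 x5 x6 : R) :
      x1 = - (la * y0) -> y0 = la * a0 -> x4 = la * a1 -> x2 = la * y1 -> x3 = la * z0 ->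
      y1 = - (la * b) -> z0 = - (la * c0) -> x5 = - (la * c1) -> x6 = - (la * z1) ->
      la ^+ 4 * (a0 ^+ 2 + b ^+ 2 + c0 ^+ 2) + la ^+ 2 * (a1 ^+ 2 + c1 ^+ 2 + z1 ^+ 2) =
      x1 ^+ 2 + x2 ^+ 2 + x3 ^+ 2 + x4 ^+ 2 + x5 ^+ 2 + x6 ^+ 2.
    by move=> -> -> -> -> -> -> -> -> ->; ring.
  exact: (alg _ _ _ _ _ _ _ _ _ _ _ _ _ _ _ _ e1 e2 e3 e4 e5 e6 e7 e8 e9).
under eq_bigr => i _ do rewrite E.
rewrite !big_split /= !mulrDr.
by do ?apply: lerD; [exact: bessel_sn|exact: bessel_cn|exact: bessel_cn|exact: bessel_cn|exact: bessel_sn|exact: bessel_sn].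
Qed.

(** An [H^1] bound makes the Parseval inequality quantitative. *)
Lemma parseval_H1 v : H1 v -> ip v (fun=> 1) = 0 ->
  exists2 r : nat -> R, r N @[N --> \oo] --> (0 : R) & forall N,
  ip v v <= 2 / L * \sum_(i < N) ip v (cn i.+1) ^+ 2 + r N.
Proof.
move=> hv v1; have [lv _] := hv; have [ld wd] := dxP hv.
have b n : (lam n.+1 * ip v (cn n.+1)) ^+ 2 <= ip (dx v) (sn n.+1) ^+ 2.
  by rewrite (lam_ip_cn_sqr L0 _ lv ld wd).
have b0 n : 0 <= ip (dx v) (sn n.+1) ^+ 2 by exact: sqr_ge0.
have bB N := bessel_sn L0 N ld.
have [u [_ _ _ H]] := parseval_cn L0 b0 bB lv v1 b.
exists (fun N => L * prem L (fun n => ip (dx v) (sn n.+1) ^+ 2) N ^+ 2); last exact: H.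
have c := prem_cvg L0 b0 bB.
by rewrite -(mulr0 L) -(mulr0 0); apply: cvgM; [exact: cvg_cst|exact: cvgM].
Qed.

Lemma parseval_sine v d : L2 v -> L2 d -> (forall n, ip d (cn n) = lam n * ip v (sn n)) ->
  exists2 r : nat -> R, r N @[N --> \oo] --> (0 : R) & forall N,
  ip v v <= 2 / L * \sum_(i < N) ip v (sn i.+1) ^+ 2 + r N.
Proof.
move=> lv ld E.
have b n : (lam n.+1 * ip v (sn n.+1)) ^+ 2 <= ip d (cn n.+1) ^+ 2 by rewrite E.
have b0 n : 0 <= ip d (cn n.+1) ^+ 2 by exact: sqr_ge0.
have bB N := bessel_cn L0 N ld.
have [u [_ _ _ H]] := parseval_sn L0 b0 bB lv b.
exists (fun N => L * prem L (fun n => ip d (cn n.+1) ^+ 2) N ^+ 2); last exact: H.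
have c := prem_cvg L0 b0 bB.
by rewrite -(mulr0 L) -(mulr0 0); apply: cvgM; [exact: cvg_cst|exact: cvgM].
Qed.

Lemma int_comb6 (a1 a2 a3 a4 a5 a6 : R) u1 u2 u3 u4 u5 u6 :
  L2 u1 -> L2 u2 -> L2 u3 -> L2 u4 -> L2 u5 -> L2 u6 ->
  \int[mu]_(x in D) (a1 * u1 x ^+ 2 + a2 * u2 x ^+ 2 + a3 * u3 x ^+ 2 + a4 * u4 x ^+ 2
    + a5 * u5 x ^+ 2 + a6 * u6 x ^+ 2) =
  a1 * ip u1 u1 + a2 * ip u2 u2 + a3 * ip u3 u3 + a4 * ip u4 u4 + a5 * ip u5 u5 + a6 * ip u6 u6.
Proof.
move=> h1 h2 h3 h4 h5 h6.
have i u (a : R) : L2 u -> mu.-integrable D (EFin \o (fun x => a * u x ^+ 2)).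
  by move=> /L2P[_ iu]; exact: (integrableZl mD a iu).
have e u (a : R) : L2 u -> \int[mu]_(x in D) (a * u x ^+ 2) = a * ip u u.
  by move=> /L2P[_ iu]; rewrite RintegralZl.
have j12 := integrableD mD (i _ a1 h1) (i _ a2 h2).
have j3 := integrableD mD j12 (i _ a3 h3); have j4 := integrableD mD j3 (i _ a4 h4).
have j5 := integrableD mD j4 (i _ a5 h5).
rewrite (RintegralD mD j5 (i _ a6 h6)) (RintegralD mD j4 (i _ a5 h5)).
rewrite (RintegralD mD j3 (i _ a4 h4)) (RintegralD mD j12 (i _ a3 h3)).
by rewrite (RintegralD mD (i _ a1 h1) (i _ a2 h2)) !e.
Qed.

Section at_time.
Variables (C K T : R).
Hypotheses (T0 : 0 <= T) (C0 : 0 <= C) (dataK : forall N, \sum_(i < N) mode_data i.+1 <= K)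
  (Cb : forall n (t : R), 0 <= t -> (lam n.+1 ^+ 2 * coef psi (cn n.+1) t) ^+ 2 <= C * mode_data n.+1).

Lemma memory_energy_le : exists2 r : nat -> R, r N @[N --> \oo] --> (0 : R) & forall N,
  memory L g (fun s => dx (psi s)) T <=
  2 / L * \sum_(i < N) lam i.+1 ^+ 2 * mem2 gh (coef psi (cn i.+1)) T + r N.
Proof.
have spc (s : R) : 0 <= s -> H2s (psi s) by move=> s0; have [] := psi_w_spaces rpsi s0.
have f2 (s : R) : 0 <= s -> L2 (dx (psi s)) by move=> /spc [[_ [h _]] _ _].
have fc (s : R) : 0 <= s -> {within `[0, L], continuous (dx (psi s))}.
  by move=> /spc [h _ _]; exact: H2_dx_continuous.
have E n (s : R) : 0 <= s -> ip (dx (psi s)) (sn n) = - (lam n * coef psi (cn n) s).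
  by move=> s0; have [[h _] _ _] := spc s s0; rewrite (ip_dx_sn L0 n h) coef_nonneg.
have [_ _ [cpsi _]] := rpsi; have [c0psi _ _] := cpsi.
have pc n : continuous (coef psi (cn n)) := coef_continuous c0psi (L2_cn L n).
have E' n : coef (fun s => dx (psi s)) (sn n) = fun s => - lam n * coef psi (cn n) s.
  apply/funext => s; rewrite /coef E ?clamp_ge0// mulNr /coef.
  by rewrite [clamp (clamp s)]clamp_id ?clamp_ge0.
have coefc n : continuous (coef (fun s => dx (psi s)) (sn n)).
  by rewrite E'; apply: continuousMf => //; exact: cont_cst.
have b0 n : 0 <= C * mode_data n.+1 by rewrite mulr_ge0// data_ge0.
have bB N : \sum_(i < N) C * mode_data i.+1 <= C * K by rewrite -mulr_sumr ler_wpM2l.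
have fb (s : R) n : 0 <= s -> (lam n.+1 * ip (dx (psi s)) (sn n.+1)) ^+ 2 <= C * mode_data n.+1.
  move=> s0; apply: le_trans (Cb n s0); rewrite E// le_eqVlt; apply/orP; left; apply/eqP; ring.
have gK : Iu gh T <= k2.
  by rewrite -subr_ge0; apply: le_trans (gkap T0); exact: ltW.
have [r rc H] := memory_le_modes L0 f2 fc coefc b0 bB fb ghc gh0 T0 gK.
exists r; first exact: rc.
move=> N; have := H N.
have -> : \int[mu]_(x in D) \int[mu]_(s in `[0, T]) (gh (T - s) * (dx (psi T) x - dx (psi s) x) ^+ 2) =
    memory L g (fun s => dx (psi s)) T.
  apply: eq_Rintegral => x _; apply: eq_Rintegral => s; rewrite inE /= in_itv /= => /andP[s0 sT].
  by rewrite clamp_id// subr_ge0.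
move=> /le_trans; apply; rewrite lerD2r; apply: ler_wpM2l; first by rewrite divr_ge0// ltW.
apply: ler_sum => i _; have [[[c1 _ _]] _ _ _ _] := sol i.+1.
have [_ [Cpsi _] _ _] := sol i.+1.
rewrite (mem2E kg Cpsi) -IuZ; last first.
  have pc' := pc i.+1; have pr := @continuous_rev R _ T pc'; ctn.
have pc' := pc i.+1; have pr := @continuous_rev R _ T pc'.
rewrite -Iu_rev; last by have gr := @continuous_rev R _ T ghc; rewrite E'; ctn.
rewrite le_eqVlt; apply/orP; left; apply/eqP; apply: eq_Iu => s _.
by rewrite E' (_ : T - (T - s) = s); ring.
Qed.

(** Each of the seven terms of the energy is compared with its coefficients by a
    Parseval inequality up to a remainder that tends to 0 with the number of
    modes. *)
Lemma energy_le_modes (del : R) : 0 < del -> exists N,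
  energy L rho1 rho2 k1 k2 k1 l g phi psi w T <= 2 / L * \sum_(i < N) mode_En i.+1 T + del.
Proof.
move=> del0; have [hphi hphix hphiz hphit _] := phi_spaces rphi T0.
have [hpsi2 [hpsi hpsiz] [hpsit hpsitz] _] := psi_w_spaces rpsi T0.
have [hw2 [hw hwz] [hwt hwtz] _] := psi_w_spaces rw T0.
have hs := shear_H1 l rphi rpsi rw T0; have ha := axial_H1 l rphi rw T0.
have [hphit1 _] := hphit; have [dphit _] := dxP hphit1.
have [[_ hpsix] _ _] := hpsi2; have [dpsix _] := dxP hpsix; have [daxx _] := dxP ha.
have [[[lphit _] [lpsit _]] [[lwt _] [lpsix _]]] := ((hphit1, hpsit), (hwt, hpsix)).
have [[lsh _] [lax _]] := (hs, ha).
have l1 : L2 (fun=> 1) by apply: continuous_L2; exact: cont_cst.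
have mean v : L2s L v -> ip v (fun=> 1) = 0.
  by move=> [_ h]; rewrite -[RHS]h; apply: eq_Rintegral => x _; rewrite mulr1.
have shz : ip (shear L l phi psi w T) (fun=> 1) = 0.
  have := ip_shear_cn l L0 rphi rpsi rw 0%N T0; rewrite /shr /lam !mul0r add0r.
  have c1 v : ip v (cn 0) = ip v (fun=> 1) by apply: eq_ip => // x _; rewrite cn_0.
  rewrite !c1 => ->; rewrite (coef_nonneg L _ _ T0) (coef_nonneg L _ _ T0).
  by rewrite !c1 (mean _ hpsiz) (mean _ hwz) mulr0 addr0.
have [r1 c1 P1] := parseval_sine lphit dphit (fun n => ip_dx_cn_H10 L0 n hphit).
have [r2 c2 P2] := parseval_H1 hpsit (mean _ hpsitz).
have [r3 c3 P3] := parseval_H1 hwt (mean _ hwtz).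
have [r4 c4 P4] := parseval_sine lpsix dpsix (fun n => ip_dxdx_cn L0 n hpsi2).
have [r5 c5 P5] := parseval_sine lax daxx (fun n => ip_dx_axial_cn l L0 rphi rw n T0).
have [r6 c6 P6] := parseval_H1 hs shz.
have [r7 c7 P7] := memory_energy_le.
have kk : 0 <= k2 - Iu gh T by apply: le_trans (gkap T0); exact: ltW.
have [r1' r2' k1'] := And3 (ltW r1p) (ltW r2p) (ltW k1p).
pose r N := 2^-1 * (rho1 * r1 N + rho2 * r2 N + rho1 * r3 N + (k2 - Iu gh T) * r4 N
   + k1 * r5 N + k1 * r6 N) + 2^-1 * r7 N.
have rc : r N @[N --> \oo] --> (0 : R).
  exact: (cvg_comb _ _ _ _ _ _ c1 c2 c3 c4 c5 c6 c7).
have [N _ hN] := (cvgrPdist_le _ _).1 rc _ del0.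
have {}hN : r N <= del.
  by have := hN N (leqnn N); rewrite sub0r normrN; apply: le_trans; exact: ler_norm.
exists N; apply: le_trans (lerD (lexx _) hN); rewrite /energy.
have -> : \int[mu]_(s in `[0, T]) g s = Iu gh T.
  by apply: eq_Rintegral => s; rewrite inE /= in_itv /= => /andP[s0 _]; rewrite clamp_id.
rewrite int_comb6//.
have S4 : \sum_(i < N) ip (dx (psi T)) (sn i.+1) ^+ 2 = \sum_(i < N) (lam i.+1 * coef psi (cn i.+1) T) ^+ 2.
  apply: eq_bigr => i _; have [[h _] _ _] := hpsi2.
  by rewrite (ip_dx_sn L0 i.+1 h) coef_nonneg// sqrrN.
have S5 : \sum_(i < N) ip (axial L l phi w T) (sn i.+1) ^+ 2 =
    \sum_(i < N) axl l (lam i.+1) (coef phi (sn i.+1) T) (coef w (cn i.+1) T) ^+ 2.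
  by apply: eq_bigr => i _; rewrite (ip_axial_sn l L0 rphi rw i.+1 T0) sqrrN.
have S6 : \sum_(i < N) ip (shear L l phi psi w T) (cn i.+1) ^+ 2 =
    \sum_(i < N) shr l (lam i.+1) (coef phi (sn i.+1) T) (coef psi (cn i.+1) T) (coef w (cn i.+1) T) ^+ 2.
  by apply: eq_bigr => i _; rewrite (ip_shear_cn l L0 rphi rpsi rw i.+1 T0).
have {}P4 := P4 N; rewrite S4 in P4; have {}P5 := P5 N; rewrite S5 in P5; have {}P6 := P6 N; rewrite S6 in P6.
have EN : \sum_(i < N) mode_En i.+1 T = 2^-1 * (rho1 * \sum_(i < N) ip (dt phi T) (sn i.+1) ^+ 2
   + rho2 * \sum_(i < N) ip (dt psi T) (cn i.+1) ^+ 2 + rho1 * \sum_(i < N) ip (dt w T) (cn i.+1) ^+ 2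
   + (k2 - Iu gh T) * \sum_(i < N) (lam i.+1 * coef psi (cn i.+1) T) ^+ 2
   + k1 * \sum_(i < N) axl l (lam i.+1) (coef phi (sn i.+1) T) (coef w (cn i.+1) T) ^+ 2
   + k1 * \sum_(i < N) shr l (lam i.+1) (coef phi (sn i.+1) T) (coef psi (cn i.+1) T) (coef w (cn i.+1) T) ^+ 2
   + \sum_(i < N) lam i.+1 ^+ 2 * mem2 gh (coef psi (cn i.+1)) T).
  rewrite !mulr_sumr -!big_split /= mulr_sumr; apply: eq_bigr => i _.
  by rewrite /mode_En /En ![coef (dt _) _ _]coef_nonneg.
rewrite EN; have {}P1 := P1 N; have {}P2 := P2 N; have {}P3 := P3 N; have {}P7 := P7 N.
exact: (le_comb r1' r2' r1' kk k1' k1' P1 P2 P3 P4 P5 P6 P7).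
Qed.

End at_time.

End EnergyModes.

(** * Decay of the energy *)

Section RelaxationKernel.
Variables (R : realType) (g : R -> R) (k2 : R).
Hypothesis hg : hypA1 k2 g.
Notation mu := (@lebesgue_measure R).
Notation gh := (fun t => g (clamp t)).

Lemma derivable_half_continuous (f : R -> R) : (forall t : R, 0 <= t -> derivable_half f t) ->
  continuous (fun t => f (clamp t)).
Proof.
move=> fd; apply: half_continuous => t t0.
exact: (half_diff_cont (derivable_half_diff (fd t t0))).
Qed.

Lemma derivable_half_is_derive (f : R -> R) (t : R) : 0 < t ->
  (forall t : R, 0 <= t -> derivable_half f t) ->
  is_derive t 1 (fun t => f (clamp t)) (deriv_half f t).
Proof.
by move=> t0 fd; exact: (half_is_derive t0 (derivable_half_diff (fd t (ltW t0)))).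
Qed.

Lemma deriv_half_le0 (f : R -> R) (t : R) : 0 < t -> nonincreasing_half f ->
  (forall t : R, 0 <= t -> derivable_half f t) -> deriv_half f t <= 0.
Proof.
move=> t0 fn fd.
exact: (half_diff_le0 (ltW t0) fn (derivable_half_diff (fd t (ltW t0)))).
Qed.

Lemma relaxation_kernel : kernel gh (deriv_half g).
Proof.
have [g0 gn gd _ _] := hg; split.
- exact: derivable_half_continuous.
- by move=> t; apply: g0; exact: clamp_ge0.
- by move=> t t0; exact: derivable_half_is_derive.
- by move=> t t0; exact: deriv_half_le0.
Qed.

Lemma relaxation_margin : exists2 kap : R, 0 < kap &
  forall t : R, 0 <= t -> kap <= k2 - Iu gh t.
Proof.
have [_ _ _ _ hk] := hg; have [gc g0 _ _] := relaxation_kernel.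
have mg : measurable_fun setT (EFin \o gh).
  by apply/measurable_EFinP; exact: continuous_measurable_fun.
have E : (\int[mu]_(s in `[0%R, +oo[) (g s)%:E = \int[mu]_(s in `[0%R, +oo[) (gh s)%:E)%E.
  apply: eq_integral => s; rewrite inE /= in_itv /= andbT => s0.
  by rewrite clamp_id.
move: hk; rewrite E; set G := (\int[mu]_(s in _) _)%E => hk.
have G0 : (0 <= G)%E by apply: integral_ge0 => s _; rewrite lee_fin.
have Gf : G \is a fin_num.
  by move: G0 hk; case: G.
exists (k2 - fine G); first by move: hk; rewrite -[X in (_ - X)%E](fineK Gf) -EFinB lte_fin.
move=> t t0; rewrite lerD2l lerN2.
apply: (fine_le _ Gf).
  exact: integrable_fin_num (continuous_integrable 0 t gc).
apply: ge0_subset_integral => //=.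
- exact: measurable_funS mg.
- by move=> s _; rewrite lee_fin.
- by move=> s /=; rewrite !in_itv /= => /andP[->].
Qed.

Lemma relaxation_mass_gt0 (t : R) : 0 < t -> 0 < Iu gh t.
Proof.
have [_ _ _ gp _] := hg; have kg := relaxation_kernel; have [gc g0 _ _] := kg => t0.
have g2 : 0 < g 0 / 2 by rewrite divr_gt0.
have := (cvgrPdist_le _ _).1 (gc 0) _ g2; move=> [d /= d0 H].
pose m := Num.min (d / 2) t.
have m0 : 0 < m by rewrite lt_min divr_gt0.
have md : m <= d / 2 by rewrite ge_min lexx.
have mt : m <= t by rewrite ge_min lexx orbT.
apply: lt_le_trans (Iu_kernel_mono kg (ltW m0) mt).
apply: (@lt_le_trans _ _ (Iu (fun=> g 0 / 2) m)).
  by rewrite Iu_cst ?(ltW m0)// mulr_gt0.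
apply: Iu_le => //; first exact: cont_cst.
move=> s /andP[s0 sm]; have := H s; rewrite /= sub0r normrN ger0_norm// => /(_ _).
rewrite (clamp_id (lexx 0)) (clamp_id s0) => h.
have {}h : `|g 0 - g s| <= g 0 / 2 by apply: h; lra.
by move: h; rewrite ler_norml => /andP[_ ?]; lra.
Qed.

End RelaxationKernel.

Section Conclusion.
Variable R : realType.

Lemma Iu_tail (f : R -> R) (a t : R) : continuous f -> 0 <= a -> a <= t ->
  \int[lebesgue_measure]_(s in `[a, t]) f s = Iu f t - Iu f a.
Proof.
move=> fc a0 at_; rewrite /Iu Rintegral_itvB ?bnd_simp//; last exact: continuous_integrable.
rewrite Rintegral_itv_obnd_cbnd//.
apply: integrableS (continuous_integrable a t fc) => //=.
by apply: subset_itvr; rewrite bnd_simp.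
Qed.

Lemma Iu_tail_ge (f : R -> R) (a t c : R) : continuous f -> 0 <= a -> a <= t ->
  (forall s : R, a < s < t -> c <= f s) -> c * (t - a) <= Iu f t - Iu f a.
Proof.
move=> fc a0 at_ h.
suff : Iu f a + - c * a <= Iu f t + - c * t by move=> ?; lra.
have Ic := continuous_Iu fc.
apply: (@derive_ge0_le _ (fun s => Iu f s + - c * s) (fun s => f s - c)) => //.
- by apply: contD => //; apply: continuousMf; [exact: cont_cst|exact: cont_id].
- move=> s sat; have s0 : 0 < s by case/andP: sat => ? _; lra.
  have d := is_derive_Iu fc s0.
  have dd := derD d (derM (der_cst (- c) s) (der_id s)).
  by apply: (is_derive_eq dd); ring.
- by move=> s /h; rewrite subr_ge0.
Qed.

(** The 1 makes the constant of the decay positive. *)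
Lemma powR_decay (q e I M : R) : 0 < q -> 0 < e -> 0 < I -> 0 <= M ->
  e `^ q * I <= M -> e <= (M + 1) `^ (1 / q) * (1 / I) `^ (1 / q).
Proof.
move=> q0 e0 I0 M0 h.
have qq : 0 <= 1 / q by rewrite divr_ge0// ltW.
rewrite -powRM ?addr_ge0// ?divr_ge0 ?(ltW I0)//.
have eE : e = (e `^ q) `^ (1 / q).
  by rewrite -powRrM mulrCA divff ?gt_eqF// mulr1 powRr1// ltW.
rewrite [X in X <= _]eE; apply: ge0_ler_powR => //.
- by rewrite nnegrE powR_ge0.
- by rewrite nnegrE mulr_ge0 ?divr_ge0 ?addr_ge0 ?(ltW I0).
by rewrite mulrA mulr1 ler_pdivlMr//; apply: (le_trans h); rewrite lerDl.
Qed.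

(** [S] is the sum of the energies of the modes. The weight [L / (8 * K)] is such
    that the last term of the hypothesis, multiplied by [4 / L], is half of
    [e^(2p-1) I]. *)
Lemma absorb_modes (p L Cd Cb K e I S : R) : 1 <= p -> 0 < L -> 0 <= Cd -> 0 <= Cb -> 0 < K ->
  0 < e -> 0 < I -> e <= 2 / L * S + e / 2 -> S <= Cb * K ->
  e `^ (2 * p - 2) * S * I <= Cd * (1 + e `^ (2 * p - 2)) * K
    + L / (8 * K) * e `^ (2 * p - 1) * I * K ->
  e `^ (2 * p - 1) * I <= 8 / L * Cd * (1 + (4 / L * (Cb * K)) `^ (2 * p - 2)) * K.
Proof.
move=> p1 L0 Cd0 Cb0 K0 e0 I0 eS SK h.
have L4 : 0 < 4 / L by rewrite divr_gt0.
have eS' : e <= 4 / L * S.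
  by have -> : 4 / L * S = 2 * (2 / L * S) by [ring]; lra.
have eM : e <= 4 / L * (Cb * K) by apply: (le_trans eS'); rewrite ler_wpM2l// ltW.
have bE : e `^ (2 * p - 1) = e * e `^ (2 * p - 2).
  rewrite (_ : 2 * p - 1 = 1 + (2 * p - 2)); last by ring.
  by rewrite powRD ?powRr1 ?(ltW e0)// (gt_eqF e0) implybT.
have bm : e `^ (2 * p - 2) <= (4 / L * (Cb * K)) `^ (2 * p - 2).
  apply: ge0_ler_powR => //; first by lra.
  - by rewrite nnegrE ltW.
  - by rewrite nnegrE mulr_ge0 ?(ltW L4)// mulr_ge0// ltW.
move: h bm; rewrite bE; set b := e `^ (2 * p - 2); set M := _ `^ _ => h bm.
have b0 : 0 <= b by exact: powR_ge0.
have h2 := ler_wpM2l (ltW L4) h.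
have h3 : e * b * I <= 4 / L * (b * S * I).
  rewrite (_ : 4 / L * (b * S * I) = 4 / L * S * (b * I)); last by ring.
  by rewrite -mulrA ler_wpM2r// mulr_ge0// ltW.
have h4 : 4 / L * (Cd * (1 + b) * K) <= 4 / L * (Cd * (1 + M) * K).
  by rewrite ler_wpM2l ?(ltW L4)// ler_wpM2r ?(ltW K0)// ler_wpM2l// lerD2l.
have e8 : 4 / L * (L / (8 * K) * (e * b) * I * K) = 2^-1 * (e * b * I).
  by field; rewrite !gt_eqF.
have e9 : 8 / L * Cd * (1 + M) * K = 2 * (4 / L * (Cd * (1 + M) * K)) by ring.
move: h2 h3 h4; rewrite mulrDr e8 e9; move=> *; lra.
Qed.

End Conclusion.

Theorem theorem5p1 (R : realType) (L rho1 rho2 k1 k2 k3 : R) (g : R -> R)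
  (hL : 0 < L) (hrho1 : 0 < rho1) (hrho2 : 0 < rho2)
  (hk1 : 0 < k1) (hk2 : 0 < k2) (hk3 : 0 < k3)
  (hg : hypA1 k2 g)
  (hspeed : rho1 / k1 <> rho2 / k2) (hk13 : k1 = k3) :
  exists l0 : R, 0 < l0 /\
    forall (xi : R -> R) (p : R), hypA2 g xi p ->
    forall l : R, 0 < l -> l < l0 ->
    forall t0 : R, 0 < t0 ->
    forall phi0 phi1 psi0 psi1 w0 w1 : R -> R,
      (H2 L `&` H10 L) phi0 -> H10 L phi1 ->
      (H2s L `&` H1s L) psi0 -> H1s L psi1 ->
      (H2s L `&` H1s L) w0 -> H1s L w1 ->
    exists C : R, 0 < C /\
      forall phi psi w : R -> R -> R,
        strong_solution L rho1 rho2 k1 k2 k3 l g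
          phi0 phi1 psi0 psi1 w0 w1 phi psi w ->
        forall t : R, t0 < t ->
          energy L rho1 rho2 k1 k2 k3 l g phi psi w t <=
          C * (1 / \int[lebesgue_measure]_(s in `[t0, t])
                     (xi s `^ (2 * p - 1))) `^ (1 / (2 * p - 1)).
Proof.
have [kap kapp gkap] := relaxation_margin hg; have kg := relaxation_kernel hg.
have mup : 0 < pi / L :> R by rewrite divr_gt0// pi_gt0.
(* half of the lowest frequency, so that [lam - l] is comparable with [lam] *)
exists (pi / L / 2); split; first by rewrite divr_gt0.
move=> xi p [xip xin xid /andP[p1 p2] gxi] l lp /ltW lmu t0 t00.
move=> phi0 phi1 psi0 psi1 w0 w1 hp0 hp1 hs0 hs1 hw0 hw1.
subst k3.
have xic := derivable_half_continuous xid.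
have xi0 (t : R) : 0 < xi (clamp t) by apply: xip; exact: clamp_ge0.
have xid' (t : R) (tp : 0 < t) := derivable_half_is_derive tp xid.
have xi1 (t : R) (tp : 0 < t) := deriv_half_le0 tp xin xid.
have gxi' (t : R) : 0 < t -> xi (clamp t) * g (clamp t) `^ p <= - deriv_half g t.
  move=> tp; have := gxi t (ltW tp).
  by rewrite (clamp_id (ltW tp)) mulNr lerNr.
have [Cb Cb0 HB] := mode_bounds hrho1 hrho2 hk1 hk2 lp mup kapp lmu kg gkap.
(* the bound of [mode_data_sum]; the 1 makes it positive *)
pose K := L / 2 *
    (ip L (dx L (dx L phi0)) (dx L (dx L phi0)) + ip L (dx L (dx L psi0)) (dx L (dx L psi0))
     + ip L (dx L (dx L w0)) (dx L (dx L w0)) + ip L (dx L phi1) (dx L phi1)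
     + ip L (dx L psi1) (dx L psi1) + ip L (dx L w1) (dx L w1)) + 1.
have ip0 v : 0 <= ip L v v by apply: Rintegral_ge0 => x _; rewrite -expr2 sqr_ge0.
have K0 : 0 < K.
  by rewrite /K ltr_wpDl// mulr_ge0 ?divr_ge0 ?(ltW hL)// !addr_ge0.
have eps0 : 0 < L / (8 * K) by rewrite divr_gt0// mulr_gt0.
have [Cd Cd0 HD] := mode_decay hrho1 hrho2 hk1 hk2 lp mup kapp lmu kg gkap xic xi0 xid' xi1
  p1 p2 gxi' t00 (relaxation_mass_gt0 hg t00) eps0.
pose M := 8 / L * Cd * (1 + (4 / L * (Cb * K)) `^ (2 * p - 2)) * K.
have M0 : 0 <= M.
  apply: mulr_ge0; last exact: ltW.
  apply: mulr_ge0; last by rewrite addr_ge0// powR_ge0.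
  by apply: mulr_ge0 => //; rewrite divr_ge0// ltW.
exists ((M + 1) `^ (1 / (2 * p - 1))); split; first by rewrite powR_gt0// ltr_wpDl.
move=> phi psi w [[rphi rpsi rw] eqs _ ini] t t0t.
have tp := lt_trans t00 t0t.
have wc := continuous_wgt xic xi0 p1.
pose W := wgt (fun t => xi (clamp t)) p.
have IE : \int[lebesgue_measure]_(s in `[t0, t]) (xi s `^ (2 * p - 1)) = Iu W t - Iu W t0.
  rewrite -(Iu_tail wc (ltW t00) (ltW t0t)).
  apply: eq_Rintegral => s; rewrite inE /= in_itv /= => /andP[s0 _].
  by rewrite /W /wgt clamp_id//; apply: le_trans s0; exact: ltW.
have I0 : 0 < Iu W t - Iu W t0.
  have c0 : 0 < W t * (t - t0) by rewrite mulr_gt0 ?subr_gt0// powR_gt0.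
  apply: (lt_le_trans c0); apply: (Iu_tail_ge wc (ltW t00) (ltW t0t)) => s /andP[ts st].
  have s0 := ltW (lt_trans t00 ts).
  apply: ge0_ler_powR; [lra|by rewrite nnegrE ltW|by rewrite nnegrE ltW|].
  by rewrite !clamp_id ?(ltW tp)//; apply: xin => //; exact: ltW.
rewrite IE; set I := _ - _ in I0 *.
set e := energy _ _ _ _ _ _ _ _ _ _ _ _.
(* [mode_decay] needs a positive parameter [e] *)
have [ee|e0] := leP e 0.
  by apply: (le_trans ee); rewrite mulr_ge0 ?powR_ge0.
have [gc _ _ _] := kg.
have sol n := mode_system hL rphi rpsi rw eqs gc n.
have laml n : pi / L <= lam L n.+1.
  by rewrite /lam ler_wpM2r ?invr_ge0 ?(ltW hL)// ler_peMl ?ler1n// pi_ge0.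
have dataK N : \sum_(i < N) mode_data L phi psi w i.+1 <= K.
  by apply: (le_trans (mode_data_sum hL rphi rpsi rw N ini hp0 hp1 hs0 hs1 hw0 hw1)); rewrite lerDl.
have bnd n (s : R) (s0 : 0 <= s) := HB _ _ _ _ _ _ _ _ _ _ (laml n) (sol n.+1) s s0.
have psiK n (s : R) : 0 <= s ->
    (lam L n.+1 ^+ 2 * coef L psi (cn L n.+1) s) ^+ 2 <= Cb * mode_data L phi psi w n.+1.
  by move=> s0; have [] := bnd n s s0.
have [N hN] := energy_le_modes hL hrho1 hrho2 hk1 rphi rpsi rw eqs kapp kg gkap (ltW tp) Cb0
  dataK psiK (divr_gt0 e0 (ltr0n R 2)).
have q0 : 0 < 2 * p - 1 by lra.
apply: (powR_decay q0 e0 I0 M0); apply: (absorb_modes p1 hL Cd0 Cb0 K0 e0 I0 hN).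
  apply: le_trans (_ : \sum_(i < N) Cb * mode_data L phi psi w i.+1 <= _).
    by apply: ler_sum => i _; have [] := bnd i t (ltW tp).
  by rewrite -mulr_sumr ler_wpM2l.
have P b : 0 <= b -> b * \sum_(i < N) mode_data L phi psi w i.+1 <= b * K.
  by move=> b0; exact: ler_wpM2l.
have b0 : 0 <= Cd * (1 + e `^ (2 * p - 2)).
  by rewrite mulr_ge0// addr_ge0// powR_ge0.
have b1 : 0 <= L / (8 * K) * e `^ (2 * p - 1) * I.
  apply: mulr_ge0; last exact: ltW.
  by apply: mulr_ge0; [exact: ltW|exact: powR_ge0].
apply: le_trans (lerD (P _ b0) (P _ b1)).
rewrite mulr_sumr mulr_suml !mulr_sumr -big_split /=; apply: ler_sum => i _.
exact: (HD _ _ _ _ _ _ _ _ _ _ (laml i) (sol i.+1) e t e0 (ltW t0t)).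
Qed.
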